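(* There exists a complete but stochastically incomplete Riemannian manifold $(M,g)$ (i.e. $Q_{1,0}$ is not conservative) and a smooth potential $V:M\to[0,\infty)$ such that $Q_{1,V}$ is conservative in the generalized sense.
   Context: Riemannian manifolds are smooth, connected and without boundary; the measure is the Riemannian measure $\mu=\mathrm{vol}_g$. Complete means complete with respect to the geodesic distance. For a smooth $w:M\to(0,\infty)$ let $W^1(M,w)=\{f\in L^2(M,w\mu): |\nabla f|\in L^2(M,\mu)\}$ (distributional gradient) with norm $\|f\|_{W^1}=(\int_M|\nabla f|^2d\mu+\int_M f^2 w\,d\mu)^{1/2}$, and let $W^1_0(M,w)$ be the closure of $C_c^\infty(M)$ in it. For smooth $V\ge0$ the quadratic form $Q_{1,V}$ with domain $W_0^1(M,1+V)$, $Q_{1,V}(f,h)=\int_M\langle\nabla f,\nabla h\rangle d\mu+\int_M fhV\,d\mu$, is a Dirichlet form on $L^2(M,\mu)$. Let $L_{1,V}$ be the associated nonpositive self-adjoint operator on $L^2(M,\mu)$ and $T^{1,V}_t=e^{tL_{1,V}}$, $t>0$, the associated positivity preserving Markovian semigroup. $L^+(M)$ denotes the cone of $[0,\infty]$-valued, $\mu$-a.e. defined measurable functions. Any positivity preserving linear operator $T$ on $L^2(M,\mu)$ is extended to $L^+(M)$ by $Tf=\lim_{n\to\infty}Tf_n$, where $(f_n)$ is any increasing sequence of nonnegative functions in $L^2(M,\mu)$ with $f_n\to f$ $\mu$-a.e. (this is well defined). $Q_{1,0}$ is conservative (equivalently, by definition, the manifold is stochastically complete) if $T_t^{1,0}1=1$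 for all $t>0$. $Q_{1,V}$ is conservative in the generalized sense if $$T_t^{1,V}1+\int_0^tT_s^{1,V}V\,ds=1\quad\text{for all }t>0,$$ where the integral denotes the $L^+(M)$-extension of the positivity preserving operator $f\mapsto\int_0^tT_s^{1,V}f\,ds$ on $L^2(M,\mu)$, applied to $V$. *)

(* Defs.v *)
From HB Require Import structures.
From mathcomp Require Import all_boot all_order all_algebra.
From mathcomp Require Import all_classical all_reals all_analysis.
Set Implicit Arguments.
Unset Strict Implicit.
Unset Printing Implicit Defensive.
Import Order.TTheory GRing.Theory Num.Theory.
Import numFieldNormedType.Exports.
Local Open Scope classical_set_scope.
Local Open Scope ring_scope.

(* Points and tangent vectors in coordinates are row vectors, so a linear map
   acts on them by multiplication on the right, as in ['J f p]. *)

Section Smoothness.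
Context {R : realType} {n : nat}.
Implicit Types (O : set 'rV[R]_n) (f : 'rV[R]_n -> R).

Definition partial (k : 'I_n) f : 'rV[R]_n -> R :=
  fun x => 'D_(delta_mx 0 k) f x.

Definition partials (s : seq 'I_n) f : 'rV[R]_n -> R := foldr partial f s.

(* C^oo on the open set O; the values of f outside O are irrelevant. *)
Definition smooth_on O f :=
  forall (s : seq 'I_n) (x : 'rV[R]_n), O x ->
    {for x, continuous (partials s f)} /\
    forall k, derivable (partials s f) x (delta_mx 0 k).

End Smoothness.

(* A chart i is the map chart_map i, with domain dom i; param i is its inverse,
   extended arbitrarily outside of the image of dom i. *)
Record manifold (R : realType) (n : nat) := Manifold {
  carrier :> ptopologicalType;
  hausdorff_carrier : hausdorff_space carrier;
  second_countable_carrier : @second_countable carrier;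
  connected_carrier : connected [set: carrier];
  chart : Type;
  dom : chart -> set carrier;
  chart_map : chart -> carrier -> 'rV[R]_n;
  param : chart -> 'rV[R]_n -> carrier;
  chart_at : carrier -> chart;
  dom_chart_at : forall x, dom (chart_at x) x;
  open_dom : forall i, open (dom i);
  open_chart_map : forall i, open (chart_map i @` dom i);
  chart_mapK : forall i x, dom i x -> param i (chart_map i x) = x;
  chart_map_continuous : forall i x, dom i x -> {for x, continuous (chart_map i)};
  param_continuous : forall i x, dom i x ->
    {for chart_map i x, continuous (param i)};
  transition_smooth : forall i j k,
    smooth_on (chart_map i @` (dom i `&` dom j))
      (fun y => chart_map j (param i y) 0 k)
}.

Definition transition (R : realType) (n : nat) (M : manifold R n)
  (i j : chart M) : 'rV[R]_n -> 'rV[R]_n := chart_map j \o param i.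

(* metric i y is the Gram matrix of the coordinate frame of the chart i at the
   point with coordinates y. *)
Record riemannian (R : realType) (n : nat) := Riemannian {
  base :> manifold R n;
  metric : chart base -> 'rV[R]_n -> 'M[R]_n;
  metric_smooth : forall i k l,
    smooth_on (chart_map i @` dom i) (fun y => metric i y k l);
  metric_sym : forall i x, dom i x ->
    (metric i (chart_map i x))^T = metric i (chart_map i x);
  metric_pos : forall i x, dom i x -> forall v : 'rV[R]_n, v != 0 ->
    0 < (v *m metric i (chart_map i x) *m v^T) 0 0;
  metric_compat : forall i j x, dom i x -> dom j x ->
    let J := 'J (transition i j) (chart_map i x) in
    metric i (chart_map i x) = J *m metric j (chart_map j x) *m J^T
}.

Section Geometry.
Context {R : realType} {n : nat} (M : riemannian R n).

Definition smooth (f : M -> R) :=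
  forall i : chart M, smooth_on (chart_map i @` dom i) (f \o param i).

Definition test_function (f : M -> R) :=
  smooth f /\ exists2 K : set M, compact K & forall x, ~ K x -> f x = 0.

(* The inner product at x of two tangent vectors given by their components in
   the chart i. *)
Definition dot (i : chart M) (x : M) (v w : 'rV[R]_n) : R :=
  (v *m metric i (chart_map i x) *m w^T) 0 0.

(* X i x is the vector of the components, in the chart i, of the tangent vector
   at x; only the values for x in dom i are meaningful. *)
Definition field := chart M -> M -> 'rV[R]_n.

Definition vector_field (X : field) :=
  forall i j x, dom i x -> dom j x ->
    X j x = X i x *m 'J (transition i j) (chart_map i x).

Lemma dot_transition (i j : chart M) (x : M) (v w : 'rV[R]_n) :
  dom i x -> dom j x ->
  let J := 'J (transition i j) (chart_map i x) in
  dot j x (v *m J) (w *m J) = dot i x v w.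
Proof.
by move=> ix jx J; rewrite /dot (metric_compat ix jx) trmx_mul !mulmxA.
Qed.

(* By dot_transition the choice of the chart does not matter. *)
Definition inner (X Y : field) (x : M) : R :=
  dot (chart_at x) x (X (chart_at x) x) (Y (chart_at x) x).

Definition test_field (X : field) :=
  [/\ vector_field X,
      forall i k, smooth_on (chart_map i @` dom i) (fun y => X i (param i y) 0 k) &
      exists2 K : set M, compact K &
        forall i x, dom i x -> ~ K x -> X i x = 0].

Definition volume_density (i : chart M) (y : 'rV[R]_n) : R :=
  Num.sqrt (\det (metric i y)).

Definition div (X : field) (x : M) : R :=
  let i := chart_at x in
  (volume_density i (chart_map i x))^-1 *
  \sum_(k < n) partial k
    (fun y => volume_density i y * X i (param i y) 0 k) (chart_map i x).

(* Curves are parametrized by [0, 1], and C^1 up to the endpoints.  Since the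
   velocity may vanish, reparametrizing shows that piecewise C^1 curves give the
   same distance. *)
Definition C1_curve (c : R -> M) :=
  forall t, t \in `[0, 1] -> {for t, continuous c} /\
    forall i, dom i (c t) ->
      (\forall s \near t, derivable (chart_map i \o c) s 1) /\
      {for t, continuous (derive1 (chart_map i \o c))}.

Definition speed (c : R -> M) (t : R) : R :=
  let i := chart_at (c t) in
  let v := derive1 (chart_map i \o c) t in
  Num.sqrt (dot i (c t) v v).

Definition curve_length (c : R -> M) : \bar R :=
  (\int[lebesgue_measure]_(t in `[0%R, 1%R]) (speed c t)%:E)%E.

Definition geodesic_dist (x y : M) : \bar R :=
  ereal_inf [set curve_length c | c in
    [set c : R -> M | [/\ C1_curve c, c 0 = x & c 1 = y]]].

Definition geodesically_complete :=
  forall u : nat -> M,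
    (forall e : R, 0 < e -> exists N : nat, forall p q : nat,
       (N <= p)%N -> (N <= q)%N -> (geodesic_dist (u p) (u q) < e%:E)%E) ->
    exists x : M, geodesic_dist (u p) x @[p --> \oo] --> 0%E.

End Geometry.

Definition borel (T : ptopologicalType) := g_sigma_algebraType (@open T).

(* Equivalently, lam is the n-dimensional Lebesgue measure on Borel sets. *)
Definition is_lebesgue (R : realType) (n : nat)
    (lam : {measure set (borel 'rV[R]_n) -> \bar R}) :=
  forall a b : 'rV[R]_n, (forall k, a 0 k <= b 0 k) ->
    lam [set x | forall k, a 0 k <= x 0 k <= b 0 k] =
    (\prod_(k < n) (b 0 k - a 0 k))%:E.

(* mu = vol_g, that is, sqrt (det g) dx in every chart. *)
Definition is_riemannian_measure (R : realType) (n : nat) (M : riemannian R n)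
    (mu : {measure set (borel M) -> \bar R}) :=
  exists2 lam : {measure set (borel 'rV[R]_n) -> \bar R}, is_lebesgue lam &
    forall (i : chart M) (A : set (borel M)), measurable A -> A `<=` dom i ->
      mu A = (\int[lam]_(y in chart_map i @` A) (volume_density i y)%:E)%E.

Section Sobolev.
Context {R : realType} {n : nat} (M : riemannian R n).
Variable mu : {measure set (borel M) -> \bar R}.
Implicit Types (f h u w V : borel M -> R).

Definition L2 f := f \in Lfun mu 2%:E.

Definition L2norm f : \bar R := 'N[mu]_2%:E[EFin \o f]%E.

Definition L2dot f h : R := \int[mu]_x (f x * h x).

(* X is the distributional gradient of f, and |X| is in L^2; integrability of X
   cannot be dropped, since divergent integrals have the junk value 0. *)
Definition is_gradient f (X : field M) :=
  [/\ vector_field X,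
      forall (i : chart M) k,
        measurable_fun (dom i : set (borel M)) (fun x => X i x 0 k),
      (\int[mu]_x (inner X X x)%:E < +oo)%E &
      forall Y : field M, test_field Y ->
        \int[mu]_x inner X Y x = - \int[mu]_x (f x * div Y x)].

(* Unique up to a negligible set; 0 if there is no gradient in L^2. *)
Definition gradient f : field M := xget (fun _ _ => 0) (is_gradient f).

Definition W1_sqnorm w f : \bar R :=
  (\int[mu]_x (inner (gradient f) (gradient f) x)%:E +
   \int[mu]_x (f x ^+ 2 * w x)%:E)%E.

Definition W1 w f :=
  [/\ measurable_fun [set: borel M] f,
      exists X, is_gradient f X &
      (W1_sqnorm w f < +oo)%E].

Definition W10 w f :=
  W1 w f /\ forall e : R, 0 < e ->
    exists2 phi : borel M -> R, test_function phi &
      (W1_sqnorm w (f - phi)%R < e%:E)%E.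

Definition form_dom V := W10 (fun x => 1 + V x).

Definition energy_form V f h : R :=
  \int[mu]_x inner (gradient f) (gradient h) x + \int[mu]_x (f x * h x * V x).

(* The graph of the operator L_{1,V} associated with the form Q_{1,V}. *)
Definition form_operator V f u :=
  [/\ form_dom V f, L2 u &
      forall h, form_dom V h -> energy_form V f h = - L2dot u h].

(* Operators on L^2 act on representatives, up to a.e. equality. *)
Definition bounded_operator (S : (borel M -> R) -> (borel M -> R)) :=
  [/\ forall f, L2 f -> L2 (S f),
      forall (a : R) f h, L2 f -> L2 h ->
        S (a *: f + h) = a *: S f + S h %[ae mu] &
      exists C : R, forall f, L2 f -> (L2norm (S f) <= C%:E * L2norm f)%E].

(* T t = exp (t L) for t >= 0, where L is given by its graph: T is the strongly
   continuous semigroup on L^2 with generator L. *)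
Definition is_semigroup_of (L : (borel M -> R) -> (borel M -> R) -> Prop)
    (T : R -> (borel M -> R) -> (borel M -> R)) :=
  [/\ forall t, 0 <= t -> bounded_operator (T t),
      forall f, L2 f -> T 0 f = f %[ae mu],
      forall s t f, 0 <= s -> 0 <= t -> L2 f ->
        T (s + t) f = T s (T t f) %[ae mu],
      forall f, L2 f -> L2norm (T t f - f) @[t --> 0^'+] --> 0%E &
      forall f u, L2 f -> L2 u ->
        L f u <-> L2norm (t^-1 *: (T t f - f) - u) @[t --> 0^'+] --> 0%E].

Definition is_heat_semigroup V := is_semigroup_of (form_operator V).

(* F = S f for the extension to L^+(M) of the positivity preserving S. *)
Definition Lplus_extension (S : (borel M -> R) -> (borel M -> R))
    (f F : borel M -> \bar R) :=
  exists f_ : nat -> borel M -> R,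
    [/\ forall k, L2 (f_ k),
        \forall x \ae mu, (forall k, 0 <= f_ k x) /\
          nondecreasing_seq (fun k => f_ k x),
        \forall x \ae mu, (f_ k x)%:E @[k --> \oo] --> f x &
        \forall x \ae mu, (S (f_ k) x)%:E @[k --> \oo] --> F x].

(* S f = \int_0^t T_s f ds, the L^2-valued integral being characterized by
   testing it against all elements of L^2. *)
Definition is_time_integral (T : R -> (borel M -> R) -> (borel M -> R)) (t : R)
    (S : (borel M -> R) -> (borel M -> R)) :=
  forall f, L2 f -> L2 (S f) /\
    forall h, L2 h -> L2dot (S f) h =
      \int[lebesgue_measure]_(s in `[0, t]) L2dot (T s f) h.

Definition conservative (T : R -> (borel M -> R) -> (borel M -> R)) :=
  forall t, 0 < t -> Lplus_extension (T t) (cst 1%E) (cst 1%E).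

Definition generalized_conservative V
    (T : R -> (borel M -> R) -> (borel M -> R)) :=
  forall t, 0 < t ->
    exists S (A B : borel M -> \bar R),
      [/\ is_time_integral T t S, Lplus_extension (T t) (cst 1%E) A,
          Lplus_extension S (EFin \o V) B & \forall x \ae mu, (A x + B x = 1)%E].

End Sobolev.

(* Main.v *)
(* The surface is the plane with the metric dx^2 + E(x)^2 dy^2, E(x) = exp (exp x),
   and V(x, y) = exp x.  It is complete because the metric dominates the Euclidean
   one.

   The Laplacian is f_xx + e^x f_x + E^-2 f_yy.  The drift e^x makes the Brownian
   motion explode: the function psi(x, y) = S(x) exp (- e^x - x) b(y), where S is a
   smooth step at 0 and b a bump, lies in the domain of the Laplacian, psi and its
   Laplacian are in L^1, but the integral of the Laplacian is - \int b, the flux of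
   E psi_x at infinity.  If the semigroup T_t preserved integrals, the integral of
   T_t psi - psi = \int_0^t T_s (Delta psi) ds would be both 0 and - t \int b.

   With the potential V, let h >= 0 have compact support, let T = T_t h and
   U = \int_0^t T_s h ds, so that (Delta - V) U = T - h.  The Markov property of the
   resolvent bounds \int (1 + V) U, and the cutoffs chi_n = chi(./n) satisfy
   |Delta chi_n| <= C (1 + V) / n.  Pairing with chi_n and letting n tend to infinity
   yields \int T + \int V U = \int h, which by symmetry of the operators says that
   T_t 1 + \int_0^t T_s V ds = 1. *)
From HB Require Import structures.
Require Import Defs.
From mathcomp Require Import all_boot all_order all_algebra.
From mathcomp Require Import all_classical all_reals all_analysis.
From mathcomp Require Import measurable_realfun ring lra.
Import Order.TTheory GRing.Theory Num.Theory.
Import numFieldNormedType.Exports.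
Set Implicit Arguments.
Unset Strict Implicit.
Unset Printing Implicit Defensive.
Local Open Scope classical_set_scope.
Local Open Scope ring_scope.

(** * Closed forms on Hilbert spaces and their semigroups *)

(** The functions are tied together. The drift of the Laplacian is E'/E = e^x and V is chosen equal
    to it, so the drift term that spoils cutoffs has the size of the killing rate. The control of (1
    + V) U rests on the formal identity (1 - Delta + V) 1 = 1 + V: the resolvent should send a
    function between 0 and 1 + V into [0, 1]. This is proved variationally, by truncating
    approximate minimizers, and the truncation has to be smooth because the form domain is the
    closure of the test functions.

    The factor exp(- e^x - x) of psi is chosen because it solves f'' + e^x f' = f while E f' tends
    to -1: applying the Laplacian does not worsen its decay, and yet its flux at infinity does not
    vanish.

    Both forms are treated at once by writing the potential as W^2. Multiplication by W counts as a
    third component of the gradient, so one closable operator covers W = 0 (incompleteness) and W =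
    e^(x/2) (conservation). *)

Lemma cvgn_unique (R : realType) (V : normedModType R) (u : nat -> V)
    (x y : V) :
  u n @[n --> \oo] --> x -> u n @[n --> \oo] --> y -> x = y.
Proof. by move=> ux uy; exact: (cvg_unique (@norm_hausdorff _ V) ux uy). Qed.

Lemma eq_le_r (R : realType) (x y : R) : x = y -> x <= y.
Proof. by move=> ->. Qed.

Lemma inv_small (R : realType) (e : R) : 0 < e ->
  exists N, forall n, (N <= n)%N -> n.+1%:R^-1 < e.
Proof.
by move=> e0; have [N _ h] := near_infty_natSinv_lt (PosNum e0); exists N => n /h.
Qed.

Lemma le_cvgn (R : realType) (f : nat -> R) (a b : R) :
  (forall p, a <= f p) -> f p @[p --> \oo] --> b -> a <= b.
Proof.
move=> a_f f_b; rewrite -(cvg_lim _ f_b) //.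
by apply: limr_ge; [apply/cvg_ex; exists b|exact: nearW].
Qed.

(** * Riesz representation for a semi-inner product complete on a subspace *)

Section Riesz.
Context (R : realType) (E : lmodType R) (D : E -> Prop) (B : E -> E -> R).
Hypothesis D0 : D 0.
Hypothesis D_linear : forall a x y, D x -> D y -> D (a *: x + y).
Hypothesis B_sym : forall x y, D x -> D y -> B x y = B y x.
Hypothesis B_linear : forall a x y z, D x -> D y -> D z ->
  B (a *: x + y) z = a * B x z + B y z.
Hypothesis B_ge0 : forall x, D x -> 0 <= B x x.

Lemma D_scale a x : D x -> D (a *: x).
Proof. by move=> Dx; rewrite -[a *: x]addr0; apply: D_linear. Qed.

Lemma D_sub x y : D x -> D y -> D (x - y).
Proof. by move=> Dx Dy; rewrite -scaleN1r addrC; apply: D_linear. Qed.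

Lemma B_linear_r a x y z : D x -> D y -> D z ->
  B z (a *: x + y) = a * B z x + B z y.
Proof.
move=> Dx Dy Dz.
by rewrite B_sym ?B_linear //; [rewrite !(B_sym Dz)|apply: D_linear].
Qed.

Lemma B_expand t x y : D x -> D y ->
  B (t *: y + x) (t *: y + x) = t ^+ 2 * B y y + 2 * t * B x y + B x x.
Proof.
move=> Dx Dy; have Dyx := D_linear t Dy Dx.
by rewrite B_linear // !B_linear_r // (B_sym Dy Dx); ring.
Qed.

Lemma B_sub_sq x y : D x -> D y ->
  B (x - y) (x - y) = B x x - 2 * B x y + B y y.
Proof.
by move=> Dx Dy; rewrite -scaleN1r addrC B_expand //; ring.
Qed.

Lemma quadratic_discriminant (a b c : R) :
  0 <= a -> (forall t, 0 <= t ^+ 2 * a + 2 * t * b + c) -> b ^+ 2 <= a * c.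
Proof.
move=> a0 h; have [a_gt0|] := ltP 0 a.
  have := h (- b / a).
  have -> : (- b / a) ^+ 2 * a + 2 * (- b / a) * b + c = (a * c - b ^+ 2) / a.
    by field; rewrite gt_eqF.
  by rewrite pmulr_lge0 ?invr_gt0 // subr_ge0.
move=> a_le0; have a_eq0 : a = 0 by apply/eqP; rewrite eq_le a_le0 a0.
rewrite a_eq0 mul0r; have [->|b0] := eqVneq b 0; first by rewrite expr0n.
(* With a = 0 the expression is affine in t, and this t makes it equal to -1. *)
have := h (- (c + 1) / (2 * b)); rewrite a_eq0.
have -> : (- (c + 1) / (2 * b)) ^+ 2 * 0 + 2 * (- (c + 1) / (2 * b)) * b + c
  = -1 by field.
by rewrite leNgt ltrN10.
Qed.

Lemma B_0l x : D x -> B 0 x = 0.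
Proof. by move=> Dx; have := B_linear (-1) D0 D0 Dx; rewrite scaler0 addr0; lra. Qed.

Lemma B_cauchy_schwarz x y : D x -> D y -> B x y ^+ 2 <= B x x * B y y.
Proof.
move=> Dx Dy; rewrite mulrC; apply: quadratic_discriminant; first exact: B_ge0.
by move=> t; rewrite -B_expand //; apply/B_ge0/D_linear.
Qed.

Hypothesis B_complete : forall u : nat -> E, (forall p, D (u p)) ->
  (forall e : R, 0 < e -> exists N, forall p q, (N <= p)%N -> (N <= q)%N ->
     B (u p - u q) (u p - u q) < e) ->
  exists2 x, D x & B (u p - x) (u p - x) @[p --> \oo] --> (0 : R).

(** By minimizing B v v - 2 l v. The predicate [D] and the form [B] are kept general because the
    result is used for resolvents (B is s times the form plus the inner product), for time
    integrals, and for orthogonal projection onto a closed subspace. *)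
Lemma riesz (l : E -> R) (C : R) : 0 <= C ->
  (forall a x y, D x -> D y -> l (a *: x + y) = a * l x + l y) ->
  (forall x, D x -> l x ^+ 2 <= C * B x x) ->
  exists2 u, D u & forall v, D v -> B u v = l v.
Proof.
move=> C0 l_linear l_bound.
pose J v := B v v - 2 * l v.
have J_ge v : D v -> - C <= J v.
  move=> Dv; rewrite /J.
  suff : 2 * l v <= B v v + C by lra.
  have BC : 0 <= B v v + C by rewrite addr_ge0 // B_ge0.
  have [l0|l0] := leP (l v) 0; first by apply: le_trans BC; lra.
  have := l_bound _ Dv; have := sqr_ge0 (B v v - C) => h1 h2.
  by rewrite -ler_sqr ?nnegrE //; [lra|lra].
pose S := [set J v | v in D].
have infS : has_inf S.
  split; first by exists (J 0); exists 0.
  by exists (- C) => _ [v Dv <-]; exact: J_ge.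
pose m := inf S.
have J_ge_m v : D v -> m <= J v.
  by move=> Dv; apply: ge_inf; [exact: infS.2|exists v].
have minimizing p : exists v, D v /\ J v < m + p.+1%:R^-1.
  have e0 : 0 < (p.+1%:R^-1 : R) by rewrite invr_gt0.
  by have [_ [v Dv <-] Jv] := inf_adherent e0 infS; exists v.
have [v_ v_P] := choice minimizing.
have v_D p : D (v_ p) by have [] := v_P p.
(* Parallelogram law: J at the midpoint of v_i and v_j is also at least m, so two near-minimizers
   are close to each other. *)
have v_gap i j : B (v_ i - v_ j) (v_ i - v_ j)
    <= 2 * (i.+1%:R^-1 + j.+1%:R^-1).
  have Dij : D (2^-1 *: v_ i + 2^-1 *: v_ j) by apply/D_linear/D_scale.
  have := J_ge_m _ Dij; have := (v_P i).2; have := (v_P j).2.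
  have l_half : l (2^-1 *: v_ j) = 2^-1 * l (v_ j).
    have l0 : l 0 = 0.
      have := l_linear (-1) 0 0 D0 D0; rewrite scaler0 addr0; lra.
    by rewrite -[_ *: v_ j]addr0 l_linear // l0 addr0.
  rewrite /J l_linear ?l_half //; last exact: D_scale.
  rewrite B_sub_sq // B_expand //; last exact: D_scale.
  have B_half z : D z -> B (2^-1 *: v_ j) z = 2^-1 * B (v_ j) z.
    by move=> Dz; rewrite -[_ *: v_ j]addr0 B_linear // B_0l // addr0.
  have D_half : D (2^-1 *: v_ j) by exact: D_scale.
  have -> : B (2^-1 *: v_ j) (2^-1 *: v_ j) = 4^-1 * B (v_ j) (v_ j).
    by rewrite B_half // B_sym // B_half //; field.
  rewrite B_half // (B_sym (v_D j) (v_D i)) exprVn.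
  by move: (j.+1%:R^-1) (i.+1%:R^-1) => dj di; lra.
have [e e0|u Du v_u] := B_complete v_D.
  have [N N_lt] := inv_small (divr_gt0 e0 (ltr0n R 4)).
  exists N => p q Np Nq; apply: le_lt_trans (v_gap p q) _.
  have := N_lt _ Np; have := N_lt _ Nq.
  by move: (p.+1%:R^-1) (q.+1%:R^-1) => dp dq; lra.
exists u => // v Dv; apply/eqP; rewrite -subr_eq0 -sqrf_eq0 eq_le sqr_ge0 andbT.
(* The first-order condition holds approximately at v_p: since J (v_p + t v) >= m for all t, a
   discriminant bounds the square of B v_p v - l v by B v v / (p + 1). Replacing v_p by u costs one
   Cauchy-Schwarz term. *)
have bound p : (B u v - l v) ^+ 2 <=
    2 * B v v * (B (v_ p - u) (v_ p - u)) + 2 * B v v * p.+1%:R^-1.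
  have : (B (v_ p) v - l v) ^+ 2 <= B v v * p.+1%:R^-1.
    apply: quadratic_discriminant => [|t]; first exact: B_ge0.
    have := J_ge_m _ (D_linear t Dv (v_D p)); have := (v_P p).2.
    by rewrite /J B_expand // l_linear //; move: (p.+1%:R^-1) => dp; lra.
  have : (B (v_ p) v - B u v) ^+ 2 <= B (v_ p - u) (v_ p - u) * B v v.
    have -> : B (v_ p) v - B u v = B (v_ p - u) v.
      by rewrite addrC -mulN1r -B_linear // scaleN1r addrC.
    by apply: B_cauchy_schwarz => //; exact: D_sub.
  have : 0 <= (B (v_ p) v - l v + (B (v_ p) v - B u v)) ^+ 2 by exact: sqr_ge0.
  move: (p.+1%:R^-1) => dp; lra.
have inv0 : p.+1%:R^-1 @[p --> \oo] --> (0 : R) by exact: cvg_harmonic.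
suff rhs0 : 2 * B v v * B (v_ p - u) (v_ p - u) + 2 * B v v * p.+1%:R^-1
    @[p --> \oo] --> 2 * B v v * 0 + 2 * B v v * 0.
  by rewrite mulr0 addr0 in rhs0; exact: le_cvgn bound rhs0.
by apply: cvgD; apply: cvgM => //; exact: cvg_cst.
Qed.
End Riesz.

Record hilbert (R : realType) := Hilbert {
  hlmod : lmodType R;
  hip : hlmod -> hlmod -> R;
  hip_sym : forall x y, hip x y = hip y x;
  hip_linear : forall a x y z, hip (a *: x + y) z = a * hip x z + hip y z;
  hip_ge0 : forall x, 0 <= hip x x;
  hip_definite : forall x, hip x x = 0 -> x = 0;
  hip_complete : forall u : nat -> hlmod,
    (forall e : R, 0 < e -> exists N, forall p q, (N <= p)%N -> (N <= q)%N ->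
       hip (u p - u q) (u p - u q) < e) ->
    exists x, hip (u p - x) (u p - x) @[p --> \oo] --> (0 : R)
}.

(** An alias of the underlying module, to which the normed structure given by [hnorm] is attached
    below. *)
Definition hspace (R : realType) (H : hilbert R) : Type := hlmod H.
Coercion hspace : hilbert >-> Sortclass.
HB.instance Definition _ (R : realType) (H : hilbert R) :=
  GRing.Lmodule.copy (hspace H) (hlmod H).

Section HilbertNorm.
Context (R : realType) (H : hilbert R).
Implicit Types x y z : H.

Definition ip x y : R := hip x y.

Lemma ip_sym x y : ip x y = ip y x. Proof. exact: hip_sym. Qed.
Lemma ip_linear a x y z : ip (a *: x + y) z = a * ip x z + ip y z.
Proof. exact: hip_linear. Qed.
Lemma ip_ge0 x : 0 <= ip x x. Proof. exact: hip_ge0. Qed.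

Lemma ipDl x y z : ip (x + y) z = ip x z + ip y z.
Proof. by rewrite -[x]scale1r ip_linear mul1r scale1r. Qed.

Lemma ip0l z : ip 0 z = 0.
Proof. by have := ipDl 0 0 z; rewrite addr0; lra. Qed.

Lemma ipZl a x z : ip (a *: x) z = a * ip x z.
Proof. by rewrite -[a *: x]addr0 ip_linear ip0l addr0. Qed.

Lemma ipNl x z : ip (- x) z = - ip x z.
Proof. by rewrite -scaleN1r ipZl mulN1r. Qed.

Lemma ipBl x y z : ip (x - y) z = ip x z - ip y z.
Proof. by rewrite ipDl ipNl. Qed.

Lemma ipDr x y z : ip z (x + y) = ip z x + ip z y.
Proof. by rewrite !(ip_sym z) ipDl. Qed.

Lemma ipZr a x z : ip z (a *: x) = a * ip z x.
Proof. by rewrite !(ip_sym z) ipZl. Qed.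

Lemma ipBr x y z : ip z (x - y) = ip z x - ip z y.
Proof. by rewrite !(ip_sym z) ipBl. Qed.

Lemma ip_cauchy_schwarz x y : ip x y ^+ 2 <= ip x x * ip y y.
Proof.
apply: (@B_cauchy_schwarz R H (fun=> True)) => //.
- by move=> *; exact: ip_sym.
- by move=> *; exact: ip_linear.
- by move=> *; exact: ip_ge0.
Qed.

Definition hnorm x : R := Num.sqrt (ip x x).

Lemma hnorm_sq x : hnorm x ^+ 2 = ip x x.
Proof. exact/sqr_sqrtr/ip_ge0. Qed.

Lemma hnorm_ge0 x : 0 <= hnorm x. Proof. exact: sqrtr_ge0. Qed.

Lemma ip_le_hnorm x y : `|ip x y| <= hnorm x * hnorm y.
Proof.
rewrite -ler_sqr ?nnegrE ?mulr_ge0 ?hnorm_ge0 //.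
by rewrite exprMn !hnorm_sq real_normK ?num_real // ip_cauchy_schwarz.
Qed.

Lemma hnormD x y : hnorm (x + y) <= hnorm x + hnorm y.
Proof.
rewrite -ler_sqr ?nnegrE ?addr_ge0 ?hnorm_ge0 // sqrrD !hnorm_sq.
rewrite ipDl !ipDr (ip_sym y x) mulr2n.
have := le_trans (ler_norm _) (ip_le_hnorm x y); lra.
Qed.

Lemma hnormZ a x : hnorm (a *: x) = `|a| * hnorm x.
Proof.
by rewrite /hnorm ipZl ipZr mulrA -expr2 sqrtrM ?sqr_ge0 // sqrtr_sqr.
Qed.

Lemma hnorm_eq0 x : hnorm x = 0 -> x = 0.
Proof.
move=> x0; apply: hip_definite; rewrite -[LHS]hnorm_sq x0 expr0n //.
Qed.

End HilbertNorm.

HB.instance Definition _ (R : realType) (H : hilbert R) :=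
  Lmodule_isNormed.Build R (hspace H) (@hnormD R H) (@hnormZ R H)
    (@hnorm_eq0 R H).

Section HilbertTopology.
Context (R : realType) (H : hilbert R).
Implicit Types x y z : H.

Lemma norm_sq x : `|x| ^+ 2 = ip x x. Proof. exact: hnorm_sq. Qed.

Lemma ip_le_norm x y : `|ip x y| <= `|x| * `|y|.
Proof. exact: ip_le_hnorm. Qed.

Lemma hilbert_complete (u : nat -> H) :
  (forall e : R, 0 < e -> exists N, forall p q, (N <= p)%N -> (N <= q)%N ->
     `|u p - u q| < e) -> cvg (u @ \oo).
Proof.
move=> u_cauchy.
have [e e0|x u_x] := @hip_complete R H u.
  have [|N N_lt] := u_cauchy (Num.sqrt e); first by rewrite sqrtr_gt0.
  exists N => p q Np Nq; have := N_lt p q Np Nq.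
  rewrite -ltr_sqr ?nnegrE ?sqrtr_ge0 // norm_sq sqr_sqrtr //; exact: ltW.
apply/cvg_ex; exists x; apply/cvgrPdist_lt => e e0.
have e20 : 0 < e ^+ 2 by rewrite exprn_gt0.
near=> p; rewrite distrC -ltr_sqr ?nnegrE // ?ltW // norm_sq.
by near: p; exact: cvgr_lt u_x _ e20.
Unshelve. all: by end_near. Qed.

Lemma ip_ext x y : (forall z, ip x z = ip y z) -> x = y.
Proof.
move=> xy; apply/eqP; rewrite -subr_eq0 -normr_eq0 -sqrf_eq0 norm_sq.
by rewrite ipBl xy subrr.
Qed.

Lemma cvg_ipl {T : Type} (F : set_system T) {FF : Filter F} (f : T -> H) x y :
  f @ F --> x -> ip (f t) y @[t --> F] --> ip x y.
Proof.
move=> f_x; apply/cvgrPdist_le => e e0.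
have d0 : 0 < e / (`|y| + 1) by rewrite divr_gt0 // ltr_pwDr.
near=> t; rewrite -ipBl; apply: le_trans (ip_le_norm _ _) _.
apply: (@le_trans _ _ (e / (`|y| + 1) * (`|y| + 1))).
  by apply: ler_pM => //; [near: t; exact: cvgr_dist_le f_x _ d0|rewrite lerDl].
by rewrite divfK // gt_eqF // ltr_pwDr.
Unshelve. all: by end_near. Qed.

End HilbertTopology.

Arguments cvg_ipl {R H T F FF f x} y _.

(** Vector identities become identities in R after pairing both sides with an arbitrary vector. *)
Ltac hring := apply: ip_ext => ?; rewrite !(ipDl, ipNl, ipZl, ip0l); ring.

Record closed_form (R : realType) (H : hilbert R) := ClosedForm {
  fdom : H -> Prop;
  form : H -> H -> R;
  fdom_linear : forall a x y, fdom x -> fdom y -> fdom (a *: x + y);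
  form_sym : forall x y, fdom x -> fdom y -> form x y = form y x;
  form_linear : forall a x y z, fdom x -> fdom y -> fdom z ->
    form (a *: x + y) z = a * form x z + form y z;
  form_ge0 : forall x, fdom x -> 0 <= form x x;
  form_complete : forall u : nat -> H, (forall p, fdom (u p)) ->
    (forall e : R, 0 < e -> exists N, forall p q, (N <= p)%N -> (N <= q)%N ->
       form (u p - u q) (u p - u q) + ip (u p - u q) (u p - u q) < e) ->
    exists x, [/\ fdom x, form (u p - x) (u p - x) @[p --> \oo] --> (0 : R) &
                 u p @[p --> \oo] --> x];
  fdom_dense : forall x (e : R), 0 < e -> exists2 y, fdom y & `|x - y| < e
}.

(** * Resolvents of a closed form *)

Section Resolvent.
Context (R : realType) (H : hilbert R) (F : closed_form H).
Implicit Types (x y f g a b u v : H) (s t : R).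

Lemma fdom0 : fdom F 0.
Proof.
have [y Dy _] := fdom_dense F 0 ltr01.
by have := fdom_linear (-1) Dy Dy; rewrite scaleN1r addNr.
Qed.

Lemma fdomB x y : fdom F x -> fdom F y -> fdom F (x - y).
Proof. exact: (D_sub (@fdom_linear _ _ F)). Qed.

Lemma formBl x y z : fdom F x -> fdom F y -> fdom F z ->
  form F (x - y) z = form F x z - form F y z.
Proof.
by move=> Dx Dy Dz; rewrite -scaleN1r addrC form_linear // mulN1r addrC.
Qed.

(** The graph of the nonpositive operator L of the form, hence the sign. *)
Definition op f a := fdom F f /\ forall v, fdom F v -> form F f v = - ip a v.

Lemma op_linear s f a g b : op f a -> op g b -> op (s *: f + g) (s *: a + b).
Proof.
move=> [Df fa] [Dg gb]; split; first exact: fdom_linear.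
by move=> v Dv; rewrite form_linear // fa // gb // ip_linear; ring.
Qed.

(** Weak form of u = (1 - s L)^-1 f, which is an implicit Euler step of length s for u' = L u. *)
Definition resolvent_spec s f u :=
  fdom F u /\ forall v, fdom F v -> s * form F u v + ip u v = ip f v.

Definition res s f := xget 0 [set u | resolvent_spec s f u].

Lemma resP s f : 0 < s -> resolvent_spec s f (res s f).
Proof.
move=> s0; rewrite /res; apply: (@xgetPex _ _ [set u | resolvent_spec s f u]).
have ge0 x : fdom F x -> 0 <= s * form F x x.
  by move=> Dx; rewrite mulr_ge0 ?form_ge0 // ltW.
case: (@riesz R H (fdom F) (fun x y => s * form F x y + ip x y) fdom0
   (@fdom_linear _ _ F) _ _ _ _ (ip f) (ip f f)).
- by move=> x y Dx Dy; rewrite form_sym // ip_sym.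
- by move=> c x y z Dx Dy Dz; rewrite form_linear // ip_linear; ring.
- by move=> x Dx; rewrite addr_ge0 ?ge0 ?ip_ge0.
- move=> u Du u_cauchy; have [e e0|x [Dx fx ux]] := form_complete Du.
    (* s form + ip dominates min(s, 1) (form + ip), so a Cauchy sequence for the former is one for
       the latter. *)
    have [|N N_lt] := u_cauchy (e * Num.min s 1).
      by rewrite mulr_gt0 // lt_min s0 ltr01.
    exists N => p q Np Nq; have := N_lt p q Np Nq.
    have m0 : 0 < Num.min s 1 by rewrite lt_min s0 ltr01.
    rewrite -[e * _](mulrC) -ltr_pdivrMl // => /(le_lt_trans _); apply.
    rewrite ler_pdivlMl // mulrDr; apply: lerD.
      by rewrite ler_wpM2r ?form_ge0 //; [exact: fdomB|rewrite ge_min lexx].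
    by rewrite -[leRHS]mul1r ler_wpM2r ?ip_ge0 // ge_min lexx orbT.
  exists x => //.
  rewrite -[X in _ --> X](addr0 (0 : R)) -[X in _ --> X + _](mulr0 s).
  apply: cvgD; first by apply: cvgM => //; exact: cvg_cst.
  have -> : (fun p => ip (u p - x) (u p - x)) = (fun p => `|u p - x| * `|u p - x|).
    by apply/funext => p; rewrite -norm_sq expr2.
  have d0 : `|u p - x| @[p --> \oo] --> (0 : R) by apply/norm_cvg0P/subr_cvg0.
  by rewrite -[X in _ --> X](mulr0 (0 : R)); exact: cvgM.
- exact: ip_ge0.
- by move=> c x y _ _; rewrite ipDr ipZr.
- move=> x Dx; apply: le_trans (ip_cauchy_schwarz _ _) _.
  by rewrite ler_wpM2l ?ip_ge0 // lerDr ge0.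
- by move=> u Du h; exists u.
Qed.

Lemma resolvent_uniq s f u : 0 < s -> resolvent_spec s f u -> res s f = u.
Proof.
move=> s0 [Du u_f]; have [Dr r_f] := resP f s0.
set r := res s f in Dr r_f *.
have Dw : fdom F (r - u) by exact: fdomB.
have : s * form F (r - u) (r - u) + ip (r - u) (r - u) = 0.
  by rewrite formBl // ipBl; have := u_f _ Dw; have := r_f _ Dw; lra.
have : 0 <= s * form F (r - u) (r - u) by rewrite mulr_ge0 ?form_ge0 // ltW.
have := ip_ge0 (r - u) => h1 h2 h3; apply/eqP; rewrite -subr_eq0 -normr_eq0.
by rewrite -sqrf_eq0 norm_sq; apply/eqP; lra.
Qed.

Lemma op_res s f : 0 < s -> op (res s f) (s^-1 *: (res s f - f)).
Proof.
move=> s0; have [Dr r_f] := resP f s0; split => // v Dv.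
have := r_f v Dv; rewrite ipZl ipBl => <-; field; exact: lt0r_neq0.
Qed.

Lemma res_op s f a : 0 < s -> op f a -> res s (f - s *: a) = f.
Proof.
move=> s0 [Df fa]; apply: resolvent_uniq => //; split => // v Dv.
by rewrite fa // ipBl ipZl; ring.
Qed.

Lemma res_linear s c f g : 0 < s -> res s (c *: f + g) = c *: res s f + res s g.
Proof.
move=> s0; apply: resolvent_uniq => //.
have [Df hf] := resP f s0; have [Dg hg] := resP g s0.
split; first exact: fdom_linear.
by move=> v Dv; rewrite form_linear // !ip_linear -hf // -hg //; ring.
Qed.

Lemma res0 s : 0 < s -> res s 0 = 0.
Proof. by move=> s0; have := res_linear (-1) 0 0 s0; rewrite scaler0 addr0 scaleN1r addNr. Qed.

Lemma resD s f g : 0 < s -> res s (f + g) = res s f + res s g.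
Proof. by move=> s0; rewrite -[f in LHS]scale1r res_linear // scale1r. Qed.

Lemma resZ s c f : 0 < s -> res s (c *: f) = c *: res s f.
Proof. by move=> s0; rewrite -[c *: f]addr0 res_linear // res0 // addr0. Qed.

Lemma resB s f g : 0 < s -> res s (f - g) = res s f - res s g.
Proof. by move=> s0; rewrite -scaleN1r addrC res_linear // scaleN1r addrC. Qed.

Lemma res_contract s f : 0 < s -> `|res s f| <= `|f|.
Proof.
move=> s0; have [Dr r_f] := resP f s0.
have [->|r0] := eqVneq (res s f) 0; first by rewrite normr0.
rewrite -(ler_pM2r (x := `|res s f|)) ?normr_gt0 // -expr2 norm_sq.
apply: le_trans (ip_le_norm _ _); rewrite -r_f //.
apply: le_trans (ler_norm _); rewrite lerDr mulr_ge0 ?form_ge0 //; exact: ltW.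
Qed.

Lemma res_sym s f g : 0 < s -> ip (res s f) g = ip f (res s g).
Proof.
move=> s0; have [Df hf] := resP f s0; have [Dg hg] := resP g s0.
by rewrite ip_sym -hg // -hf // form_sym // ip_sym.
Qed.

Lemma res_sub s f a : 0 < s -> op f a -> res s f - f = s *: res s a.
Proof.
move=> s0 fa; rewrite -{2}(res_op s0 fa) -resB // opprB addrC subrK.
by rewrite resZ.
Qed.

Lemma op_res_comm s f a : 0 < s -> op f a -> op (res s f) (res s a).
Proof.
move=> s0 fa; have := op_res f s0; rewrite (res_sub s0 fa) scalerA mulVf ?scale1r //.
exact: lt0r_neq0.
Qed.

Lemma res_comm s t f : 0 < s -> 0 < t -> res s (res t f) = res t (res s f).
Proof.
move=> s0 t0; have h := op_res_comm t0 (op_res f s0).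
have := res_op s0 h; rewrite resZ // resB // scalerA divff ?lt0r_neq0 // scale1r.
by rewrite !resB // opprB addrC subrK.
Qed.

(** Since (1 - s L)(1 - t L) = 1 - (s + t) L + s t L^2, the difference is s t times a product of
    three resolvents applied to L^2 f = b, and resolvents are contractions. *)
Lemma res_add s t f a b : 0 < s -> 0 < t -> op f a -> op a b ->
  `|res s (res t f) - res (s + t) f| <= s * t * `|b|.
Proof.
move=> s0 t0 fa ab; have st0 : 0 < s + t by exact: addr_gt0.
set u := res s (res t f); set a' := res s (res t a); set b' := res s (res t b).
have ua' : op u a' by exact/op_res_comm/op_res_comm.
have f_eq : f = u - (s + t) *: a' + (s * t) *: b'.
  have e1 := res_sub t0 fa; have e2 := res_sub s0 (op_res_comm t0 fa).
  have e3 := res_sub s0 (op_res_comm t0 ab).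
  rewrite -/u -/a' -/b' in e2 e3.
  have -> : f = res t f - t *: res t a by rewrite -e1; hring.
  have -> : res t f = u - s *: a' by rewrite -e2; hring.
  have -> : res t a = a' - s *: b' by rewrite -e3; hring.
  by hring.
rewrite f_eq resD // (res_op st0 ua') opprD addrA subrr add0r normrN resZ //.
rewrite normrZ gtr0_norm ?mulr_gt0 // ler_wpM2l //; first by rewrite mulr_ge0 // ltW.
apply: le_trans (res_contract _ st0) _; apply: le_trans (res_contract _ s0) _.
exact: res_contract.
Qed.

Lemma cvg_res s {T : Type} (G : set_system T) {FG : Filter G} (f_ : T -> H) f :
  0 < s -> f_ n @[n --> G] --> f -> res s (f_ n) @[n --> G] --> res s f.
Proof.
move=> s0 f_f; apply/cvgrPdist_le => e e0; near=> n.
rewrite -resB //; apply: le_trans (res_contract _ s0) _.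
by near: n; exact: cvgr_dist_le f_f _ e0.
Unshelve. all: by end_near. Qed.

(** The relation L f = a amounts to f = (1 - L)^-1 (f - a), which passes to the limit. *)
Lemma op_closed (f_ a_ : nat -> H) f a : (forall n, op (f_ n) (a_ n)) ->
  f_ n @[n --> \oo] --> f -> a_ n @[n --> \oo] --> a -> op f a.
Proof.
move=> fa_ f_f a_a.
have f_eq : f = res 1 (f - a).
  have h : res 1 (f_ n - a_ n) @[n --> \oo] --> res 1 (f - a).
    by apply: cvg_res => //; exact: cvgB.
  have e n : res 1 (f_ n - a_ n) = f_ n.
    by have := res_op ltr01 (fa_ n); rewrite scale1r.
  by rewrite (eq_cvg _ _ e) in h; exact: cvgn_unique f_f h.
have := op_res (f - a) (ltr01 : 0 < 1 :> R).
by rewrite -f_eq invr1 scale1r opprB addrC subrK.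
Qed.

(** Test the resolvent equation with u - f and use that the form is nonnegative at u - f. This gives
    the strong continuity of resolvents at 0, on a dense set. *)
Lemma res_dist s f : 0 < s -> fdom F f -> `|res s f - f| ^+ 2 <= s * form F f f.
Proof.
move=> s0 Df; have [Dr r_f] := resP f s0; set u := res s f in Dr r_f *.
have Dw : fdom F (u - f) by exact: fdomB.
have := r_f _ Dw; have := form_ge0 Dw.
rewrite norm_sq ipBl !ipBr (ip_sym f u).
rewrite -scaleN1r addrC !form_linear //; last exact: fdom_linear.
rewrite !(form_sym _ (fdom_linear _ Df Dr)) // !form_linear // (form_sym Df Dr).
have : 0 <= s * form F u u by rewrite mulr_ge0 ?form_ge0 // ltW.
have : 0 <= s * form F f f by rewrite mulr_ge0 ?form_ge0 // ltW.
move=> h1 h2 h3 h4.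
have : 0 <= s * (form F f f - 2 * form F u f + form F u u) by apply: mulr_ge0; [exact: ltW|lra].
lra.
Qed.

End Resolvent.

(** * The semigroup as a limit of implicit Euler schemes *)

Section Semigroup.
Context (R : realType) (H : hilbert R) (F : closed_form H).
Implicit Types (x y f g a b u v : H) (s t : R) (A B : H -> H) (m n : nat).

(** In the telescoping sum of A^m - B^m, commutation lets each factor A - B act on f itself, where
    the error of a single step is under control; the other factors are contractions. *)
Lemma iter_telescope A B m f :
  (forall x y, `|A x - A y| <= `|x - y|) ->
  (forall x y, `|B x - B y| <= `|x - y|) -> (forall x, A (B x) = B (A x)) ->
  `|iter m A f - iter m B f| <= m%:R * `|A f - B f|.
Proof.
move=> cA cB AB.
have cAm k x y : `|iter k A x - iter k A y| <= `|x - y|.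
  by elim: k => //= k IH; exact: le_trans (cA _ _) IH.
have ABm k x : iter k A (B x) = B (iter k A x) by elim: k => //= k ->; rewrite AB.
elim: m => [|m IH]; first by rewrite subrr normr0 mul0r.
rewrite iterSr [iter m.+1 B f]iterS.
rewrite -(subrKA (iter m A (B f))); apply: le_trans (ler_normD _ _) _.
rewrite -natr1 mulrDl mul1r addrC lerD // ABm.
exact: le_trans (cB _ _) IH.
Qed.

(** 2^n Euler steps. With dyadic numbers of steps each refinement cuts every step into two halves,
    so that [res_add] compares consecutive approximations. *)
Definition approx n t f := iter (2 ^ n) (res F (t / 2 ^+ n)) f.

Lemma dyadic_gt0 n t : 0 < t -> 0 < t / 2 ^+ n.
Proof. by move=> t0; rewrite divr_gt0 // exprn_gt0. Qed.

Lemma steps_total n t : (2 ^ n)%:R * (t / 2 ^+ n) = t.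
Proof. by rewrite natrX mulrC divfK // expf_neq0. Qed.

Lemma iter_res_linear m s c f g : 0 < s ->
  iter m (res F s) (c *: f + g) = c *: iter m (res F s) f + iter m (res F s) g.
Proof. by move=> s0; elim: m => //= m ->; rewrite res_linear. Qed.

Lemma iter_res_contract m s f : 0 < s -> `|iter m (res F s) f| <= `|f|.
Proof.
by move=> s0; elim: m => //= m IH; apply: le_trans (res_contract _ _ s0) IH.
Qed.

Lemma iter_res_sym m s f g : 0 < s ->
  ip (iter m (res F s) f) g = ip f (iter m (res F s) g).
Proof.
move=> s0; elim: m f g => //= m IH f g.
by rewrite res_sym // IH -iterSr.
Qed.

Lemma iter_res_comm m k s t f : 0 < s -> 0 < t ->
  iter m (res F s) (iter k (res F t) f) = iter k (res F t) (iter m (res F s) f).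
Proof.
move=> s0 t0; elim: m f => //= m IH f; rewrite IH.
by elim: k {IH} => //= k <-; rewrite res_comm.
Qed.

Lemma res_lip s x y : 0 < s -> `|res F s x - res F s y| <= `|x - y|.
Proof. by move=> s0; rewrite -resB //; exact: res_contract. Qed.

Lemma approx_linear n t c f g : 0 < t ->
  approx n t (c *: f + g) = c *: approx n t f + approx n t g.
Proof. by move=> t0; apply/iter_res_linear/dyadic_gt0. Qed.

Lemma approxB n t f g : 0 < t -> approx n t (f - g) = approx n t f - approx n t g.
Proof.
by move=> t0; rewrite -scaleN1r addrC approx_linear // scaleN1r addrC.
Qed.

Lemma approx_contract n t f : 0 < t -> `|approx n t f| <= `|f|.
Proof. by move=> t0; apply/iter_res_contract/dyadic_gt0. Qed.

Lemma approx_step n t f a b : 0 < t -> op F f a -> op F a b ->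
  `|approx n t f - approx n.+1 t f| <= t ^+ 2 * `|b| / 4 / 2 ^+ n.
Proof.
move=> t0 fa ab; set s := t / 2 ^+ n.+1.
have s0 : 0 < s by exact: dyadic_gt0.
have s2 : t / 2 ^+ n = s + s.
  by rewrite /s exprS; field; rewrite expf_neq0.
have -> : approx n.+1 t f = iter (2 ^ n) (fun x => res F s (res F s x)) f.
  rewrite /approx -/s expnS mul2n -addnn.
  elim: (2 ^ n)%N => //= m IH; rewrite addnS /=; by rewrite IH.
rewrite distrC; apply: le_trans (iter_telescope _ _ _ _ _) _.
- by move=> x y; apply: le_trans (res_lip _ _ s0) (res_lip _ _ s0).
- by move=> x y; exact/res_lip/dyadic_gt0.
- move=> x; have h := dyadic_gt0 n t0.
  by rewrite (res_comm F x s0 h) (res_comm _ _ s0 h).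
rewrite s2; apply: le_trans (ler_wpM2l _ (res_add s0 s0 fa ab)) _ => //.
rewrite /s exprS natrX; apply: eq_le_r.
by field; rewrite expf_neq0.
Qed.

Lemma approx_cauchy_op2 n k t f a b : 0 < t -> op F f a -> op F a b ->
  `|approx n t f - approx (n + k) t f| <= t ^+ 2 * `|b| / 2 ^+ n.
Proof.
move=> t0 fa ab; set C := t ^+ 2 * `|b|.
have C0 : 0 <= C by rewrite mulr_ge0 // sqr_ge0.
(* A telescoping bound makes the induction on k go through. *)
suff : `|approx n t f - approx (n + k) t f| <= C * (2 ^- n - 2 ^- (n + k)).
  move/le_trans; apply; rewrite ler_wpM2l // lerBlDr lerDl invr_ge0.
  by rewrite exprn_ge0.
elim: k => [|k IH]; first by rewrite addn0 !subrr normr0 mulr0.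
rewrite addnS -(subrKA (approx (n + k) t f)).
apply: le_trans (ler_normD _ _) _; apply: le_trans (lerD IH (approx_step _ t0 fa ab)) _.
rewrite (exprS _ (n + k)) invfM -/C; have : 0 <= C * 2 ^- (n + k).
  by rewrite mulr_ge0 // invr_ge0 exprn_ge0.
move: (2 ^- (n + k)) (2 ^- n) => x y; lra.
Qed.

Lemma res_cvg f : res F t f @[t --> 0^'+] --> f.
Proof.
apply/cvgrPdist_le => e e0; have e3 : 0 < e / 3 by rewrite divr_gt0.
have [g Dg fg] := fdom_dense F f e3.
have d0 : 0 < (e / 3) ^+ 2 / (form F g g + 1).
  by rewrite divr_gt0 ?exprn_gt0 // ltr_pwDr // form_ge0.
near=> t; have t0 : 0 < t by near: t; exact: nbhs_right_gt.
have -> : f - res F t f = f - g - (res F t g - g) - res F t (f - g).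
  by rewrite resB //; hring.
rewrite (_ : e = e / 3 + e / 3 + e / 3); last by field.
apply: le_trans (ler_normB _ _) _; apply: lerD; last first.
  exact: le_trans (res_contract _ _ t0) (ltW fg).
apply: le_trans (ler_normB _ _) _; apply: lerD; first exact: ltW.
rewrite -ler_sqr ?nnegrE ?(ltW e3) //; apply: le_trans (res_dist t0 Dg) _.
have g0 : 0 < form F g g + 1 by rewrite ltr_pwDr // form_ge0.
apply: (@le_trans _ _ (t * (form F g g + 1))).
  by rewrite ler_wpM2l ?(ltW t0) // lerDl.
by rewrite -ler_pdivlMr //; near: t; exact: nbhs_right_le.
Unshelve. all: by end_near. Qed.

(** Two resolvents with small steps move f into the domain of L^2, which is where [res_add] and the
    Taylor bounds below apply. *)
Lemma op2_dense f (e : R) : 0 < e ->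
  exists g a b, [/\ op F g a, op F a b & `|f - g| < e].
Proof.
move=> e0; have e2 : 0 < e / 2 by rewrite divr_gt0.
have res_near g : exists2 s, 0 < s & `|g - res F s g| < e / 2.
  near (0 : R)^'+ => s; exists s; first by near: s; exact: nbhs_right_gt.
  by near: s; move/cvgrPdist_lt: (@res_cvg g) => /(_ _ e2).
have [s s0 fs] := res_near f; have [t t0 ft] := res_near (res F s f).
have o1 := op_res F f s0; have o2 := op_res_comm t0 o1.
exists (res F t (res F s f)), (res F t (s^-1 *: (res F s f - f))).
exists (t^-1 *: (res F t (s^-1 *: (res F s f - f)) - s^-1 *: (res F s f - f))).
split => //; first exact: op_res.
rewrite -(subrKA (res F s f)) (splitr e).
exact: le_lt_trans (ler_normD _ _) (ltrD fs ft).
Unshelve. all: by end_near. Qed.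

Lemma approx_cvg t f : 0 < t -> cvg (approx n t f @[n --> \oo]).
Proof.
move=> t0; apply: hilbert_complete => e e0.
have e3 : 0 < e / 3 by rewrite divr_gt0.
have [g [a [b [ga ab fg]]]] := op2_dense f e3.
pose C := t ^+ 2 * `|b|; have C0 : 0 <= C by rewrite mulr_ge0 // sqr_ge0.
have [N N_lt] := inv_small (divr_gt0 e3 (ltr_pwDr ltr01 C0)).
exists N.
have main p q : (N <= p)%N -> (p <= q)%N -> `|approx p t f - approx q t f| < e.
  move=> Np pq.
  have gpq : `|approx p t g - approx q t g| < e / 3.
    rewrite -(subnKC pq); apply: le_lt_trans (approx_cauchy_op2 _ _ t0 ga ab) _.
    rewrite -/C ltr_pdivrMr ?exprn_gt0 //.
    have := N_lt p Np; rewrite ltr_pdivlMr ?ltr_pwDr // => h.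
    have p2 : p.+1%:R <= 2 ^+ p :> R by rewrite -natrX ler_nat ltn_expl.
    have p0 : 0 < p.+1%:R :> R by [].
    rewrite mulrC ltr_pdivrMr // in h.
    apply: (@lt_le_trans _ _ (e / 3 * p.+1%:R)); first by apply: le_lt_trans h; rewrite lerDl.
    by rewrite ler_wpM2l // ltW.
  have -> : approx p t f - approx q t f = approx p t (f - g)
      + (approx p t g - approx q t g) - approx q t (f - g).
    by rewrite !approxB //; hring.
  rewrite (_ : e = e / 3 + e / 3 + e / 3); last by field.
  apply: le_lt_trans (ler_normB _ _) _; apply: ltrD; last first.
    exact: le_lt_trans (approx_contract _ _ t0) fg.
  apply: le_lt_trans (ler_normD _ _) _; apply: ltrD => //.
  exact: le_lt_trans (approx_contract _ _ t0) fg.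
move=> p q Np Nq; case: (leqP p q) => [pq|/ltnW qp]; first exact: main.
by rewrite distrC; exact: main.
Qed.

(** Being the identity for t <= 0 makes the orbits continuous on the whole line. *)
Definition sg t f : H := if 0 < t then limn (fun n => approx n t f) else f.

Lemma sgP t f : 0 < t -> approx n t f @[n --> \oo] --> sg t f.
Proof. by move=> t0; rewrite /sg t0; exact: approx_cvg. Qed.

Lemma sg_cvg t f g : 0 < t -> approx n t f @[n --> \oo] --> g -> sg t f = g.
Proof. by move=> t0 fg; exact: cvgn_unique (sgP t0) fg. Qed.

Lemma sg0 t f : t <= 0 -> sg t f = f.
Proof. by rewrite /sg leNgt => /negbTE ->. Qed.

Lemma sg_linear t c f g : sg t (c *: f + g) = c *: sg t f + sg t g.
Proof.
have [t0|t0] := ltP 0 t; last by rewrite !sg0.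
apply: sg_cvg => //; under eq_fun do rewrite approx_linear //.
by apply: cvgD; [apply: cvgZ; [exact: cvg_cst|]|]; exact: sgP.
Qed.

Lemma sgB t f g : sg t (f - g) = sg t f - sg t g.
Proof. by rewrite -scaleN1r addrC sg_linear // scaleN1r addrC. Qed.

Lemma sgZ t c f : sg t (c *: f) = c *: sg t f.
Proof.
have sg00 : sg t 0 = 0 by have := sgB t 0 0; rewrite !subrr.
by have := sg_linear t c f 0; rewrite sg00 !addr0.
Qed.

Lemma cvg_norm_le (u : nat -> H) x (r : R) : (forall n, `|u n| <= r) ->
  u n @[n --> \oo] --> x -> `|x| <= r.
Proof.
move=> ur ux; rewrite -lerN2; apply: le_cvgn (cvgN (cvg_norm ux)).
by move=> n; rewrite /= lerN2.
Qed.

Lemma sg_contract t f : `|sg t f| <= `|f|.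
Proof.
have [t0|t0] := ltP 0 t; last by rewrite !sg0.
exact: cvg_norm_le (fun n => approx_contract n f t0) (sgP t0).
Qed.

Lemma sg_sym t f g : ip (sg t f) g = ip f (sg t g).
Proof.
have [t0|t0] := ltP 0 t; last by rewrite !sg0.
have fg : ip (approx n t f) g @[n --> \oo] --> ip (sg t f) g.
  exact: (cvg_ipl g (sgP t0)).
have gf : ip (approx n t f) g @[n --> \oo] --> ip f (sg t g).
  have e n : ip (approx n t f) g = ip (approx n t g) f.
    by rewrite (ip_sym _ f); apply/iter_res_sym/dyadic_gt0.
  by rewrite (ip_sym f) (eq_cvg _ _ e); exact: (cvg_ipl f (sgP t0)).
exact: (cvg_unique (@Rhausdorff R) fg gf).
Qed.

(** Resolvents commute, so the two schemes can be interleaved into 2^n double steps; each of them is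
    then compared with one step of length (s + t) / 2^n. *)
Lemma approx_add n s t f a b : 0 < s -> 0 < t -> op F f a -> op F a b ->
  `|approx n s (approx n t f) - approx n (s + t) f| <= s * t * `|b| / 2 ^+ n.
Proof.
move=> s0 t0 fa ab; have s'0 := dyadic_gt0 n s0; have t'0 := dyadic_gt0 n t0.
have -> : approx n s (approx n t f) =
    iter (2 ^ n) (fun x => res F (s / 2 ^+ n) (res F (t / 2 ^+ n) x)) f.
  rewrite /approx; elim: (2 ^ n)%N f {fa} => //= m IH x.
  by rewrite -IH (iter_res_comm m 1 _ s'0 t'0).
apply: le_trans (iter_telescope _ _ _ _ _) _.
- by move=> x y; apply: le_trans (res_lip _ _ s'0) (res_lip _ _ t'0).
- by move=> x y; exact/res_lip/dyadic_gt0/addr_gt0.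
- move=> x; have h := dyadic_gt0 n (addr_gt0 s0 t0).
  by rewrite (res_comm F x t'0 h) (res_comm _ _ s'0 h).
rewrite mulrDl; apply: le_trans (ler_wpM2l _ (res_add s'0 t'0 fa ab)) _ => //.
rewrite natrX; apply: eq_le_r.
by field; rewrite expf_neq0.
Qed.

Lemma sg_comp_cvg s t f : 0 < s -> 0 < t ->
  approx n s (approx n t f) @[n --> \oo] --> sg s (sg t f).
Proof.
move=> s0 t0; apply/subr_cvg0/norm_cvg0P.
apply: (@squeeze_cvgr _ _ _ _ (fun=> 0)
  (fun n => `|approx n t f - sg t f| + `|approx n s (sg t f) - sg s (sg t f)|)).
- near=> n; rewrite normr_ge0 /=.
  rewrite -(subrKA (approx n s (sg t f))); apply: le_trans (ler_normD _ _) _.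
  by rewrite lerD2r -approxB //; exact: approx_contract.
- exact: cvg_cst.
- rewrite -[X in _ --> X](addr0 (0 : R)).
  by apply: cvgD; apply/norm_cvg0P/subr_cvg0; exact: sgP.
Unshelve. all: by end_near. Qed.

Lemma inv_exp2_cvg (c : R) : c / 2 ^+ n @[n --> \oo] --> (0 : R).
Proof.
rewrite -(mulr0 c); apply: cvgM; first exact: cvg_cst.
have e n : 2 ^- n = (2^-1 : R) ^+ n by rewrite exprVn.
rewrite (eq_cvg _ _ e); apply: cvg_expr.
by rewrite ger0_norm // invf_lt1 // ltr1n.
Qed.

Lemma sg_add s t f : 0 <= s -> 0 <= t -> sg (s + t) f = sg s (sg t f).
Proof.
rewrite le_eqVlt => /orP[/eqP <- t0|s0]; first by rewrite add0r (sg0 (sg t f)).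
rewrite le_eqVlt => /orP[/eqP <-|t0]; first by rewrite addr0 (@sg0 0 f).
apply/eqP; rewrite -subr_eq0 -normr_eq0 eq_le normr_ge0 andbT.
apply/ler_addgt0Pr => e e0; rewrite add0r.
have e2 : 0 < e / 2 by rewrite divr_gt0.
(* On the domain of L^2 the identity follows from [approx_add]; it extends by density and
   contraction. *)
have [g [a [b [ga ab fg]]]] := op2_dense f e2.
have gE : sg (s + t) g = sg s (sg t g).
  apply: sg_cvg; first exact: addr_gt0.
  have h := @sg_comp_cvg s t g s0 t0.
  have d0 : approx n s (approx n t g) - approx n (s + t) g @[n --> \oo] --> (0 : H).
    apply/norm_cvg0P; apply: (@squeeze_cvgr _ _ _ _ (fun=> 0)
      (fun n => s * t * `|b| / 2 ^+ n)).
    - by near=> n; rewrite normr_ge0 /=; exact: approx_add ga ab.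
    - exact: cvg_cst.
    - exact: inv_exp2_cvg.
  rewrite -[X in _ --> X](subr0 (sg s (sg t g))).
  have e' n : approx n (s + t) g = approx n s (approx n t g)
      - (approx n s (approx n t g) - approx n (s + t) g) by hring.
  by rewrite (eq_cvg _ _ e'); exact: cvgB.
have -> : sg (s + t) f - sg s (sg t f)
    = sg (s + t) (f - g) - sg s (sg t (f - g)).
  by rewrite !sgB gE; hring.
rewrite (splitr e); apply: le_trans (ler_normB _ _) _; apply: lerD.
  exact: le_trans (sg_contract _ _) (ltW fg).
by apply: le_trans (sg_contract _ _) _; exact: le_trans (sg_contract _ _) (ltW fg).
Unshelve. all: by end_near. Qed.

Lemma iter_res_op m s f a : 0 < s -> op F f a ->
  op F (iter m (res F s) f) (iter m (res F s) a).
Proof. by move=> s0 fa; elim: m => //= m IH; exact: op_res_comm. Qed.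

Lemma iter_res_lip m s f a : 0 < s -> op F f a ->
  `|iter m (res F s) f - f| <= m%:R * s * `|a|.
Proof.
move=> s0 fa.
have -> : iter m (res F s) f - f = iter m (res F s) f - iter m id f.
  by congr (_ - _); elim: m.
apply: le_trans (iter_telescope _ _ _ _ _) _ => //.
  by move=> x y; exact: res_lip.
rewrite (res_sub s0 fa) normrZ gtr0_norm // -mulrA ler_wpM2l // ler_wpM2l //.
  exact: ltW.
exact: res_contract.
Qed.

(** The increment of step m + 1 is s R^(m+1) a with R the resolvent, and it differs from s a by at
    most s (m + 1) s |b|. The induction closes because m^2 + (m + 1) <= (m + 1)^2. *)
Lemma iter_res_taylor m s f a b : 0 < s -> op F f a -> op F a b ->
  `|iter m (res F s) f - f - (m%:R * s) *: a| <= (m%:R * s) ^+ 2 * `|b|.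
Proof.
move=> s0 fa ab; elim: m => [|m IH].
  by rewrite mul0r scale0r subrr subr0 normr0 expr0n mul0r.
have -> : iter m.+1 (res F s) f - f - (m.+1%:R * s) *: a =
    iter m (res F s) f - f - (m%:R * s) *: a
    + s *: (iter m.+1 (res F s) a - a).
  rewrite -natr1 mulrDl mul1r scalerDl.
  have := res_sub s0 (iter_res_op m s0 fa); rewrite -!iterS => e.
  have -> : iter m.+1 (res F s) f = iter m (res F s) f + s *: iter m.+1 (res F s) a.
    by rewrite -e; hring.
  hring.
apply: le_trans (ler_normD _ _) _; apply: le_trans (lerD IH (lexx _)) _.
rewrite normrZ gtr0_norm //.
apply: le_trans (lerD (lexx _) (ler_wpM2l (ltW s0) (iter_res_lip m.+1 s0 ab))) _.
rewrite -natr1 -subr_ge0.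
have -> : ((m%:R + 1) * s) ^+ 2 * `|b| - ((m%:R * s) ^+ 2 * `|b| + s * ((m%:R + 1) * s * `|b|))
  = m%:R * s ^+ 2 * `|b| by ring.
by apply: mulr_ge0 => //; apply: mulr_ge0 => //; exact: sqr_ge0.
Qed.

Lemma sg_lip t f a : 0 <= t -> op F f a -> `|sg t f - f| <= t * `|a|.
Proof.
rewrite le_eqVlt => /orP[/eqP <- _|t0 fa]; first by rewrite sg0 // subrr normr0 mul0r.
apply: (@cvg_norm_le (fun n => approx n t f - f)); last first.
  by apply: cvgB; [exact: sgP|exact: cvg_cst].
move=> n; apply: le_trans (iter_res_lip _ (dyadic_gt0 n t0) fa) _.
by rewrite steps_total.
Qed.

Lemma sg_taylor t f a b : 0 <= t -> op F f a -> op F a b ->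
  `|sg t f - f - t *: a| <= t ^+ 2 * `|b|.
Proof.
rewrite le_eqVlt => /orP[/eqP <- _ _|t0 fa ab].
  by rewrite sg0 // subrr scale0r subr0 normr0 expr0n mul0r.
apply: (@cvg_norm_le (fun n => approx n t f - f - t *: a)); last first.
  by apply: cvgB; [apply: cvgB; [exact: sgP|]|]; exact: cvg_cst.
move=> n; have := iter_res_taylor (2 ^ n) (dyadic_gt0 n t0) fa ab.
by rewrite steps_total.
Qed.

Lemma sg_op t f a : op F f a -> op F (sg t f) (sg t a).
Proof.
move=> fa; have [t0|t0] := ltP 0 t; last by rewrite !sg0.
apply: op_closed (fun n => iter_res_op _ (dyadic_gt0 n t0) fa) _ _; exact: sgP.
Qed.

Lemma sg_cvg0 f : sg t f @[t --> (0 : R)] --> f.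
Proof.
apply/cvgrPdist_le => e e0; have e3 : 0 < e / 3 by rewrite divr_gt0.
have [g [a [b [ga ab fg]]]] := op2_dense f e3.
have d0 : 0 < e / 3 / (`|a| + 1) by rewrite divr_gt0 // ltr_pwDr.
near=> t; have [t0|/ltW t0] := leP 0 t; last by rewrite sg0 // subrr normr0 ltW.
have -> : f - sg t f = f - g - (sg t g - g) - sg t (f - g) by rewrite sgB; hring.
rewrite (_ : e = e / 3 + e / 3 + e / 3); last by field.
apply: le_trans (ler_normB _ _) _; apply: lerD; last first.
  exact: le_trans (sg_contract _ _) (ltW fg).
apply: le_trans (ler_normB _ _) _; apply: lerD; first exact: ltW.
apply: le_trans (sg_lip t0 ga) _.
apply: (@le_trans _ _ (t * (`|a| + 1))); first by rewrite ler_wpM2l // lerDl.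
rewrite -ler_pdivlMr ?ltr_pwDr //; by near: t; exact: (@cvgr_le R _ _ _ id (0 : R) (@cvg_id _ _) _ d0).
Unshelve. all: by end_near. Qed.

Lemma op_approx f a (e : R) : op F f a -> 0 < e ->
  exists g b c, [/\ op F g b, op F b c, `|f - g| < e & `|a - b| < e].
Proof.
move=> fa e0.
near (0 : R)^'+ => s; have s0 : 0 < s by near: s; exact: nbhs_right_gt.
exists (res F s f), (res F s a), (s^-1 *: (res F s a - a)); split.
- exact: op_res_comm.
- exact: op_res.
- by near: s; move/cvgrPdist_lt: (@res_cvg f) => /(_ _ e0).
- by near: s; move/cvgrPdist_lt: (@res_cvg a) => /(_ _ e0).
Unshelve. all: by end_near. Qed.

Lemma sg_right_deriv f a : op F f a ->
  t^-1 *: (sg t f - f) @[t --> 0^'+] --> a.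
Proof.
move=> fa; apply/cvgrPdist_le => e e0; have e3 : 0 < e / 3 by rewrite divr_gt0.
have [g [b [c [gb bc fg ab]]]] := op_approx fa e3.
have d0 : 0 < e / 3 / (`|c| + 1) by rewrite divr_gt0 // ltr_pwDr.
near=> t; have t0 : 0 < t by near: t; exact: nbhs_right_gt.
have fgab : op F (f - g) (a - b).
  by have := op_linear (-1) gb fa; rewrite !scaleN1r ![- _ + _]addrC.
have -> : a - t^-1 *: (sg t f - f) = a - b - t^-1 *: (sg t (f - g) - (f - g))
    - t^-1 *: (sg t g - g - t *: b).
  rewrite sgB; apply: ip_ext => z; rewrite !(ipDl, ipNl, ipZl); field.
  by rewrite gt_eqF.
rewrite (_ : e = e / 3 + e / 3 + e / 3); last by field.
apply: le_trans (ler_normB _ _) _; apply: lerD.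
  apply: le_trans (ler_normB _ _) _; apply: lerD; first exact: ltW.
  rewrite normrZ gtr0_norm ?invr_gt0 // ler_pdivrMl //.
  apply: le_trans (sg_lip (ltW t0) fgab) _; rewrite ler_wpM2l //; exact: ltW.
rewrite normrZ gtr0_norm ?invr_gt0 // ler_pdivrMl //.
apply: le_trans (sg_taylor (ltW t0) gb bc) _; rewrite expr2 -mulrA ler_wpM2l ?(ltW t0) //.
apply: (@le_trans _ _ (t * (`|c| + 1))); first by rewrite ler_wpM2l ?(ltW t0) // lerDl.
by rewrite -ler_pdivlMr ?ltr_pwDr //; near: t; exact: nbhs_right_le.
Unshelve. all: by end_near. Qed.

(** For the converse let g = (1 - L)^-1 (f - a), so that L g = g - f + a. Then the orbit of f - g
    has right derivative f - g at 0; as the semigroup contracts, the pairing of this derivative with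
    f - g is nonpositive, whence f = g. *)
Lemma sg_generator f a : op F f a <-> t^-1 *: (sg t f - f) @[t --> 0^'+] --> a.
Proof.
split; first exact: sg_right_deriv.
move=> fa; pose g := res F 1 (f - a).
have gE : op F g (g - (f - a)).
  by have := op_res F (f - a) (ltr01 : 0 < 1 :> R); rewrite invr1 scale1r.
have da : t^-1 *: (sg t (f - g) - (f - g)) @[t --> 0^'+] --> f - g.
  have -> : f - g = a - (g - (f - a)) by hring.
  have e t : t^-1 *: (sg t (a - (g - (f - a))) - (a - (g - (f - a)))) =
     t^-1 *: (sg t f - f) - t^-1 *: (sg t g - g).
    have -> : a - (g - (f - a)) = f - g by hring.
    by rewrite sgB; hring.
  by rewrite (eq_cvg _ _ e); apply: cvgB => //; exact: sg_right_deriv.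
have : ip (f - g) (f - g) <= 0.
  have h : ip (t^-1 *: (sg t (f - g) - (f - g))) (f - g) @[t --> 0^'+]
      --> ip (f - g) (f - g) by exact: cvg_ipl.
  rewrite -(cvg_lim (@Rhausdorff R) h); apply: limr_le; first by apply/cvg_ex; eexists; exact: h.
  near=> t; have t0 : 0 < t by near: t; exact: nbhs_right_gt.
  rewrite ipZl pmulr_rle0 ?invr_gt0 // ipBl subr_le0.
  apply: le_trans (ler_norm _) _; apply: le_trans (ip_le_norm _ _) _.
  by rewrite -norm_sq expr2 ler_wpM2r // sg_contract.
rewrite -norm_sq => h; have fg : f = g.
  apply/eqP; rewrite -subr_eq0 -normr_eq0 -sqrf_eq0 eq_le h.
  exact: sqr_ge0.
by move: gE; rewrite -fg; congr op; hring.
Unshelve. all: by end_near. Qed.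

End Semigroup.

(** * Time integrals and derivatives of orbits *)

Section TimeIntegral.
Context (R : realType) (H : hilbert R) (F : closed_form H).
Implicit Types (f g a : H) (s t : R).
Local Notation sg := (sg F).
Local Notation leb := lebesgue_measure.

Lemma sg_dist s t f : 0 <= s -> 0 <= t -> `|sg s f - sg t f| <= `|sg `|s - t| f - f|.
Proof.
wlog st : s t / t <= s.
  move=> h s0 t0; have [st|/ltW st] := leP t s; first exact: h.
  by rewrite distrC (distrC s); exact: h.
move=> s0 t0; rewrite ger0_norm ?subr_ge0 //.
have -> : sg s f = sg t (sg (s - t) f) by rewrite -sg_add ?subr_ge0 // addrC subrK.
by rewrite -sgB; exact: sg_contract.
Qed.

Lemma sg_max0 t f : sg (Num.max t 0) f = sg t f.
Proof.
by have [t0|/ltW t0] := leP t 0; rewrite // !sg0.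
Qed.

Lemma sg_continuous f : continuous (fun t : R => sg t f).
Proof.
move=> t; apply/subr_cvg0/norm_cvg0P.
have h : `|sg `|Num.max s 0 - Num.max t 0| f - f| @[s --> t] --> (0 : R).
  apply/norm_cvg0P/subr_cvg0.
  have m0 : `|Num.max s 0 - Num.max t 0| @[s --> t] --> (0 : R).
    rewrite [X in _ --> X](_ : 0 = `|Num.max t 0 - Num.max t 0|); last first.
      by rewrite subrr normr0.
    apply: cvg_norm.
    apply: cvgB; last exact: cvg_cst.
    by apply: continuous_max => //; exact: cvg_cst.
  exact: cvg_comp m0 (@sg_cvg0 _ _ F f).
apply: squeeze_cvgr (cvg_cst 0) h; near=> s.
by rewrite normr_ge0 /= -(sg_max0 s) -(sg_max0 t) sg_dist // le_max lexx orbT.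
Unshelve. all: by end_near. Qed.

Lemma ip_sg_continuous f g : continuous (fun t : R => ip (sg t f) g).
Proof. by move=> t; apply: cvg_ipl; exact: sg_continuous. Qed.

Lemma ip_sg_bound t f g : `|ip (sg t f) g| <= `|f| * `|g|.
Proof.
apply: le_trans (ip_le_norm _ _) _; rewrite ler_wpM2r //; exact: sg_contract.
Qed.

Lemma integrable_continuous (h : R -> R) t : continuous h ->
  leb.-integrable `[0, t] (EFin \o h).
Proof.
move=> ch; apply: continuous_compact_integrable; first exact: segment_compact.
exact: continuous_subspaceT.
Qed.

Definition time_pairing t f g := \int[leb]_(s in `[0, t]) ip (sg s f) g.

(** The vector-valued integral is weak: the real integrals of ip (T_s f) g are linear in g and
    bounded by t |f| |g|, and [riesz] represents them. *)
Lemma sg_integral_exists t f : 0 <= t ->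
  exists u, forall g, ip u g = time_pairing t f g.
Proof.
move=> t0.
have [] := @riesz R H (fun=> True) (@ip R H) I (fun _ _ _ _ _ => I)
  (fun x y _ _ => ip_sym x y) (fun c x y z _ _ _ => ip_linear c x y z)
  (fun x _ => ip_ge0 x) _ (time_pairing t f) ((t * `|f|) ^+ 2).
- by move=> u _ /(@hip_complete R H)[x ux]; exists x.
- exact: sqr_ge0.
- move=> c x y _ _; rewrite /time_pairing.
  have e s : ip (sg s f) (c *: x + y) = c * ip (sg s f) x + ip (sg s f) y.
    by rewrite ipDr ipZr.
  under eq_Rintegral do rewrite e.
  rewrite RintegralD // ?RintegralZl //.
  + exact/integrable_continuous/ip_sg_continuous.
  + apply: (@integrable_continuous (fun s => c * ip (sg s f) x)) => s.
    by apply: cvgM; [exact: cvg_cst|exact: ip_sg_continuous].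
  + exact/integrable_continuous/ip_sg_continuous.
- move=> g _; rewrite -norm_sq -exprMn -(real_normK (num_real (time_pairing _ _ _))).
  rewrite ler_sqr ?nnegrE ?mulr_ge0 //.
  apply: le_trans (le_normr_Rintegral _ _) _ => //.
    exact/integrable_continuous/ip_sg_continuous.
  apply: (@le_trans _ _ (\int[leb]_(s in `[0, t]) (fun=> `|f| * `|g|) s)).
    apply: le_Rintegral => //.
    + apply: (@integrable_continuous (fun s => `|ip (sg s f) g|)) => s.
      by apply: cvg_norm; exact: ip_sg_continuous.
    + by apply: (@integrable_continuous (fun=> `|f| * `|g|)); exact: cst_continuous.
    + by move=> s _; exact: ip_sg_bound.
  rewrite Rintegral_cst //.
  have leb_itv : leb (`[0, t] : set R) = t%:E.
    rewrite lebesgue_measure_itv /= lte_fin.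
    case: ifPn => [_|]; first by rewrite -EFinD subr0.
    by rewrite -leNgt => t_le0; congr _%:E; apply/eqP; rewrite eq_le t0.
  by rewrite [X in fine X]leb_itv /= mulrC mulrA.
- by move=> u _ h; exists u => g; exact: h.
Qed.

Definition sgint t f := xget 0 [set u | forall g, ip u g = time_pairing t f g].

Lemma sgintP t f g : 0 <= t -> ip (sgint t f) g = time_pairing t f g.
Proof.
move=> t0; rewrite /sgint.
by case: xgetP => [u _ ->//|/(_ _)]; have [u hu] := sg_integral_exists f t0 => /(_ u).
Qed.

Lemma sgint_sym t f g : 0 <= t -> ip (sgint t f) g = ip f (sgint t g).
Proof.
move=> t0; rewrite (ip_sym f) !sgintP //; apply: eq_Rintegral => s _.
by rewrite sg_sym ip_sym.
Qed.

(** Both one-sided derivatives reduce to the right derivative at 0: an increment from t factors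
    through T_t, one up to t through T_(t-k), and these factors contract. The error in either
    direction is at most [rho] of the step size. *)
Lemma ip_sg_derive f a g t : op F f a -> 0 < t ->
  is_derive t 1 (fun s => ip (sg s f) g) (ip (sg t a) g).
Proof.
move=> fa t0.
suff d : h^-1 *: (ip (sg (h + t) f) g - ip (sg t f) g) @[h --> (0 : R)^'] --> ip (sg t a) g.
  have e : (fun h => h^-1 *: ((fun s => ip (sg s f) g) (h *: 1 + t) - ip (sg t f) g))
      = (fun h => h^-1 *: (ip (sg (h + t) f) g - ip (sg t f) g)).
    by apply/funext => h; rewrite [h *: _]mulr1.
  apply: DeriveDef; first by apply/cvg_ex; exists (ip (sg t a) g); rewrite e.
  by rewrite /derive e; exact: cvg_lim.
pose rho (k : R) := `|k^-1 *: (sg k f - f) - a| + `|a - sg k a|.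
have rho0 : rho k @[k --> 0^'+] --> (0 : R).
  rewrite -[X in _ --> X](addr0 (0 : R)); apply: cvgD.
    by apply/norm_cvg0P/subr_cvg0; exact: sg_right_deriv.
  have -> : (fun k => `|a - sg k a|) = (fun k => `|sg k a - a|).
    by apply/funext => k; rewrite distrC.
  apply/norm_cvg0P/subr_cvg0/cvg_at_right_filter.
  by have := @sg_continuous a 0; rewrite /continuous_at sg0.
have bound h : h != 0 -> `|h| < t ->
    `|ip (sg t a) g - h^-1 *: (ip (sg (h + t) f) g - ip (sg t f) g)| <= rho `|h| * `|g|.
  move=> h0 ht; rewrite [_ *: _](_ : _ = ip (h^-1 *: (sg (h + t) f - sg t f)) g); last first.
    by rewrite ipZl ipBl.
  rewrite -ipBl; apply: le_trans (ip_le_norm _ _) _; rewrite ler_wpM2r //.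
  have [h_lt0|h_gt0|/eqP] := ltgtP h 0; last by rewrite (negbTE h0).
    rewrite ltr0_norm // in ht *; set k := - h in ht *.
    have k0 : 0 < k by rewrite oppr_gt0.
    have -> : h + t = t - k by rewrite opprK addrC.
    have -> : h^-1 = - k^-1 by rewrite /k invrN opprK.
    have tk : 0 <= t - k by rewrite subr_ge0 ltW.
    have e x : sg t x = sg (t - k) (sg k x) by rewrite -sg_add ?subrK // ltW.
    rewrite !e -sgB -sgZ -sgB; apply: le_trans (sg_contract _ _ _) _.
    rewrite distrC.
    have -> : - k^-1 *: (f - sg k f) - sg k a = (k^-1 *: (sg k f - f) - a) + (a - sg k a).
      by hring.
    exact: ler_normD.
  rewrite gtr0_norm // (addrC h) sg_add ?(ltW t0) ?(ltW h_gt0) // -sgB -sgZ -sgB.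
  apply: le_trans (sg_contract _ _ _) _; rewrite distrC /rho lerDl //.
apply/cvgrPdist_le => e e0.
have rg : rho k * `|g| @[k --> 0^'+] --> (0 : R).
  by rewrite -[X in _ --> X](mul0r `|g|); apply: cvgM => //; exact: cvg_cst.
have [d /= d0 small] := cvgr_le _ rg _ e0.
near=> h; have h0 : h != 0 by near: h; exact: nbhs_dnbhs_neq.
apply: le_trans (bound _ h0 _) _; first by near: h; exact: dnbhs0_lt.
apply: small => /=; last by rewrite normr_gt0.
by rewrite sub0r normrN normr_id; near: h; exact: dnbhs0_lt.
Unshelve. all: by end_near. Qed.

Lemma sgint_op t f a : 0 <= t -> op F f a -> sgint t a = sg t f - f.
Proof.
move=> t0 fa; apply: ip_ext => g; rewrite sgintP // ipBl.
have -> : ip f g = ip (sg 0 f) g by rewrite sg0.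
have [->|t_neq0] := eqVneq t 0.
  by rewrite subrr /time_pairing set_itv1 Rintegral_set1.
have {t_neq0}t0 : 0 < t by rewrite lt_neqAle eq_sym t_neq0.
rewrite /time_pairing /Rintegral (@continuous_FTC2 _ _ (fun s => ip (sg s f) g)) //.
- exact/continuous_subspaceT/ip_sg_continuous.
- split.
  + move=> s; rewrite in_itv /= => /andP[s0 _].
    by have [] := ip_sg_derive g fa s0.
  + apply: cvg_at_right_filter; exact: ip_sg_continuous.
  + apply: cvg_at_left_filter; exact: ip_sg_continuous.
- move=> s; rewrite in_itv /= => /andP[s0 _].
  by rewrite derive1E; have [_ ->] := ip_sg_derive g fa s0.
Qed.

End TimeIntegral.

(** * Smooth functions *)

Section DiffClass.
Context (R : realType) (V : normedModType R) (I : Type) (dir : I -> V).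
Implicit Types (f g : V -> R) (k : nat) (x v : V).

(** The family [dir] has one member on the line and two in the plane; [cinf_comp] combines the two
    cases. *)
Fixpoint diff_class k f : Prop :=
  continuous f /\
  if k is k'.+1 then forall i, (forall x, derivable f x (dir i)) /\
    diff_class k' (fun x => 'D_(dir i) f x)
  else True.

Definition cinf f := forall k, diff_class k f.

Lemma diff_class_cont k f : diff_class k f -> continuous f.
Proof. by case: k => [|k] []. Qed.

Lemma diff_classS k f : diff_class k.+1 f -> diff_class k f.
Proof.
elim: k f => [|k IH] f /= [cf h]; first by split.
by split => // i; have [df /IH] := h i.
Qed.

Lemma cinf_cont f : cinf f -> continuous f.
Proof. by move=> /(_ 0%N)/diff_class_cont. Qed.

Lemma cinf_derivable f i x : cinf f -> derivable f x (dir i).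
Proof. by move=> /(_ 1%N)[_ /(_ i)[]]. Qed.

Lemma cinf_derive f i : cinf f -> cinf (fun x => 'D_(dir i) f x).
Proof. by move=> h k; have [_ /(_ i)[]] := h k.+1. Qed.

(* A class of functions that is stable under differentiation consists of
   smooth functions. *)
Lemma cinf_class (P : (V -> R) -> Prop) :
  (forall f, P f -> continuous f) ->
  (forall f i, P f -> (forall x, derivable f x (dir i)) /\
     P (fun x => 'D_(dir i) f x)) ->
  forall f, P f -> cinf f.
Proof.
move=> Pc Pd f Pf k; elim: k f Pf => [|k IH] f Pf /=; split; [exact: Pc|by []|exact: Pc|].
by move=> i; have [df /IH] := Pd f i Pf.
Qed.

Lemma cinf_cst (c : R) : cinf (fun=> c).
Proof.
apply: (@cinf_class (fun f => exists c, f = fun=> c)); last by exists c.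
  by move=> _ [d ->]; exact: cst_continuous.
move=> _ i [d ->]; split; first by move=> x; exact: derivable_cst.
by exists 0; apply/funext => x; exact: derive_cst.
Qed.

Lemma diff_classD k f g : diff_class k f -> diff_class k g ->
  diff_class k (fun x => f x + g x).
Proof.
elim: k f g => [|k IH] f g [cf hf] [cg hg]; split => //.
- by move=> x; apply: cvgD; [exact: cf|exact: cg].
- by move=> x; apply: cvgD; [exact: cf|exact: cg].
move=> i; have [df f'] := hf i; have [dg g'] := hg i; split.
  by move=> x; exact: (derivableD (df x) (dg x)).
have -> : (fun x => 'D_(dir i) (fun x => f x + g x) x)
  = (fun x => 'D_(dir i) f x + 'D_(dir i) g x).
  by apply/funext => x; exact: (deriveD (df x) (dg x)).
exact: IH.
Qed.

Lemma diff_classM k f g : diff_class k f -> diff_class k g ->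
  diff_class k (fun x => f x * g x).
Proof.
elim: k f g => [|k IH] f g hf hg.
  by split => // x; apply: cvgM; [exact: (proj1 hf)|exact: (proj1 hg)].
split; first by move=> x; apply: cvgM; [exact: (proj1 hf)|exact: (proj1 hg)].
move=> i; have [df f'] := (proj2 hf) i; have [dg g'] := (proj2 hg) i; split.
  by move=> x; exact: (derivableM (df x) (dg x)).
have -> : (fun x => 'D_(dir i) (fun x => f x * g x) x)
  = (fun x => f x * 'D_(dir i) g x + g x * 'D_(dir i) f x).
  by apply/funext => x; exact: (deriveM (df x) (dg x)).
by apply: diff_classD; apply: IH => //; exact: diff_classS.
Qed.

Lemma cinfD f g : cinf f -> cinf g -> cinf (fun x => f x + g x).
Proof. by move=> hf hg k; exact: diff_classD. Qed.

Lemma cinfM f g : cinf f -> cinf g -> cinf (fun x => f x * g x).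
Proof. by move=> hf hg k; exact: diff_classM. Qed.

Lemma cinfZ (c : R) f : cinf f -> cinf (fun x => c * f x).
Proof. by move=> hf; apply: cinfM => //; exact: cinf_cst. Qed.

Lemma cinfN f : cinf f -> cinf (fun x => - f x).
Proof.
by move=> /(cinfZ (-1)); congr cinf; apply/funext => x; rewrite mulN1r.
Qed.

Lemma cinfB f g : cinf f -> cinf g -> cinf (fun x => f x - g x).
Proof. by move=> hf hg; apply: cinfD => //; exact: cinfN. Qed.

Lemma cinfV f : cinf f -> (forall x, f x != 0) -> cinf (fun x => (f x)^-1).
Proof.
move=> hf f0; elim=> [|k IH]; split => //.
- by move=> x; apply: cvgV => //; exact: cinf_cont.
- by move=> x; apply: cvgV => //; exact: cinf_cont.
move=> i; have df x : derivable f x (dir i) by exact: cinf_derivable.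
split; first by move=> x; exact: derivableV.
have -> : (fun x => 'D_(dir i) (fun x => (f x)^-1) x)
    = (fun x => -1 * ((f x)^-1 * (f x)^-1) * 'D_(dir i) f x).
  apply/funext => x; rewrite deriveV // expr2 invfM mulN1r //.
apply: diff_classM; last exact: cinf_derive.
apply: diff_classM; first exact: cinf_cst.
exact: diff_classM.
Qed.

Lemma derive_line f x v : 'D_v f x = derive1 (fun h : R => f (h *: v + x)) 0.
Proof.
rewrite /derive derive1E /derive.
set g1 := fun h => h^-1 *: _; set g2 := fun h => h^-1 *: _.
suff -> : g1 = g2 by [].
by apply/funext => h; rewrite /g1 /g2 /= addr0 scale0r add0r [_%:A]mulr1.
Qed.

(** Along the line h -> h v + x this is the chain rule for functions of one variable, and
    derivability along v is what [diff_class] provides. *)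
Lemma is_derive_comp (g : R -> R) f x v : derivable f x v ->
  derivable g (f x) 1 -> is_derive x v (g \o f) (derive1 g (f x) * 'D_v f x).
Proof.
move=> df dg; pose F (h : R) := f (h *: v + x).
have F0 : F 0 = f x by rewrite /F scale0r add0r.
have dF : derivable F 0 1 by move/derivable1P : df.
rewrite -F0 in dg.
have -> : derive1 g (f x) * 'D_v f x = 'D_v (g \o f) x.
  by rewrite !derive_line -F0; exact/esym/(derive1_comp dF dg).
apply: derivableP; apply/derivable1P.
by apply/derivable1_diffP/(@differentiable_comp _ _ _ _ F g);
  exact/derivable1_diffP.
Qed.

End DiffClass.

Definition cinf1 (R : realType) (f : R -> R) := cinf (fun _ : unit => (1 : R)) f.

Section DiffClassComp.
Context (R : realType) (V : normedModType R) (I : Type) (dir : I -> V).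
Implicit Types (f : V -> R) (g : R -> R).

Lemma cinf1_derivable g x : cinf1 g -> derivable g x 1.
Proof. by move=> hg; exact: (@cinf_derivable _ _ _ _ g tt x hg). Qed.

Lemma cinf1_derive g : cinf1 g -> cinf1 (derive1 g).
Proof.
by move=> /(cinf_derive tt); congr cinf; apply/funext => x; rewrite derive1E.
Qed.

Lemma cinf_comp g f : cinf1 g -> cinf dir f -> cinf dir (fun x => g (f x)).
Proof.
move=> hg hf k; elim: k g hg => [|k IH] g hg; split => //.
- by move=> x; apply: continuous_comp; exact: cinf_cont.
- by move=> x; apply: continuous_comp; exact: cinf_cont.
move=> i.
have d x : is_derive x (dir i) (fun x => g (f x)) (derive1 g (f x) * 'D_(dir i) f x).
  by apply: is_derive_comp; [exact: (@cinf_derivable _ _ _ dir f i x hf)|exact: cinf1_derivable].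
split; first by move=> x; have [] := d x.
have -> : (fun x => 'D_(dir i) (fun x => g (f x)) x)
  = (fun x => derive1 g (f x) * 'D_(dir i) f x).
  by apply/funext => x; have [_ ->] := d x.
apply: diff_classM; last exact: cinf_derive.
exact/IH/cinf1_derive.
Qed.

End DiffClassComp.

(** * Flat functions, smooth steps and plateaus *)

Section OneVariable.
Context (R : realType).
Implicit Types (f g : R -> R) (p : {poly R}) (x u : R).

Lemma cinf1_class (P : (R -> R) -> Prop) :
  (forall f, P f -> exists2 g, P g & forall x, is_derive x 1 f (g x)) ->
  forall f, P f -> cinf1 f.
Proof.
move=> Pd; apply: (@cinf_class R R unit (fun=> 1) P).
  move=> f /Pd[g _ fg] x; apply/differentiable_continuous/derivable1_diffP.
  by have [] := fg x.
move=> f i /Pd[g Pg fg]; split; first by move=> x; have [] := fg x.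
by have -> : (fun x => 'D_1 f x) = g by apply/funext => x; have [_ ->] := fg x.
Qed.

Lemma cinf1_id : cinf1 (@id R).
Proof.
apply: (@cinf1_class (fun f => f = id \/ exists c, f = fun=> c)); last by left.
move=> f [->|[c ->]].
  by exists (fun=> 1) => [|x]; [right; exists 1|exact: is_derive_id].
by exists (fun=> 0) => [|x]; [right; exists 0|exact: is_derive_cst].
Qed.

Lemma cinf1_expR : cinf1 (@expR R).
Proof.
apply: (@cinf1_class (fun f => f = expR)) => // _ ->.
by exists expR => // x; exact: is_derive_expR.
Qed.

(** The n-th power of u / n <= exp (u / n). *)
Lemma exprn_le_expR n u : 0 <= u -> u ^+ n <= n%:R ^+ n * expR u.
Proof.
move=> u0; case: n => [|n]; first by rewrite !expr0 mul1r -expR0 ler_expR.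
have -> : expR u = expR (u / n.+1%:R) ^+ n.+1.
  by rewrite -expRM_natl mulrC divfK.
rewrite -exprMn; apply: lerXn2r; rewrite ?nnegrE ?mulr_ge0 ?expR_ge0 //.
rewrite -ler_pdivrMl // mulrC; apply: le_trans (expR_ge1Dx _).
by rewrite lerDr.
Qed.

Lemma poly_le_expR p : exists2 C : R, 0 <= C &
  forall u, 0 <= u -> `|p.[u]| <= C * expR u.
Proof.
exists (\sum_(i < size p) `|p`_i| * i%:R ^+ i).
  by apply: sumr_ge0 => i _; rewrite mulr_ge0 // exprn_ge0.
move=> u u0; rewrite horner_coef mulr_suml; apply: le_trans (ler_norm_sum _ _ _) _.
apply: ler_sum => i _; rewrite normrM -mulrA ler_wpM2l //.
by rewrite ger0_norm ?exprn_ge0 // exprn_le_expR.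
Qed.

(** Allowing every polynomial p makes the family stable under differentiation, so that smoothness
    follows from [cinf1_class] alone. *)
Definition flat p x : R := if 0 < x then p.[x^-1] * expR (- x^-1) else 0.

Definition flat_deriv p : {poly R} := 'X^2 * (p - p^`()).

(** A quadratic bound forces the difference quotients at 0 to tend to 0. It comes from bounding u^2
    p(u) by C exp u at u = 1 / x. *)
Lemma flat_bound p : exists2 C : R, 0 <= C & forall x, `|flat p x| <= C * x ^+ 2.
Proof.
have [C C0 hC] := poly_le_expR ('X^2 * p); exists C => // x.
rewrite /flat; case: ifPn => [x0|_]; last by rewrite normr0 mulr_ge0 // sqr_ge0.
have := hC x^-1; rewrite invr_ge0 (ltW x0) => /(_ isT).
rewrite hornerM hornerXn !normrM (gtr0_norm (x := x^-1)) ?invr_gt0 // => h.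
rewrite (gtr0_norm (expR_gt0 _)) expRN ler_pdivrMr ?expR_gt0 //.
have -> : `|p.[x^-1]| = x ^+ 2 * (x^-1 * x^-1 * `|p.[x^-1]|).
  by field; rewrite gt_eqF.
have -> : C * x ^+ 2 * expR x^-1 = x ^+ 2 * (C * expR x^-1) by ring.
by rewrite ler_wpM2l // sqr_ge0.
Qed.

Lemma flat_is_derive p x : is_derive x 1 (flat p) (flat (flat_deriv p) x).
Proof.
have [x0|x0|->] := ltgtP x 0.
- have -> : flat (flat_deriv p) x = 0 by rewrite /flat ltNge (ltW x0).
  apply: (@near_eq_is_derive _ _ _ (fun=> 0)) => //.
  near=> y; rewrite /flat ltNge; have : y < 0 by near: y; exact: (@cvgr_lt R _ _ _ id x (@cvg_id _ _) 0 x0).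
  by move/ltW => ->.
- pose G (y : R) := p.[y^-1] * expR (- y^-1).
  have xn0 : x != 0 by rewrite gt_eqF.
  have dV : is_derive x 1 (fun y : R => y^-1) (- x ^- 2).
    split; first exact: (@derivableV _ _ id x 1 xn0 (@derivable_id _ _ x 1)).
    rewrite (@deriveV _ _ id x 1 xn0 (@derivable_id _ _ x 1)) derive_id.
    by rewrite /GRing.scale /= mulr1.
  have dp : is_derive x 1 (fun y => p.[y^-1]) (p^`().[x^-1] * - x ^- 2).
    have dh : is_derive x^-1 1 (horner p) p^`().[x^-1].
      have := derivableP (@derivable_horner _ p x^-1).
      by rewrite -derive1E -derivE.
    exact: (@is_derive1_comp _ (horner p) (fun y => y^-1)).
  have de : is_derive x 1 (fun y => expR (- y^-1)) (expR (- x^-1) * x ^- 2).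
    apply: (@is_derive1_comp _ expR (fun y => - y^-1)) => //.
    by rewrite -[X in is_derive _ _ _ X]opprK; exact: is_deriveN.
  have dG : is_derive x 1 G (flat (flat_deriv p) x).
    apply: is_derive_eq; rewrite /flat x0 /flat_deriv /GRing.scale /=.
    rewrite hornerM hornerXn hornerD hornerN exprVn; ring.
  apply: (@near_eq_is_derive _ _ _ G) => //.
  by near=> y; rewrite /flat; have -> : 0 < y by near: y; exact: (@cvgr_gt R _ _ _ id x (@cvg_id _ _) 0 x0).
have flat0 q : flat q 0 = 0 by rewrite /flat ltxx.
rewrite flat0; have [C C0 hC] := flat_bound p.
have d : h^-1 *: (flat p (h *: 1 + 0) - flat p 0) @[h --> (0 : R)^'] --> (0 : R).
  apply/norm_cvg0P; apply: (@squeeze_cvgr _ _ _ _ (fun=> 0) (fun h => C * `|h|)).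
  - near=> h; have h0 : h != 0 by near: h; exact: nbhs_dnbhs_neq.
    rewrite normr_ge0 /= flat0 subr0 addr0 [h *: 1]mulr1 normrM normfV.
    rewrite mulrC ler_pdivrMr ?normr_gt0 //; apply: le_trans (hC h) _.
    by rewrite -real_normK ?num_real // expr2 mulrA.
  - exact: cvg_cst.
  - rewrite -[X in _ --> X](mulr0 C); apply: cvgM; first exact: cvg_cst.
    by rewrite -[X in _ --> X](normr0 R); apply: cvg_norm; exact: nbhs_dnbhs.
apply: DeriveDef; first by apply/cvg_ex; exists 0.
exact: cvg_lim d.
Unshelve. all: by end_near. Qed.

Lemma flat_cinf p : cinf1 (flat p).
Proof.
apply: (@cinf1_class (fun f => exists p, f = flat p)); last by exists p.
move=> _ [q ->]; exists (flat (flat_deriv q)); first by exists (flat_deriv q).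
by move=> x; exact: flat_is_derive.
Qed.

Definition flat1 x : R := flat 1 x.

Lemma flat1_ge0 x : 0 <= flat1 x.
Proof. by rewrite /flat1 /flat hornerE mul1r; case: ifP => // _; exact: expR_ge0. Qed.

Lemma flat1_gt0 x : 0 < x -> 0 < flat1 x.
Proof. by rewrite /flat1 /flat => ->; rewrite hornerE mul1r expR_gt0. Qed.

Lemma flat1_eq0 x : x <= 0 -> flat1 x = 0.
Proof. by rewrite /flat1 /flat leNgt => /negbTE ->. Qed.

Lemma flat1_sum_gt0 x : 0 < flat1 x + flat1 (1 - x).
Proof.
have [x0|x0] := ltP 0 x; first by rewrite ltr_pwDl ?flat1_gt0 ?flat1_ge0.
by rewrite ltr_wpDl ?flat1_ge0 // flat1_gt0 // subr_gt0; lra.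
Qed.

Definition step x : R := flat1 x / (flat1 x + flat1 (1 - x)).

Lemma step_cinf : cinf1 step.
Proof.
have f1 : cinf1 flat1 by exact: flat_cinf.
apply: cinfM => //; apply: cinfV; last by move=> x; rewrite gt_eqF // flat1_sum_gt0.
apply: cinfD => //; apply: (cinf_comp (f := fun x => 1 - x)) => //.
by apply: cinfB; [exact: cinf_cst|exact: cinf1_id].
Qed.

Lemma step_eq0 x : x <= 0 -> step x = 0.
Proof. by move=> x0; rewrite /step flat1_eq0 // mul0r. Qed.

Lemma step_eq1 x : 1 <= x -> step x = 1.
Proof.
move=> x1; rewrite /step [flat1 (1 - x)]flat1_eq0 ?subr_le0 // addr0 divff //.
by rewrite gt_eqF // flat1_gt0 // (lt_le_trans ltr01).
Qed.

Lemma step_ge0 x : 0 <= step x.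
Proof. by rewrite divr_ge0 ?flat1_ge0 // ltW // flat1_sum_gt0. Qed.

Lemma step_le1 x : step x <= 1.
Proof. by rewrite ler_pdivrMr ?flat1_sum_gt0 // mul1r lerDl flat1_ge0. Qed.

Definition plateau x : R := step (2 - x) * step (2 + x).

Lemma plateau_cinf : cinf1 plateau.
Proof.
by apply: cinfM; apply: (cinf_comp (f := fun x => _)) step_cinf _;
  [apply: cinfB|apply: cinfD]; (exact: cinf_cst || exact: cinf1_id).
Qed.

Lemma plateau_eq1 x : `|x| <= 1 -> plateau x = 1.
Proof.
by rewrite ler_norml => /andP[x1 x2]; rewrite /plateau !step_eq1 ?mulr1 //; lra.
Qed.

Lemma plateau_eq0 x : 2 <= `|x| -> plateau x = 0.
Proof.
rewrite ler_normr /plateau => /orP[x2|x2].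
  by rewrite (@step_eq0 (2 - x)) ?mul0r //; lra.
by rewrite (@step_eq0 (2 + x)) ?mulr0 //; lra.
Qed.

Lemma plateau_ge0 x : 0 <= plateau x.
Proof. by rewrite mulr_ge0 ?step_ge0. Qed.

Lemma plateau_le1 x : plateau x <= 1.
Proof. by rewrite -[leRHS]mulr1 ler_pM ?step_ge0 ?step_le1. Qed.

End OneVariable.

(** * A smooth substitute for truncation to the unit interval *)

Section Clamp.
Context (R : realType).
Implicit Types (f g : R -> R) (x a b : R).
Local Notation leb := lebesgue_measure.

Lemma antiderivative f a : continuous f -> (forall x, x <= a -> f x = 0) ->
  exists F : R -> R, forall x, is_derive x 1 F (f x).
Proof.
(* Starting to the left of a makes F locally zero at every point up to a - 1, hence differentiable
   there too. *)
move=> cf f0; pose F x := \int[leb]_(t in `[(a - 1), x]) f t.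
exists F => x; have [ax|xa] := ltP (a - 1) x.
  have [||||dF F'] := @continuous_FTC1_closed R f (a - 1) x (x + 1).
  - by rewrite ltrDl.
  - apply: continuous_compact_integrable; first exact: segment_compact.
    exact: continuous_subspaceT.
  - by [].
  - exact: cf.
  by apply: DeriveDef; [exact: dF|rewrite -derive1E; exact: F'].
have xa' : x < a by apply: le_lt_trans xa _; rewrite ltrBlDr ltrDl.
rewrite f0 ?(ltW xa') //; apply: (@near_eq_is_derive _ _ _ (fun=> 0)) => //.
near=> y; rewrite /F Rintegral_mkcond; apply/esym.
rewrite -[RHS](Rintegral_set0 leb f) [RHS]Rintegral_mkcond; apply: eq_Rintegral => t _.
rewrite !patchE in_set0; case: ifPn => //; rewrite inE /= in_itv /= => /andP[_ ty].
apply: f0; apply: le_trans ty _; apply: ltW; near: y.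
exact: (@cvgr_lt R _ _ _ id x (@cvg_id _ _) a xa').
Unshelve. all: by end_near. Qed.

(** Composition with g keeps a test function smooth, does not increase its gradient, and does not
    move values in [0, 1]; this is what the Markov property needs. g is the primitive of a smooth
    plateau with values in [0, 1], equal to 1 on [0, 1] and to 0 outside (- e, 1 + e). *)
Lemma clamp_exists (e : R) : 0 < e -> exists g : R -> R,
  [/\ cinf1 g, forall x, 0 <= x -> x <= 1 -> g x = x,
      forall x y, `|g x - g y| <= `|x - y|, forall x, `|derive1 g x| <= 1 &
      forall x, - e <= g x <= 1 + e].
Proof.
move=> e0; pose h x := step (1 + x / e) * step (1 + (1 - x) / e).
have hc : cinf1 h.
  have lin c d : cinf1 (fun x => 1 + (c + d * x) / e).
    apply: cinfD; first exact: cinf_cst.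
    apply: cinfM; last exact: cinf_cst.
    apply: cinfD; first exact: cinf_cst.
    by apply: cinfZ; exact: cinf1_id.
  apply: cinfM; apply: cinf_comp; try exact: step_cinf.
    by have := lin 0 1; congr cinf1; apply/funext => x; rewrite add0r mul1r.
  by have := lin 1 (-1); congr cinf1; apply/funext => x; rewrite mulN1r.
have h01 x : 0 <= h x <= 1.
  by rewrite mulr_ge0 ?step_ge0 //= -[leRHS]mulr1 ler_pM ?step_ge0 ?step_le1.
have h1 x : 0 <= x -> x <= 1 -> h x = 1.
  by move=> x0 x1; rewrite /h !step_eq1 ?mulr1 // lerDl divr_ge0 ?subr_ge0 ?(ltW e0).
have h_left x : x <= - e -> h x = 0.
  move=> xe; rewrite /h step_eq0 ?mul0r // -lerBrDl sub0r ler_pdivrMr //.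
  by rewrite mulN1r.
have h_right x : 1 + e <= x -> h x = 0.
  move=> xe; rewrite /h (@step_eq0 _ (1 + (1 - x) / e)) ?mulr0 //.
  by rewrite -lerBrDl sub0r ler_pdivrMr // mulN1r; lra.
have [F F'] := antiderivative (cinf_cont hc) h_left.
pose g x := F x - F 0.
have g' x : is_derive x 1 g (h x).
  by rewrite -[h x]subr0; apply: is_deriveB.
have gc : continuous g.
  by move=> x; apply/differentiable_continuous/derivable1_diffP; have [] := g' x.
have mvt x y : x <= y -> exists2 z, z \in `[x, y] & g y - g x = h z * (y - x).
  move=> xy; apply: (@MVT_segment _ g h) => //; exact: continuous_subspaceT.
have g0 : g 0 = 0 by rewrite /g subrr.
have gid x : 0 <= x -> x <= 1 -> g x = x.
  move=> x0 x1; have [z] := mvt 0 x x0; rewrite in_itv /= => /andP[z0 zx].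
  by rewrite g0 !subr0 h1 ?mul1r //; exact: le_trans zx x1.
have glip x y : `|g x - g y| <= `|x - y|.
  wlog xy : x y / y <= x.
    move=> H; have [|/ltW] := leP y x; first exact: H.
    by rewrite distrC (distrC x); exact: H.
  have [z _ ->] := mvt y x xy; have /andP[z0 z1] := h01 z.
  by rewrite normrM ger0_norm // ler_piMl.
exists g; split => //.
- apply: (@cinf1_class _ (fun f => f = g \/ cinf1 f)); last by left.
  move=> f [->|fc]; first by exists h => //; right.
  exists (derive1 f); first by right; exact: cinf1_derive.
  by move=> x; rewrite derive1E; apply: derivableP; exact: cinf1_derivable.
- move=> x; rewrite derive1E; have [_ ->] := g' x.
  by have /andP[z0 z1] := h01 x; rewrite ger0_norm.
have g_e : - e <= g (- e).
  have := glip 0 (- e); rewrite g0 sub0r sub0r opprK normrN (gtr0_norm e0) ler_norml.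
  by move=> /andP[].
have g_1e : g (1 + e) <= 1 + e.
  have := glip (1 + e) 0; rewrite g0 !subr0 [X in _ <= X]gtr0_norm; last by lra.
  by rewrite ler_norml => /andP[].
have mono x y : x <= y -> g x <= g y.
  move=> xy; have [z _ gz] := mvt x y xy; have /andP[z0 _] := h01 z.
  by rewrite -subr_ge0 gz mulr_ge0 // subr_ge0.
move=> x; apply/andP; split.
  have [xe|/ltW xe] := leP x (- e); last exact: le_trans g_e (mono _ _ xe).
  have [z] := mvt x (- e) xe; rewrite in_itv /= => /andP[_ ze].
  by rewrite h_left // mul0r => /eqP; rewrite subr_eq0 => /eqP <-.
have [xe|/ltW xe] := leP (1 + e) x; last exact: le_trans (mono _ _ xe) g_1e.
have [z] := mvt (1 + e) x xe; rewrite in_itv /= => /andP[ze _].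
by rewrite h_right // mul0r => /eqP; rewrite subr_eq0 => /eqP ->.
Qed.

Lemma bounded_support f (r : R) : continuous f ->
  (forall x, r <= `|x| -> f x = 0) -> exists2 C, 0 <= C & forall x, `|f x| <= C.
Proof.
move=> cf f0; have [r0|r0] := leP r 0.
  by exists 0 => // x; rewrite f0 ?normr0 //; apply: le_trans r0 _.
have [||c _ hc] := @EVT_max R (fun x => `|f x|) (- r) r.
- by rewrite ltW // (lt_trans _ r0) // oppr_lt0.
- by apply: continuous_subspaceT => x; apply: cvg_norm; exact: cf.
exists `|f c| => // x; have [xr|xr] := leP r `|x|; first by rewrite f0 ?normr0.
by apply: hc; rewrite in_itv /= -ler_norml ltW.
Qed.

End Clamp.

(** * The surface *)

Section Plane.
Context (R : realType).
Local Notation P := 'rV[R]_2.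
Implicit Types (v w : P) (x y : R).

Definition pt x y : P := \row_j (if j == 0 then x else y).

Lemma pt0 x y : pt x y 0 0 = x. Proof. by rewrite mxE. Qed.
Lemma pt1 x y : pt x y 0 1 = y. Proof. by rewrite mxE. Qed.

Lemma ord2P (j : 'I_2) : (j == 0) || (j == 1).
Proof. by case: j => [[|[|]]]. Qed.

Lemma plane_eq v w : v 0 0 = w 0 0 -> v 0 1 = w 0 1 -> v = w.
Proof.
move=> h0 h1; apply/matrixP => i j; rewrite (ord1 i).
by case/orP: (ord2P j) => /eqP ->.
Qed.

Lemma sum2E (V : nmodType) (F : 'I_2 -> V) : \sum_(i < 2) F i = F 0 + F 1.
Proof.
by rewrite !big_ord_recl big_ord0 addr0; congr (_ + F _); exact: val_inj.
Qed.

Lemma coord_le_norm v j : `|v 0 j| <= `|v|.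
Proof.
have [->|v0] := eqVneq v 0; first by rewrite mxE !normr0.
rewrite [leRHS]mx_normE; apply: (@le_bigmax _ _ _ _ (fun ij => `|v ij.1 ij.2|%:nng) (0, j)).
Qed.

Lemma ball_plane v w (e : R) : 0 < e -> ball v e w <-> `|v 0 0 - w 0 0| < e /\ `|v 0 1 - w 0 1| < e.
Proof.
move=> e0; split.
  by move=> [_ h]; split; exact: (h 0).
move=> [h0 h1]; split => // i j; rewrite (ord1 i).
by case/orP: (ord2P j) => /eqP ->.
Qed.

Lemma pt_continuous2 (T : topologicalType) (f g : T -> R) :
  continuous f -> continuous g -> continuous (fun t => pt (f t) (g t)).
Proof.
move=> cf cg t; apply/cvg_ballP => e e0; near=> s; apply/ball_plane => //.
rewrite !pt0 !pt1; split; near: s.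
  by move: (cf t) => /cvgrPdist_lt/(_ e e0).
by move: (cg t) => /cvgrPdist_lt/(_ e e0).
Unshelve. all: by end_near. Qed.

Lemma coord_cont j : continuous (fun v => v 0 j).
Proof. exact: coord_continuous. Qed.

Lemma plane_connected : connected [set: P].
Proof.
have seg (v : P) : connected ((fun t : R => t *: v) @` `[0, 1]).
  apply: connected_continuous_connected; first exact: segment_connected.
  by apply: continuous_subspaceT => t; apply: cvgZl; exact: cvg_id.
have -> : [set: P] = \bigcup_(v in [set: P]) ((fun t : R => t *: v) @` `[0, 1]).
  apply/seteqP; split => // v _; exists v => //; exists 1; last by rewrite scale1r.
  by rewrite /= in_itv /= ler01 lexx.
apply: bigcup_connected; last by move=> v _; exact: seg.
exists 0 => v _; exists 0; last by rewrite scale0r.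
by rewrite /= in_itv /= ler01 lexx.
Qed.

(** Balls of the sup norm are products of intervals, which relates Borel sets of the plane to the
    product sigma-algebra in [measurable_ptp]. *)
Definition rational_box (q : rat * rat * nat) : set P :=
  ball (pt (ratr q.1.1) (ratr q.1.2)) q.2.+1%:R^-1.

Lemma rational_box_basis v (A : set P) : nbhs v A ->
  exists q, rational_box q v /\ rational_box q `<=` A.
Proof.
move=> /nbhs_ballP[e /= e0 eA].
have [N N_lt] := inv_small (divr_gt0 e0 (ltr0n R 2)).
pose r : R := N.+1%:R^-1.
have r0 : 0 < r by rewrite invr_gt0.
have near_rat (x : R) : exists q : rat, `|ratr q - x| < r.
  have /rat_in_itvoo[q] : x - r < x + r by rewrite ltrBlDr -addrA ltrDl addr_gt0.
  rewrite in_itv /= => /andP[h1 h2]; exists q; rewrite ltr_norml.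
  by apply/andP; split; lra.
have [q0 h0] := near_rat (v 0 0); have [q1 h1] := near_rat (v 0 1).
exists (q0, q1, N); split; first by apply/ball_plane; rewrite ?pt0 ?pt1.
move=> w /(ball_plane _ _ r0); rewrite pt0 pt1 /= => -[w0 w1]; apply: eA.
apply/ball_plane => //.
have re : r + r < e by have := N_lt N (leqnn N); rewrite -/r; lra.
rewrite distrC in h0; rewrite distrC in h1.
split; apply: le_lt_trans re; apply: le_trans (ler_distD (ratr _) _ _) _.
  exact: lerD (ltW h0) (ltW w0).
exact: lerD (ltW h1) (ltW w1).
Qed.

Lemma rational_box_open q : open (rational_box q).
Proof. by apply: ball_open; rewrite invr_gt0. Qed.

Lemma plane_second_countable : @second_countable P.
Proof.
exists (range rational_box).
  by apply: card_le_trans (card_image_le _ _) _; exact: countableP.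
split; first by move=> _ [q _ <-]; exact: rational_box_open.
move=> v A vA; have [q [qv qA]] := rational_box_basis vA.
by exists (rational_box q) => //; split => //; exists q.
Qed.

Lemma open_plane_bigcup (A : set P) : open A ->
  A = \bigcup_(q in [set q | rational_box q `<=` A]) rational_box q.
Proof.
move=> oA; apply/seteqP; split; last by move=> v [q qA]; exact: qA.
move=> v Av; have [q [qv qA]] := rational_box_basis (open_nbhs_nbhs (conj oA Av)).
by exists q.
Qed.

Notation pdir := (fun k : 'I_2 => delta_mx 0 k : P).

Lemma coord_is_derive (j k : 'I_2) v :
  is_derive v (delta_mx 0 k) (fun w : P => w 0 j) (j == k)%:R.
Proof.
have d : h^-1 *: ((h *: delta_mx 0 k + v : P) 0 j - v 0 j) @[h --> (0 : R)^']
    --> ((j == k)%:R : R).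
  apply: cvg_near_cst; near=> h; have h0 : h != 0 by near: h; exact: nbhs_dnbhs_neq.
  by rewrite !mxE addrK eqxx /= /GRing.scale /= mulrA mulVf ?mul1r.
apply: DeriveDef; first by apply/cvg_ex; exists (j == k)%:R.
exact: cvg_lim d.
Unshelve. all: by end_near. Qed.

Lemma coord_cinf (j : 'I_2) : cinf pdir (fun v => v 0 j).
Proof.
apply: (@cinf_class _ _ _ pdir
  (fun f => f = (fun v : P => v 0 j) \/ exists c, f = fun=> c)); last by left.
  by move=> f [->|[c ->]]; [exact: coord_cont|exact: cst_continuous].
move=> f k [->|[c ->]]; split.
- by move=> v; have [] := coord_is_derive j k v.
- right; exists (j == k)%:R; apply/funext => v.
  by have [_ ->] := coord_is_derive j k v.
- by move=> v; exact: derivable_cst.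
- by right; exists 0; apply/funext => v; exact: derive_cst.
Qed.

Lemma cinf_smooth_on (A : set P) (f : P -> R) : cinf pdir f -> smooth_on A f.
Proof.
move=> hf s x _.
have hs : cinf pdir (partials s f).
  by elim: s => //= k s; exact: (@cinf_derive _ _ _ pdir _ k).
split; first exact: (cinf_cont hs).
by move=> k; exact: (@cinf_derivable _ _ _ pdir _ k x hs).
Qed.

Lemma smooth_on_cinf (f : P -> R) : smooth_on setT f -> cinf pdir f.
Proof.
move=> hf; apply: (@cinf_class _ _ _ pdir (fun g => exists s, g = partials s f)); last first.
  by exists [::].
- move=> _ k [s ->]; split; first by move=> x; have [_] := hf s x I.
  by exists (k :: s).
- by move=> _ [s ->] x; have [] := hf s x I.
Qed.

End Plane.

(** * The Riemannian structure *)

Section Surface.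
Context (R : realType).
Local Notation P := 'rV[R]_2.
Local Notation pdir := (fun k : 'I_2 => delta_mx 0 k : P).
Implicit Types (v w : P) (x y : R).

Lemma open_image_id : open ((fun v : P => v) @` [set: P]).
Proof. by rewrite image_id; exact: openT. Qed.

(** One global chart, so that every transition map is the identity and every Jacobian is trivial. *)
Definition plane_manifold : manifold R 2 :=
  @Manifold R 2 P (@norm_hausdorff R P) (@plane_second_countable R)
    (@plane_connected R) unit (fun=> setT) (fun _ v => v) (fun _ v => v)
    (fun=> tt) (fun _ => I) (fun=> openT) (fun=> open_image_id)
    (fun _ _ _ => erefl) (fun _ v _ => cvg_id) (fun _ v _ => cvg_id)
    (fun _ _ k => cinf_smooth_on (@coord_cinf R k)).

Lemma jacobian_id (f : P -> P) v : f = id -> 'J f v = 1%:M.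
Proof.
move=> ->; apply/row_matrixP => i.
rewrite rowE mul_rV_lin1 rowE mulmx1.
by rewrite (_ : ('d id v : P -> P) = id) //; exact: diff_val.
Qed.

(* The density of the Riemannian measure; the metric is dx^2 + E^2 dy^2. *)
Definition E v : R := expR (expR (v 0 0)).

Lemma E_gt0 v : 0 < E v. Proof. exact: expR_gt0. Qed.
Lemma E_ge1 v : 1 <= E v. Proof. by rewrite -expR0 ler_expR expR_ge0. Qed.

Lemma E_cinf : cinf pdir E.
Proof.
apply: (cinf_comp (g := expR)); first exact: cinf1_expR.
by apply: (cinf_comp (g := expR)); [exact: cinf1_expR|exact: coord_cinf].
Qed.

Definition gram v : 'M[R]_2 := diag_mx (pt 1 (E v ^+ 2)).

Lemma gram_smooth k l : smooth_on ((fun v : P => v) @` [set: P]) (fun v => gram v k l).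
Proof.
apply: cinf_smooth_on.
have -> : (fun v => gram v k l) = (fun v => (if k == 0 then 1 else E v * E v) * (k == l)%:R).
  by apply/funext => v; rewrite !mxE mulr_natr.
apply: cinfM; last exact: cinf_cst.
by case: (k == 0); [exact: cinf_cst|apply: cinfM; exact: E_cinf].
Qed.

Lemma dot_gram v (a b : P) :
  (a *m gram v *m b^T) 0 0 = a 0 0 * b 0 0 + E v ^+ 2 * (a 0 1 * b 0 1).
Proof.
rewrite mxE sum2E !mxE !sum2E !mxE /= !mulr1n !mulr0n; ring.
Qed.

Lemma gram_pos v (a : P) : a != 0 -> 0 < (a *m gram v *m a^T) 0 0.
Proof.
move=> a0; rewrite dot_gram -!expr2.
have E2 : 0 < E v ^+ 2 by rewrite exprn_gt0 // E_gt0.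
have [a00|a00] := eqVneq (a 0 0) 0; last first.
  apply: ltr_pwDl; last by rewrite mulr_ge0 ?sqr_ge0.
  by rewrite lt_neqAle sqr_ge0 eq_sym sqrf_eq0 a00.
have [a01|a01] := eqVneq (a 0 1) 0.
  by case/negP: a0; apply/eqP/plane_eq; rewrite mxE.
apply: ltr_wpDl; first exact: sqr_ge0.
by apply: mulr_gt0 => //; rewrite lt_neqAle sqr_ge0 eq_sym sqrf_eq0 a01.
Qed.

Lemma gram_compat (i j : unit) v : setT v -> setT v ->
  let J := 'J (transition (M := plane_manifold) i j) v in
  gram v = J *m gram v *m J^T.
Proof.
move=> _ _ /=; rewrite jacobian_id; last by apply/funext.
by rewrite trmx1 mulmx1 mul1mx.
Qed.

Definition surface : riemannian R 2 :=
  @Riemannian R 2 plane_manifold (fun _ => gram)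
    (fun _ => gram_smooth) (fun _ v _ => tr_diag_mx _) (fun _ v _ => @gram_pos v)
    gram_compat.

Lemma volume_densityE (i : chart surface) v : @volume_density _ _ surface i v = E v.
Proof.
rewrite /volume_density /= det_diag big_ord_recl big_ord1 !mxE /= mul1r.
by rewrite sqrtr_sqr gtr0_norm // E_gt0.
Qed.

Lemma innerE (X Y : field surface) (v : surface) :
  inner X Y v = X tt v 0 0 * Y tt v 0 0 + E v ^+ 2 * (X tt v 0 1 * Y tt v 0 1).
Proof. exact: dot_gram. Qed.

Lemma divE (X : field surface) (v : surface) :
  div X v = (E v)^-1 * (partial 0 (fun w => E w * X tt w 0 0) v
                      + partial 1 (fun w => E w * X tt w 0 1) v).
Proof.
rewrite /div; have -> : @volume_density _ _ surface (chart_at v) = E.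
  by apply/funext => w; exact: volume_densityE.
by rewrite sum2E.
Qed.

Lemma vector_fieldT (X : field surface) : vector_field X.
Proof.
move=> [] [] v _ _; rewrite jacobian_id; last by apply/funext.
by rewrite mulmx1.
Qed.

End Surface.

(** * Geodesic completeness *)

Section Completeness.
Context (R : realType).
Local Notation P := 'rV[R]_2.
Local Notation M := (surface R).
Local Notation leb := (@lebesgue_measure R).
Implicit Types (v w : P) (c : R -> P).

Lemma curve_coord c j (t : R) : C1_curve (c : R -> M) -> t \in `[0, 1] ->
  [/\ {for t, continuous c}, derivable (fun s => c s 0 j) t 1,
      derive1 c t 0 j = derive1 (fun s => c s 0 j) t &
      {for t, continuous (fun s => derive1 c s 0 j)}].
Proof.
move=> hc /hc[ct /(_ tt I)[dc cc]].
have dct : derivable c t 1 by exact: nbhs_singleton dc.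
split => //.
- exact: (derivable_mxP c t 1).1 dct 0 j.
- by rewrite !derive1E derive_mx // mxE.
- exact: (continuous_comp (g := fun v : P => v 0 j) cc (@coord_cont R j _)).
Qed.

Lemma speedE c (t : R) : speed (c : R -> M) t =
  Num.sqrt (derive1 c t 0 0 ^+ 2 + E (c t) ^+ 2 * derive1 c t 0 1 ^+ 2).
Proof. by rewrite /speed /dot /= dot_gram -!expr2. Qed.

Lemma coord_le_speed c j (t : R) : `|derive1 c t 0 j| <= speed (c : R -> M) t.
Proof.
rewrite speedE -sqrtr_sqr ler_wsqrtr //.
case/orP: (ord2P j) => /eqP ->; first by rewrite lerDl mulr_ge0 ?sqr_ge0.
rewrite -[leLHS]add0r; apply: lerD; first exact: sqr_ge0.
rewrite -[leLHS]mul1r ler_wpM2r ?sqr_ge0 //.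
by rewrite -(expr1n _ 2) ler_sqr ?nnegrE ?ler01 ?(ltW (E_gt0 _)) // E_ge1.
Qed.

Lemma speed_continuous c (t : R) : C1_curve (c : R -> M) -> t \in `[0, 1] ->
  {for t, continuous (speed (c : R -> M))}.
Proof.
move=> hc t01; have [ct _ _ c0] := curve_coord 0 hc t01.
have [_ _ _ c1] := curve_coord 1 hc t01.
have -> : speed (c : R -> M) = Num.sqrt \o (fun t => derive1 c t 0 0 * derive1 c t 0 0
    + E (c t) * E (c t) * (derive1 c t 0 1 * derive1 c t 0 1)).
  by apply/funext => s; rewrite speedE /= !expr2.
have Ec : {for t, continuous (fun t => E (c t))}.
  exact: (@continuous_comp _ _ _ c (@E R) t ct (@cinf_cont _ _ _ _ _ (@E_cinf R) (c t))).
apply: continuous_comp; last exact: sqrt_continuous.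
by apply: cvgD; first exact: cvgM; apply: cvgM; exact: cvgM.
Qed.

Lemma speed_measurable c : C1_curve (c : R -> M) ->
  @measurable_fun _ _ (measurableTypeR R) (measurableTypeR R) `[0, 1] (speed (c : R -> M)).
Proof.
move=> hc; apply: subspace_continuous_measurable_fun => //.
apply: continuous_in_subspaceT => s; rewrite inE /= => s01.
exact: speed_continuous.
Qed.

Lemma coord_dist_le_length c j : C1_curve (c : R -> M) ->
  ((`|c 1 0 j - c 0 0 j|)%:E <= curve_length (c : R -> M))%E.
Proof.
move=> hc; pose f s := derive1 c s 0 j.
have cf : {within `[0, 1], continuous f}.
  apply: continuous_in_subspaceT => s; rewrite inE /= => s01.
  by have [] := curve_coord j hc s01.
have ci (s : R) : s \in `[0, 1] -> {for s, continuous (fun s => c s 0 j)}.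
  move=> s01; have [cs _ _ _] := curve_coord j hc s01.
  exact: continuous_comp cs (@coord_cont R j _).
have fint : (\int[leb]_(s in `[0%R, 1%R]) (f s)%:E)%E = ((c 1 0 j)%:E - (c 0 0 j)%:E)%E.
  apply: (@continuous_FTC2 _ f (fun s => c s 0 j)) => //.
    split.
    - by move=> s /subset_itv_oo_cc s01; have [] := curve_coord j hc s01.
    - by apply: cvg_at_right_filter; apply: ci; rewrite in_itv /= lexx ler01.
    - by apply: cvg_at_left_filter; apply: ci; rewrite in_itv /= lexx ler01.
  by move=> s /subset_itv_oo_cc s01; rewrite /f; have [_ _ -> _] := curve_coord j hc s01.
have -> : (`|c 1 0 j - c 0 0 j|)%:E = (`| \int[leb]_(s in `[0%R, 1%R]) (f s)%:E|)%E.
  by rewrite fint.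
have mf : @measurable_fun _ _ (measurableTypeR R) (measurableTypeR R) `[0, 1] f by exact: subspace_continuous_measurable_fun.
have ms := speed_measurable hc.
apply: le_trans (le_abse_integral _ _ _) _ => //; first exact/measurable_EFinP.
apply: ge0_le_integral => //.
- by apply/measurable_EFinP/measurableT_comp.
- exact/measurable_EFinP.
- by move=> s _; rewrite lee_fin coord_le_speed.
Qed.

Lemma coord_dist_le v w j :
  ((`|w 0 j - v 0 j|)%:E <= geodesic_dist (v : M) (w : M))%E.
Proof.
by apply: le_ereal_inf_tmp => _ [c [hc <- <-] <-]; exact: coord_dist_le_length.
Qed.

(** The length of the straight segment, along which E is at most exp (exp b). This returns from
    convergence of the coordinates to convergence in the geodesic distance. *)
Lemma geodesic_dist_le v w (b : R) : v 0 0 <= b -> w 0 0 <= b ->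
  (geodesic_dist (v : M) (w : M) <=
   (`|w 0 0 - v 0 0| + expR (expR b) * `|w 0 1 - v 0 1|)%:E)%E.
Proof.
move=> vb wb; pose c (t : R) : P := v + t *: (w - v).
have dc (s : R) : is_derive s 1 c (w - v).
  have d : h^-1 *: (c (h *: 1 + s) - c s) @[h --> (0 : R)^'] --> w - v.
    apply: cvg_near_cst; near=> h; have h0 : h != 0 by near: h; exact: nbhs_dnbhs_neq.
    rewrite /c scalerDl [h *: 1]mulr1 opprD addrACA subrr add0r addrK scalerA.
    by rewrite mulVf // scale1r.
  apply: DeriveDef; first by apply/cvg_ex; exists (w - v).
  exact: cvg_lim d.
have dcE : derive1 c = fun=> w - v.
  by apply/funext => s; rewrite derive1E; have [_ ->] := dc s.
have hc : C1_curve (c : R -> M).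
  move=> s _; split.
    by apply/differentiable_continuous/derivable1_diffP; have [] := dc s.
  move=> [] _; split; first by near=> r; have [] := dc r.
  rewrite (_ : derive1 _ = fun=> w - v) //; exact: cst_continuous.
have cE s : c s = v + s *: (w - v) by [].
clearbody c; have ms := speed_measurable hc.
apply: (@le_trans _ _ (curve_length (c : R -> M))).
  apply: ereal_inf_lbound; exists c => //; split => //.
    by rewrite cE scale0r addr0.
  by rewrite cE scale1r addrC subrK.
set K := (_ + _ * _).
apply: (@le_trans _ _ (\int[leb]_(t in `[0%R, 1%R]) K%:E)%E).
  apply: ge0_le_integral => //.
  - by move=> s _; rewrite lee_fin sqrtr_ge0.
  - exact/measurable_EFinP.
  - move=> s; rewrite /= in_itv /= => /andP[s0 s1]; rewrite lee_fin speedE dcE !mxE.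
    rewrite -(ger0_norm (x := K)) ?addr_ge0 ?mulr_ge0 ?expR_ge0 // -sqrtr_sqr ler_wsqrtr //.
    have Eb : E (c s) <= expR (expR b).
      rewrite !ler_expR cE !mxE; nra.
    have E0 := E_gt0 (c s); have K0 : 0 <= expR (expR b) by exact: expR_ge0.
    rewrite -(real_normK (num_real (w 0 0 - v 0 0))) -(real_normK (num_real (w 0 1 - v 0 1))) /K.
    have a0 := normr_ge0 (w 0 0 - v 0 0); have b0 := normr_ge0 (w 0 1 - v 0 1).
    set a := `|_| in a0 *; set d := `|_| in b0 *.
    have h1 : E (c s) ^+ 2 * d ^+ 2 <= expR (expR b) ^+ 2 * d ^+ 2.
      apply: ler_wpM2r; first exact: sqr_ge0.
      by rewrite ler_sqr ?nnegrE ?(ltW E0).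
    have h2 : 0 <= a * (expR (expR b) * d) by rewrite !mulr_ge0.
    have -> : (a + expR (expR b) * d) ^+ 2 = a ^+ 2 + expR (expR b) ^+ 2 * d ^+ 2
      + 2 * (a * (expR (expR b) * d)) by ring.
    lra.
rewrite integral_cst //= lebesgue_measure_itv /= lte_fin ltr01 oppr0 adde0 mule1 //.
Unshelve. all: by end_near. Qed.

Lemma real_complete (u : nat -> R) :
  (forall e : R, 0 < e -> exists N, forall p q, (N <= p)%N -> (N <= q)%N ->
     `|u p - u q| < e) -> cvg (u @ \oo).
Proof.
move=> hu; apply/cauchy_cvgP/cauchy_ballP => e e0; have [N hN] := hu e e0.
exists (u @` [set p | (N <= p)%N], u @` [set p | (N <= p)%N]) => /=.
  by split; exists N => // q Nq; exists q.
by move=> [_ _] [/= [p Np <-] [q Nq <-]]; exact: hN.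
Qed.

Lemma surface_complete : geodesically_complete M.
Proof.
move=> u hu.
have cvg_coord j : cvg ((fun p => (u p : P) 0 j) @ \oo).
  apply: real_complete => e e0; have [N hN] := hu e e0; exists N => p q Np Nq.
  by rewrite -lte_fin; apply: le_lt_trans (coord_dist_le _ _ _) (hN q p Nq Np).
have [/cvg_ex[/= x hx] /cvg_ex[/= y hy]] := (cvg_coord 0, cvg_coord 1).
exists (pt x y).
(* The first coordinates are eventually below x + 1, which bounds E on the segments to the limit
   point. *)
pose f p := `|x - (u p : P) 0 0| + expR (expR (x + 1)) * `|y - (u p : P) 0 1|.
have f0 : (f p)%:E @[p --> \oo] --> 0%E.
  apply: cvg_EFin; first exact: nearW.
  have h0 (z : R) g : g p @[p --> \oo] --> z -> `|z - g p| @[p --> \oo] --> (0 : R).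
    move=> gz; rewrite -[X in _ --> X](normr0 R) -(subrr z).
    by apply: cvg_norm; apply: cvgB => //; exact: cvg_cst.
  rewrite -[X in _ --> X](addr0 (0 : R)) -[X in _ --> _ + X](mulr0 (expR (expR (x + 1)))).
  by apply: cvgD; [exact: h0|apply: cvgM; [exact: cvg_cst|exact: h0]].
apply: squeeze_cvge (cvg_cst 0%E) f0; near=> p; apply/andP; split.
  by apply: le_trans (coord_dist_le _ _ 0); rewrite lee_fin.
have := @geodesic_dist_le (u p) (pt x y) (x + 1); rewrite pt0 pt1; apply.
  have : `|x - (u p : P) 0 0| < 1.
    by near: p; move/cvgrPdist_lt: hx => /(_ 1 ltr01).
  by rewrite ltr_norml => /andP[]; lra.
by rewrite lerDl.
Unshelve. all: by end_near. Qed.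

End Completeness.

(** * Measures given by a density *)

Section Density.
Import HBNNSimple.
Context d (T : measurableType d) (R : realType).
Variables (m : {measure set T -> \bar R}) (w : T -> \bar R).
Hypothesis w0 : forall x, (0 <= w x)%E.
Hypothesis w_fin : forall x, w x \is a fin_num.
Hypothesis mw : measurable_fun setT w.
Local Open Scope ereal_scope.

Lemma density_exists : exists nu : {measure set T -> \bar R},
  forall A, measurable A -> nu A = \int[m]_(x in A) w x.
Proof.
pose nu A := \int[m]_(x in A) w x.
have nu0 : nu set0 = 0 by exact: integral_set0.
have nu_ge0 A : 0 <= nu A by apply: integral_ge0 => x _.
have nu_sigma : semi_sigma_additive nu.
  move=> F mF tF mUF; rewrite /nu; apply: cvg_toP.
    by apply: is_cvg_ereal_nneg_natsum => n _; exact: integral_ge0.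
  rewrite ge0_integral_bigcup //; exact: measurable_funTS.
pose mix := isMeasure.Build _ _ _ nu nu0 nu_ge0 nu_sigma.
pose nu' : {measure set T -> \bar R} := HB.pack nu mix.
by exists nu'.
Qed.

Variable nu : {measure set T -> \bar R}.
Hypothesis nuE : forall A, measurable A -> nu A = \int[m]_(x in A) w x.

Lemma nnsfun_integral_density (h : {nnsfun T >-> R}) :
  \int[nu]_x (h x)%:E = \int[m]_x ((h x)%:E * w x).
Proof.
rewrite integralT_nnsfun sintegralE.
have hE x : (h x)%:E * w x = \sum_(y \in range h) ((y * \1_(h @^-1` [set y]) x)%:E * w x).
  by rewrite -ge0_mule_fsuml => [|y]; [rewrite fsumEFin // -fimfunE|exact: nnfun_muleindic_ge0].
under [RHS]eq_integral do rewrite hE.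
rewrite ge0_integral_fsum //; last 2 first.
- move=> y; apply: emeasurable_funM => //; apply/measurable_EFinP.
  by apply: measurable_funM => //; exact: measurable_indic.
- by move=> y x _; rewrite mule_ge0 // nnfun_muleindic_ge0.
apply: eq_fsbigr => y _; rewrite nuE //.
have [y0|y0] := leP 0%R y; last first.
  have -> : h @^-1` [set y] = set0.
    by apply/seteqP; split => // x /= hx; move: y0; rewrite -hx ltNge fun_ge0.
  rewrite integral_set0 mule0; under eq_integral do rewrite indic0 mulr0 mul0e.
  by rewrite integral0.
rewrite integral_mkcond -ge0_integralZl //.
- apply: eq_integral => x _; rewrite patchE indicE.
  by case: ifPn => [/=|_ /=]; rewrite ?mulr1 // mulr0 mule0 mul0e.
- by apply/(measurable_restrictT _ _).1 => //; exact: measurable_funTS.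
- by move=> x _; rewrite patchE; case: ifP.
Qed.

Lemma ge0_integral_density (f : T -> \bar R) :
  measurable_fun setT f -> (forall x, 0 <= f x) ->
  \int[nu]_x f x = \int[m]_x (f x * w x).
Proof.
move=> mf f0; pose h := nnsfun_approx measurableT mf.
have h_nd x : {homo (fun n => (h n x)%:E) : a b / (a <= b)%N >-> a <= b}.
  by move=> a b ab; rewrite lee_fin; exact/lefP/nd_nnsfun_approx.
have h_f x : (h n x)%:E @[n --> \oo] --> f x by exact: cvg_nnsfun_approx.
have mh n : measurable_fun setT (fun x => (h n x)%:E) by exact/measurable_EFinP.
have lhs : \int[nu]_x (h n x)%:E @[n --> \oo] --> \int[nu]_x f x.
  have -> : (fun x => f x) = (fun x => limn (fun n => (h n x)%:E)).
    by apply/funext => x; apply/esym/cvg_lim.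
  by apply: cvg_monotone_convergence => // n x _; rewrite lee_fin.
have rhs : \int[m]_x ((h n x)%:E * w x) @[n --> \oo] --> \int[m]_x (f x * w x).
  have -> : (fun x => f x * w x) = (fun x => limn (fun n => (h n x)%:E * w x)).
    by apply/funext => x; apply/esym/cvg_lim => //; exact: cvgeZr.
  apply: cvg_monotone_convergence => //.
  - by move=> n; exact: emeasurable_funM.
  - by move=> n x _; rewrite mule_ge0 // lee_fin.
  - by move=> x _ a b ab; rewrite lee_wpmul2r //; exact: h_nd.
have e n : \int[nu]_x (h n x)%:E = \int[m]_x ((h n x)%:E * w x).
  exact: nnsfun_integral_density.
by rewrite (eq_cvg _ _ e) in lhs; exact: (cvg_unique (@ereal_hausdorff R) lhs rhs).
Qed.

Lemma integral_density (f : T -> \bar R) : measurable_fun setT f ->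
  \int[nu]_x f x = \int[m]_x (f x * w x).
Proof.
move=> mf; rewrite integralE [RHS]integralE.
rewrite !ge0_integral_density //; [|exact: measurable_funeneg|exact: measurable_funepos].
congr (_ - _); apply: eq_integral => x _.
  rewrite !funeposE; have [fx|fx] := leP 0 (f x).
    by rewrite max_l // mule_ge0.
  by rewrite mul0e max_r // mule_le0_ge0 // ltW.
rewrite !funenegE; have [fx|fx] := leP 0 (- f x).
  by rewrite -mulNe max_l // mule_ge0.
by rewrite mul0e -mulNe max_r // mule_le0_ge0 // ltW.
Qed.

End Density.

(** * Lebesgue measure on the plane *)

Section PlaneMeasure.
Context (R : realType).
Local Notation P := 'rV[R]_2.
Local Notation mR := (measurableTypeR R).
Local Notation leb := (@lebesgue_measure R).
Local Notation B := (borel P).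
Implicit Types (v w : P) (x y : R).

Definition ptp (z : mR * mR) : B := pt z.1 z.2.

Lemma borel_open (A : set P) : open A -> measurable (A : set B).
Proof. by move=> oA; exact: sub_sigma_algebra. Qed.

Lemma preimage_ptp_box q : ptp @^-1` (@rational_box R q) =
  ball (ratr q.1.1 : R) q.2.+1%:R^-1 `*` ball (ratr q.1.2 : R) q.2.+1%:R^-1.
Proof.
have r0 : 0 < (q.2.+1%:R^-1 : R) by rewrite invr_gt0.
apply/seteqP; split=> -[x y].
  by move=> /(ball_plane _ _ r0); rewrite !pt0 !pt1.
by move=> [h0 h1]; apply/ball_plane => //; rewrite !pt0 !pt1.
Qed.

(** An open set is a countable union of rational boxes, and these are rectangles. *)
Lemma measurable_ptp : measurable_fun setT ptp.
Proof.
apply: measurability; first by [].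
move=> _ [A oA <-]; rewrite setTI (open_plane_bigcup oA) preimage_bigcup bigcup_mkcond.
apply: countable_bigcupT_measurable; first exact: countableP.
move=> q; case: ifP => // _; rewrite preimage_ptp_box.
by apply: measurableX; exact: measurable_ball.
Qed.

Lemma continuous_measurable (f : P -> R) : continuous f ->
  @measurable_fun _ _ B mR setT f.
Proof.
move=> /continuousP cf; apply: (measurability _ (RGenOInfty.measurableE R)).
move=> _ [_ [x ->] <-]; rewrite setTI; apply: borel_open; apply: cf.
exact: rray_open.
Qed.

(** The image of the product measure, so that Fubini's theorem applies. *)
Definition lam : {measure set B -> \bar R} :=
  measure_function_pushforward__canonical__measure_function_Measure
    (leb \x leb)%E measurable_ptp.

Lemma lamE A : lam A = (leb \x leb)%E (ptp @^-1` A).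
Proof. by []. Qed.

Lemma lebesgue_segment (a b : R) : a <= b -> leb (`[a, b] : set R) = (b - a)%:E.
Proof.
move=> ab; rewrite lebesgue_measure_itv /= lte_fin.
case: ifPn => [_|]; first by rewrite -EFinD.
by rewrite -leNgt => ba; congr _%:E; apply/eqP; rewrite eq_sym subr_eq0 eq_le ba.
Qed.

Lemma is_lebesgue_lam : is_lebesgue lam.
Proof.
move=> a b ab; rewrite lamE.
have -> : ptp @^-1` [set v | forall k, a 0 k <= v 0 k <= b 0 k] =
    `[a 0 0, b 0 0] `*` `[a 0 1, b 0 1].
  apply/seteqP; split => -[x y].
    move=> h; split => /=; rewrite in_itv /=; first by have := h 0; rewrite pt0.
    by have := h 1; rewrite pt1.
  move=> [/= h0 h1] k; rewrite !in_itv /= in h0 h1.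
  by case/orP: (ord2P k) => /eqP ->; rewrite ?pt0 ?pt1.
rewrite product_measure1E // !big_ord_recl big_ord0 mulr1 EFinM.
have -> : lift ord0 ord0 = 1 :> 'I_2 by exact: val_inj.
by congr (_ * _)%E; exact: lebesgue_segment.
Qed.

Lemma integrable_lam (f : P -> \bar R) : lam.-integrable setT f ->
  (leb \x leb)%E.-integrable setT (f \o ptp).
Proof.
move=> fi; have mf := measurable_int _ fi.
apply/integrableP; split; first exact: measurableT_comp mf measurable_ptp.
have /integrableP[_] := fi; rewrite ge0_integral_pushforward //.
  exact: measurable_ptp.
exact: measurableT_comp.
Qed.

Lemma integral_lam_prod (f : P -> \bar R) : lam.-integrable setT f ->
  (\int[lam]_v f v = \int[leb \x leb]_z (f (ptp z)))%E.
Proof.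
move=> fi; rewrite (integral_pushforward measurable_ptp) //.
  exact: measurable_int fi.
by rewrite preimage_setT; exact: integrable_lam.
Qed.

Lemma integral_lam12 (f : P -> \bar R) : lam.-integrable setT f ->
  (\int[lam]_v f v = \int[leb]_x \int[leb]_y f (pt x y))%E.
Proof.
move=> fi; rewrite integral_lam_prod //.
by rewrite -(integral12_prod_meas1 (integrable_lam fi)).
Qed.

Lemma integral_lam21 (f : P -> \bar R) : lam.-integrable setT f ->
  (\int[lam]_v f v = \int[leb]_y \int[leb]_x f (pt x y))%E.
Proof.
move=> fi; rewrite integral_lam_prod //.
by rewrite -(integral21_prod_meas1 (integrable_lam fi)).
Qed.

Lemma measurable_E : measurable_fun setT (fun v : B => (@E R v)%:E).
Proof.
apply/measurable_EFinP; apply: (@continuous_measurable (@E R)).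
exact: (cinf_cont (@E_cinf R)).
Qed.

End PlaneMeasure.

(** * The Riemannian measure *)

Section RiemannianMeasure.
Context (R : realType).
Local Notation P := 'rV[R]_2.
Local Notation B := (borel P).
Local Notation M := (surface R).

Lemma E_ge0E (v : B) : (0 <= (@E R v)%:E)%E.
Proof. by rewrite lee_fin ltW // E_gt0. Qed.

Definition mu : {measure set (borel M) -> \bar R} :=
  projT1 (cid (density_exists (@lam R) E_ge0E (@measurable_E R))).

Lemma muE (A : set B) : measurable A -> mu A = (\int[@lam R]_(v in A) (E v)%:E)%E.
Proof. rewrite /mu; case: cid => nu /= h; exact: h. Qed.

Lemma is_riemannian_measure_mu : is_riemannian_measure mu.
Proof.
exists (@lam R); first exact: is_lebesgue_lam.
move=> i A mA _; rewrite image_id muE //; apply: eq_integral => v _.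
by rewrite volume_densityE.
Qed.

Lemma integral_mu (f : P -> \bar R) : @measurable_fun _ _ B _ setT f ->
  (\int[mu]_v f v = \int[@lam R]_v (f v * (E v)%:E))%E.
Proof.
apply: integral_density; [exact: E_ge0E|by []|exact: measurable_E|exact: muE].
Qed.

Lemma integrable_mu (f : P -> \bar R) : @measurable_fun _ _ B _ setT f ->
  (@lam R).-integrable setT (fun v => f v * (E v)%:E)%E -> mu.-integrable setT f.
Proof.
move=> mf /integrableP[_ fi]; apply/integrableP; split => //.
rewrite integral_mu; last exact: measurableT_comp.
apply: le_lt_trans fi; rewrite le_eqVlt; apply/orP; left; apply/eqP.
apply: eq_integral => v _; rewrite abseM; congr (_ * _)%E.
by rewrite gee0_abs // E_ge0E.
Qed.

End RiemannianMeasure.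

(** * L^2 spaces *)

Lemma filterS4 (T : Type) (F : set_system T) {FF : Filter F} (P1 P2 P3 P4 Q : set T) :
  (forall x, P1 x -> P2 x -> P3 x -> P4 x -> Q x) -> F P1 -> F P2 -> F P3 -> F P4 -> F Q.
Proof.
move=> h f1 f2 f3 f4; have := @filterI _ F FF _ _ f1 (@filterI _ F FF _ _ f2 (@filterI _ F FF _ _ f3 f4)).
by apply: (@filterS _ F FF) => x [? [? [? ?]]]; exact: h.
Qed.

Lemma filterS5 (T : Type) (F : set_system T) {FF : Filter F} (P1 P2 P3 P4 P5 Q : set T) :
  (forall x, P1 x -> P2 x -> P3 x -> P4 x -> P5 x -> Q x) ->
  F P1 -> F P2 -> F P3 -> F P4 -> F P5 -> F Q.
Proof.
move=> h f1 f2 f3 f4 f5; have := @filterI _ F FF _ _ f1 (@filterI _ F FF _ _ f2 (@filterI _ F FF _ _ f3 (@filterI _ F FF _ _ f4 f5))).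
by apply: (@filterS _ F FF) => x [? [? [? [? ?]]]]; exact: h.
Qed.

(** * Square integrable functions *)

Section L2Functions.
Context d (T : measurableType d) (R : realType) (m : {measure set T -> \bar R}).
Implicit Types (f g h : T -> R) (a : R).

Definition l2 f := f \in Lfun m 2%:E.

Lemma l2P f : l2 f <-> measurable_fun setT f /\ (\int[m]_x (f x ^+ 2)%:E < +oo)%E.
Proof.
have e : (\int[m]_x (f x ^+ 2)%:E = 'N[m]_2%:E[EFin \o f] `^ 2)%E.
  rewrite powR_Lnorm ?pnatr_eq0 //; apply: eq_integral => x _ /=.
  by rewrite (@powR_mulrn _ _ 2) // real_normK // num_real.
rewrite /l2 e; split.
  rewrite inE => /andP[]; rewrite !inE /= => mf fN; split => //.
  by apply: poweR_lty; exact: fN.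
move=> [mf fN]; rewrite inE; apply/andP; split; rewrite inE //=.
by rewrite /finite_norm; apply: lty_poweRy fN; rewrite pnatr_eq0.
Qed.

Lemma l2_measurable f : l2 f -> measurable_fun setT f.
Proof. by move/l2P => []. Qed.

Lemma l2_linear a f g : l2 f -> l2 g -> l2 (a *: f + g).
Proof.
have [_] := @Lfun_submod_closed _ _ _ m 2%:E (lee1n 2); exact.
Qed.

Lemma l2_0 : l2 (cst 0).
Proof. by have [] := @Lfun_submod_closed _ _ _ m 2%:E (lee1n 2). Qed.

Lemma l2Z a f : l2 f -> l2 (a *: f).
Proof. by move=> f2; rewrite -[_ *: _]addr0; apply: l2_linear => //; exact: l2_0. Qed.

Lemma l2D f g : l2 f -> l2 g -> l2 (f + g).
Proof. by move=> f2 g2; rewrite -[f]scale1r; exact: l2_linear. Qed.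

Lemma l2N f : l2 f -> l2 (- f).
Proof. by move=> f2; rewrite -scaleN1r; exact: l2Z. Qed.

Lemma l2B f g : l2 f -> l2 g -> l2 (f - g).
Proof. by move=> f2 g2; apply: l2D => //; exact: l2N. Qed.

Lemma l2_integrable f g : l2 f -> l2 g ->
  m.-integrable setT (fun x => (f x * g x)%:E).
Proof. by move=> f2 g2; exact/Lfun1_integrable/Lfun2_mul_Lfun1. Qed.

Lemma l2_dominated f g : measurable_fun setT f -> l2 g ->
  (forall x, `|f x| <= `|g x|) -> l2 f.
Proof.
move=> mf /l2P[mg g2] fg; apply/l2P; split => //.
apply: le_lt_trans g2; apply: ge0_le_integral => //.
- by move=> x _; rewrite lee_fin sqr_ge0.
- by apply/measurable_EFinP; exact: measurable_funX.
- by apply/measurable_EFinP; exact: measurable_funX.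
- move=> x _; rewrite lee_fin -(real_normK (num_real (f x))).
  by rewrite -(real_normK (num_real (g x))) lerXn2r // nnegrE.
Qed.

Lemma ae_eqP (U : Type) (f g : T -> U) : f = g %[ae m] <-> (\forall x \ae m, f x = g x).
Proof. by split; apply: filterS => x; [exact|]. Qed.

Definition dotm f g : R := \int[m]_x (f x * g x).

Lemma dotmC f g : dotm f g = dotm g f.
Proof. by apply: eq_Rintegral => x _; rewrite mulrC. Qed.

Lemma dotm_linear a f g h : l2 f -> l2 g -> l2 h ->
  dotm (a *: f + g) h = a * dotm f h + dotm g h.
Proof.
move=> f2 g2 h2; rewrite /dotm -RintegralZl //; last exact: l2_integrable.
rewrite -RintegralD //.
- by apply: eq_Rintegral => x _; rewrite !fctE /= /GRing.scale /=; ring.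
- have := l2_integrable (l2Z a f2) h2.
  by apply: eq_integrable => // x _ /=; rewrite !fctE /GRing.scale /= mulrA.
- exact: l2_integrable.
Qed.

Lemma dotm_ge0 f : 0 <= dotm f f.
Proof. by apply: Rintegral_ge0 => x _; rewrite -expr2 sqr_ge0. Qed.

Lemma dotm_ae f f' g g' : l2 f -> l2 f' -> l2 g -> l2 g' ->
  (\forall x \ae m, f x = f' x) -> (\forall x \ae m, g x = g' x) -> dotm f g = dotm f' g'.
Proof.
move=> f2 f'2 g2 g'2 ff' gg'; rewrite /dotm /Rintegral; congr fine.
apply: ae_eq_integral => //.
- by have /integrableP[] := l2_integrable f2 g2.
- by have /integrableP[] := l2_integrable f'2 g'2.
- by move: ff' gg'; apply: filterS2 => x -> -> .
Qed.

Lemma dotmE f : l2 f -> (dotm f f)%:E = (\int[m]_x (f x ^+ 2)%:E)%E.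
Proof.
move=> f2; rewrite /dotm /Rintegral fineK.
  by apply: eq_integral => x _; rewrite expr2.
by apply: integrable_fin_num => //; exact: l2_integrable.
Qed.

Lemma ge0_ae_eq0 f : measurable_fun setT f -> (forall x, 0 <= f x) ->
  (\int[m]_x (f x)%:E = 0)%E -> \forall x \ae m, f x = 0.
Proof.
move=> mf f0 i0; have mEf : measurable_fun setT (EFin \o f) by apply/measurable_EFinP.
have [h _] := @ae_eq_integral_abs _ _ _ m setT measurableT _ mEf.
have : ae_eq m setT (EFin \o f) (cst 0%E).
  apply: h; rewrite -[RHS]i0; apply: eq_integral => x _ /=.
  by rewrite ger0_norm.
by apply: filterS => x /(_ I) /= [].
Qed.

Lemma dotm_definite f : l2 f -> dotm f f = 0 -> \forall x \ae m, f x = 0.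
Proof.
move=> f2 f0; have := dotmE f2; rewrite f0 => /esym i0.
have mf2 : measurable_fun setT (fun x => f x ^+ 2).
  by apply: measurable_funX; exact: l2_measurable.
have := @ge0_ae_eq0 _ mf2 (fun x => sqr_ge0 (f x)) i0.
by apply: filterS => x /eqP; rewrite sqrf_eq0 => /eqP.
Qed.

Lemma L2norm_dotm f : l2 f -> 'N[m]_2%:E[EFin \o f]%E = (Num.sqrt (dotm f f))%:E.
Proof.
move=> f2; have /l2P[mf fi] := f2.
have e : ('N[m]_2%:E[EFin \o f] `^ 2 = (dotm f f)%:E)%E.
  rewrite dotmE // powR_Lnorm ?pnatr_eq0 //; apply: eq_integral => x _ /=.
  by rewrite (@powR_mulrn _ _ 2) // real_normK // num_real.
have : ('N[m]_2%:E[EFin \o f] < +oo)%E.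
  by apply: (@lty_poweRy _ _ 2); rewrite ?pnatr_eq0 // e ltry.
move: (Lnorm_ge0 m 2%:E (EFin \o f)) e.
case: ('N[m]_2%:E[EFin \o f]%E) => [r| |] //; rewrite ?lee_fin => r0.
by rewrite poweR_EFin (@powR_mulrn _ _ 2) // => -[<-] _; rewrite sqrtr_sqr ger0_norm.
Qed.

Lemma l2_fatou (v : nat -> T -> R) f (C : R) : (forall k, l2 (v k)) ->
  measurable_fun setT f -> (\forall x \ae m, v k x @[k --> \oo] --> f x) ->
  (forall k, dotm (v k) (v k) <= C) -> l2 f /\ dotm f f <= C.
Proof.
move=> v2 mf vf vC.
have mv k : measurable_fun setT (fun x => ((v k x ^+ 2)%:E : \bar R)).
  by apply/measurable_EFinP; apply: measurable_funX; exact: l2_measurable.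
have fC : (\int[m]_x (f x ^+ 2)%:E <= C%:E)%E.
  have -> : (\int[m]_x (f x ^+ 2)%:E = \int[m]_x limn_einf (fun k => (v k x ^+ 2)%:E))%E.
    apply: ae_eq_integral => //.
    - by apply/measurable_EFinP; exact: measurable_funX.
    - rewrite /limn_einf; apply: measurableT_comp => //.
      by apply: measurable_fun_limn_esup => k; exact: measurableT_comp.
    - apply: filterS vf => x vx _; apply/esym.
      rewrite (@cvg_limn_einf_sup _ _ (f x ^+ 2)%:E) //; apply/cvg_EFin; first exact: nearW.
      by rewrite [X in X @ _](_ : _ = (fun k => v k x * v k x)) //; exact: cvgM.
  apply: le_trans (fatou m measurableT mv _) _.
    by move=> k x _; rewrite lee_fin sqr_ge0.
  rewrite limn_einf_lim; apply: lime_le; first exact: is_cvg_einfs.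
  apply: nearW => k; apply: le_trans (_ : (dotm (v k) (v k))%:E <= _)%E; last by rewrite lee_fin.
  by rewrite dotmE //; apply: ereal_inf_lbound; exists k => //=.
have f2 : l2 f by apply/l2P; split => //; exact: le_lt_trans fC (ltry _).
by split => //; rewrite -lee_fin dotmE.
Qed.

(** Riesz-Fischer. Along a subsequence the increments d_k satisfy 4^k |d_k|^2 <= 2^-(k+1) in L^2. So
    the series of the functions 4^k d_k^2 has integral at most 1, its sum S is finite almost
    everywhere, and there |d_k| <= 2^-k sqrt S. *)
Lemma l2_complete (u : nat -> T -> R) : (forall n, l2 (u n)) ->
  (forall e : R, 0 < e -> exists N : nat, forall p q : nat, (N <= p)%N -> (N <= q)%N ->
     dotm (u p - u q) (u p - u q) < e) ->
  exists2 f, l2 f & dotm (u p - f) (u p - f) @[p --> \oo] --> (0 : R).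
Proof.
move=> u2 uc.
have /choice[N NP] : forall k : nat, exists N : nat, forall p q : nat,
    (N <= p)%N -> (N <= q)%N ->
    dotm (u p - u q) (u p - u q) < (4 ^+ k * 2 ^+ k.+1)^-1.
  by move=> k; apply: uc; rewrite invr_gt0 mulr_gt0 // exprn_gt0.
pose M := fix M k := if k is k'.+1 then maxn (M k').+1 (N k'.+1) else N 0%N.
have MN k : (N k <= M k)%N by case: k => //= k; exact: leq_maxr.
have MS k : (M k < M k.+1)%N by exact: leq_maxl.
have Mk k : (k <= M k)%N by elim: k => // k ih; exact: leq_ltn_trans (MS k).
pose v k := u (M k).
pose d_ k := v k.+1 - v k.
have d2 k : l2 (d_ k) by apply: l2B; exact: u2.
have dk k : 4 ^+ k * dotm (d_ k) (d_ k) <= 1 / (2 ^ k.+1)%:R.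
  rewrite natrX mulrC -ler_pdivlMr ?exprn_gt0 // div1r -invfM mulrC.
  by apply/ltW/NP; [apply: (leq_trans (MN k)); exact/ltnW|exact: MN].
have md k : measurable_fun setT (fun x => ((4 ^+ k * d_ k x ^+ 2)%:E : \bar R)).
  apply/measurable_EFinP; apply: measurable_funM => //.
  by apply: measurable_funX; exact: l2_measurable.
have d0 k x : (0 <= (4 ^+ k * d_ k x ^+ 2)%:E :> \bar R)%E.
  by rewrite lee_fin; apply: mulr_ge0; [exact: exprn_ge0|exact: sqr_ge0].
have int_lt : (\int[m]_x (\sum_(k <oo) (4 ^+ k * d_ k x ^+ 2)%:E) < +oo)%E.
  rewrite integral_nneseries //.
  have := @epsilon_trick R (fun=> 0%E) 1 predT (fun=> lexx _) ler01.
  rewrite [X in (_ <= X + _)%E]eseries0 // add0e => h; apply: le_lt_trans (ltry 1).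
  apply: le_trans h; apply: lee_nneseries => k _.
    by rewrite integral_ge0.
  rewrite add0e; apply: le_trans (_ : (4 ^+ k * dotm (d_ k) (d_ k))%:E <= _)%E; last by rewrite lee_fin.
  under eq_integral do rewrite EFinM.
  rewrite ge0_integralZl //.
  - by rewrite -dotmE.
  - by apply/measurable_EFinP; apply: measurable_funX; exact: l2_measurable.
  - by move=> x _; rewrite lee_fin sqr_ge0.
have ms : measurable_fun setT (fun x => \sum_(k <oo) (4 ^+ k * d_ k x ^+ 2)%:E)%E.
  by apply: ge0_emeasurable_sum.
have v_cvg : \forall x \ae m, cvg (v k x @[k --> \oo]).
  have si : m.-integrable setT (fun x => \sum_(k <oo) (4 ^+ k * d_ k x ^+ 2)%:E)%E.
    apply/integrableP; split => //; under eq_integral => x _ do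
      rewrite gee0_abs ?nneseries_ge0 //.
    exact: int_lt.
  have := integrable_ae measurableT si; apply: filterS => x /(_ I) sf.
  set S := (\sum_(k <oo) (4 ^+ k * d_ k x ^+ 2)%:E)%E in sf.
  have dS k : `|d_ k x| <= geometric (Num.sqrt (fine S)) 2^-1 k.
    rewrite /geometric /= -(@ler_pXn2r _ 2) // ?nnegrE ?mulr_ge0 ?sqrtr_ge0 ?exprn_ge0 ?invr_ge0 //.
    rewrite exprMn sqr_sqrtr; last by apply: fine_ge0; exact: nneseries_ge0.
    rewrite real_normK ?num_real // -exprM mulnC exprM exprVn.
    rewrite (_ : 2 ^+ 2 = 4 :> R) -?natrX // exprVn ler_pdivlMr ?exprn_gt0 // mulrC.
    rewrite -lee_fin fineK //.
    apply: le_trans (@nneseries_lim_ge _ _ predT 0 k.+1 _); last by move=> j _ _; exact: d0.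
    by rewrite big_nat_recr //= leeDr // sume_ge0.
  have : cvgn (series (telescope (v^~ x))).
    apply: normed_cvg; apply: (series_le_cvg _ _ dS) => [k|k|].
    - exact: normr_ge0.
    - exact: le_trans (dS k).
    - by apply: is_cvg_geometric_series; rewrite ger0_norm // invf_lt1 // ltr1n.
  rewrite telescopeK => cv.
  have -> : v^~ x = (fun k => (v k x - v 0%N x) + v 0%N x) by apply/funext => k; ring.
  by apply: is_cvgD => //; exact: is_cvg_cst.
(* The upper limit is measurable everywhere, so the null set where the sequence diverges need not be
   removed. *)
pose f x := fine (limn_esup (fun k => (v k x)%:E)).
have mf : measurable_fun setT f.
  apply: measurableT_comp => //; apply: measurable_fun_limn_esup => k.
  by apply/measurable_EFinP; exact/l2_measurable/u2.
have vf : \forall x \ae m, v k x @[k --> \oo] --> f x.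
  apply: filterS v_cvg => x vx; rewrite /f is_cvg_limn_esupE; last first.
    by apply/cvg_ex; exists (limn (v^~ x))%:E; apply/cvg_EFin => //; exact: nearW.
  by rewrite EFin_lim.
(* Fatou's lemma along the subsequence turns the Cauchy bound for the whole sequence into a bound on
   its distance to f. *)
have fu (e : R) : 0 < e -> exists N0 : nat, forall p : nat, (N0 <= p)%N ->
    l2 (u p - f) /\ dotm (u p - f) (u p - f) <= e.
  move=> e0; have [N0 N0P] := uc e e0; exists N0 => p N0p.
  apply: (@l2_fatou (fun k => u p - v (k + N0)%N)).
  - by move=> k; apply: l2B; exact: u2.
  - by apply: measurable_funB => //; exact: l2_measurable.
  - apply: filterS vf => x vx; apply: cvgB; first exact: cvg_cst.
    by rewrite (cvg_shiftn N0 (v^~ x)).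
  - move=> k; apply/ltW/N0P => //.
    by apply: leq_trans (Mk _); rewrite leq_addl.
exists f.
  have [N0 /(_ N0 (leqnn _))[h _]] := fu 1 ltr01.
  by rewrite (_ : f = u N0 - (u N0 - f)); [exact: l2B|rewrite opprB addrC subrK].
apply/cvgrPdist_le => e e0; have [N0 N0P] := fu e e0.
exists N0 => // p /= /N0P[_]; rewrite sub0r normrN ger0_norm //.
exact: dotm_ge0.
Qed.

Lemma integrable_bounded_on (K : set T) f (C : R) : measurable K -> (m K < +oo)%E ->
  measurable_fun setT f -> (forall x, ~ K x -> f x = 0) -> (forall x, `|f x| <= C) ->
  m.-integrable setT (EFin \o f).
Proof.
move=> mK Koo mf fK fC; apply/integrableP; split; first exact/measurable_EFinP.
have [[x0]|T0] := pselect (inhabited T); last first.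
  rewrite (_ : setT = set0) ?integral_set0 ?ltry //.
  by apply/seteqP; split => // x _; apply: T0; exists.
have C0 : 0 <= C by exact: le_trans (fC x0).
apply: (@le_lt_trans _ _ (\int[m]_x (C%:E * (\1_K x)%:E))%E).
  apply: ge0_le_integral => //.
  - by apply/measurable_EFinP; exact: measurableT_comp.
  - by apply/measurable_EFinP; apply: measurable_funM => //; exact: measurable_indic.
  - move=> x _; rewrite /= lee_fin indicE; case: (pselect (K x)) => xK.
      by rewrite mem_set // mulr1.
    by rewrite memNset // fK // mulr0 normr0.
rewrite ge0_integralZl //; last first.
- by apply/measurable_EFinP; exact: measurable_indic.
rewrite integral_indic // setIT; have /fineK <- : m K \is a fin_num by rewrite ge0_fin_numE.
by rewrite -EFinM ltry.
Qed.

Lemma Rintegral_cvg (f_ : nat -> T -> R) f g : (forall n, measurable_fun setT (f_ n)) ->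
  measurable_fun setT f -> (\forall x \ae m, f_ n x @[n --> \oo] --> f x) ->
  m.-integrable setT (EFin \o g) -> (\forall x \ae m, forall n, `|f_ n x| <= g x) ->
  \int[m]_x f_ n x @[n --> \oo] --> \int[m]_x f x.
Proof.
move=> mf_ mf f_f gi f_g.
have [||||fi _ h] := @dominated_convergence _ _ _ m setT measurableT
  (fun n => EFin \o f_ n) (EFin \o f) (EFin \o g) _ _ _ gi.
- by move=> n; exact/measurable_EFinP.
- exact/measurable_EFinP.
- by apply: filterS f_f => x fx _; apply: cvg_EFin => //; exact: nearW.
- by apply: filterS f_g => x fg n _ /=; rewrite lee_fin.
rewrite /Rintegral; apply: fine_cvg; rewrite fineK; first exact: h.
exact: integrable_fin_num.
Qed.

End L2Functions.

(** * The Hilbert space of classes modulo null sets *)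

Section L2Space.
Context d (T : measurableType d) (R : realType) (m : {measure set T -> \bar R}).
Implicit Types (f g h : T -> R) (a : R).

(* The classes of L^2 modulo a.e. equality are represented by canonical
   representatives. *)
Definition canon f : T -> R := xget (cst 0) [set g | l2 m g /\ \forall x \ae m, g x = f x].

Lemma canonP f : l2 m f -> l2 m (canon f) /\ \forall x \ae m, canon f x = f x.
Proof.
move=> f2; rewrite /canon; case: xgetP => [g _ //|] /(_ f) /= [].
by split => //; apply: aeW.
Qed.

Lemma canon_l2 f : l2 m (canon f).
Proof. by rewrite /canon; case: xgetP => [g _ [] //|_]; exact: l2_0. Qed.

Lemma canon_eq f g : (\forall x \ae m, f x = g x) -> canon f = canon g.
Proof.
move=> fg; rewrite /canon; congr xget; apply/seteqP; split => h /= [h2 hh]; split => //;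
  by move: hh fg; apply: filterS2 => x -> ->.
Qed.

Lemma canonK f : l2 m f -> canon (canon f) = canon f.
Proof. by move=> f2; apply: canon_eq; have [] := canonP f2. Qed.

Record L2space := L2Class { rep :> T -> R; rep_canon : l2 m rep /\ canon rep = rep }.
HB.instance Definition _ := gen_eqMixin L2space.
HB.instance Definition _ := gen_choiceMixin L2space.
Implicit Types u v w : L2space.

Lemma rep_l2 u : l2 m u. Proof. by have [] := rep_canon u. Qed.

Lemma rep_inj u v : (u = v :> (T -> R)) -> u = v.
Proof.
case: u v => [f hf] [g hg] /= fg; subst g; congr L2Class; exact: Prop_irrelevance.
Qed.

(** Makes [cls] total, since [canonK] is about square integrable functions. *)
Definition l2cut f : T -> R := if `[< l2 m f >] then f else cst 0.

Lemma l2cut_l2 f : l2 m (l2cut f).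
Proof. by rewrite /l2cut; case: asboolP => // _; exact: l2_0. Qed.

Lemma cls_subproof f : l2 m (canon (l2cut f)) /\ canon (canon (l2cut f)) = canon (l2cut f).
Proof. by split; [exact: canon_l2|apply/canonK/l2cut_l2]. Qed.

(* 0 if [f] is not in L^2. *)
Definition cls f : L2space := L2Class (cls_subproof f).

Lemma clsP f : l2 m f -> \forall x \ae m, cls f x = f x.
Proof. by move=> f2; rewrite /= /l2cut asboolT //; have [] := canonP f2. Qed.

Lemma cls_eq f g : l2 m f -> l2 m g -> (\forall x \ae m, f x = g x) -> cls f = cls g.
Proof. by move=> f2 g2 fg; apply: rep_inj; rewrite /= /l2cut !asboolT //; exact: canon_eq. Qed.

Lemma repK u : cls u = u.
Proof.
by apply: rep_inj; rewrite /= /l2cut asboolT; have [] := rep_canon u.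
Qed.

Lemma rep_ae u v : (\forall x \ae m, u x = v x) -> u = v.
Proof. by move=> uv; rewrite -(repK u) -(repK v); apply: cls_eq => //; exact: rep_l2. Qed.

Lemma cls_inj f g : l2 m f -> l2 m g -> cls f = cls g -> (\forall x \ae m, f x = g x).
Proof.
move=> f2 g2 fg; have := clsP g2; rewrite -fg => h.
by move: (clsP f2) h; apply: filterS2 => x <- <-.
Qed.

Definition zeroL := cls (cst 0).
Definition addL u v := cls (rep u + rep v).
Definition oppL u := cls (- rep u).
Definition scaleL a u := cls (a *: rep u).

Lemma addLE u v : \forall x \ae m, addL u v x = u x + v x.
Proof. by apply: clsP; apply: l2D; exact: rep_l2. Qed.
Lemma oppLE u : \forall x \ae m, oppL u x = - u x.
Proof. by apply: clsP; apply: l2N; exact: rep_l2. Qed.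
Lemma scaleLE a u : \forall x \ae m, scaleL a u x = a * u x.
Proof. by apply: clsP; apply: l2Z; exact: rep_l2. Qed.

Let z0 : \forall x \ae m, zeroL x = 0. Proof. exact/clsP/l2_0. Qed.

Lemma addLA : associative addL.
Proof.
move=> u v w; apply: rep_ae.
move: (addLE u (addL v w)) (addLE v w) (addLE (addL u v) w) (addLE u v).
by apply: filterS4 => x -> h2 -> h4; rewrite h2 h4 addrA.

Qed.
Lemma addLC : commutative addL.
Proof. by move=> u v; rewrite /addL addrC. Qed.
Lemma add0L : left_id zeroL addL.
Proof.
move=> u; apply: rep_ae; move: z0 (addLE zeroL u).
by apply: filterS2 => x h1 ->; rewrite h1 add0r.
Qed.
Lemma addNL : left_inverse zeroL oppL addL.
Proof.
move=> u; apply: rep_ae; move: z0 (addLE (oppL u) u) (oppLE u).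
by apply: filterS3 => x -> -> ->; rewrite addNr.
Qed.

HB.instance Definition _ := GRing.isZmodule.Build L2space addLA addLC add0L addNL.

Lemma scaleLA a b u : scaleL a (scaleL b u) = scaleL (a * b) u.
Proof.
apply: rep_ae; move: (scaleLE a (scaleL b u)) (scaleLE b u) (scaleLE (a * b) u).
by apply: filterS3 => x -> -> ->; rewrite mulrA.

Qed.
Lemma scale1L : left_id 1 scaleL.
Proof.
move=> u; apply: rep_ae; move: (scaleLE 1 u).
by apply: filterS => x ->; rewrite mul1r.
Qed.
Lemma scaleLDr : right_distributive scaleL +%R.
Proof.
move=> a u v; apply: rep_ae.
move: (scaleLE a (u + v)) (addLE u v) (addLE (scaleL a u) (scaleL a v)) (scaleLE a u) (scaleLE a v).
by apply: filterS5 => x -> h2 -> -> ->; rewrite [rep (u + v) x]h2 mulrDr.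

Qed.
Lemma scaleLDl v : {morph scaleL^~ v : a b / a + b}.
Proof.
move=> a b; apply: rep_ae.
move: (scaleLE (a + b) v) (addLE (scaleL a v) (scaleL b v)) (scaleLE a v) (scaleLE b v).
by apply: filterS4 => x -> -> -> ->; rewrite mulrDl.

Qed.

HB.instance Definition _ := GRing.Zmodule_isLmodule.Build R L2space
  scaleLA scale1L scaleLDr scaleLDl.

Lemma repD u v : \forall x \ae m, (u + v) x = u x + v x. Proof. exact: addLE. Qed.
Lemma repN u : \forall x \ae m, (- u) x = - u x. Proof. exact: oppLE. Qed.
Lemma repZ a u : \forall x \ae m, (a *: u) x = a * u x. Proof. exact: scaleLE. Qed.
Lemma rep0 : \forall x \ae m, (0 : L2space) x = 0. Proof. exact: z0. Qed.
Lemma repB u v : \forall x \ae m, (u - v) x = u x - v x.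
Proof.
move: (repD u (- v)) (repN v).
by apply: filterS2 => x -> ->.
Qed.
Lemma rep_linear a u v : \forall x \ae m, (a *: u + v) x = a * u x + v x.
Proof.
move: (repD (a *: u) v) (repZ a u).
by apply: filterS2 => x -> ->.
Qed.

Lemma cls_linear a f g : l2 m f -> l2 m g -> cls (a *: f + g) = a *: cls f + cls g.
Proof.
move=> f2 g2; apply: rep_ae; move: (clsP (l2_linear a f2 g2)) (rep_linear a (cls f) (cls g)).
by move: (clsP f2) (clsP g2); apply: filterS4 => x h1 h2 -> ->; rewrite h1 h2.

Qed.

Let ipL u v := dotm m u v.

Let ipL_linear a u v w : ipL (a *: u + v) w = a * ipL u w + ipL v w.
Proof.
rewrite /ipL -dotm_linear; do ?exact: rep_l2.
apply: dotm_ae; do ?exact: rep_l2; last exact: aeW.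
  by apply: l2_linear; exact: rep_l2.
exact: rep_linear.
Qed.

Let ipL_definite u : ipL u u = 0 -> u = 0.
Proof.
move=> /(dotm_definite (rep_l2 u)) u0; apply: rep_ae; move: u0 z0.
by apply: filterS2 => x -> ->.
Qed.

Let dotm_repB u v f : l2 m f -> (\forall x \ae m, f x = v x) ->
  dotm m (rep u - f) (rep u - f) = ipL (u - v) (u - v).
Proof.
move=> f2 fv.
have h : \forall x \ae m, (rep u - f) x = (u - v) x.
  by move: (repB u v) fv; apply: filterS2 => x -> <-.
by apply: dotm_ae; do ?[exact: rep_l2|apply: l2B].
Qed.

Let ipL_complete (u : nat -> L2space) :
  (forall e : R, 0 < e -> exists N : nat, forall p q : nat, (N <= p)%N -> (N <= q)%N ->
       ipL (u p - u q) (u p - u q) < e) ->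
  exists x, ipL (u p - x) (u p - x) @[p --> \oo] --> (0 : R).
Proof.
move=> uc; have [||f f2 fl] := @l2_complete _ _ _ m (fun p => rep (u p)).
- by move=> n; exact: rep_l2.
- move=> e /uc[N NP]; exists N => p q Np Nq.
  rewrite (@dotm_repB _ (u q)); [exact: NP|exact: rep_l2|].
  exact: aeW.
exists (cls f).
rewrite [X in X @ _](_ : _ = fun p => dotm m (rep (u p) - f) (rep (u p) - f)) //.
apply/funext => p; rewrite (@dotm_repB _ (cls f)) //.
by have := clsP f2; apply: filterS => x ->.
Qed.

Definition l2_hilbert : hilbert R := @Hilbert R L2space ipL
  (fun u v => dotmC m u v) ipL_linear (fun u => dotm_ge0 m u) ipL_definite ipL_complete.

End L2Space.

(** * Integration on the surface *)

Section CompactSupport.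
Context (R : realType).
Local Notation P := 'rV[R]_2.
Local Notation B := (borel P).
Local Notation M := (surface R).
Local Notation pdir := (fun k : 'I_2 => delta_mx 0 k : P).
Implicit Types (v w : P) (f g : P -> R).

(** The boundary of the square belongs to the zero set, so that boundary terms vanish in
    integrations by parts. *)
Definition supported (r : R) f := forall v, (r <= `|v 0 0|) || (r <= `|v 0 1|) -> f v = 0.

Definition box (r : R) : set P := [set v | forall i : 'I_2, `[- r, r]%classic (v 0 i)].

Lemma boxP (r : R) v : box r v <-> `|v 0 0| <= r /\ `|v 0 1| <= r.
Proof.
have h (x : R) : `[- r, r]%classic x <-> `|x| <= r by rewrite /= in_itv /= ler_norml.
split; first by move=> vr; split; apply/h.
by move=> [v0 v1] i; apply/h; case/orP: (ord2P i) => /eqP ->.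
Qed.

Lemma box_compact (r : R) : compact (box r).
Proof. by apply: (@rV_compact R 2 (fun=> `[- r, r]%classic)) => i; exact: segment_compact. Qed.

Lemma supported_box (r : R) f v : supported r f -> ~ box r v -> f v = 0.
Proof.
move=> fr vr; apply: fr; apply: contra_notT vr; rewrite negb_or -!ltNge => /andP[h0 h1].
by apply/boxP; split; exact: ltW.
Qed.

Lemma box_measurable (r : R) : measurable (box r : set B).
Proof.
rewrite -(setCK (box r)); apply: measurableC; apply: borel_open.
apply: closed_openC; apply: compact_closed; last exact: box_compact.
exact: (@norm_hausdorff R P).
Qed.

Lemma lam_box (r : R) : (@lam R (box r) < +oo)%E.
Proof.
have [r0|r0] := leP 0 r.
  have -> : box r = [set x : P | forall k, pt (- r) (- r) 0 k <= x 0 k <= pt r r 0 k].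
    apply/seteqP; split => v /= h k; move: (h k); case/orP: (ord2P k) => /eqP ->;
      by rewrite ?pt0 ?pt1 /= in_itv.
  rewrite (@is_lebesgue_lam R) ?ltry // => k.
  by case/orP: (ord2P k) => /eqP ->; rewrite ?pt0 ?pt1; lra.
rewrite (_ : box r = set0) ?measure0 ?ltry //.
by apply/seteqP; split => // v /boxP[/(le_trans (normr_ge0 _))]; rewrite leNgt r0.
Qed.

Lemma supported_bounded (r : R) f : continuous f -> supported r f ->
  exists2 C : R, 0 <= C & forall v, `|f v| <= C.
Proof.
move=> cf fr; have cK : compact (f @` box r).
  apply: continuous_compact; last exact: box_compact.
  exact: continuous_subspaceT.
have [C [Cr hC]] := compact_bounded cK.
exists (`|C| + 1); first by rewrite addr_ge0.
move=> v; case: (pselect (box r v)) => vr.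
  by apply: (hC (`|C| + 1)); [rewrite ltr_pwDr // ler_norm|exists v].
by rewrite (supported_box fr vr) normr0 addr_ge0.
Qed.

Lemma integrable_supported (r : R) f : continuous f -> supported r f ->
  (@lam R).-integrable setT (EFin \o f).
Proof.
move=> cf fr; have [C C0 fC] := supported_bounded cf fr.
apply: (integrable_bounded_on (box_measurable r) (lam_box r) _ _ fC).
  exact: continuous_measurable.
by move=> v; exact: supported_box.
Qed.

Lemma supportedM (r : R) f g : supported r f -> supported r (fun v => f v * g v).
Proof. by move=> fr v /fr ->; rewrite mul0r. Qed.

Lemma supportedMr (r : R) f g : supported r f -> supported r (fun v => g v * f v).
Proof. by move=> fr v /fr ->; rewrite mulr0. Qed.

Lemma supportedD (r : R) f g : supported r f -> supported r g -> supported r (fun v => f v + g v).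
Proof. by move=> fr gr v vr; rewrite fr // gr // addr0. Qed.

Lemma supported_le (r s : R) f : r <= s -> supported r f -> supported s f.
Proof. by move=> rs fr v /orP[h|h]; apply: fr; rewrite (le_trans rs h) ?orbT. Qed.

Lemma continuous_mul (V : topologicalType) (f g : V -> R) :
  continuous f -> continuous g -> continuous (fun u => f u * g u).
Proof. by move=> cf cg u; exact: (@cvgM _ _ _ _ f g _ _ (cf u) (cg u)). Qed.

Lemma E_cont : continuous (@E R).
Proof. exact/cinf_cont/E_cinf. Qed.

Lemma integrable_mu_supported (r : R) f : continuous f -> supported r f ->
  (@mu R).-integrable setT (EFin \o f).
Proof.
move=> cf fr; apply: (integrable_mu (f := EFin \o f)).
  by apply/measurable_EFinP; exact: continuous_measurable.
apply: (@integrable_supported r (fun v => f v * E v)); last exact: supportedM.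
exact: continuous_mul cf E_cont.
Qed.

Lemma l2_supported (r : R) f : continuous f -> supported r f -> l2 (@mu R) f.
Proof.
move=> cf fr; apply/l2P; split; first exact: (continuous_measurable cf).
have [||_] := integrableP _ _ _ (@integrable_mu_supported r (fun v => f v * f v) _ _).
- exact: continuous_mul.
- exact: supportedM.
apply: le_lt_trans; rewrite le_eqVlt; apply/orP; left; apply/eqP.
by apply: eq_integral => v _ /=; rewrite -expr2 ger0_norm // sqr_ge0.
Qed.

Definition test_fun f := cinf pdir f /\ exists r, supported r f.

Lemma test_functionP f : test_function (f : M -> R) <-> test_fun f.
Proof.
split=> [[sf [K cK fK]]|[sf [r fr]]].
  split; first by have := sf tt; rewrite image_id => /smooth_on_cinf.
  have [C [Cr hC]] := compact_bounded cK; exists (`|C| + 2) => v vC; apply: fK => Kv.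
  have : `|v| <= `|C| + 1 by apply: hC => //; rewrite ltr_pwDr // ler_norm.
  have := coord_le_norm v 0; have := coord_le_norm v 1.
  by case/orP: vC; lra.
split; first by move=> i; exact: cinf_smooth_on.
by exists (box r); [exact: box_compact|move=> v; exact: supported_box].
Qed.

End CompactSupport.

(** * Partial derivatives and their integrals *)

Section ByParts.
Context (R : realType).
Local Notation P := 'rV[R]_2.
Local Notation leb := (@lebesgue_measure R).
Local Notation pdir := (fun k : 'I_2 => delta_mx 0 k : P).
Implicit Types (v w : P) (f g : P -> R).

(** The margin 1 leaves a whole neighbourhood on which f vanishes. *)
Lemma supported_partial (r : R) k f : supported r f -> supported (r + 1) (partial k f).
Proof.
move=> fr v vr; rewrite /partial derive_line derive1E.
have e : \forall h \near (0 : R), f (h *: delta_mx 0 k + v) = 0.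
  have c j : \forall h \near (0 : R), `|(h *: (delta_mx 0 k : P) + v) 0 j - v 0 j| < 1.
    near=> h; rewrite !mxE eqxx addrK /= normrM.
    apply: (@le_lt_trans _ _ `|h|); first by rewrite ler_piMr // normr_nat lern1 leq_b1.
    by near: h; exact: (@cvgr0_norm_lt _ _ _ _ _ id (@cvg_id _ _) _ ltr01).
  near=> h; apply: fr; have h0 : `|(h *: (delta_mx 0 k : P) + v) 0 0 - v 0 0| < 1 by near: h; exact: c.
  have h1 : `|(h *: (delta_mx 0 k : P) + v) 0 1 - v 0 1| < 1 by near: h; exact: c.
  have tri (a b : R) : r + 1 <= `|b| -> `|a - b| < 1 -> r <= `|a|.
    by move=> rb ab; have := ler_distD a b 0; rewrite !subr0 distrC; lra.
  by case/orP: vr => vr; apply/orP; [left; exact: tri vr h0|right; exact: tri vr h1].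
rewrite (near_eq_derive (g := cst 0)) ?derive_cst //.
Unshelve. all: by end_near. Qed.

Lemma integral_derive0 (r : R) (g g' : R -> R) : (forall x : R, is_derive x 1 g (g' x)) ->
  continuous g' -> (forall x, r <= `|x| -> g x = 0) -> (forall x, r <= `|x| -> g' x = 0) ->
  (\int[leb]_x (g' x)%:E = 0)%E.
Proof.
move=> dg cg' g0 g'0; wlog r0 : r g0 g'0 / 0 < r.
  by move=> /(_ (`|r| + 1)); apply; [move=> x xr; apply: g0|move=> x xr; apply: g'0|];
    rewrite ?ltr_pwDr //; apply: le_trans xr; rewrite (le_trans (ler_norm r)) // lerDl.
have -> : (\int[leb]_x (g' x)%:E = \int[leb]_(x in `[(- r)%R, r%R]) (g' x)%:E)%E.
  rewrite [RHS]integral_mkcond; apply: eq_integral => x _; rewrite patchE.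
  case: ifPn => //; rewrite notin_setE /= in_itv /= -ler_norml => /negP.
  by rewrite -ltNge => /ltW/g'0 ->.
rewrite (@continuous_FTC2 _ g' g) //.
- by rewrite !g0 ?sube0 // ?normrN gtr0_norm.
- by lra.
- exact: continuous_subspaceT.
- have cg : continuous g by move=> x; apply: differentiable_continuous; apply/derivable1_diffP; have [] := dg x.
  split; [by move=> x _; have [] := dg x| exact: cvg_at_right_filter (cg _)|exact: cvg_at_left_filter (cg _)].
- by move=> x _; rewrite derive1E; have [_ ->] := dg x.
Qed.

Lemma line_is_derive f (d w : P) (t : R) : derivable f (t *: d + w) d ->
  is_derive t 1 (fun s => f (s *: d + w)) ('D_d f (t *: d + w)).
Proof.
have e : (fun h : R => h^-1 *: (f ((h *: 1 + t) *: d + w) - f (t *: d + w))) =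
         (fun h => h^-1 *: (f (h *: d + (t *: d + w)) - f (t *: d + w))).
  by apply/funext => h; rewrite addrA -scalerDl /GRing.scale /= mulr1.
by move=> df; apply: DeriveDef; rewrite /derivable /derive e.
Qed.

Lemma pt_line0 x y : pt x y = x *: delta_mx 0 0 + pt 0 y :> P.
Proof. by apply: plane_eq; rewrite !mxE /=; ring. Qed.

Lemma pt_line1 x y : pt x y = y *: delta_mx 0 1 + pt x 0 :> P.
Proof. by apply: plane_eq; rewrite !mxE /=; ring. Qed.

Lemma partial_slice0 f (x y : R) : cinf pdir f ->
  is_derive x 1 (fun t => f (pt t y)) (partial 0 f (pt x y)).
Proof.
move=> hf; rewrite pt_line0 (_ : (fun t => _) = (fun t => f (t *: delta_mx 0 0 + pt 0 y))).
  by apply: line_is_derive; exact: cinf_derivable hf.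
by apply/funext => t; rewrite pt_line0.
Qed.

Lemma partial_slice1 f (x y : R) : cinf pdir f ->
  is_derive y 1 (fun t => f (pt x t)) (partial 1 f (pt x y)).
Proof.
move=> hf; rewrite pt_line1 (_ : (fun t => _) = (fun t => f (t *: delta_mx 0 1 + pt x 0))).
  by apply: line_is_derive; exact: cinf_derivable hf.
by apply/funext => t; rewrite pt_line1.
Qed.

Lemma pt_slice0 (y : R) : continuous (fun x : R => pt x y).
Proof. by apply: (@pt_continuous2 R R id (fun=> y)) => u; [exact: cvg_id|exact: cvg_cst]. Qed.

Lemma pt_slice1 (x : R) : continuous (fun y : R => pt x y).
Proof. by apply: (@pt_continuous2 R R (fun=> x) id) => u; [exact: cvg_cst|exact: cvg_id]. Qed.

Lemma partial_cinf k f : cinf pdir f -> cinf pdir (partial k f).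
Proof. by move=> hf; exact: cinf_derive. Qed.

(** Fubini's theorem, with the inner integral taken in the direction k; each inner integral is zero
    by [integral_derive0]. *)
Lemma integral_partial0 (r : R) k f : cinf pdir f -> supported r f ->
  (\int[@lam R]_v (partial k f v)%:E = 0)%E.
Proof.
move=> hf fr; have fr' := supported_partial k fr.
have cf' : continuous (partial k f) by exact/cinf_cont/partial_cinf.
have fi := integrable_supported cf' fr'.
have fr1 : supported (r + 1) f by apply: supported_le fr; rewrite lerDl.
case/orP: (ord2P k) => /eqP k01; subst k.
  rewrite (integral_lam21 fi) integral0_eq // => y _.
  apply: (@integral_derive0 (r + 1) (fun t => f (pt t y)) (fun t => partial 0 f (pt t y))).
  - by move=> x; exact: partial_slice0.
  - move=> x; apply: continuous_comp; last exact: cf'.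
    exact: pt_slice0.
  - by move=> x xr; apply: fr1; rewrite pt0 xr.
  - by move=> x xr; apply: fr'; rewrite pt0 xr.
rewrite (integral_lam12 fi) integral0_eq // => x _.
apply: (@integral_derive0 (r + 1) (fun t => f (pt x t)) (fun t => partial 1 f (pt x t))).
- by move=> y; exact: partial_slice1.
- move=> y; apply: continuous_comp; last exact: cf'.
  exact: pt_slice1.
- by move=> y yr; apply: fr1; rewrite pt1 yr orbT.
- by move=> y yr; apply: fr'; rewrite pt1 yr orbT.
Qed.

Lemma partial_derivable k f v : cinf pdir f -> derivable f v (delta_mx 0 k).
Proof. exact: (@cinf_derivable _ _ _ pdir f k v). Qed.

Lemma partialM k f g v : cinf pdir f -> cinf pdir g ->
  partial k (fun w => f w * g w) v = partial k f v * g v + f v * partial k g v.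
Proof.
move=> hf hg; rewrite /partial.
have := @deriveM _ _ f g v _ (@partial_derivable k _ v hf) (@partial_derivable k _ v hg).
by rewrite /GRing.scale /= addrC [g v * _]mulrC => <-.
Qed.

Lemma partialD k f g v : cinf pdir f -> cinf pdir g ->
  partial k (fun w => f w + g w) v = partial k f v + partial k g v.
Proof.
by move=> hf hg; have := @deriveD _ _ _ f g v _ (@partial_derivable k _ v hf) (@partial_derivable k _ v hg).
Qed.

Lemma partialZ k (c : R) f v : cinf pdir f ->
  partial k (fun w => c * f w) v = c * partial k f v.
Proof.
by move=> hf; have := @deriveZ _ _ _ f c v _ (@partial_derivable k _ v hf).
Qed.

Lemma partial_comp k (h : R -> R) f v : cinf1 h -> cinf pdir f ->
  partial k (fun w => h (f w)) v = derive1 h (f v) * partial k f v.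
Proof.
move=> hh hf; have [_] := is_derive_comp (@partial_derivable k _ v hf) (@cinf1_derivable _ h (f v) hh).
by [].
Qed.

Lemma partial_coord k j v : partial k (fun w : P => w 0 j) v = (j == k)%:R.
Proof. by have [_] := coord_is_derive j k v. Qed.

Lemma cinf_coord (h : R -> R) j : cinf1 h -> cinf pdir (fun v => h (v 0 j)).
Proof. by move=> hh; apply: (cinf_comp hh); exact: coord_cinf. Qed.

Lemma partial_comp_coord k j (h : R -> R) v : cinf1 h ->
  partial k (fun w => h (w 0 j)) v = (j == k)%:R * derive1 h (v 0 j).
Proof.
by move=> hh; rewrite (@partial_comp _ h (fun w => w 0 j)) // ?partial_coord 1?mulrC //; exact: coord_cinf.
Qed.

End ByParts.

(** * The fundamental lemma of the calculus of variations *)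

Section Fundamental.
Context (R : realType).
Local Notation P := 'rV[R]_2.
Local Notation B := (borel P).
Local Notation pdir := (fun k : 'I_2 => delta_mx 0 k : P).
Local Notation mu := (@mu R).
Implicit Types (v w : P) (f g : P -> R).

Definition bump (a b : R) n (x : R) : R := step (n%:R * (x - a)) * step (n%:R * (b - x)).

Lemma bump_cinf a b n : cinf1 (bump a b n).
Proof.
have h (c : R) : cinf1 (fun x : R => n%:R * (x - c)).
  by apply: cinfZ; apply: cinfB; [exact: cinf1_id|exact: cinf_cst].
have h' (c : R) : cinf1 (fun x : R => n%:R * (c - x)).
  by apply: cinfZ; apply: cinfB; [exact: cinf_cst|exact: cinf1_id].
by apply: cinfM; [exact: (cinf_comp (@step_cinf R) (h a))|exact: (cinf_comp (@step_cinf R) (h' b))].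
Qed.

Lemma bump_ge0 a b n x : 0 <= bump a b n x.
Proof. by rewrite mulr_ge0 ?step_ge0. Qed.

Lemma bump_le1 a b n x : bump a b n x <= 1.
Proof. by rewrite mulr_ile1 ?step_ge0 ?step_le1. Qed.

Lemma bump_eq0 a b n x : ~~ (a < x < b) -> bump a b n x = 0.
Proof.
rewrite negb_and -!leNgt /bump => /orP[h|h].
  by rewrite step_eq0 ?mul0r // mulr_ge0_le0 // subr_le0.
by rewrite [X in _ * X]step_eq0 ?mulr0 // mulr_ge0_le0 // subr_le0.
Qed.

Lemma bump_cvg a b x : bump a b n x @[n --> \oo] --> (((a < x) && (x < b))%:R : R).
Proof.
have [/andP[ax xb]|h] := boolP (a < x < b); last first.
  rewrite [X in X @ _](_ : _ = (fun=> 0)); first exact: cvg_cst.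
  by apply/funext => n; rewrite bump_eq0.
have big (y : R) : 0 < y -> \forall n \near \oo, 1 <= n%:R * y.
  move=> y0; near=> k; rewrite -ler_pdivrMr // div1r.
  by near: k; exact: nbhs_infty_ger.
apply/cvgrPdist_le => e e0; near=> n; rewrite /bump.
rewrite !step_eq1 ?mulr1 ?subrr ?normr0 ?(ltW e0) //.
  by near: n; apply: big; rewrite subr_gt0.
by near: n; apply: big; rewrite subr_gt0.
Unshelve. all: by end_near. Qed.

Definition obox (q : R * R * R * R) : set P :=
  [set v | ((q.1.1.1 < v 0 0) && (v 0 0 < q.1.1.2)) && ((q.1.2 < v 0 1) && (v 0 1 < q.2))].

Definition obump (q : R * R * R * R) n v : R :=
  bump q.1.1.1 q.1.1.2 n (v 0 0) * bump q.1.2 q.2 n (v 0 1).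

Definition oradius (q : R * R * R * R) : R := `|q.1.1.1| + `|q.1.1.2| + `|q.1.2| + `|q.2|.

Lemma obump_eq0 q n v : ~ obox q v -> obump q n v = 0.
Proof.
move=> /negP; rewrite negb_and /obump => /orP[h|h]; first by rewrite bump_eq0 ?mul0r.
by rewrite [X in _ * X]bump_eq0 ?mulr0.
Qed.

Lemma obox_radius q v : obox q v -> `|v 0 0| < oradius q /\ `|v 0 1| < oradius q.
Proof.
case: q => [[[a b] c] d]; rewrite /obox /oradius /= => /andP[/andP[h1 h2] /andP[h3 h4]].
have := ler_norm (- a); have := ler_norm b; have := ler_norm (- c); have := ler_norm d.
rewrite !normrN !ltr_norml.
have := normr_ge0 a; have := normr_ge0 b; have := normr_ge0 c; have := normr_ge0 d.
by move=> *; split; lra.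
Qed.

Lemma obump_supported q n : supported (oradius q) (obump q n).
Proof.
by move=> v vr; apply: obump_eq0 => /obox_radius[h0 h1]; move: vr; rewrite !leNgt h0 h1.
Qed.

Lemma obump_test q n : test_fun (obump q n).
Proof.
split; last by exists (oradius q); exact: obump_supported.
by apply: cinfM; apply: cinf_coord; exact: bump_cinf.
Qed.

Lemma obump_cvg q v : obump q n v @[n --> \oo] --> ((v \in obox q)%:R : R).
Proof.
rewrite (_ : (v \in obox q) = ((q.1.1.1 < v 0 0) && (v 0 0 < q.1.1.2)) &&
  ((q.1.2 < v 0 1) && (v 0 1 < q.2))); last by apply/idP/idP; rewrite inE.
by rewrite -mulnb natrM; apply: cvgM; exact: bump_cvg.
Qed.

Lemma obump_bound q n v : 0 <= obump q n v <= 1.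
Proof.
by rewrite mulr_ge0 ?bump_ge0 //= mulr_ile1 ?bump_ge0 ?bump_le1.
Qed.

Definition cutoff (r : R) v : R := plateau (r^-1 * v 0 0) * plateau (r^-1 * v 0 1).

Lemma cutoff_cinf r : cinf pdir (cutoff r).
Proof.
have h j : cinf pdir (fun v => r^-1 * v 0 j) by apply: cinfZ; exact: coord_cinf.
by apply: cinfM; [exact: (cinf_comp (@plateau_cinf R) (h 0))|exact: (cinf_comp (@plateau_cinf R) (h 1))].
Qed.

Lemma cutoff_ge0 r v : 0 <= cutoff r v.
Proof. by rewrite mulr_ge0 ?plateau_ge0. Qed.

Lemma cutoff_le1 r v : cutoff r v <= 1.
Proof. by rewrite mulr_ile1 ?plateau_ge0 ?plateau_le1. Qed.

Lemma cutoff_eq1 r v : 0 < r -> `|v 0 0| <= r -> `|v 0 1| <= r -> cutoff r v = 1.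
Proof.
move=> r0 h0 h1; have h (x : R) : `|x| <= r -> plateau (r^-1 * x) = 1.
  by move=> xr; rewrite plateau_eq1 // normrM gtr0_norm ?invr_gt0 // mulrC ler_pdivrMr // mul1r.
by rewrite /cutoff !h // mulr1.
Qed.

Lemma cutoff_supported r : 0 < r -> supported (2 * r) (cutoff r).
Proof.
move=> r0 v; have h (x : R) : 2 * r <= `|x| -> plateau (r^-1 * x) = 0.
  by move=> xr; rewrite plateau_eq0 // normrM gtr0_norm ?invr_gt0 // mulrC ler_pdivlMr.
by rewrite /cutoff => /orP[/h ->|/h ->]; rewrite ?mul0r ?mulr0.
Qed.

Lemma cutoff_test r : 0 < r -> test_fun (cutoff r).
Proof. by move=> r0; split; [exact: cutoff_cinf|exists (2 * r); exact: cutoff_supported]. Qed.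

Lemma test_fun_cont f : test_fun f -> continuous f.
Proof. by move=> [/cinf_cont]. Qed.

Lemma test_fun_l2 f : test_fun f -> l2 mu f.
Proof. by move=> tf; have [_ [r fr]] := tf; exact: l2_supported (test_fun_cont tf) fr. Qed.

Lemma obox_measurable q : measurable (obox q : set B).
Proof.
apply: borel_open.
have -> : obox q = ((fun v : P => v 0 0) @^-1` `]q.1.1.1, q.1.1.2[) `&`
                   ((fun v : P => v 0 1) @^-1` `]q.1.2, q.2[).
  apply/seteqP; split => v; rewrite /obox /= !in_itv /=; first by move=> /andP.
  by move=> [-> ->].
by apply: openI; apply: open_comp => [v _|]; [exact: coord_cont|exact: interval_open|exact: coord_cont|exact: interval_open].
Qed.

Lemma obox_fun_measurable q : measurable_fun setT (fun v : B => (v \in obox q)%:R : R).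
Proof. exact: (@measurable_indic _ B R setT _ (obox_measurable q)). Qed.

(** Smooth bumps converge to the indicator of an open box. The cutoff, equal to 1 on the box and
    square integrable, provides the dominating function. *)
Lemma integral_obox g q : l2 mu g -> (forall phi, test_fun phi -> dotm mu g phi = 0) ->
  dotm mu g (fun v => (v \in obox q)%:R) = 0.
Proof.
move=> g2 g0; pose r := oradius q + 1.
have r0 : 0 < r by rewrite ltr_wpDl // !addr_ge0.
have mg := l2_measurable g2.
have cut1 v : obox q v -> cutoff r v = 1.
  by move=> /obox_radius[/ltW h0 /ltW h1]; rewrite cutoff_eq1 // (le_trans _ (_ : oradius q <= r)) // lerDl.
have ma : measurable_fun setT (fun v : B => g v * (v \in obox q)%:R).
  by apply: measurable_funM => //; exact: obox_fun_measurable.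
have lim : dotm mu g (obump q n) @[n --> \oo] --> dotm mu g (fun v => (v \in obox q)%:R).
  apply: (@Rintegral_cvg _ _ _ mu (fun n v => g v * obump q n v)
    (fun v => g v * (v \in obox q)%:R) (fun v => `|g v * cutoff r v|)).
  - move=> n; apply: measurable_funM => //.
    exact: l2_measurable (test_fun_l2 (obump_test q n)).
  - exact: ma.
  - by apply: aeW => v; apply: cvgM; [exact: cvg_cst|exact: obump_cvg].
  - exact: (integrable_abse (l2_integrable g2 (test_fun_l2 (cutoff_test r0)))).
  - apply: aeW => v n; rewrite normrM [leRHS]normrM ler_wpM2l //.
    have /andP[h0 h1] := obump_bound q n v; rewrite ger0_norm //.
    have [/cut1 ->|/(@obump_eq0 _ n) ->] := pselect (obox q v); first by rewrite normr1.
    exact: normr_ge0.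
move: lim; rewrite [X in X @ _ --> _](_ : _ = (fun=> 0)).
  by move=> /(cvg_unique (@Rhausdorff R) (cvg_cst _)).
by apply/funext => n; exact: g0 (obump_test q n).
Qed.

Lemma obox_l2 q : l2 mu (fun v => (v \in obox q)%:R).
Proof.
have r0 : 0 < oradius q + 1 by rewrite ltr_wpDl // !addr_ge0.
apply: (l2_dominated (obox_fun_measurable q) (test_fun_l2 (cutoff_test r0))) => v.
have [qv|qv] := pselect (obox q v); last by rewrite memNset // normr0.
have [/ltW h0 /ltW h1] := obox_radius qv.
rewrite mem_set // cutoff_eq1 // (le_trans _ (_ : oradius q <= _)) //; by rewrite lerDl.
Qed.

Lemma obox_sigma : @measurable _ B = <<s [set obox q | q in setT] >>.
Proof.
apply/seteqP; split; last first.
  apply: smallest_sub; first exact: sigma_algebra_measurable.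
  by move=> _ [q _ <-]; exact: obox_measurable.
apply: smallest_sub; first exact: smallest_sigma_algebra.
move=> A oA; rewrite (open_plane_bigcup oA).
have qA q : (<<s [set obox q | q in setT] >>) (@rational_box R q).
  apply: sub_sigma_algebra; pose r : R := q.2.+1%:R^-1.
  exists (ratr q.1.1 - r, ratr q.1.1 + r, ratr q.1.2 - r, ratr q.1.2 + r) => //.
  apply/seteqP; split => v; rewrite /rational_box ball_plane ?invr_gt0 ?ltr0n // pt0 pt1 /obox /=;
    rewrite -!/r !ltr_norml.
    by move=> /andP[/andP[h1 h2] /andP[h3 h4]]; split; lra.
  by move=> [/andP[h1 h2] /andP[h3 h4]]; apply/andP; split; apply/andP; split; lra.
rewrite bigcup_mkcond.
apply: (@countable_bigcupT_measurable _ (g_sigma_algebraType [set obox q | q in setT]) _).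
  exact: countableP.
by move=> q; case: ifP => // _; exact: qA.
Qed.

Lemma obox_setI : setI_closed [set obox q | q in setT].
Proof.
move=> _ _ [[[[a b] c] d] _ <-] [[[[a' b'] c'] d'] _ <-].
exists (Num.max a a', Num.min b b', Num.max c c', Num.min d d') => //.
apply/seteqP; split => v; rewrite /obox /= !gt_max !lt_min.
  by move=> /andP[/andP[/andP[-> ->] /andP[-> ->]] /andP[/andP[-> ->] /andP[-> ->]]].
by move=> [/andP[/andP[-> ->] /andP[-> ->]] /andP[/andP[-> ->] /andP[-> ->]]].
Qed.

Lemma obox_cover : \bigcup_k obox (- k%:R, k%:R, - k%:R, k%:R) = [set: P].
Proof.
apply/seteqP; split => // v _.
exists (Num.bound (`|v 0 0| + `|v 0 1|)) => //.
have : `|v 0 0| + `|v 0 1| < (Num.bound (`|v 0 0| + `|v 0 1|))%:R.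
  by apply: archi_boundP; rewrite addr_ge0.
set k := _%:R.
have := ler_norm (v 0 0); have := ler_norm (v 0 1).
have := ler_norm (- v 0 0); have := ler_norm (- v 0 1); rewrite !normrN.
have := normr_ge0 (v 0 0); have := normr_ge0 (v 0 1).
by rewrite /obox /= -/k => *; apply/andP; split; apply/andP; split; lra.
Qed.

(** The measures with densities g^+ and g^- agree on open boxes, which are stable under
    intersection, generate the Borel sets, and exhaust the plane with finite measures; so they are
    equal. Since g^+ and g^- live on disjoint sets, both vanish almost everywhere. *)
Lemma fundamental_lemma g : l2 mu g -> (forall phi, test_fun phi -> dotm mu g phi = 0) ->
  \forall v \ae mu, g v = 0.
Proof.
move=> g2 g0; have mg := l2_measurable g2.
pose gp (v : B) := Num.max (g v) 0; pose gn (v : B) := Num.max (- g v) 0.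
have mgp : measurable_fun setT gp by exact: measurable_maxr.
have mgn : measurable_fun setT gn.
  by apply: measurable_maxr => //; exact: measurableT_comp.
have gp2 : l2 mu gp.
  apply: (l2_dominated mgp g2) => v; rewrite /gp; case: (leP (g v) 0) => // _.
  by rewrite normr0.
have gn2 : l2 mu gn.
  apply: (l2_dominated mgn g2) => v; rewrite /gn; case: (leP (- g v) 0) => // _; rewrite ?normrN //.
  by rewrite normr0.
have gpn v : gp v - gn v = g v.
  rewrite /gp /gn; case: (leP (g v) 0); case: (leP (- g v) 0); lra.
have gp0 v : (0 <= (gp v)%:E)%E by rewrite lee_fin le_max lexx orbT.
have gn0 v : (0 <= (gn v)%:E)%E by rewrite lee_fin le_max lexx orbT.
have [nup nupE] := @density_exists _ B R mu (fun v => (gp v)%:E) gp0 (iffRL (measurable_EFinP _ _) mgp).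
have [nun nunE] := @density_exists _ B R mu (fun v => (gn v)%:E) gn0 (iffRL (measurable_EFinP _ _) mgn).
have int_box (h : P -> R) q : l2 mu h -> (forall v, 0 <= (h v)%:E)%E ->
    (\int[mu]_(v in obox q) (h v)%:E = (dotm mu h (fun v => (v \in obox q)%:R))%:E)%E.
  move=> h2 h0; rewrite integral_mkcond /dotm /Rintegral fineK.
    apply: eq_integral => v _; rewrite patchE; case: ifP => _; by rewrite ?mulr1 ?mulr0.
  by apply: integrable_fin_num => //; exact: (l2_integrable h2 (obox_l2 q)).
have same A : measurable A -> nup A = nun A.
  apply: (@measure_unique _ R B [set obox q | q in setT] (fun k => obox (- k%:R, k%:R, - k%:R, k%:R))).
  - exact: obox_sigma.
  - exact: obox_setI.
  - by move=> i; exists (- i%:R, i%:R, - i%:R, i%:R).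
  - exact: obox_cover.
  - move=> _ [q _ <-]; rewrite nupE ?nunE; try exact: obox_measurable.
    rewrite !int_box //; congr EFin; apply/eqP; rewrite -subr_eq0; apply/eqP.
    rewrite -(integral_obox q g2 g0) /dotm -RintegralB //; try exact: (l2_integrable _ (obox_l2 q)).
    by apply: eq_Rintegral => v _; rewrite -mulrBl gpn.
  - move=> k; rewrite nupE; last exact: obox_measurable.
    by rewrite int_box // ltry.
(* The whole integral of h is over the set h > 0, where it equals that of h', which is zero
   there. *)
have half (h h' : P -> R) : l2 mu h -> (forall v, 0 <= (h v)%:E)%E ->
    (forall A : set B, measurable A -> (\int[mu]_(v in A) (h v)%:E = \int[mu]_(v in A) (h' v)%:E)%E) ->
    (forall v, 0 < h v -> h' v = 0) -> \forall v \ae mu, h v = 0.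
  move=> h2 h0 hh' hh0; have mh := l2_measurable h2.
  have mpos : measurable [set v : B | 0 < h v].
    rewrite (_ : [set v : B | _] = h @^-1` `]0, +oo[); last first.
      by apply/seteqP; split => v; rewrite /= in_itv /= andbT.
    by rewrite -[X in measurable X]setTI; apply: mh.
  apply: (ge0_ae_eq0 mh) => [v|]; first by have := h0 v; rewrite lee_fin.
  have -> : (\int[mu]_v (h v)%:E = \int[mu]_(v in [set v : B | (0 < h v)%R]) (h v)%:E)%E.
    rewrite [RHS]integral_mkcond; apply: eq_integral => v _; rewrite patchE.
    case: ifPn => //; rewrite notin_setE /= => /negP; rewrite -leNgt => hv.
    by congr EFin; apply/eqP; rewrite eq_le hv -lee_fin h0.
  by rewrite hh' // integral0_eq // => v /= /hh0 ->.
have [zp zn] : (\forall v \ae mu, gp v = 0) /\ (\forall v \ae mu, gn v = 0).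
  split; [apply: (half gp gn)|apply: (half gn gp)] => //.
  - by move=> A mA; rewrite -nupE // same // nunE.
  - by move=> v; rewrite /gp /gn; case: (leP (g v) 0); case: (leP (- g v) 0); lra.
  - by move=> A mA; rewrite -nunE // -same // nupE.
  - by move=> v; rewrite /gp /gn; case: (leP (g v) 0); case: (leP (- g v) 0); lra.
by move: zp zn; apply: filterS2 => v; rewrite -gpn => -> ->; rewrite subr0.
Qed.

End Fundamental.

(** * The Dirichlet form and its heat semigroup *)

Section ClosableFamily.
Context (R : realType) (H : hilbert R) (n : nat).
Variables (core : H -> ('I_n -> H) -> Prop) (adj : 'I_n -> H -> H -> Prop).
Implicit Types (x c b : H) (y z : 'I_n -> H).
Hypothesis core0 : core 0 (fun=> 0).
Hypothesis core_linear : forall a c z c' z', core c z -> core c' z' ->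
  core (a *: c + c') (fun i => a *: z i + z' i).
Hypothesis adjP : forall i c z b b', core c z -> adj i b b' -> ip (z i) b = ip c b'.
Hypothesis adj_total : forall i (w : H), (forall b b', adj i b b' -> ip w b = 0) -> w = 0.
Hypothesis core_total : forall w : H, (forall c z, core c z -> ip w c = 0) -> w = 0.

(* The closure of [core], the graph of a densely defined operator H -> H^n which
   is closable since it has a densely defined adjoint. *)
Definition graph x y := forall e : R, 0 < e ->
  exists c z, [/\ core c z, `|x - c| < e & forall i, `|y i - z i| < e].

Lemma core_graph c z : core c z -> graph c z.
Proof.
by move=> Cc e e0; exists c, z; rewrite ?subrr ?normr0; split => // i; rewrite subrr normr0.
Qed.

Lemma graph_linear a x y x' y' : graph x y -> graph x' y' ->
  graph (a *: x + x') (fun i => a *: y i + y' i).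
Proof.
move=> gx gx' e e0; pose d := e / (`|a| + 2).
have a2 : 0 < `|a| + 2 by rewrite ltr_wpDl.
have d0 : 0 < d by rewrite divr_gt0.
have [c [z [Cc xc yc]]] := gx _ d0; have [c' [z' [Cc' xc' yc']]] := gx' _ d0.
have est (u u' v v' : H) : `|u - v| < d -> `|u' - v'| < d ->
    `|(a *: u + u') - (a *: v + v')| < e.
  move=> h h'; rewrite (_ : _ - _ = a *: (u - v) + (u' - v')).
    apply: le_lt_trans (ler_normD _ _) _; rewrite normrZ.
    have : `|a| * `|u - v| <= `|a| * d by rewrite ler_wpM2l // ltW.
    have : e = `|a| * d + 2 * d by rewrite -mulrDl mulrC divfK // gt_eqF.
    by move: d0 h'; lra.
  by rewrite scalerBr opprD addrACA.
exists (a *: c + c'), (fun i => a *: z i + z' i); split; first exact: core_linear.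
  exact: est.
by move=> i; apply: est.
Qed.

Lemma graph_adj x y i b b' : graph x y -> adj i b b' -> ip (y i) b = ip x b'.
Proof.
move=> gx ab; apply/eqP; rewrite -subr_eq0 -normr_le0; apply/ler_addgt0Pr => e e0; rewrite add0r.
pose d := e / (`|b| + `|b'| + 1); have s0 : 0 < `|b| + `|b'| + 1 by rewrite ltr_wpDl // addr_ge0.
have d0 : 0 < d by rewrite divr_gt0.
have [c [z [Cc xc yc]]] := gx _ d0.
have -> : ip (y i) b - ip x b' = ip (y i - z i) b - ip (x - c) b'.
  by rewrite !ipBl (adjP Cc ab); ring.
apply: le_trans (ler_normB _ _) _.
have h1 := ip_le_norm (y i - z i) b; have h2 := ip_le_norm (x - c) b'.
have h3 : `|y i - z i| * `|b| <= d * `|b| by rewrite ler_wpM2r // ltW.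
have h4 : `|x - c| * `|b'| <= d * `|b'| by rewrite ler_wpM2r // ltW.
have : e = d * `|b| + d * `|b'| + d by rewrite -mulrDr -[X in _ + X]mulr1 -mulrDr divfK // gt_eqF.
by move: d0; lra.
Qed.

(** Closability: the pairings of y with the domain of the adjoint are determined by x, and that
    domain is total. *)
Lemma graph_uniq x y z : graph x y -> graph x z -> y = z.
Proof.
move=> gy gz; apply/funext => i; apply/eqP; rewrite -subr_eq0; apply/eqP/(@adj_total i) => b b' ab.
by rewrite ipBl (graph_adj gy ab) (graph_adj gz ab) subrr.
Qed.

Definition cdom x := exists y, graph x y.
Definition cgrad x := xget (fun=> 0) [set y | graph x y].

Lemma cgradP x : cdom x -> graph x (cgrad x).
Proof. by move=> [y gy]; rewrite /cgrad; case: xgetP => [z _ //|/(_ y)]. Qed.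

Lemma cgradE x y : graph x y -> cgrad x = y.
Proof. by move=> gy; apply: (@graph_uniq x) => //; apply: cgradP; exists y. Qed.

Definition cform x x' := \sum_i ip (cgrad x i) (cgrad x' i).

Let cdom_linear a x x' : cdom x -> cdom x' -> cdom (a *: x + x').
Proof.
by move=> [y gy] [y' gy']; exists (fun i => a *: y i + y' i); exact: graph_linear.
Qed.

Let cgrad_linear a x x' i : cdom x -> cdom x' ->
  cgrad (a *: x + x') i = a *: cgrad x i + cgrad x' i.
Proof. by move=> dx dx'; rewrite (cgradE (graph_linear a (cgradP dx) (cgradP dx'))). Qed.

Let cform_sym x x' : cdom x -> cdom x' -> cform x x' = cform x' x.
Proof. by move=> _ _; apply: eq_bigr => i _; rewrite ip_sym. Qed.

Let cform_linear a x x' (z : H) : cdom x -> cdom x' -> cdom z ->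
  cform (a *: x + x') z = a * cform x z + cform x' z.
Proof.
move=> dx dx' dz; rewrite /cform mulr_sumr -big_split; apply: eq_bigr => i _.
by rewrite cgrad_linear // ip_linear.
Qed.

Let cform_ge0 x : cdom x -> 0 <= cform x x.
Proof. by move=> _; apply: sumr_ge0 => i _; exact: ip_ge0. Qed.

Lemma cgradB x x' i : cdom x -> cdom x' -> cgrad (x - x') i = cgrad x i - cgrad x' i.
Proof.
move=> dx dx'; rewrite -scaleN1r addrC cgrad_linear // scaleN1r addrC.
by [].
Qed.

Lemma graph_closed (u : nat -> H) (w : nat -> 'I_n -> H) x y :
  (forall p, graph (u p) (w p)) -> u p @[p --> \oo] --> x ->
  (forall i, w p i @[p --> \oo] --> y i) -> graph x y.
Proof.
move=> gu ux wy e e0; have e20 : 0 < e / 2 by rewrite divr_gt0.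
have nx : \forall p \near \oo, `|x - u p| < e / 2 by move/cvgrPdist_lt : ux; exact.
have ny : \forall p \near \oo, forall i, `|y i - w p i| < e / 2.
  apply: filter_forall => i; by move/cvgrPdist_lt : (wy i); exact.
have [p [xp yp]] := filter_ex (filterI nx ny).
have [c [z [Cc uc wc]]] := gu p _ e20; exists c, z; split => //.
  by apply: le_lt_trans (ler_distD (u p) _ _) _; move: xp uc; lra.
by move=> i; apply: le_lt_trans (ler_distD (w p i) _ _) _; move: (yp i) (wc i); lra.
Qed.

Let cform_complete (u : nat -> H) : (forall p, cdom (u p)) ->
  (forall e : R, 0 < e -> exists N, forall p q, (N <= p)%N -> (N <= q)%N ->
     cform (u p - u q) (u p - u q) + ip (u p - u q) (u p - u q) < e) ->
  exists x, [/\ cdom x, cform (u p - x) (u p - x) @[p --> \oo] --> (0 : R) &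
               u p @[p --> \oo] --> x].
Proof.
move=> du uc.
have cauchy (w : nat -> H) : (forall p q, ip (w p - w q) (w p - w q) <=
    cform (u p - u q) (u p - u q) + ip (u p - u q) (u p - u q)) -> cvg (w @ \oo).
  move=> wu; apply: hilbert_complete => e e0.
  have [N NP] := uc (e ^+ 2) (exprn_gt0 2 e0); exists N => p q Np Nq.
  rewrite -(@ltr_pXn2r _ 2) ?nnegrE ?(ltW e0) // norm_sq.
  exact: le_lt_trans (NP p q Np Nq).
have /cvg_ex[/= x ux] : cvg (u @ \oo).
  by apply: cauchy => p q; rewrite lerDr; apply: sumr_ge0 => i _; exact: ip_ge0.
have /choice[y wy] : forall i, exists y : H, cgrad (u p) i @[p --> \oo] --> y.
  move=> i; have /cvg_ex[y ?] : cvg ((fun p => cgrad (u p) i) @ \oo); last by exists y.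
  apply: cauchy => p q; rewrite -cgradB // /cform (bigD1 i) //= -addrA lerDl addr_ge0 ?ip_ge0 //.
  by apply: sumr_ge0 => j _; exact: ip_ge0.
have gx : graph x y by apply: graph_closed ux wy => p; exact: cgradP.
have dx : cdom x by exists y.
exists x; split => //.
rewrite [X in X @ _](_ : _ = (fun p => \sum_i `|cgrad (u p) i - y i| ^+ 2)); last first.
  by apply/funext => p; apply: eq_bigr => i _; rewrite cgradB // (cgradE gx) norm_sq.
have z0 : \sum_(i < n) (0 : R) = 0 by exact: big1.
rewrite -[X in _ --> X]z0; apply: cvg_big => [|i _]; first exact: add_continuous.
have h : `|cgrad (u p) i - y i| @[p --> \oo] --> (0 : R).
  rewrite -[X in _ --> X](@normr0 R H) -(subrr (y i)).
  by apply: cvg_norm; apply: cvgB => //; exact: cvg_cst.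
by rewrite -[X in _ --> X](mulr0 0); exact: (cvgM h h).
Qed.

(** The closure D of the core is a complete subspace, on which [riesz] represents the pairing with x
    by the orthogonal projection u of x. As x - u is orthogonal to the core, it is zero by
    totality. *)
Lemma total_dense x (e : R) : 0 < e -> exists2 c, (exists z, core c z) & `|x - c| < e.
Proof.
move=> e0; pose D (v : H) := forall e : R, 0 < e -> exists2 c, (exists z, core c z) & `|v - c| < e.
suff : D x by apply.
have D0 : D 0 by move=> d d0; exists 0; [by exists (fun=> 0)|rewrite subrr normr0].
have D_linear a (v v' : H) : D v -> D v' -> D (a *: v + v').
  move=> Dv Dv' d d0; have a2 : 0 < `|a| + 2 by rewrite ltr_wpDl.
  have k0 : 0 < d / (`|a| + 2) by rewrite divr_gt0.
  have [c [z Cc] zc] := Dv _ k0; have [c' [z' Cc'] zc'] := Dv' _ k0.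
  exists (a *: c + c'); first by exists (fun i => a *: z i + z' i); exact: core_linear.
  rewrite (_ : _ - _ = a *: (v - c) + (v' - c')); last by rewrite scalerBr opprD addrACA.
  apply: le_lt_trans (ler_normD _ _) _; rewrite normrZ.
  have : `|a| * `|v - c| <= `|a| * (d / (`|a| + 2)) by rewrite ler_wpM2l // ltW.
  have : d = `|a| * (d / (`|a| + 2)) + 2 * (d / (`|a| + 2)).
    by rewrite -mulrDl mulrC divfK // gt_eqF.
  by move: (d / _) k0 zc' => k k0 zc'; lra.
have Dcore c z : core c z -> D c.
  by move=> Cc d d0; exists c; [exists z|rewrite subrr normr0].
have Dclosed (u : nat -> H) (v : H) : (forall p, D (u p)) -> u p @[p --> \oo] --> v -> D v.
  move=> Du uz d d0; have d20 : 0 < d / 2 by rewrite divr_gt0.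
  have nz : \forall p \near \oo, `|v - u p| < d / 2 by move/cvgrPdist_lt : uz; exact.
  have [p zp] := filter_ex nz; have [c Cc uc] := Du p _ d20; exists c => //.
  by apply: le_lt_trans (ler_distD (u p) _ _) _; move: zp uc; lra.
have [u Du uP] : exists2 u, D u & forall v, D v -> ip u v = ip x v.
  apply: (@riesz R H D (@ip R H) D0 D_linear _ _ _ _ (fun v => ip x v) (ip x x)).
  - by move=> v w _ _; exact: ip_sym.
  - by move=> a v w w' _ _ _; exact: ip_linear.
  - by move=> v _; exact: ip_ge0.
  - move=> u Du uc; have /cvg_ex[/= v uv] : cvg (u @ \oo).
      apply: hilbert_complete => d d0; have [N NP] := uc (d ^+ 2) (exprn_gt0 2 d0).
      exists N => p q Np Nq; rewrite -(@ltr_pXn2r _ 2) ?nnegrE ?(ltW d0) // norm_sq.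
      exact: NP.
    exists v; first exact: Dclosed uv.
    rewrite [X in X @ _](_ : _ = (fun p => `|u p - v| ^+ 2)); last first.
      by apply/funext => p; rewrite norm_sq.
    have h : `|u p - v| @[p --> \oo] --> (0 : R).
      rewrite -[X in _ --> X](@normr0 R H) -(subrr v).
      by apply: cvg_norm; apply: cvgB => //; exact: cvg_cst.
    by rewrite -[X in _ --> X](mulr0 0); exact: (cvgM h h).
  - exact: ip_ge0.
  - by move=> a v w _ _; rewrite ipDr ipZr.
  - by move=> v _; exact: ip_cauchy_schwarz.
rewrite (_ : x = u) //; apply/eqP; rewrite -subr_eq0; apply/eqP/core_total => c z Cc.
by rewrite ipBl uP ?subrr //; exact: Dcore Cc.
Qed.

Let cdom_dense x (e : R) : 0 < e -> exists2 y, cdom y & `|x - y| < e.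
Proof.
move=> e0; have [c [z Cc] xc] := total_dense x e0; exists c => //.
by exists z; exact: core_graph.
Qed.

Definition closable_form : closed_form H :=
  ClosedForm cdom_linear cform_sym cform_linear cform_ge0 cform_complete cdom_dense.

End ClosableFamily.

(** * The Dirichlet form of the surface *)

Section DirichletForm.
Context (R : realType).
Local Notation P := 'rV[R]_2.
Local Notation pdir := (fun k : 'I_2 => delta_mx 0 k : P).
Local Notation mu := (@mu R).
Local Notation H := (l2_hilbert mu).
Implicit Types (v w : P) (f g phi psi : P -> R) (u x : H).

Definition Einv v : R := (E v)^-1.

Lemma Einv_cinf : cinf pdir Einv.
Proof. by apply: cinfV; [exact: E_cinf|move=> v; rewrite gt_eqF // E_gt0]. Qed.

Lemma EinvK v : E v * Einv v = 1.
Proof. by rewrite divff // gt_eqF // E_gt0. Qed.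

Lemma test_funM f phi : cinf pdir f -> test_fun phi -> test_fun (fun v => f v * phi v).
Proof. by move=> hf [hp [r rp]]; split; [exact: cinfM|exists r; exact: supportedMr]. Qed.

Lemma test_funD phi psi : test_fun phi -> test_fun psi -> test_fun (fun v => phi v + psi v).
Proof.
move=> [hp [r rp]] [hq [s sq]]; split; first exact: cinfD.
exists (Num.max r s); apply: supportedD.
  by apply: supported_le rp; rewrite le_max lexx.
by apply: supported_le sq; rewrite le_max lexx orbT.
Qed.

Lemma test_funZ a phi : test_fun phi -> test_fun (fun v => a * phi v).
Proof. by apply: test_funM; exact: cinf_cst. Qed.

Lemma test_fun_partial k phi : test_fun phi -> test_fun (partial k phi).
Proof.
move=> [hp [r rp]]; split; first exact: partial_cinf.
by exists (r + 1); exact: supported_partial.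
Qed.

Lemma test_fun0 : test_fun (fun _ : P => 0).
Proof. by split; [exact: cinf_cst|exists 0]. Qed.

Lemma Rintegral_mu (f : P -> R) : continuous f ->
  \int[mu]_v f v = \int[@lam R]_v (f v * E v).
Proof.
move=> cf; rewrite /Rintegral; congr fine.
by rewrite integral_mu //; apply/measurable_EFinP; exact: continuous_measurable.
Qed.

(** [dual0] and [dual1] are the formal adjoints, with respect to mu = E dx dy, of the derivatives
    d/dx and E^-1 d/dy along the orthonormal frame; the latter derivative is [grad1]. *)
Definition dual0 b v : R := - (Einv v * partial 0 (fun w => E w * b w) v).
Definition dual1 b v : R := - (Einv v * partial 1 b v).
Definition grad1 f v : R := Einv v * partial 1 f v.

Lemma dual0_test b : test_fun b -> test_fun (dual0 b).
Proof.
move=> tb; have := test_funM (@Einv_cinf) (test_fun_partial 0 (test_funM (@E_cinf R) tb)).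
move=> /(test_funZ (-1)); congr test_fun; apply/funext => v; exact: mulN1r.
Qed.

Lemma dual1_test b : test_fun b -> test_fun (dual1 b).
Proof.
move=> tb; have := test_funM (@Einv_cinf) (test_fun_partial 1 tb).
move=> /(test_funZ (-1)); congr test_fun; apply/funext => v; exact: mulN1r.
Qed.

Lemma grad1_test b : test_fun b -> test_fun (grad1 b).
Proof. by move=> tb; exact: test_funM (@Einv_cinf) (test_fun_partial 1 tb). Qed.

Lemma by_parts k f g : cinf pdir f -> test_fun g ->
  \int[@lam R]_v (partial k f v * g v) = \int[@lam R]_v (f v * - partial k g v).
Proof.
move=> hf tg; have [hg [r rg]] := tg.
have cM h h' : cinf pdir h -> cinf pdir h' -> continuous (fun v => h v * h' v).
  by move=> hh hh'; apply: cinf_cont; exact: cinfM.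
have i1 : (@lam R).-integrable setT (EFin \o (fun v => partial k f v * g v)).
  by apply: (@integrable_supported _ r); [apply: cM => //; exact: partial_cinf|exact: supportedMr].
have i2 : (@lam R).-integrable setT (EFin \o (fun v => f v * - partial k g v)).
  apply: (@integrable_supported _ (r + 1)).
    by apply: cM => //; apply: cinfN; exact: partial_cinf.
  by apply: supportedMr => v vr; rewrite (supported_partial k rg vr) oppr0.
have := @integral_partial0 R r k (fun v => f v * g v) (cinfM hf hg) (supportedMr f rg).
move=> h; apply/eqP; rewrite -subr_eq0 -RintegralB // /Rintegral; apply/eqP.
rewrite [X in fine X](_ : _ = 0%E) // -[RHS]h.
by apply: eq_integral => v _; rewrite partialM // mulrN opprK.
Qed.

Lemma dual0P f b : cinf pdir f -> test_fun b ->
  \int[mu]_v (partial 0 f v * b v) = \int[mu]_v (f v * dual0 b v).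
Proof.
move=> hf tb; have hb : cinf pdir b by case: tb.
rewrite !Rintegral_mu; last 2 first.
- by apply: cinf_cont; apply: cinfM => //; case: (dual0_test tb).
- by apply: cinf_cont; apply: cinfM => //; exact: partial_cinf.
have -> : \int[lam R]_v (partial 0 f v * b v * E v) =
    \int[lam R]_v (partial 0 f v * (E v * b v)).
  by apply: eq_Rintegral => v _; rewrite mulrCA mulrC mulrA.
rewrite by_parts //; last exact: test_funM (@E_cinf R) tb.
apply: eq_Rintegral => v _; rewrite /dual0 -mulrA; congr (_ * _).
by rewrite mulNr mulrAC [Einv v * _]mulrC EinvK mul1r.
Qed.

Lemma dual1P f b : cinf pdir f -> test_fun b ->
  \int[mu]_v (grad1 f v * b v) = \int[mu]_v (f v * dual1 b v).
Proof.
move=> hf tb; have hb : cinf pdir b by case: tb.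
rewrite !Rintegral_mu; last 2 first.
- by apply: cinf_cont; apply: cinfM => //; case: (dual1_test tb).
- apply: cinf_cont; apply: cinfM => //; apply: cinfM; first exact: Einv_cinf.
  exact: partial_cinf.
have -> : \int[lam R]_v (grad1 f v * b v * E v) = \int[lam R]_v (partial 1 f v * b v).
  apply: eq_Rintegral => v _; rewrite /grad1 -[RHS]mul1r -(EinvK v); ring.
rewrite by_parts //; apply: eq_Rintegral => v _; rewrite /dual1 -mulrA; congr (_ * _).
by rewrite mulNr mulrAC [Einv v * _]mulrC EinvK mul1r.
Qed.

Lemma ip_cls f g : l2 mu f -> l2 mu g -> ip (cls mu f : H) (cls mu g : H) = dotm mu f g.
Proof.
by move=> f2 g2; apply: dotm_ae; try exact: rep_l2; rewrite //; exact: clsP.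
Qed.

Lemma ip_cls_r f u : l2 mu f -> ip u (cls mu f : H) = dotm mu (rep u) f.
Proof. by move=> f2; rewrite -[u in LHS]repK ip_cls //; exact: rep_l2. Qed.

Variable W : P -> R.
Hypothesis W_cinf : cinf pdir W.

(** Multiplication by W is treated as a third derivative. The form with potential W^2 is then a sum
    of three squares, and its closure is an instance of [closable_form]. *)
Definition grad_comp (i : 'I_3) f : P -> R :=
  match val i with 0 => partial 0 f | 1 => grad1 f | _ => fun v => W v * f v end.

Definition dual_comp (i : 'I_3) f : P -> R :=
  match val i with 0 => dual0 f | 1 => dual1 f | _ => fun v => W v * f v end.

Lemma grad_comp_test i f : test_fun f -> test_fun (grad_comp i f).
Proof.
rewrite /grad_comp => tf; case: (val i) => [|[|_]].
- exact: test_fun_partial.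
- exact: grad1_test.
- exact: test_funM.
Qed.

Lemma dual_comp_test i f : test_fun f -> test_fun (dual_comp i f).
Proof.
rewrite /dual_comp => tf; case: (val i) => [|[|_]].
- exact: dual0_test.
- exact: dual1_test.
- exact: test_funM.
Qed.

Lemma dual_compP i f b : test_fun f -> test_fun b ->
  dotm mu (grad_comp i f) b = dotm mu f (dual_comp i b).
Proof.
move=> [hf _] tb; rewrite /dotm /grad_comp /dual_comp; case: (val i) => [|[|_]].
- exact: dual0P.
- exact: dual1P.
- by apply: eq_Rintegral => v _; ring.
Qed.

Lemma grad_comp_linear i a f g v : cinf pdir f -> cinf pdir g ->
  grad_comp i (a *: f + g) v = a * grad_comp i f v + grad_comp i g v.
Proof.
move=> hf hg; have part k : partial k (a *: f + g) v = a * partial k f v + partial k g v.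
  have -> : a *: f + g = (fun w => a * f w + g w) by [].
  by rewrite partialD ?partialZ //; exact: cinfZ.
rewrite /grad_comp; case: (val i) => [|[|_]]; rewrite /grad1 ?part //.
  by ring.
by rewrite !fctE /GRing.scale /=; ring.
Qed.

Definition core (c : H) (z : 'I_3 -> H) := exists f, [/\ test_fun f, c = cls mu f &
  forall i, z i = cls mu (grad_comp i f)].

Definition adjoint (i : 'I_3) (b b' : H) := exists f, [/\ test_fun f, b = cls mu f &
  b' = cls mu (dual_comp i f)].

Let core0 : core 0 (fun=> 0).
Proof.
have z0 : (0 : H) = cls mu (fun=> 0) by [].
exists (fun=> 0); split => //; first exact: test_fun0.
move=> i; rewrite z0; congr cls; apply/funext => v.
rewrite /grad_comp; case: (val i) => [|[|_]]; rewrite /grad1 /partial ?derive_cst ?mulr0 //.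
Qed.

Lemma core_linear a c z c' z' : core c z -> core c' z' ->
  core (a *: c + c') (fun i => a *: z i + z' i).
Proof.
move=> [f [tf -> zf]] [g [tg -> zg]]; exists (a *: f + g); split.
- by apply: (@test_funD (fun v => a * f v) g) => //; exact: test_funZ.
- by rewrite cls_linear //; exact: test_fun_l2.
- move=> i; rewrite zf zg -cls_linear; try exact/test_fun_l2/grad_comp_test.
  by congr cls; apply/funext => v; rewrite grad_comp_linear //; [case: tf|case: tg].
Qed.

Lemma coreP i c z b b' : core c z -> adjoint i b b' -> ip (z i) b = ip c b'.
Proof.
move=> [f [tf -> zf]] [g [tg -> ->]]; rewrite zf !ip_cls ?dual_compP //; do ?exact: test_fun_l2.
  exact/test_fun_l2/dual_comp_test.
exact/test_fun_l2/grad_comp_test.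
Qed.

Let test_total (x : H) : (forall f, test_fun f -> ip x (cls mu f : H) = 0) -> x = 0.
Proof.
move=> x0; apply: rep_ae.
have x1 : \forall v \ae mu, rep x v = 0.
  apply: fundamental_lemma; first exact: rep_l2.
  by move=> phi tphi; rewrite -ip_cls_r ?x0 //; exact: test_fun_l2.
by move: x1 (rep0 mu); apply: filterS2 => v -> ->.
Qed.

Let core_total x : (forall c z, core c z -> ip x c = 0) -> x = 0.
Proof.
move=> x0; apply: test_total => f tf; apply: (x0 _ (fun i => cls mu (grad_comp i f))).
by exists f.
Qed.

Lemma adj_total (i : 'I_3) x : (forall b b', adjoint i b b' -> ip x b = 0) -> x = 0.
Proof.
move=> x0; apply: test_total => f tf; apply: (x0 _ (cls mu (dual_comp i f))).
by exists f.
Qed.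

Definition dirichlet_form : closed_form H :=
  closable_form core0 core_linear coreP adj_total core_total.

End DirichletForm.

Section AlmostEverywhere.
Context d (T : measurableType d) (R : realType) (m : {measure set T -> \bar R}).
Implicit Types (P Q S U Z : T -> Prop).

Lemma aeS P Q : (forall x, P x -> Q x) ->
  (\forall x \ae m, P x) -> \forall x \ae m, Q x.
Proof. exact: filterS. Qed.

Lemma aeS2 P Q S : (forall x, P x -> Q x -> S x) ->
  (\forall x \ae m, P x) -> (\forall x \ae m, Q x) -> \forall x \ae m, S x.
Proof. exact: filterS2. Qed.

Lemma aeS3 P Q S U : (forall x, P x -> Q x -> S x -> U x) ->
  (\forall x \ae m, P x) -> (\forall x \ae m, Q x) -> (\forall x \ae m, S x) ->
  \forall x \ae m, U x.
Proof. exact: filterS3. Qed.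

Lemma aeS4 P Q S U Z : (forall x, P x -> Q x -> S x -> U x -> Z x) ->
  (\forall x \ae m, P x) -> (\forall x \ae m, Q x) -> (\forall x \ae m, S x) ->
  (\forall x \ae m, U x) -> \forall x \ae m, Z x.
Proof. exact: filterS4. Qed.

End AlmostEverywhere.

(** * Distributional gradients in the orthonormal frame *)

Section Gradient.
Context (R : realType).
Local Notation P := 'rV[R]_2.
Local Notation B := (borel P).
Local Notation M := (surface R).
Local Notation mu := (@mu R).
Implicit Types (v w : P) (f g phi psi : P -> R) (X Y : field M).

(** [fcomp0] and [fcomp1] are the components along the orthonormal frame d/dx, E^-1 d/dy, in which
    the inner product is Euclidean. *)
Definition fcomp0 (X : field M) (v : P) : R := X tt v 0 0.
Definition fcomp1 (X : field M) (v : P) : R := E v * X tt v 0 1.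

Definition mkfield (p q : P -> R) : field M := fun _ v => pt (p v) (Einv v * q v).

Lemma mkfield0 p q : fcomp0 (mkfield p q) = p.
Proof. by apply/funext => v; rewrite /fcomp0 pt0. Qed.

Lemma mkfield1 p q : fcomp1 (mkfield p q) = q.
Proof. by apply/funext => v; rewrite /fcomp1 pt1 mulrA EinvK mul1r. Qed.

Lemma inner_comp X Y v : inner X Y v = fcomp0 X v * fcomp0 Y v + fcomp1 X v * fcomp1 Y v.
Proof. by rewrite innerE /fcomp0 /fcomp1; ring. Qed.

Lemma div_comp Y v : div Y v = - dual0 (fcomp0 Y) v - dual1 (fcomp1 Y) v.
Proof. by rewrite divE /dual0 /dual1 mulrDr !opprK. Qed.

Lemma test_field_comp Y : test_field Y -> test_fun (fcomp0 Y) /\ test_fun (fcomp1 Y).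
Proof.
move=> [_ sY [K cK YK]].
have tY k : test_fun (fun v => Y tt v 0 k).
  apply/test_functionP; split; first by move=> [] ; exact: (sY tt k).
  by exists K => // v Kv; rewrite (YK tt) // mxE.
by split; [exact: (tY 0)|exact: (test_funM (@E_cinf R) (tY 1))].
Qed.

Lemma mkfield_test p q : test_fun p -> test_fun q -> test_field (mkfield p q).
Proof.
move=> tp tq; have tq' := test_funM (@Einv_cinf R) tq.
split; first exact: vector_fieldT.
  move=> [] k; apply: cinf_smooth_on; case/orP: (ord2P k) => /eqP ->.
    by rewrite (_ : (fun y => _) = p); [case: tp|apply/funext => v; rewrite /= pt0].
  by rewrite (_ : (fun y => _) = (fun v => Einv v * q v)); [case: tq'|apply/funext => v; rewrite /= pt1].
have [[_ [r rp]] [_ [s rq]]] := (tp, tq).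
exists (box (Num.max r s)); first exact: box_compact.
move=> [] v _ vK; apply: plane_eq; rewrite /mkfield ?pt0 ?pt1 mxE.
  by apply: (supported_box _ vK); apply: supported_le rp; rewrite le_max lexx.
by rewrite (supported_box (supported_le _ rq) vK) ?mulr0 // le_max lexx orbT.
Qed.

(** The distributional gradient, split into two scalar identities that only involve functions in
    L^2. *)
Definition weak_gradient f p q := [/\ l2 mu p, l2 mu q,
  forall psi, test_fun psi -> dotm mu p psi = dotm mu f (dual0 psi) &
  forall psi, test_fun psi -> dotm mu q psi = dotm mu f (dual1 psi)].

Lemma dotm_ae_l2 f f' g : l2 mu f -> l2 mu f' -> l2 mu g ->
  (\forall v \ae mu, f v = f' v) -> dotm mu f g = dotm mu f' g.
Proof. by move=> f2 f'2 g2 ff'; apply: dotm_ae => //; exact: aeW. Qed.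

Lemma weak_gradient_uniq f p q p' q' : weak_gradient f p q -> weak_gradient f p' q' ->
  (\forall v \ae mu, p v = p' v) /\ (\forall v \ae mu, q v = q' v).
Proof.
have main (h h' : P -> R) : l2 mu h -> l2 mu h' ->
    (forall psi, test_fun psi -> dotm mu h psi = dotm mu h' psi) -> \forall v \ae mu, h v = h' v.
  move=> h2 h'2 hh'; have : \forall v \ae mu, h v - h' v = 0.
    apply: (@fundamental_lemma R (h - h')); first exact: l2B.
    move=> psi tpsi; have psi2 := test_fun_l2 tpsi.
    by rewrite -scaleN1r addrC dotm_linear // hh' // mulN1r addNr.
  by apply: aeS => v hv; apply/eqP; rewrite -subr_eq0 hv.
move=> [p2 q2 pP qP] [p'2 q'2 p'P q'P]; split; apply: main => // psi tpsi.
  by rewrite pP // p'P.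
by rewrite qP // q'P.
Qed.

Lemma is_gradientP f X : l2 mu f ->
  is_gradient mu f X <-> weak_gradient f (fcomp0 X) (fcomp1 X).
Proof.
move=> f2; set p := fcomp0 X; set q := fcomp1 X.
have pq v : inner X X v = p v ^+ 2 + q v ^+ 2 by rewrite inner_comp -!expr2.
have sumE (a b : P -> R) : l2 mu p -> l2 mu q -> test_fun a -> test_fun b ->
    \int[mu]_v (p v * a v + q v * b v) = dotm mu p a + dotm mu q b.
  by move=> p2 q2 ta tb; rewrite RintegralD //; apply: l2_integrable => //; exact: test_fun_l2.
have divY a b : test_fun a -> test_fun b ->
    - (\int[mu]_v (f v * (- dual0 a v - dual1 b v))) = dotm mu f (dual0 a) + dotm mu f (dual1 b).
  move=> ta tb; have a2 := test_fun_l2 (dual0_test ta); have b2 := test_fun_l2 (dual1_test tb).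
  rewrite dotmC [X in _ + X]dotmC -[dotm mu (dual0 a) f]mul1r -dotm_linear //.
  rewrite -[LHS]mulN1r -RintegralZl //.
    by apply: eq_Rintegral => v _; rewrite !fctE /GRing.scale /=; ring.
  have := l2_integrable f2 (l2B (l2N a2) b2); exact.
split=> [[_ mX iX gX]|[p2 q2 pP qP]].
  have mp : measurable_fun (setT : set B) p by exact: (mX tt 0).
  have mq : measurable_fun (setT : set B) q.
    apply: measurable_funM; last exact: (mX tt 1).
    exact: (continuous_measurable (@E_cont R)).
  have p2 : l2 mu p.
    apply/l2P; split => //; apply: le_lt_trans iX; apply: ge0_le_integral => //.
    - by move=> v _; rewrite lee_fin sqr_ge0.
    - by apply/measurable_EFinP; exact: measurable_funX.
    - apply/measurable_EFinP; rewrite (funext pq).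
      by apply: measurable_funD; exact: measurable_funX.
    - by move=> v _; rewrite lee_fin pq lerDl sqr_ge0.
  have q2 : l2 mu q.
    apply/l2P; split => //; apply: le_lt_trans iX; apply: ge0_le_integral => //.
    - by move=> v _; rewrite lee_fin sqr_ge0.
    - by apply/measurable_EFinP; exact: measurable_funX.
    - apply/measurable_EFinP; rewrite (funext pq).
      by apply: measurable_funD; exact: measurable_funX.
    - by move=> v _; rewrite lee_fin pq lerDr sqr_ge0.
  have key a b : test_fun a -> test_fun b ->
      dotm mu p a + dotm mu q b = dotm mu f (dual0 a) + dotm mu f (dual1 b).
    move=> ta tb; rewrite -sumE // -divY //.
    have := gX _ (mkfield_test ta tb).
    under eq_Rintegral do rewrite inner_comp mkfield0 mkfield1.
    by under [X in - X]eq_Rintegral do rewrite div_comp mkfield0 mkfield1.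
  have part0 k (h : P -> R) v : h = (fun=> 0) -> partial k h v = 0.
    by move=> ->; rewrite /partial derive_cst.
  have d0 (h g : P -> R) : g = (fun=> 0) -> dotm mu h g = 0.
    by move=> ->; rewrite /dotm; rewrite /Rintegral integral0_eq // => v _; rewrite mulr0.
  have d00 : dual0 (fun _ : P => 0) = fun=> 0.
    by apply/funext => v; rewrite /dual0 part0 ?mulr0 ?oppr0 //; apply/funext => w; rewrite mulr0.
  have d10 : dual1 (fun _ : P => 0) = fun=> 0.
    by apply/funext => v; rewrite /dual1 part0 ?mulr0 ?oppr0.
  (* A test field with one zero component separates the two identities that [key] provides as a
     sum. *)
  split => // psi tpsi.
    have := key _ _ tpsi (@test_fun0 R); rewrite (d0 q) // (d0 f (dual1 _)) // !addr0; exact.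
  have := key _ _ (@test_fun0 R) tpsi; rewrite (d0 p) // (d0 f (dual0 _)) // !add0r; exact.
split.
- exact: vector_fieldT.
- move=> [] k; case/orP: (ord2P k) => /eqP ->; first exact: l2_measurable p2.
  have -> : (fun v : M => X tt v 0 1) = (fun v => Einv v * q v).
    by apply/funext => v; rewrite /q /fcomp1 mulrA [Einv _ * _]mulrC EinvK mul1r.
  apply: measurable_funM; last exact: l2_measurable q2.
  exact: (continuous_measurable (cinf_cont (@Einv_cinf R))).
- under eq_integral do rewrite pq EFinD.
  rewrite ge0_integralD //.
  + by rewrite lte_add_pinfty //; [have /l2P[] := p2|have /l2P[] := q2].
  + by move=> v _; rewrite lee_fin sqr_ge0.
  + by apply/measurable_EFinP; apply: measurable_funX; exact: (l2_measurable p2).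
  + by move=> v _; rewrite lee_fin sqr_ge0.
  + by apply/measurable_EFinP; apply: measurable_funX; exact: (l2_measurable q2).
- move=> Y tY; have [ta tb] := test_field_comp tY.
  under eq_Rintegral do rewrite inner_comp.
  under [X in - X]eq_Rintegral do rewrite div_comp.
  by rewrite sumE // divY // pP // qP.
Qed.

End Gradient.

(** * Comparison of the closure with the Sobolev space W^1_0 *)

Section FormDomain.
Context (R : realType).
Local Notation P := 'rV[R]_2.
Local Notation B := (borel P).
Local Notation pdir := (fun k : 'I_2 => delta_mx 0 k : P).
Local Notation mu := (@mu R).
Local Notation H := (l2_hilbert mu).
Implicit Types (v w : P) (f g h p q phi psi : P -> R).
Variable W : P -> R.
Hypothesis W_cinf : cinf pdir W.
Local Notation F := (dirichlet_form W_cinf).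
Local Notation V := (fun v => W v ^+ 2).
Local Notation WM f := (fun v => W v * f v).

Lemma W_measurable : measurable_fun setT (W : B -> R).
Proof. exact: (continuous_measurable (cinf_cont W_cinf)). Qed.

Lemma dotmBB f g : l2 mu f -> l2 mu g ->
  dotm mu (f - g) (f - g) = `|(cls mu f : H) - cls mu g| ^+ 2.
Proof.
move=> f2 g2; rewrite norm_sq -ip_cls; do ?exact: l2B.
by rewrite (_ : cls mu (f - g) = (cls mu f : H) - cls mu g) // -scaleN1r addrC cls_linear // scaleN1r addrC.
Qed.

Lemma weak_gradient_test phi : test_fun phi -> weak_gradient phi (partial 0 phi) (grad1 phi).
Proof.
move=> tphi; have [hphi _] := tphi; split.
- exact/test_fun_l2/test_fun_partial.
- exact/test_fun_l2/grad1_test.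
- by move=> psi tpsi; exact: dual0P.
- by move=> psi tpsi; exact: dual1P.
Qed.

Lemma weak_gradientB f p q g p' q' : l2 mu f -> l2 mu g ->
  weak_gradient f p q -> weak_gradient g p' q' -> weak_gradient (f - g) (p - p') (q - q').
Proof.
have dB (h h' k : P -> R) : l2 mu h -> l2 mu h' -> l2 mu k ->
    dotm mu (h - h') k = dotm mu h k - dotm mu h' k.
  by move=> h2 h'2 k2; rewrite -scaleN1r addrC dotm_linear // mulN1r addrC.
move=> f2 g2 [p2 q2 pP qP] [p'2 q'2 p'P q'P]; split; do ?exact: l2B.
  move=> psi tpsi; rewrite !dB ?pP ?p'P //; do ?exact: test_fun_l2.
  exact/test_fun_l2/dual0_test.
move=> psi tpsi; rewrite !dB ?qP ?q'P //; do ?exact: test_fun_l2.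
exact/test_fun_l2/dual1_test.
Qed.

Lemma gradientP f p q : l2 mu f -> weak_gradient f p q ->
  weak_gradient f (fcomp0 (gradient mu f)) (fcomp1 (gradient mu f)).
Proof.
move=> f2 fpq; apply/is_gradientP => //; rewrite /gradient.
case: xgetP => [X _ //|/(_ (mkfield p q)) /=].
by rewrite is_gradientP // mkfield0 mkfield1.
Qed.

Lemma inner_gradient f p q g p' q' : l2 mu f -> l2 mu g ->
  weak_gradient f p q -> weak_gradient g p' q' ->
  \forall v \ae mu, inner (gradient mu f) (gradient mu g) v = p v * p' v + q v * q' v.
Proof.
move=> f2 g2 fpq gpq.
have [h0 h1] := weak_gradient_uniq (gradientP f2 fpq) fpq.
have [h2 h3] := weak_gradient_uniq (gradientP g2 gpq) gpq.
by move: h0 h1 h2 h3; apply: aeS4 => v a b c d; rewrite inner_comp a b c d.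
Qed.

Lemma weak_l2 f p q : weak_gradient f p q -> l2 mu p /\ l2 mu q.
Proof. by case. Qed.

Lemma integral_inner f p q g p' q' : l2 mu f -> l2 mu g ->
  weak_gradient f p q -> weak_gradient g p' q' ->
  (\int[mu]_v (inner (gradient mu f) (gradient mu g) v)%:E =
   (dotm mu p p' + dotm mu q q')%:E)%E.
Proof.
move=> f2 g2 fpq gpq; have [p2 q2] := weak_l2 fpq; have [p'2 q'2] := weak_l2 gpq.
have [x0 x1] := weak_l2 (gradientP f2 fpq); have [y0 y1] := weak_l2 (gradientP g2 gpq).
have meas (a b c d : P -> R) : l2 mu a -> l2 mu b -> l2 mu c -> l2 mu d ->
    measurable_fun setT (fun v : B => (a v * b v + c v * d v)%:E).
  move=> a2 b2 c2 d2; apply/measurable_EFinP; apply: measurable_funD;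
    apply: measurable_funM;
    by [exact: (l2_measurable a2)|exact: (l2_measurable b2)|exact: (l2_measurable c2)|exact: (l2_measurable d2)].
transitivity (\int[mu]_v (p v * p' v + q v * q' v)%:E)%E.
  apply: ae_eq_integral => //.
  - under eq_fun do rewrite inner_comp; exact: meas.
  - exact: meas.
  - by move: (inner_gradient f2 g2 fpq gpq); apply: aeS => v -> .
have i1 := l2_integrable p2 p'2; have i2 := l2_integrable q2 q'2.
under eq_integral do rewrite EFinD; rewrite integralD //.
by rewrite EFinD /dotm /Rintegral !fineK //; apply: integrable_fin_num.
Qed.

Lemma weighted_l2 f : measurable_fun setT (f : B -> R) ->
  (\int[mu]_v (f v ^+ 2 * (1 + V v))%:E < +oo)%E -> l2 mu f /\ l2 mu (WM f).
Proof.
move=> mf fi; have mWf : measurable_fun setT (WM f : B -> R).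
  by apply: measurable_funM => //; exact: W_measurable.
have mw : measurable_fun setT (fun v : B => (f v ^+ 2 * (1 + V v))%:E).
  apply/measurable_EFinP; apply: measurable_funM; first exact: measurable_funX.
  by apply: measurable_funD => //; apply: measurable_funX; exact: W_measurable.
split; apply/l2P; split => //; apply: le_lt_trans fi; apply: ge0_le_integral => //.
- by move=> v _; rewrite lee_fin sqr_ge0.
- by apply/measurable_EFinP; exact: measurable_funX.
- by move=> v _; rewrite lee_fin mulrDr mulr1 lerDl mulr_ge0 ?sqr_ge0.
- by move=> v _; rewrite lee_fin sqr_ge0.
- by apply/measurable_EFinP; exact: measurable_funX.
- by move=> v _; rewrite lee_fin mulrDr mulr1 exprMn mulrC lerDr sqr_ge0.
Qed.

(** With the weight 1 + W^2 the squared norm is a sum of four squared L^2 norms, of f and of its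
    three generalized gradient components: the quantities controlled in [graph]. *)
Lemma W1_sqnormE f p q : l2 mu f -> l2 mu (WM f) -> weak_gradient f p q ->
  W1_sqnorm mu (fun v => 1 + V v) f =
  (dotm mu p p + dotm mu q q + (dotm mu f f + dotm mu (WM f) (WM f)))%:E.
Proof.
move=> f2 Wf2 fpq; rewrite /W1_sqnorm (integral_inner f2 f2 fpq fpq) [RHS]EFinD; congr (_ + _)%E.
have -> : (\int[mu]_v (f v ^+ 2 * (1 + V v))%:E = \int[mu]_v ((f v * f v)%:E + (W v * f v * (W v * f v))%:E))%E.
  by apply: eq_integral => v _; rewrite -EFinD; congr EFin; ring.
have i1 := l2_integrable f2 f2; have i2 := l2_integrable Wf2 Wf2.
rewrite integralD // EFinD /dotm /Rintegral !fineK //; exact: integrable_fin_num.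
Qed.

Let i0 : 'I_3 := @Ordinal 3 0 isT.
Let i1 : 'I_3 := @Ordinal 3 1 isT.
Let i2 : 'I_3 := @Ordinal 3 2 isT.

Lemma sum3E (G : 'I_3 -> R) : \sum_i G i = G i0 + G i1 + G i2.
Proof.
rewrite !big_ord_recl big_ord0 addr0 addrA.
by congr (G _ + G _ + G _); exact: val_inj.
Qed.

Lemma graph_weak_gradient (x : H) y : graph (core W) x y ->
  weak_gradient (rep x) (rep (y i0)) (rep (y i1)).
Proof.
have a (i : 'I_3) psi : graph (core W) x y -> test_fun psi ->
    dotm mu (rep (y i)) psi = dotm mu (rep x) (dual_comp W i psi).
  move=> gxy tpsi; have t2 := test_fun_l2 tpsi.
  have d2 : l2 mu (dual_comp W i psi) by exact/test_fun_l2/dual_comp_test.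
  rewrite -!ip_cls_r //; apply: (graph_adj _ gxy (adj := adjoint W)).
    exact: coreP.
  by exists psi.
move=> gxy; split; try exact: rep_l2.
- by move=> psi tpsi; rewrite (a i0).
- by move=> psi tpsi; rewrite (a i1).
Qed.

(** W may be unbounded, so the identity is first obtained after multiplication by a cutoff, which
    makes both sides square integrable. Duality with test functions then applies, and the cutoffs
    equal 1 on larger and larger squares. *)
Lemma graph_weight (x : H) y : graph (core W) x y ->
  \forall v \ae mu, rep (y i2) v = W v * rep x v.
Proof.
move=> gxy.
have key n : \forall v \ae mu, cutoff n.+1%:R v * (rep (y i2) v - W v * rep x v) = 0.
  have n0 : 0 < n.+1%:R :> R by rewrite ltr0n.
  have tc := cutoff_test n0; set c := cutoff _ in tc *.
  have tWc := test_funM W_cinf tc.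
  have bounded h : test_fun h -> forall u : H, l2 mu (fun v => h v * rep u v).
    move=> [hh [r rh]] u; have [C C0 hC] := supported_bounded (cinf_cont hh) rh.
    have u2 := rep_l2 u; apply: (fun m d => l2_dominated m (l2Z C u2) d).
      apply: measurable_funM; last exact: (l2_measurable u2).
      exact: (continuous_measurable (cinf_cont hh)).
    move=> v; rewrite /GRing.scale /= !normrM ler_wpM2r // (le_trans (hC v)) //.
    exact: ler_norm.
  have := @fundamental_lemma R ((fun v => c v * rep (y i2) v) - (fun v => (W v * c v) * rep x v)).
  have b1 := bounded _ tc (y i2); have b2 := bounded _ tWc x.
  move=> h; have : \forall v \ae mu, c v * rep (y i2) v - (W v * c v) * rep x v = 0.
    apply: h; first exact: l2B.
    move=> phi tphi; have phi2 := test_fun_l2 tphi.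
    rewrite -scaleN1r addrC dotm_linear //.
    have tcp := test_funM tc.1 tphi.
    have e1 : dotm mu (fun v => c v * rep (y i2) v) phi = dotm mu (rep (y i2)) (fun v => c v * phi v).
      by apply: eq_Rintegral => v _; ring.
    have e2 : dotm mu (fun v => W v * c v * rep x v) phi = dotm mu (rep x) (fun v => W v * (c v * phi v)).
      by apply: eq_Rintegral => v _; ring.
    have d2 : l2 mu (fun v => W v * (c v * phi v)) by exact/test_fun_l2/test_funM.
    rewrite e1 e2 -!ip_cls_r //; last exact: test_fun_l2.
    have -> : ip (y i2) (cls mu (fun v => c v * phi v) : H) = ip x (cls mu (fun v => W v * (c v * phi v)) : H).
      apply: (graph_adj (@coreP _ _ W_cinf) gxy (i := i2)).
      by exists (fun v => c v * phi v).
    by rewrite mulN1r addNr.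
  by apply: aeS => v hv; rewrite -hv; ring.
have : \forall v \ae mu, forall n, cutoff n.+1%:R v * (rep (y i2) v - W v * rep x v) = 0.
  exact: ae_foralln.
apply: aeS => v hv; pose n := Num.bound (`|v 0 0| + `|v 0 1|).
have nb : `|v 0 0| + `|v 0 1| < n%:R by apply: archi_boundP; rewrite addr_ge0.
have n1 : n%:R < n.+1%:R :> R by rewrite ltr_nat.
have := hv n; rewrite cutoff_eq1 ?mul1r.
- by move/eqP; rewrite subr_eq0 => /eqP.
- by rewrite ltr0n.
- by apply/ltW/(le_lt_trans _ (lt_trans nb n1)); rewrite lerDl.
- by apply/ltW/(le_lt_trans _ (lt_trans nb n1)); rewrite lerDr.
Qed.

Definition grad_of (p q r : P -> R) (i : 'I_3) : H :=
  match val i with 0 => cls mu p | 1 => cls mu q | _ => cls mu r end.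

Lemma sum4_lt (a b c d t : R) : a + b + (c + d) < t ->
  0 <= a -> 0 <= b -> 0 <= c -> 0 <= d -> [/\ a < t, b < t, c < t & d < t].
Proof. by move=> h a0 b0 c0 d0; split; lra. Qed.

Lemma sum4_small (a b c d e : R) : 0 < e -> a < e / 8 -> b < e / 8 -> c < e / 8 -> d < e / 8 ->
  a + b + (c + d) < e.
Proof. by lra. Qed.

Lemma lt_of_sqr (t e : R) : 0 <= t -> 0 < e -> t ^+ 2 < e ^+ 2 -> t < e.
Proof. by move=> t0 e0; rewrite ltr_pXn2r ?nnegrE ?(ltW e0). Qed.

Lemma form_dom_graph f : form_dom mu V f ->
  [/\ l2 mu f, l2 mu (WM f) & exists p q, weak_gradient f p q /\
    graph (core W) (cls mu f) (grad_of p q (WM f))].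
Proof.
move=> [[mf [X hX] fin] approx].
have [f2 Wf2] : l2 mu f /\ l2 mu (WM f).
  apply: weighted_l2 => //; apply: le_lt_trans fin; rewrite leeDr //.
  by apply: integral_ge0 => v _; rewrite lee_fin inner_comp addr_ge0 // -expr2 sqr_ge0.
split => //; have gX := iffLR (is_gradientP X f2) hX.
set p := fcomp0 X in gX; set q := fcomp1 X in gX; exists p, q; split => //.
have [p2 q2] := weak_l2 gX.
move=> e e0; have [phi tphi] := approx (e ^+ 2) (exprn_gt0 2 e0).
move/test_functionP : tphi => tphi; have phi2 := test_fun_l2 tphi.
have tW := test_funM W_cinf tphi; have W2 := test_fun_l2 tW.
have gphi := weak_gradient_test tphi; have [d02 d12] := weak_l2 gphi.
have Wsub : WM (f - phi) = (WM f - WM phi)%R by apply/funext => v; rewrite !fctE; ring.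
rewrite (W1_sqnormE (l2B f2 phi2) _ (weak_gradientB f2 phi2 gX gphi)); last first.
  by rewrite Wsub; exact: l2B.
rewrite lte_fin Wsub !dotmBB // => /sum4_lt[| | | |l1 l2 l3 l4]; try exact: sqr_ge0.
exists (cls mu phi), (fun i => cls mu (grad_comp W i phi)); split; first by exists phi.
- exact: lt_of_sqr (normr_ge0 _) e0 l3.
- move=> i; apply: lt_of_sqr (normr_ge0 _) e0 _.
  case: i => [[|[|[|i]]] ik]; [exact: l1|exact: l2|exact: l4|by []].
Qed.

Lemma graph_form_dom f y : l2 mu f -> graph (core W) (cls mu f) y -> form_dom mu V f.
Proof.
move=> f2 gy; have ff := clsP f2.
have [p2 q2] := weak_l2 (graph_weak_gradient gy).
set p := rep (y i0) in p2; set q := rep (y i1) in q2.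
have gX : weak_gradient f p q.
  have [_ _ pP qP] := graph_weak_gradient gy; split; [exact: p2|exact: q2| |] => psi tpsi.
    rewrite /p pP //; apply: (dotm_ae_l2 (rep_l2 _) f2 _ ff).
    exact/test_fun_l2/dual0_test.
  rewrite /q qP //; apply: (dotm_ae_l2 (rep_l2 _) f2 _ ff).
  exact/test_fun_l2/dual1_test.
have Wf : \forall v \ae mu, rep (y i2) v = W v * f v.
  by move: (graph_weight gy) ff; apply: aeS2 => v -> ->.
have mf := l2_measurable f2.
have Wf2 : l2 mu (WM f).
  have r2 := rep_l2 (y i2); apply/l2P; split.
    by apply: measurable_funM => //; exact: W_measurable.
  have /l2P[mr ri] := r2; apply: le_lt_trans ri; rewrite le_eqVlt; apply/orP; left; apply/eqP.
  apply: ae_eq_integral => //.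
  - apply/measurable_EFinP; apply: measurable_funX.
    by apply: measurable_funM => //; exact: W_measurable.
  - by apply/measurable_EFinP; exact: measurable_funX.
  - by move: Wf; apply: aeS => v ->.
have cW : cls mu (WM f) = y i2 :> H.
  by rewrite -[RHS]repK; apply: cls_eq => //; [exact: rep_l2|move: Wf; apply: aeS => v ->].
split; first split => //.
- exists (mkfield p q); apply/(is_gradientP _ f2).
  by rewrite mkfield0 mkfield1.
- by rewrite (W1_sqnormE f2 Wf2 gX) ltry.
(* Four squares, each below e / 8, add up to less than e. *)
move=> e e0; have e40 : 0 < Num.sqrt (e / 8) by rewrite sqrtr_gt0 divr_gt0.
have [c [z [[phi [tphi -> zphi]] hc hz]]] := gy _ e40.
exists phi; first exact/test_functionP.
have phi2 := test_fun_l2 tphi.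
have tW := test_funM W_cinf tphi; have W2 := test_fun_l2 tW.
have gphi := weak_gradient_test tphi; have [d02 d12] := weak_l2 gphi.
have Wsub : WM (f - phi) = (WM f - WM phi)%R by apply/funext => v; rewrite !fctE; ring.
rewrite (W1_sqnormE (l2B f2 phi2) _ (weak_gradientB f2 phi2 gX gphi)); last first.
  by rewrite Wsub; exact: l2B.
rewrite lte_fin Wsub !dotmBB // cW !repK.
have sq (t : R) : 0 <= t -> t < Num.sqrt (e / 8) -> t ^+ 2 < e / 8.
  move=> t0 te; rewrite -[ltRHS]sqr_sqrtr ?divr_ge0 ?(ltW e0) //.
  by rewrite ltr_pXn2r ?nnegrE ?(ltW e40).
have h0 := sq _ (normr_ge0 _) (hz i0); have h1 := sq _ (normr_ge0 _) (hz i1).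
have h2 := sq _ (normr_ge0 _) (hz i2); have h3 := sq _ (normr_ge0 _) hc.
rewrite !zphi /grad_comp /= in h0 h1 h2.
exact: sum4_small e0 h0 h1 h3 h2.
Qed.

Lemma form_domP f : form_dom mu V f <-> l2 mu f /\ fdom F (cls mu f).
Proof.
split=> [/form_dom_graph[f2 _ [p [q [_ g]]]]|[f2 [y gy]]].
  by split => //; exists (grad_of p q (WM f)).
exact: graph_form_dom gy.
Qed.

Lemma energy_formE f h : form_dom mu V f -> form_dom mu V h ->
  energy_form mu V f h = form F (cls mu f) (cls mu h).
Proof.
move=> /form_dom_graph[f2 Wf2 [p [q [gf cf]]]] /form_dom_graph[h2 Wh2 [p' [q' [gh ch]]]].
have [p2 q2] := weak_l2 gf; have [p'2 q'2] := weak_l2 gh.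
rewrite /energy_form /= /cform.
rewrite (cgradE (@coreP _ _ W_cinf) (@adj_total _ W) cf).
rewrite (cgradE (@coreP _ _ W_cinf) (@adj_total _ W) ch).
rewrite sum3E; change (\int[mu]_x inner (gradient mu f) (gradient mu h) x +
  \int[mu]_x (f x * h x * W x ^+ 2) = ip (cls mu p : H) (cls mu p' : H) +
  ip (cls mu q : H) (cls mu q' : H) + ip (cls mu (WM f) : H) (cls mu (WM h) : H)).
rewrite !ip_cls // {1}/Rintegral (integral_inner f2 h2 gf gh) /=.
by congr (_ + _); apply: eq_Rintegral => v _; ring.
Qed.

Lemma form_operatorP f u : form_operator mu V f u <->
  [/\ l2 mu f, l2 mu u & op F (cls mu f) (cls mu u)].
Proof.
split=> [[df u2 hf]|[f2 u2 [df hf]]].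
  have [f2 cf] := iffLR (form_domP f) df; split => //; split => // x dx.
  have dx' : form_dom mu V (rep x) by apply/form_domP; split; [exact: rep_l2|rewrite repK].
  rewrite -[x]repK -energy_formE // hf // ip_cls //; exact: rep_l2.
have df' : form_dom mu V f by apply/form_domP.
split => // h dh; have [h2 ch] := iffLR (form_domP h) dh.
by rewrite energy_formE // hf // ip_cls.
Qed.

End FormDomain.

(** * The semigroup acting on representatives *)

Section HeatSemigroup.
Context (R : realType).
Local Notation P := 'rV[R]_2.
Local Notation M := (surface R).
Local Notation pdir := (fun k : 'I_2 => delta_mx 0 k : P).
Local Notation mu := (@mu R).
Local Notation H := (l2_hilbert mu).
Implicit Types (f g h : P -> R).
Variable W : P -> R.
Hypothesis W_cinf : cinf pdir W.
Local Notation F := (dirichlet_form W_cinf).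
Local Notation V := (fun v => W v ^+ 2).

Definition heat (t : R) (f : borel M -> R) : borel M -> R := rep (sg F t (cls mu f)).

Lemma L2normE f : l2 mu f -> L2norm mu f = (`|cls mu f : H|)%:E.
Proof.
move=> f2; rewrite /L2norm L2norm_dotm //; congr EFin.
by rewrite -ip_cls // -norm_sq sqrtr_sqr normr_id.
Qed.

Lemma cls_heat t f : cls mu (heat t f) = sg F t (cls mu f).
Proof. exact: repK. Qed.

Lemma heat_l2 t f : l2 mu (heat t f).
Proof. exact: rep_l2. Qed.

Lemma clsB f g : l2 mu f -> l2 mu g -> cls mu (f - g) = (cls mu f : H) - cls mu g.
Proof. by move=> f2 g2; rewrite -scaleN1r addrC cls_linear // scaleN1r addrC. Qed.

Lemma clsZ a f : l2 mu f -> cls mu (a *: f) = a *: (cls mu f : H).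
Proof.
move=> f2; have z2 := @l2_0 _ _ _ mu.
by rewrite -[a *: f]addr0 cls_linear // (_ : cls mu (cst 0) = 0 :> H) ?addr0.
Qed.

Lemma cls_ae f g : l2 mu f -> l2 mu g -> cls mu f = cls mu g -> f = g %[ae mu].
Proof. by move=> f2 g2 fg; apply/ae_eqP; exact: cls_inj. Qed.

Lemma heat_is_heat_semigroup : is_heat_semigroup mu V heat.
Proof.
split.
- move=> t t0; split; first by move=> f _; exact: heat_l2.
    move=> a f h f2 h2; apply: cls_ae; first exact: heat_l2.
      by apply: l2_linear; exact: heat_l2.
    have e1 : cls mu (heat t (a *: f + h)) = a *: sg F t (cls mu f) + sg F t (cls mu h) :> H.
      by rewrite cls_heat cls_linear // sg_linear.
    rewrite e1; have := cls_linear a (heat_l2 t f) (heat_l2 t h).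
    by rewrite !cls_heat => ->.
  exists 1 => f f2; rewrite L2normE; last exact: heat_l2.
  by rewrite L2normE // -EFinM mul1r lee_fin cls_heat sg_contract.
- move=> f f2; apply: cls_ae => //; first exact: heat_l2.
  by rewrite cls_heat sg0.
- move=> s t f s0 t0 f2; apply: cls_ae; try exact: heat_l2.
  by rewrite !cls_heat sg_add.
- move=> f f2.
  rewrite [X in X @ _](_ : _ = (fun t => (`|sg F t (cls mu f) - cls mu f|)%:E)); last first.
    apply/funext => t; rewrite L2normE; last by apply: l2B => //; exact: heat_l2.
    by rewrite clsB ?cls_heat //; exact: heat_l2.
  apply: cvg_EFin; first exact: nearW.
  rewrite -[X in _ --> X](@normr0 R H) -(subrr (cls mu f : H)); apply: cvg_norm.
  apply: cvgB; last exact: cvg_cst.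
  by apply: cvg_within_filter; exact: sg_cvg0.
- move=> f u f2 u2; rewrite (form_operatorP W_cinf).
  have -> : (fun t => L2norm mu (t^-1 *: (heat t f - f) - u)) =
      (fun t => (`|t^-1 *: (sg F t (cls mu f) - cls mu f) - cls mu u|)%:E).
    apply/funext => t; have d2 : l2 mu (heat t f - f) by apply: l2B => //; exact: heat_l2.
    have z2 := l2Z t^-1 d2.
    rewrite L2normE; last exact: l2B.
    by rewrite (clsB z2 u2) (clsZ _ d2) (clsB (heat_l2 t f) f2) cls_heat.
  split=> [[_ _ /sg_generator h]|h].
    apply: cvg_EFin; first exact: nearW.
    rewrite -[X in _ --> X](@normr0 R H) -(subrr (cls mu u : H)); apply: cvg_norm.
    by apply: cvgB => //; exact: cvg_cst.
  split; [exact: f2|exact: u2|apply/sg_generator].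
  have h' : `|t^-1 *: (sg F t (cls mu f) - cls mu f) - cls mu u| @[t --> 0^'+] --> (0 : R).
    exact: (fine_cvg h).
  apply/cvgrPdist_lt => e e0.
  move/cvgrPdist_lt : h' => /(_ e e0); apply: filterS => t /=.
  by rewrite sub0r normrN normr_id distrC.
Qed.

End HeatSemigroup.

(** * Markov property *)

Section Testers.
Context (R : realType).
Local Notation P := 'rV[R]_2.
Local Notation mR := (measurableTypeR R).
Local Notation B := (borel P).
Local Notation mu := (@mu R).
Local Notation H := (l2_hilbert mu).
Implicit Types (v w : P) (f g h : P -> R) (u : H).

(** Such functions are integrable and square integrable, and remain so when multiplied by the
    indicator of a measurable set; smoothness would forbid the latter in [le_dual]. *)
Definition tester h := [/\ @measurable_fun _ _ B mR setT h,
  forall v, 0 <= h v <= 1 & exists r, supported r h].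

Lemma supported_cutoff r h : supported r h -> exists2 s, 0 < s & forall v, h v = h v * cutoff s v.
Proof.
move=> hr; have s0 : 0 < `|r| + 1 by rewrite ltr_wpDl.
exists (`|r| + 1) => // v; have [vb|vb] := pselect (box (`|r| + 1) v).
  by have [b0 b1] := iffLR (boxP _ _) vb; rewrite cutoff_eq1 ?mulr1.
rewrite (supported_box _ vb) ?mul0r //; apply: supported_le hr.
by rewrite (le_trans (ler_norm r)) // lerDl.
Qed.

Lemma l2_bounded_supported (C : R) h : @measurable_fun _ _ B mR setT h ->
  (forall v, `|h v| <= C) -> (exists r, supported r h) -> l2 mu h.
Proof.
move=> mh hC [r /supported_cutoff[s s0 hs]].
have c2 := test_fun_l2 (cutoff_test s0).
apply: (l2_dominated mh (l2Z C c2)) => v; rewrite hs /GRing.scale /= !normrM ler_wpM2r //.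
exact: le_trans (hC v) (ler_norm _).
Qed.

Lemma tester_l2 h : tester h -> l2 mu h.
Proof.
move=> [mh h01 hr]; apply: (@l2_bounded_supported 1) => // v.
by have /andP[h0 h1] := h01 v; rewrite ger0_norm.
Qed.

Lemma tester_integrable h : tester h -> mu.-integrable setT (EFin \o h).
Proof.
move=> th; have [mh h01 [r /supported_cutoff[s s0 hs]]] := th.
have := l2_integrable (tester_l2 th) (test_fun_l2 (cutoff_test s0)).
by under eq_fun do rewrite -hs.
Qed.

Definition ibox (k : R) v : R := (v \in box k)%:R.

Lemma ibox_tester k : tester (ibox k).
Proof.
split.
- exact: (@measurable_indic _ B R setT _ (box_measurable k)).
- by move=> v; rewrite ler0n lern1 leq_b1.
- exists (k + 1) => v vk; rewrite /ibox memNset // => /boxP[b0 b1].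
  by case/orP: vk; lra.
Qed.

Lemma ibox_ge0 k v : 0 <= ibox k v. Proof. exact: ler0n. Qed.

Lemma ibox_le1 k v : ibox k v <= 1. Proof. by rewrite lern1 leq_b1. Qed.

Lemma ibox_le k l v : k <= l -> ibox k v <= ibox l v.
Proof.
move=> kl; rewrite ler_nat; have [vk|vk] := pselect (box k v); last by rewrite memNset.
rewrite [v \in box l]mem_set ?leq_b1 //; apply/boxP.
by have [b0 b1] := iffLR (boxP _ _) vk; split; exact: le_trans kl.
Qed.

Lemma ibox_near1 v : \forall k \near \oo, ibox k%:R v = 1.
Proof.
near=> k; rewrite /ibox mem_set //; apply/boxP.
by split; near: k; exact: nbhs_infty_ger.
Unshelve. all: by end_near. Qed.

Lemma ibox_cvg v : ibox k%:R v @[k --> \oo] --> (1 : R).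
Proof.
apply/cvgrPdist_le => e e0; have := ibox_near1 v; apply: filterS => k ->.
by rewrite subrr normr0 ltW.
Qed.

Lemma dotmNl f g : l2 mu f -> l2 mu g -> dotm mu (- f) g = - dotm mu f g.
Proof.
move=> f2 g2; rewrite -[RHS]mulN1r -RintegralZl //; last exact: l2_integrable.
by apply: eq_Rintegral => v _; rewrite fctE mulN1r mulNr.
Qed.

Lemma dotmDl f g h : l2 mu f -> l2 mu g -> l2 mu h ->
  dotm mu (f + g) h = dotm mu f h + dotm mu g h.
Proof. by move=> f2 g2 h2; rewrite -[f]scale1r dotm_linear // mul1r scale1r. Qed.

(** Test with the indicator of the set f > c, cut off to boxes: the nonnegative function (f - c) h
    then has integral zero. *)
Lemma le_dual f (c : R) : l2 mu f ->
  (forall h, tester h -> dotm mu f h <= c * \int[mu]_v h v) -> \forall v \ae mu, f v <= c.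
Proof.
move=> f2 fc; have mf := l2_measurable f2.
pose A := [set v : B | c < f v].
have mA : measurable A.
  rewrite /A (_ : [set v : B | _] = f @^-1` `]c, +oo[); last first.
    by apply/seteqP; split => v; rewrite /= in_itv /= andbT.
  by rewrite -[X in measurable X]setTI; apply: mf.
have key n : \forall v \ae mu, (f v - c) * ((v \in A)%:R * ibox n%:R v) = 0.
  have th : tester (fun v => (v \in A)%:R * ibox n%:R v).
    have [mi i01 [r ir]] := ibox_tester n%:R; split.
    - by apply: measurable_funM => //; exact: (@measurable_indic _ B R setT _ mA).
    - by move=> v; rewrite mulr_ge0 ?ler0n //= mulr_ile1 ?ler0n ?lern1 ?leq_b1.
    - by exists r; exact: supportedMr.
  set h := fun v => _ in th; have h2 := tester_l2 th; have hi := tester_integrable th.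
  have mh : measurable_fun setT (h : B -> R) by case: th.
  apply: (@ge0_ae_eq0 _ _ _ mu (fun v => (f v - c) * h v)).
  - apply: measurable_funM => //; exact: measurable_funB.
  - move=> v; rewrite /h; have [vA|vA] := boolP (v \in A); last by rewrite mul0r mulr0.
    rewrite mul1r mulr_ge0 ?ibox_ge0 //; rewrite inE /A /= in vA; lra.
  apply/eqP; rewrite eq_le; apply/andP; split; last first.
    apply: integral_ge0 => v _; rewrite lee_fin /h; have [vA|vA] := boolP (v \in A); last by rewrite mul0r mulr0.
    rewrite mul1r mulr_ge0 ?ibox_ge0 //; rewrite inE /A /= in vA; lra.
  have i1 := l2_integrable f2 h2; have i2 := integrableZl measurableT c hi.
  have -> : (\int[mu]_v ((f v - c) * h v)%:E = \int[mu]_v ((f v * h v)%:E - c%:E * (h v)%:E))%E.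
    by apply: eq_integral => v _; rewrite -EFinM -EFinB; congr EFin; ring.
  rewrite integralB // integralZl //.
  have := fc _ th; rewrite /dotm /Rintegral.
  have /fineK <- : (\int[mu]_v (f v * h v)%:E)%E \is a fin_num by exact: integrable_fin_num.
  have /fineK <- : (\int[mu]_v (h v)%:E)%E \is a fin_num by exact: integrable_fin_num.
  by rewrite -EFinM -EFinB lee_fin subr_le0.
have : \forall v \ae mu, forall n : nat, (f v - c) * ((v \in A)%:R * ibox n%:R v) = 0 by exact: ae_foralln.
apply: aeS => v hv; rewrite leNgt; apply/negP => cf.
have [n ibn] := filter_ex (ibox_near1 v).
have := hv n; rewrite ibn mem_set // !mulr1 => h0; lra.
Qed.

Lemma ge_dual f : l2 mu f -> (forall h, tester h -> 0 <= dotm mu f h) ->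
  \forall v \ae mu, 0 <= f v.
Proof.
move=> f2 f0; have : \forall v \ae mu, (- f) v <= 0.
  apply: le_dual; first exact: l2N.
  move=> h th; rewrite mul0r; have := f0 h th.
  rewrite dotmNl //; last exact: tester_l2.
  by rewrite oppr_le0.
by apply: aeS => v; rewrite fctE oppr_le0.
Qed.

Lemma dotm_ge0_ae f g : l2 mu f -> l2 mu g -> (\forall v \ae mu, 0 <= f v) ->
  (\forall v \ae mu, 0 <= g v) -> 0 <= dotm mu f g.
Proof.
move=> f2 g2 f0 g0.
rewrite (_ : dotm mu f g = \int[mu]_v `|f v * g v|).
  by apply: Rintegral_ge0.
have [mf mg] := (l2_measurable f2, l2_measurable g2).
have mfg : measurable_fun setT (fun v : B => f v * g v) by exact: measurable_funM.
rewrite /dotm /Rintegral; congr fine; apply: ae_eq_integral => //.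
- exact/measurable_EFinP.
- by apply/measurable_EFinP; exact: measurableT_comp.
- by move: f0 g0; apply: aeS2 => v a b _; rewrite ger0_norm // mulr_ge0.
Qed.

End Testers.

(** * The resolvent as a minimizer *)

Section QuadraticFunctional.
Context (R : realType) (H : hilbert R).
Implicit Types (x a b w f k : H) (s : R).

Lemma norm_sqB a b : `|a - b| ^+ 2 = ip a a - 2 * ip a b + ip b b.
Proof. by rewrite norm_sq !ipBl !ipBr (ip_sym b a); ring. Qed.

Lemma sqr_dist_le a b (d : R) : `|a - b| < d -> `|b - a| ^+ 2 <= d ^+ 2.
Proof.
move=> ab; have d0 : 0 <= d by exact: le_trans (normr_ge0 _) (ltW ab).
by rewrite distrC lerXn2r ?nnegrE //; exact: ltW.
Qed.

Lemma complete_square s x f a b c w w' : ip c w = ip x w' ->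
  s * (`|a| ^+ 2 + `|b| ^+ 2 + `|c - w| ^+ 2) + `|x - f| ^+ 2 =
  s * (ip a a + ip b b + ip c c) + ip x x - 2 * ip x (f + s *: w') +
    (s * ip w w + ip f f).
Proof. by move=> cw; rewrite !norm_sqB cw !norm_sq ipDr ipZr; ring. Qed.

(** The functional has an exact quadratic gap to its minimum: the linear terms are removed by the
    resolvent equation, tested with x and with the resolvent itself. A value near the minimum
    therefore forces nearness in norm. *)
Lemma resolvent_min (F : closed_form H) s k x : 0 < s -> fdom F x ->
  (s * form F x x + ip x x - 2 * ip x k) -
  (s * form F (res F s k) (res F s k) + ip (res F s k) (res F s k) - 2 * ip (res F s k) k) =
  s * form F (x - res F s k) (x - res F s k) + `|x - res F s k| ^+ 2.
Proof.
move=> s0 dx; have [du uP] := resP F k s0; set u := res F s k in du uP *.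
have dxu := fdomB dx du; rewrite norm_sqB.
rewrite (formBl dx du dxu) (form_sym dx dxu) (form_sym du dxu).
rewrite (formBl dx du dx) (formBl dx du du) (form_sym dx du).
have h1 := uP x dx; have h2 := uP u du; rewrite (ip_sym k) in h1; rewrite (ip_sym k) in h2.
rewrite (ip_sym x u).
have e1 : s * form F u x = ip x k - ip u x by rewrite -h1; ring.
have e2 : s * form F u u = ip u k - ip u u by rewrite -h2; ring.
have -> : s * (form F x x - form F u x - (form F u x - form F u u)) =
  s * form F x x - 2 * (s * form F u x) + s * form F u u by ring.
by rewrite e1 e2; ring.
Qed.

Lemma resolvent_min_of (F : closed_form H) s k x (Jx Ju c : R) : 0 < s -> fdom F x ->
  Jx = s * form F x x + ip x x - 2 * ip x k + c ->
  Ju = s * form F (res F s k) (res F s k) + ip (res F s k) (res F s k) - 2 * ip (res F s k) k + c ->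
  Jx - Ju = s * form F (x - res F s k) (x - res F s k) + `|x - res F s k| ^+ 2.
Proof. by move=> s0 dx -> ->; rewrite -resolvent_min //; ring. Qed.

End QuadraticFunctional.

(** * Time integrals and resolvents *)

Section TimeIntegralResolvent.
Context (R : realType) (H : hilbert R) (F : closed_form H).
Implicit Types (f g k : H) (s t : R).

Lemma sg_res s t f : 0 < s -> sg F t (res F s f) = res F s (sg F t f).
Proof.
move=> s0; have h := sg_op t (op_res F f s0).
rewrite sgZ sgB in h; rewrite -[LHS](res_op s0 h) scalerA divff ?gt_eqF // scale1r.
by rewrite opprB addrC subrK.
Qed.

Lemma sgint_ext t f g : 0 <= t -> (forall h, time_pairing F t f h = ip g h) -> sgint F t f = g.
Proof. by move=> t0 fg; apply: ip_ext => h; rewrite sgintP. Qed.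

Lemma sgint_res s t f : 0 < s -> 0 <= t -> sgint F t (res F s f) = res F s (sgint F t f).
Proof.
move=> s0 t0; apply: sgint_ext => // h; rewrite res_sym // sgintP //.
by apply: eq_Rintegral => r _; rewrite sg_res // res_sym.
Qed.

Lemma sgintB t f g : 0 <= t -> sgint F t (f - g) = sgint F t f - sgint F t g.
Proof.
move=> t0; apply: ip_ext => h; rewrite sgint_sym // !ipBl.
by rewrite -!sgint_sym.
Qed.

(* [sgint_op] requires an element of the domain, here [res F 1 f]; applying the
   resolvent to its conclusion makes sense of it for all [f]. *)
Lemma sgint_resolvent t f : 0 <= t ->
  sgint F t f = res F 1 (sgint F t f - (sg F t f - f)).
Proof.
move=> t0; have h := sgint_op t0 (op_res F f (@ltr01 R)).
rewrite invr1 scale1r sgintB // sgint_res // sg_res // in h.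
rewrite !resB // -h opprB addrC subrK.
by [].
Qed.

End TimeIntegralResolvent.

(** * The Markov property of the resolvent *)

Section Markov.
Context (R : realType).
Local Notation P := 'rV[R]_2.
Local Notation pdir := (fun k : 'I_2 => delta_mx 0 k : P).
Local Notation mu := (@mu R).
Local Notation H := (l2_hilbert mu).
Implicit Types (v w : P) (f g h phi psi : P -> R) (u x : H).
Variable W : P -> R.
Hypothesis W_cinf : cinf pdir W.
Local Notation F := (dirichlet_form W_cinf).
Local Notation grad_i := (cgrad (core W)).
Local Notation WM f := (fun v => W v * f v).
Let i0 : 'I_3 := @Ordinal 3 0 isT.
Let i1 : 'I_3 := @Ordinal 3 1 isT.
Let i2 : 'I_3 := @Ordinal 3 2 isT.

Lemma le_limit (a b c : R) : 0 <= c -> (forall d, 0 < d -> a <= b + d * c) -> a <= b.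
Proof.
move=> c0 h; apply/ler_addgt0Pr => e e0; have c1 : 0 < c + 1 by rewrite ltr_wpDl.
apply: le_trans (h (e / (c + 1)) _) _; first by rewrite divr_gt0.
by rewrite lerD2l mulrAC ler_pdivrMr // mulrDr mulr1 lerDl ltW.
Qed.

Lemma eq_le_eq (a b a' b' : R) : a = a' -> b = b' -> a <= b -> a' <= b'.
Proof. by move=> -> ->. Qed.

Lemma sum3_le (a b c t : R) : a <= t -> b <= t -> c <= t -> a + b + c <= 3 * t.
Proof. by lra. Qed.

Lemma action_gap (J J1 Ju q q1 n n1 s d : R) : 0 < s -> 0 <= d -> J <= J1 ->
  J - Ju = s * q + n -> J1 - Ju = s * q1 + n1 -> 0 <= q -> q1 <= 3 * d -> n1 <= d ->
  n <= (3 * s + 1) * d.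
Proof.
move=> s0 d0 JJ hJ hJ1 q0 q1d n1d.
have h1 : s * q1 <= s * (3 * d) by rewrite ler_wpM2l // ltW.
have h2 : 0 <= s * q by rewrite mulr_ge0 // ltW.
have -> : (3 * s + 1) * d = s * (3 * d) + d by ring.
lra.
Qed.

Lemma le_of_sqr (n K d : R) : 0 <= n -> 1 <= K -> 0 < d -> n ^+ 2 <= K * d ^+ 2 -> n <= K * d.
Proof.
move=> n0 K1 d0 h; have K0 : 0 <= K by exact: le_trans K1.
rewrite -(@ler_pXn2r _ 2) ?nnegrE ?mulr_ge0 ?(ltW d0) //.
by apply: le_trans h _; rewrite exprMn ler_wpM2r ?sqr_ge0 // expr2 ler_peMl.
Qed.

Lemma dotm_sqr_le f g : l2 mu f -> l2 mu g -> (forall v, `|f v| <= `|g v|) ->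
  dotm mu f f <= dotm mu g g.
Proof.
move=> f2 g2 fg; rewrite -lee_fin !dotmE //; have [mf mg] := (l2_measurable f2, l2_measurable g2).
apply: ge0_le_integral => //.
- by move=> v _; rewrite lee_fin sqr_ge0.
- by apply/measurable_EFinP; exact: measurable_funX.
- by apply/measurable_EFinP; exact: measurable_funX.
- move=> v _; rewrite lee_fin -(real_normK (num_real (f v))) -(real_normK (num_real (g v))).
  by rewrite lerXn2r // nnegrE.
Qed.

Lemma cls_norm_le f g : l2 mu f -> l2 mu g -> (forall v, `|f v| <= `|g v|) ->
  `|cls mu f : H| ^+ 2 <= `|cls mu g : H| ^+ 2.
Proof. by move=> f2 g2 fg; rewrite !norm_sq !ip_cls // dotm_sqr_le. Qed.

Lemma cls_dist_le f g f' g' : l2 mu f -> l2 mu g -> l2 mu f' -> l2 mu g' ->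
  (forall v, `|f v - g v| <= `|f' v - g' v|) ->
  `|(cls mu f : H) - cls mu g| ^+ 2 <= `|(cls mu f' : H) - cls mu g'| ^+ 2.
Proof.
move=> f2 g2 f'2 g'2 le.
exact: eq_le_eq (dotmBB f2 g2) (dotmBB f'2 g'2) (dotm_sqr_le (l2B f2 g2) (l2B f'2 g'2) le).
Qed.

Lemma action_mono (s a b c d a' b' c' d' : R) : 0 < s -> a <= a' -> b <= b' -> c <= c' -> d <= d' ->
  s * (a + b + c) + d <= s * (a' + b' + c') + d'.
Proof. by move=> s0 *; apply: lerD => //; rewrite ler_wpM2l ?(ltW s0) // !lerD. Qed.

Lemma cgrad_graph x : fdom F x -> graph (core W) x (grad_i x).
Proof. exact: cgradP. Qed.

Lemma cgrad_sub x x' i : fdom F x -> fdom F x' -> grad_i (x - x') i = grad_i x i - grad_i x' i.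
Proof.
move=> dx dx'.
exact: (@cgradB _ _ _ _ _ (core_linear W_cinf) (@coreP _ _ W_cinf) (@adj_total _ W) x x' i dx dx').
Qed.

Lemma cgrad_cls phi : test_fun phi ->
  fdom F (cls mu phi) /\ forall i, grad_i (cls mu phi) i = cls mu (grad_comp W i phi).
Proof.
move=> tphi; have c : core W (cls mu phi) (fun i => cls mu (grad_comp W i phi)) by exists phi.
split; first by exists (fun i => cls mu (grad_comp W i phi)); exact: core_graph.
by move=> i; rewrite (cgradE (@coreP _ _ W_cinf) (@adj_total _ W) (core_graph c)).
Qed.

Section Variational.
Variables (s : R) (f0 G : P -> R).
Hypothesis s0 : 0 < s.
Hypothesis f0_l2 : l2 mu f0.
Hypothesis WG_l2 : l2 mu (WM G).
Hypothesis WWG_l2 : l2 mu (fun v => W v ^+ 2 * G v).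
Hypothesis f01 : forall v, 0 <= f0 v <= 1.
Hypothesis G01 : forall v, 0 <= G v <= 1.
(** Formally the constant 1 has resolvent data 1 + s W^2, so data f0 + s W^2 G with f0 and G in
    [0, 1] should give a resolvent in [0, 1]. The choice G = 0 is the usual Markov property; f0 = G
    = indicator of a box is used in [sgint_weight_integrable]. *)
Let k : H := cls mu f0 + s *: (cls mu (fun v => W v ^+ 2 * G v) : H).
Let u := res F s k.

(* The resolvent minimizes this functional, which decreases under truncation to
   the unit interval. *)
Definition action x : R :=
  s * (`|grad_i x i0| ^+ 2 + `|grad_i x i1| ^+ 2 + `|grad_i x i2 - cls mu (WM G)| ^+ 2)
  + `|x - cls mu f0| ^+ 2.

(** The shift by W G in the weight component yields the part s W^2 G of k, because W x paired with W
    G is x paired with W^2 G. *)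
Lemma actionE x : fdom F x ->
  action x = s * form F x x + ip x x - 2 * ip x k +
    (s * ip (cls mu (WM G) : H) (cls mu (WM G) : H) + ip (cls mu f0 : H) (cls mu f0 : H)).
Proof.
move=> dx; have fE : form F x x = ip (grad_i x i0) (grad_i x i0) + ip (grad_i x i1) (grad_i x i1)
    + ip (grad_i x i2) (grad_i x i2) by rewrite [LHS]sum3E.
have wE : ip (grad_i x i2) (cls mu (WM G) : H) = ip x (cls mu (fun v => W v ^+ 2 * G v) : H).
  rewrite !ip_cls_r //; have := graph_weight W_cinf (cgrad_graph dx).
  have [mW mG] := (W_measurable W_cinf, l2_measurable WG_l2).
  move=> gw; rewrite /dotm /Rintegral; congr fine; apply: ae_eq_integral => //.
  - apply/measurable_EFinP; apply: measurable_funM => //; exact: (l2_measurable (rep_l2 _)).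
  - apply/measurable_EFinP; apply: measurable_funM; first exact: (l2_measurable (rep_l2 _)).
    exact: (l2_measurable WWG_l2).
  - by move: gw; apply: aeS => v -> _; congr EFin; ring.
rewrite fE; exact: complete_square wE.
Qed.

Lemma action_min x : fdom F x ->
  action x - action u = s * form F (x - u) (x - u) + `|x - u| ^+ 2.
Proof.
move=> dx; have [du _] := resP F k s0.
exact: resolvent_min_of s0 dx (actionE dx) (actionE du).
Qed.

(** Each term decreases: the derivatives are multiplied by g', and the distances to f0 and to G
    shrink because g is 1-Lipschitz and fixes the values of f0 and G. *)
Lemma action_truncate (g : R -> R) phi : cinf1 g -> (forall a : R, 0 <= a -> a <= 1 -> g a = a) ->
  (forall a b : R, `|g a - g b| <= `|a - b|) -> (forall a : R, `|derive1 g a| <= 1) ->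
  test_fun phi ->
  test_fun (fun v => g (phi v)) /\ action (cls mu (fun v => g (phi v))) <= action (cls mu phi).
Proof.
move=> hg g_id g_lip g_der tphi; have [hphi [r rphi]] := tphi.
have g00 : g 0 = 0 by rewrite g_id.
have tg : test_fun (fun v => g (phi v)).
  split; first exact: (cinf_comp hg hphi).
  by exists r => v /rphi ->.
split; first exact: tg.
have [_ e1] := cgrad_cls tphi; have [_ e2] := cgrad_cls tg.
have t2 psi : test_fun psi -> l2 mu psi by exact: test_fun_l2.
have part j v : partial j (fun w => g (phi w)) v = derive1 g (phi v) * partial j phi v.
  exact: partial_comp.
rewrite /action !e1 !e2 /grad_comp /=.
have p0 := t2 _ (test_fun_partial 0 tphi); have p1 := t2 _ (grad1_test tphi).
have q0 := t2 _ (test_fun_partial 0 tg); have q1 := t2 _ (grad1_test tg).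
have w2 := t2 _ (test_funM W_cinf tphi); have x2 := t2 _ (test_funM W_cinf tg).
have a2 := t2 _ tphi; have b2 := t2 _ tg.
apply: action_mono s0 _ _ _ _.
- by apply: cls_norm_le q0 p0 _ => v; rewrite part normrM ler_piMl.
- by apply: cls_norm_le q1 p1 _ => v; rewrite /grad1 part !normrM ler_wpM2l // ler_piMl.
- apply: cls_dist_le x2 WG_l2 w2 WG_l2 _ => v; rewrite -!mulrBr !normrM ler_wpM2l //.
  by have /andP[G0 G1] := G01 v; rewrite -[X in `|_ - X| <= _](g_id (G v)).
- apply: cls_dist_le b2 f0_l2 a2 f0_l2 _ => v; have /andP[h0 h1] := f01 v.
  by rewrite -[X in `|_ - X| <= _](g_id (f0 v)).
Qed.

(** Take a test function within d of u, together with its three gradient components. Its action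
    exceeds the minimum by at most (3 s + 1) d^2, truncation does not increase it, and by
    [action_min] the excess bounds the squared distance of the truncated function to u. *)
Lemma truncated_approx (d : R) : 0 < d ->
  exists psi, [/\ test_fun psi, forall v, - d <= psi v <= 1 + d &
    `|(cls mu psi : H) - u| <= (3 * s + 1) * d].
Proof.
move=> d0; have [du _] := resP F k s0.
have [c [z [[phi [tphi -> zphi]] cu zu]]] := cgrad_graph du d0.
have [g [hg g_id g_lip g_der g_bnd]] := clamp_exists d0.
have [tg ag] := action_truncate hg g_id g_lip g_der tphi.
exists (fun v => g (phi v)); split => //.
have [dphi ephi] := cgrad_cls tphi; have [dpsi epsi] := cgrad_cls tg.
set psi : H := cls mu (fun v => g (phi v)) in ag dpsi epsi *.
have dpu := fdomB dpsi du; have dphu := fdomB dphi du.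
have h1 := action_min dpsi; have h2 := action_min dphi.
have h3 := form_ge0 dpu.
have h4 : form F (cls mu phi - u) (cls mu phi - u) <= 3 * d ^+ 2.
  have gB i : grad_i (cls mu phi - u) i = cls mu (grad_comp W i phi) - grad_i u i.
    by rewrite (cgrad_sub i dphi du) ephi.
  rewrite [form _ _ _]sum3E !gB -!norm_sq.
  have b i : `|(cls mu (grad_comp W i phi) : H) - grad_i u i| ^+ 2 <= d ^+ 2.
    by have := sqr_dist_le (zu i); rewrite zphi.
  exact: sum3_le (b i0) (b i1) (b i2).
have h5 : `|(cls mu phi : H) - u| ^+ 2 <= d ^+ 2.
  exact: sqr_dist_le cu.
have h6 : `|psi - u| ^+ 2 <= (3 * s + 1) * d ^+ 2.
  exact: action_gap s0 (sqr_ge0 d) ag h1 h2 h3 h4 h5.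
have s1 : 1 <= 3 * s + 1 by rewrite lerDr mulr_ge0 // ltW.
exact: le_of_sqr (normr_ge0 _) s1 d0 h6.
Qed.

(** The bounds - d and 1 + d of the approximants survive pairing with testers; let d tend to 0. *)
Lemma resolvent_markov : \forall v \ae mu, 0 <= rep u v <= 1.
Proof.
have ip_near h psi (d : R) : tester h -> test_fun psi -> `|(cls mu psi : H) - u| <= (3 * s + 1) * d ->
    `|dotm mu (rep u) h - dotm mu psi h| <= (3 * s + 1) * d * `|cls mu h : H|.
  move=> th tpsi near; have h2 := tester_l2 th; have p2 := test_fun_l2 tpsi.
  rewrite -ip_cls_r // -ip_cls // -ipBl; apply: le_trans (ip_le_norm _ _) _.
  rewrite distrC in near; exact: ler_wpM2r (normr_ge0 _) _ _ near.
have bnd h psi (d : R) : tester h -> test_fun psi -> (forall v, - d <= psi v <= 1 + d) ->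
    - d * \int[mu]_v h v <= dotm mu psi h <= (1 + d) * \int[mu]_v h v.
  move=> th tpsi pd; have h2 := tester_l2 th; have p2 := test_fun_l2 tpsi.
  have hi := tester_integrable th; have phi_i := l2_integrable p2 h2.
  have hh v : 0 <= h v by case: th => _ /(_ v)/andP[].
  rewrite -!RintegralZl //; apply/andP; split; apply: le_Rintegral => //.
  - by have := integrableZl measurableT (- d) hi.
  - by move=> v _; rewrite ler_wpM2r //; have /andP[] := pd v.
  - by have := integrableZl measurableT (1 + d) hi.
  - by move=> v _; rewrite ler_wpM2r //; have /andP[] := pd v.
have s10 : 0 <= 3 * s + 1 by rewrite addr_ge0 // mulr_ge0 // ltW.
have lo : \forall v \ae mu, 0 <= rep u v.
  apply: ge_dual; first exact: rep_l2.
  move=> h th; have h0 : 0 <= \int[mu]_v h v by apply: Rintegral_ge0 => v _; case: th => _ /(_ v)/andP[].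
  apply: (@le_limit _ _ ((3 * s + 1) * `|cls mu h : H| + \int[mu]_v h v)); first by rewrite addr_ge0 ?mulr_ge0.
  move=> d d0; have [psi [tpsi pd near]] := truncated_approx d0.
  have /andP[b0 b1] := bnd _ _ _ th tpsi pd.
  have := ip_near _ _ _ th tpsi near; rewrite ler_norml => /andP[c0 c1].
  by move: (\int[mu]_v h v) (dotm mu _ h) (dotm mu _ h) `|_| b0 b1 c0 c1 h0 => *; lra.
have hi : \forall v \ae mu, rep u v <= 1.
  apply: le_dual; first exact: rep_l2.
  move=> h th; have h0 : 0 <= \int[mu]_v h v by apply: Rintegral_ge0 => v _; case: th => _ /(_ v)/andP[].
  apply: (@le_limit _ _ ((3 * s + 1) * `|cls mu h : H| + \int[mu]_v h v)); first by rewrite addr_ge0 ?mulr_ge0.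
  move=> d d0; have [psi [tpsi pd near]] := truncated_approx d0.
  have /andP[b0 b1] := bnd _ _ _ th tpsi pd.
  have := ip_near _ _ _ th tpsi near; rewrite ler_norml => /andP[c0 c1].
  by move: (\int[mu]_v h v) (dotm mu _ h) (dotm mu _ h) `|_| b0 b1 c0 c1 h0 => *; lra.
by move: lo hi; apply: aeS2 => v -> ->.
Qed.

End Variational.

End Markov.

(** * Positivity and the unit interval under the semigroup *)

Section PositivityPreserving.
Context (R : realType).
Local Notation P := 'rV[R]_2.
Local Notation B := (borel P).
Local Notation pdir := (fun k : 'I_2 => delta_mx 0 k : P).
Local Notation mu := (@mu R).
Local Notation H := (l2_hilbert mu).
Implicit Types (v w : P) (f g h phi psi : P -> R) (u x : H).
Variable W : P -> R.
Hypothesis W_cinf : cinf pdir W.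
Local Notation F := (dirichlet_form W_cinf).

Lemma ae_Rintegral_ge0 f : @measurable_fun _ _ B (measurableTypeR R) setT f ->
  (\forall v \ae mu, 0 <= f v) -> 0 <= \int[mu]_v f v.
Proof.
move=> mf f0; rewrite (_ : \int[mu]_v f v = \int[mu]_v `|f v|).
  by apply: Rintegral_ge0.
rewrite /Rintegral; congr fine; apply: ae_eq_integral => //.
- exact/measurable_EFinP.
- by apply/measurable_EFinP; exact: measurableT_comp.
- by move: f0; apply: aeS => v f0 _; rewrite ger0_norm.
Qed.

Definition nonneg x := \forall v \ae mu, 0 <= rep x v.
Definition in_unit x := \forall v \ae mu, 0 <= rep x v <= 1.

Lemma in_unitP x : in_unit x <-> nonneg x /\ \forall v \ae mu, rep x v <= 1.
Proof.
split; last by move=> [a b]; move: a b; apply: aeS2 => v -> ->.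
by move=> h; split; move: h; apply: aeS => v /andP[].
Qed.

Lemma nonneg_cls f : l2 mu f -> (\forall v \ae mu, 0 <= f v) -> nonneg (cls mu f).
Proof. by move=> f2 f0; move: f0 (clsP f2); apply: aeS2 => v f0 ->. Qed.

Lemma in_unit_cls f : l2 mu f -> (\forall v \ae mu, 0 <= f v <= 1) -> in_unit (cls mu f).
Proof. by move=> f2 f0; move: f0 (clsP f2); apply: aeS2 => v f0 ->. Qed.

Lemma tester_in_unit h : tester h -> in_unit (cls mu h).
Proof. by move=> th; apply: in_unit_cls; [exact: tester_l2|apply: aeW; case: th]. Qed.

Lemma nonneg_ip x u : nonneg x -> nonneg u -> 0 <= ip x u.
Proof. by move=> x0 u0; apply: (dotm_ge0_ae (rep_l2 x) (rep_l2 u)). Qed.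

Lemma nonneg_dual x : (forall h, tester h -> 0 <= ip x (cls mu h : H)) -> nonneg x.
Proof.
move=> x0; apply: ge_dual; first exact: rep_l2.
by move=> h th; rewrite -ip_cls_r ?x0 //; exact: tester_l2.
Qed.

Lemma in_unit_dual x : nonneg x ->
  (forall h, tester h -> ip x (cls mu h : H) <= \int[mu]_v h v) -> in_unit x.
Proof.
move=> x0 x1; apply/in_unitP; split => //; apply: le_dual; first exact: rep_l2.
by move=> h th; rewrite mul1r -ip_cls_r ?x1 //; exact: tester_l2.
Qed.

Lemma in_unit_ip x h : in_unit x -> tester h -> ip x (cls mu h : H) <= \int[mu]_v h v.
Proof.
move=> /in_unitP[x0 x1] th; have h2 := tester_l2 th; have hi := tester_integrable th.
rewrite ip_cls_r //; have xi := l2_integrable (rep_l2 x) h2.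
have [[mh h01 _] mx] := (th, l2_measurable (rep_l2 x)).
rewrite -subr_ge0 /dotm -RintegralB //; apply: ae_Rintegral_ge0.
  by apply: measurable_funB => //; exact: measurable_funM.
move: x1; apply: aeS => v x1; have /andP[h0 _] := h01 v.
by rewrite subr_ge0 -[leRHS]mul1r ler_wpM2r.
Qed.

Lemma in_unit_lim (u_ : nat -> H) u : (forall n, in_unit (u_ n)) ->
  u_ n @[n --> \oo] --> u -> in_unit u.
Proof.
move=> u01 uu.
have lim h : ip (u_ n) (cls mu h : H) @[n --> \oo] --> ip u (cls mu h : H) by exact: cvg_ipl.
apply: in_unit_dual.
  apply: nonneg_dual => h th; apply: le_cvgn (lim h) => n.
  have [un0 _] := iffLR (in_unitP _) (u01 n); have [h0 _] := iffLR (in_unitP _) (tester_in_unit th).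
  exact: nonneg_ip.
move=> h th; rewrite -lerN2; apply: (@le_cvgn _ (fun n => - ip (u_ n) (cls mu h : H))) _ _.
  by move=> n; rewrite lerN2; exact: in_unit_ip.
by apply: cvgN; exact: lim.
Qed.

Lemma res_in_unit s x : 0 < s -> in_unit x -> in_unit (res F s x).
Proof.
(* The representative lies in [0, 1] only almost everywhere, whereas [resolvent_markov] asks for
   bounds at every point. *)
move=> s0 x01; pose f v := Num.min 1 (Num.max 0 (rep x v)).
have fx : \forall v \ae mu, f v = rep x v.
  move: x01; apply: aeS => v /andP[v0 v1]; rewrite /f max_r // min_r //.
have mx := l2_measurable (rep_l2 x).
have f2 : l2 mu f.
  apply: (fun m d => l2_dominated m (rep_l2 x) d).
    by apply: measurable_minr => //; exact: measurable_maxr.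
  move=> v; rewrite /f; case: (leP 0 (rep x v)) => [x0|x0]; last by rewrite min_r // normr0.
  rewrite [X in _ <= X]ger0_norm // ger0_norm ?le_min ?ler01 // ge_min lexx orbT.
  by [].
have f01 v : 0 <= f v <= 1 by rewrite /f le_min ler01 le_max lexx ge_min lexx.
have z2 (h : P -> R) : (forall v, h v = 0) -> l2 mu h.
  by move=> h0; rewrite (_ : h = cst 0); [exact: l2_0|apply/funext].
have zW : l2 mu (fun v => W v * 0) by apply: z2 => v; rewrite mulr0.
have zWW : l2 mu (fun v => W v ^+ 2 * 0) by apply: z2 => v; rewrite mulr0.
have := @resolvent_markov R W W_cinf s f (fun=> 0) s0 f2 zW zWW f01 _.
rewrite (_ : cls mu f = x); last first.
  by rewrite -[RHS]repK; apply: cls_eq => //; exact: rep_l2.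
rewrite (_ : cls mu (fun v => W v ^+ 2 * 0) = 0); last first.
  by rewrite (_ : (fun v => _) = cst 0) //; apply/funext => v; rewrite mulr0.
by rewrite scaler0 addr0; apply => v; rewrite lexx ler01.
Qed.

Lemma sg_in_unit t x : in_unit x -> in_unit (sg F t x).
Proof.
move=> x01; have [t0|t0] := leP t 0; first by rewrite sg0.
apply: in_unit_lim (@sgP _ _ F t x t0) => n; rewrite /approx.
have s0 : 0 < t / 2 ^+ n by rewrite divr_gt0 ?exprn_gt0.
elim: (2 ^ n)%N => // m ih; rewrite iterS.
exact: res_in_unit.
Qed.

(** [sg_in_unit] is about functions bounded by 1, so the semigroup is moved by symmetry onto a
    tester. *)
Lemma sg_nonneg t x : nonneg x -> nonneg (sg F t x).
Proof.
move=> x0; apply: nonneg_dual => h th; rewrite sg_sym; apply: nonneg_ip => //.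
by have /in_unitP[] := sg_in_unit t (tester_in_unit th).
Qed.

Lemma sgint_nonneg t x : 0 <= t -> nonneg x -> nonneg (sgint F t x).
Proof.
move=> t0 x0; apply: nonneg_dual => h th; rewrite sgintP //.
apply: Rintegral_ge0 => s _; apply: nonneg_ip; first exact: sg_nonneg.
by have /in_unitP[] := tester_in_unit th.
Qed.

End PositivityPreserving.

(** * Integrability of the semigroup *)

Section ProductFunctions.
Context (R : realType).
Local Notation P := 'rV[R]_2.
Local Notation pdir := (fun k : 'I_2 => delta_mx 0 k : P).
Implicit Types (v w : P) (a b : R -> R).

Definition prodf a b v : R := a (v 0 0) * b (v 0 1).

Lemma prodf_cinf a b : cinf1 a -> cinf1 b -> cinf pdir (prodf a b).
Proof. by move=> ha hb; apply: cinfM; exact: cinf_coord. Qed.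

Lemma partial_prodf0 a b v : cinf1 a -> cinf1 b ->
  partial 0 (prodf a b) v = prodf (derive1 a) b v.
Proof.
move=> ha hb; rewrite (partialM 0 v (cinf_coord 0 ha) (cinf_coord 1 hb)).
by rewrite !partial_comp_coord // eqxx mul1r mul0r mulr0 addr0.
Qed.

Lemma partial_prodf1 a b v : cinf1 a -> cinf1 b ->
  partial 1 (prodf a b) v = prodf a (derive1 b) v.
Proof.
move=> ha hb; rewrite (partialM 1 v (cinf_coord 0 ha) (cinf_coord 1 hb)).
by rewrite !partial_comp_coord // eqxx mul1r mul0r mul0r add0r.
Qed.

Lemma cinf1_cst (c : R) : cinf1 (fun _ : R => c). Proof. exact: cinf_cst. Qed.

Lemma cinf1_mul a b : cinf1 a -> cinf1 b -> cinf1 (fun x => a x * b x).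
Proof. exact: cinfM. Qed.

Lemma cinf1_expexp : cinf1 (fun x : R => expR (expR x)).
Proof. exact: (cinf_comp (@cinf1_expR R) (@cinf1_expR R)). Qed.

Lemma derive1_mul a b x : cinf1 a -> cinf1 b ->
  derive1 (fun x => a x * b x) x = derive1 a x * b x + a x * derive1 b x.
Proof.
move=> ha hb; have := @deriveM _ _ a b x 1 (cinf1_derivable ha) (cinf1_derivable hb).
by rewrite !derive1E /GRing.scale /= => ->; ring.
Qed.

Lemma derive1_comp_c a b x : cinf1 a -> cinf1 b ->
  derive1 (fun x => a (b x)) x = derive1 a (b x) * derive1 b x.
Proof.
move=> ha hb; have [_] := is_derive_comp (@cinf1_derivable _ b x hb) (@cinf1_derivable _ a (b x) ha).
by rewrite !derive1E.
Qed.

Lemma derive1_expR (x : R) : derive1 expR x = expR x.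
Proof. by rewrite derive1E; have [_ ->] := is_derive_expR x. Qed.

Lemma derive1_expexp (x : R) : derive1 (fun x => expR (expR x)) x = expR (expR x) * expR x.
Proof. by rewrite derive1_comp_c ?derive1_expR //; exact: cinf1_expR. Qed.

(** The drift arises as E'/E = e^x. *)
Lemma dual0_prodf a b v : cinf1 a -> cinf1 b ->
  dual0 (partial 0 (prodf a b)) v =
  - prodf (fun x => derive1 (derive1 a) x + expR x * derive1 a x) b v.
Proof.
move=> ha hb; have ha' := cinf1_derive ha.
have -> : partial 0 (prodf a b) = prodf (derive1 a) b by apply/funext => w; exact: partial_prodf0.
rewrite /dual0; congr (- _).
have -> : (fun w : P => E w * prodf (derive1 a) b w) =
    prodf (fun x => expR (expR x) * derive1 a x) b.
  by apply/funext => w; rewrite /prodf /E mulrA.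
rewrite partial_prodf0 //; last by apply: cinf1_mul => //; exact: cinf1_expexp.
rewrite /prodf derive1_mul //; last exact: cinf1_expexp.
rewrite derive1_expexp /Einv.
have E0 : E v != 0 :> R by rewrite gt_eqF // E_gt0.
rewrite -[expR (expR (v 0 0))]/(E v); field; exact: E0.
Qed.

Lemma dual1_prodf a b v : cinf1 a -> cinf1 b ->
  dual1 (grad1 (prodf a b)) v = - (Einv v ^+ 2 * prodf a (derive1 (derive1 b)) v).
Proof.
move=> ha hb; have hb' := cinf1_derive hb.
have hI : cinf1 (fun x : R => expR (- expR x)).
  by apply: (cinf_comp (@cinf1_expR R)); apply: cinfN; exact: cinf1_expR.
have hIa := cinf1_mul hI ha.
have -> : grad1 (prodf a b) = prodf (fun x => expR (- expR x) * a x) (derive1 b).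
  by apply/funext => w; rewrite /grad1 partial_prodf1 // /prodf /Einv /E expRN mulrA.
rewrite /dual1 partial_prodf1 //; congr (- _).
by rewrite /prodf /Einv /E expRN; ring.
Qed.

End ProductFunctions.

(** * Integrability from uniform bounds on boxes *)

Section Integrability.
Context (R : realType).
Local Notation P := 'rV[R]_2.
Local Notation B := (borel P).
Local Notation mR := (measurableTypeR R).
Local Notation mu := (@mu R).
Local Notation H := (l2_hilbert mu).
Implicit Types (v w : P) (f g h phi psi : P -> R) (u x y : H).

Lemma integrable_of_boxes f (C : R) : @measurable_fun _ _ B mR setT f ->
  (forall n : nat, (\int[mu]_v (`|f v| * ibox n%:R v)%:E <= C%:E)%E) ->
  mu.-integrable setT (EFin \o f) /\ \int[mu]_v `|f v| <= C.
Proof.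
move=> mf fC.
have mi n : @measurable_fun _ _ B mR setT (ibox n%:R) by have [] := ibox_tester (n%:R : R).
have maf : @measurable_fun _ _ B mR setT (fun v => `|f v|) by exact: measurableT_comp.
have cv : (\int[mu]_v (`|f v| * ibox n%:R v)%:E @[n --> \oo] --> \int[mu]_v (`|f v|)%:E)%E.
  have -> : (\int[mu]_v (`|f v|)%:E = \int[mu]_v limn (fun n => (`|f v| * ibox n%:R v)%:E))%E.
    apply: eq_integral => v _; apply/esym/cvg_lim => //.
    apply: cvg_EFin; first exact: nearW.
    by rewrite -[X in _ --> X]mulr1; apply: cvgM; [exact: cvg_cst|exact: ibox_cvg].
  apply: cvg_monotone_convergence => //.
  - by move=> n; apply/measurable_EFinP; exact: (measurable_funM maf (mi n)).
  - by move=> n v _; rewrite lee_fin mulr_ge0 ?ibox_ge0.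
  - by move=> v _ m n mn; rewrite lee_fin ler_wpM2l // ibox_le // ler_nat.
have le : (\int[mu]_v (`|f v|)%:E <= C%:E)%E.
  by rewrite -(cvg_lim _ cv) //; apply: lime_le; [apply/cvg_ex; eexists; exact: cv|exact: nearW].
have fi : mu.-integrable setT (EFin \o f).
  apply/integrableP; split; first exact/measurable_EFinP.
  exact: le_lt_trans le (ltry _).
split => //; rewrite -lee_fin /Rintegral fineK //.
by apply: integrable_fin_num => //; exact: (integrable_abse fi).
Qed.

Lemma ibox_weight_l2 g n : continuous g -> l2 mu (fun v => g v * ibox n%:R v).
Proof.
move=> cg; have n1 : 0 < n.+1%:R :> R by rewrite ltr0n.
have tc := cutoff_test n1; have [_ [r rc]] := tc.
have g2 : l2 mu (fun v => g v * cutoff n.+1%:R v).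
  apply: (@l2_supported _ r); last exact: supportedMr.
  exact: (continuous_mul cg (test_fun_cont tc)).
apply: (l2_dominated _ g2).
  apply: measurable_funM; first exact: (continuous_measurable cg).
  by have [] := ibox_tester (n%:R : R).
move=> v; rewrite normrM [leRHS]normrM ler_wpM2l //; have [vb|vb] := pselect (box n%:R v); last first.
  by rewrite /ibox memNset // normr0.
have [b0 b1] := iffLR (boxP _ _) vb.
have nn : n%:R <= n.+1%:R :> R by rewrite ler_nat.
by rewrite cutoff_eq1 ?(le_trans b0) ?(le_trans b1) // normr1 ger0_norm ?ibox_ge0 // ibox_le1.
Qed.

(** Converts bounds on L^2 pairings, the only quantities accessible through the Hilbert space, into
    a weighted L^1 bound, by monotone convergence. *)
Lemma nonneg_integrable x g (C : R) : nonneg x -> continuous g -> (forall v, 0 <= g v) ->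
  (forall n : nat, ip x (cls mu (fun v => g v * ibox n%:R v) : H) <= C) ->
  mu.-integrable setT (EFin \o (fun v => g v * rep x v)) /\ \int[mu]_v (g v * rep x v) <= C.
Proof.
move=> x0 cg g0 xC; have mx := l2_measurable (rep_l2 x).
have mg : @measurable_fun _ _ B mR setT g := continuous_measurable cg.
have mgx : @measurable_fun _ _ B mR setT (fun v => g v * rep x v) by exact: measurable_funM.
have gx_abs : \forall v \ae mu, `|g v * rep x v| = g v * rep x v.
  by move: x0; apply: aeS => v x0; rewrite ger0_norm // mulr_ge0.
have [|fi le] := @integrable_of_boxes _ C mgx.
  move=> n; have gn2 := ibox_weight_l2 n cg; have := xC n; rewrite ip_cls_r // => h.
  have mi : @measurable_fun _ _ B mR setT (ibox n%:R) by have [] := ibox_tester (n%:R : R).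
  have -> : (\int[mu]_v (`|g v * rep x v| * ibox n%:R v)%:E =
             (dotm mu (rep x) (fun v => (g v * ibox n%:R v)%R))%:E)%E.
    rewrite /dotm /Rintegral fineK; last first.
      by apply: integrable_fin_num => //; exact: (l2_integrable (rep_l2 x) gn2).
    apply: ae_eq_integral => //.
    - by apply/measurable_EFinP; apply: measurable_funM => //; exact: measurableT_comp.
    - by apply/measurable_EFinP; apply: measurable_funM => //; exact: measurable_funM.
    - by move: gx_abs; apply: aeS => v -> _; congr EFin; ring.
  by rewrite lee_fin.
split => //; apply: le_trans le.
apply: le_Rintegral => //; first exact: (integrable_abse fi).
by move=> v _; exact: ler_norm.
Qed.

Lemma ip_le_integral x u : nonneg x -> mu.-integrable setT (EFin \o rep x) -> in_unit u ->
  ip x u <= \int[mu]_v rep x v.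
Proof.
move=> x0 xi /in_unitP[u0 u1]; have i := l2_integrable (rep_l2 x) (rep_l2 u).
rewrite [ip _ _]/(dotm mu (rep x) (rep u)) -subr_ge0 /dotm -RintegralB //.
apply: ae_Rintegral_ge0.
  apply: measurable_funB; first exact: (l2_measurable (rep_l2 x)).
  by apply: measurable_funM; exact: (l2_measurable (rep_l2 _)).
move: x0 u1; apply: aeS2 => v x0 u1.
by rewrite subr_ge0 -[leRHS]mulr1 ler_wpM2l.
Qed.

End Integrability.

(** * L^1 bounds for the semigroup and its time integral *)

Section L1Bounds.
Context (R : realType).
Local Notation P := 'rV[R]_2.
Local Notation mR := (measurableTypeR R).
Local Notation leb := (@lebesgue_measure R).
Local Notation pdir := (fun k : 'I_2 => delta_mx 0 k : P).
Local Notation mu := (@mu R).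
Local Notation H := (l2_hilbert mu).
Implicit Types (v w : P) (f g h phi psi : P -> R) (u x y : H).
Variable W : P -> R.
Hypothesis W_cinf : cinf pdir W.
Local Notation F := (dirichlet_form W_cinf).

(** Minus the sum of adjoint after derivative over the three components, which is the Laplacian
    minus W^2. *)
Definition generator phi v : R :=
  - (dual0 (partial 0 phi) v + dual1 (grad1 phi) v + W v * (W v * phi v)).

Lemma generator_test phi : test_fun phi -> test_fun (generator phi).
Proof.
move=> tphi; have t0 := dual0_test (test_fun_partial 0 tphi).
have t1 := dual1_test (grad1_test tphi); have t2 := test_funM W_cinf (test_funM W_cinf tphi).
have := test_funZ (-1) (test_funD (test_funD t0 t1) t2).
by congr test_fun; apply/funext => v; rewrite mulN1r.
Qed.

Lemma dotm_sum3 f a b c g : l2 mu f -> l2 mu a -> l2 mu b -> l2 mu c ->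
  (forall v, a v + b v + c v = - g v) ->
  dotm mu f a + dotm mu f b + dotm mu f c = - dotm mu f g.
Proof.
move=> f2 a2 b2 c2 abc; have -> : g = - (a + b + c).
  by apply/funext => v; rewrite !fctE abc opprK.
rewrite (dotmC mu f a) (dotmC mu f b) (dotmC mu f c) (dotmC mu f (- _)).
rewrite (dotmNl (l2D (l2D a2 b2) c2) f2) opprK.
by rewrite (dotmDl (l2D a2 b2) c2 f2) (dotmDl a2 b2 f2).
Qed.

Lemma op_test phi : test_fun phi -> op F (cls mu phi) (cls mu (generator phi)).
Proof.
move=> tphi; have [dphi gphi] := cgrad_cls W_cinf tphi; split => // x dx.
have gx := cgrad_graph dx.
have key (i : 'I_3) : ip (cgrad (core W) (cls mu phi) i) (cgrad (core W) x i) =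
    ip x (cls mu (dual_comp W i (grad_comp W i phi)) : H).
  rewrite gphi ip_sym; apply: (graph_adj (@coreP _ _ W_cinf) gx (i := i)).
  by exists (grad_comp W i phi); split => //; exact: grad_comp_test.
have l (i : 'I_3) : l2 mu (dual_comp W i (grad_comp W i phi)).
  exact/test_fun_l2/dual_comp_test/grad_comp_test.
have g2 := test_fun_l2 (generator_test tphi).
have keyd (i : 'I_3) : ip (cgrad (core W) (cls mu phi) i) (cgrad (core W) x i) =
    dotm mu (rep x) (dual_comp W i (grad_comp W i phi)).
  by rewrite key (ip_cls_r x (l i)).
have r : ip (cls mu (generator phi) : H) x = dotm mu (rep x) (generator phi).
  by rewrite ip_sym (ip_cls_r x g2).
rewrite [LHS]sum3E !keyd r.
apply: (dotm_sum3 (rep_l2 x) (l _) (l _) (l _)) => v.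
by rewrite /generator opprK.
Qed.

Variable h : P -> R.
Hypothesis th : tester h.
Variable t : R.
Hypothesis t0 : 0 <= t.
Local Notation hc := (cls mu h : H).
Local Notation T := (sg F t hc).
Local Notation U := (sgint F t hc).
Local Notation m1 := (\int[mu]_v h v).

Lemma h_nonneg : nonneg hc.
Proof. by have /in_unitP[] := tester_in_unit th. Qed.

Lemma sg_ibox_le s n : ip (sg F s hc) (cls mu (ibox n%:R) : H) <= m1.
Proof.
rewrite sg_sym ip_sym; apply: in_unit_ip => //; apply: sg_in_unit.
exact/tester_in_unit/ibox_tester.
Qed.

Lemma sg_integrable : mu.-integrable setT (EFin \o rep T).
Proof.
have [||n|+ _] := @nonneg_integrable R T (fun=> 1) m1 (sg_nonneg W_cinf t h_nonneg).
- exact: (cinf_cont (cinf_cst pdir 1)).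
- by move=> v; exact: ler01.
- rewrite (_ : (fun v => 1 * _) = ibox n%:R); first exact: sg_ibox_le.
  by apply/funext => v; rewrite mul1r.
by congr integrable; apply/funext => v; rewrite /= mul1r.
Qed.

Lemma sgint_ibox_le n : ip U (cls mu (ibox n%:R) : H) <= t * m1.
Proof.
rewrite sgintP //.
have mt : measurable (`[0, t]%classic : set mR) by [].
have lt : leb `[0, t]%classic = t%:E by rewrite lebesgue_segment // subr0.
rewrite mulrC -[X in _ * X]/(fine t%:E) -lt -(Rintegral_cst _ mt).
apply: le_Rintegral => //.
- by apply: integrable_continuous; exact: ip_sg_continuous.
- by apply: integrable_continuous => s; exact: cvg_cst.
- by move=> s _; exact: sg_ibox_le.
Qed.

Lemma sgint_integrable : mu.-integrable setT (EFin \o rep U).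
Proof.
have [||n|+ _] := @nonneg_integrable R U (fun=> 1) (t * m1) (sgint_nonneg W_cinf t0 h_nonneg).
- exact: (cinf_cont (cinf_cst pdir 1)).
- by move=> v; exact: ler01.
- rewrite (_ : (fun v => 1 * _) = ibox n%:R); first exact: sgint_ibox_le.
  by apply/funext => v; rewrite mul1r.
by congr integrable; apply/funext => v; rewrite /= mul1r.
Qed.

(** Let k be 1 + W^2 on a box and 0 outside, and R the resolvent with s = 1. Since U = R (U - T + h)
    and R is symmetric, the pairing of U with k is that of U - T + h with R k. As R k takes values
    in [0, 1], this is at most the integral of U + h, whatever the box. *)
Lemma sgint_weight_integrable :
  mu.-integrable setT (EFin \o (fun v => (1 + W v ^+ 2) * rep U v)).
Proof.
have cW2 : continuous (fun v => W v ^+ 2).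
  exact: (continuous_mul (cinf_cont W_cinf) (cinf_cont W_cinf)).
have c1W2 : continuous (fun v => 1 + W v ^+ 2).
  exact: (cinf_cont (cinfD (cinf_cst pdir 1) (cinfM W_cinf W_cinf))).
have U0 := sgint_nonneg W_cinf t0 h_nonneg.
have T0 := sg_nonneg W_cinf t h_nonneg.
have [||//] := @nonneg_integrable R U _ (\int[mu]_v rep U v + m1) U0 c1W2.
  by move=> v; rewrite addr_ge0 // sqr_ge0.
move=> n; pose k : H := cls mu (fun v => (1 + W v ^+ 2) * ibox n%:R v); rewrite -/k.
have b2 := ibox_weight_l2 n cW2; have b0 := tester_l2 (ibox_tester (n%:R : R)).
have kE : k = (cls mu (ibox n%:R) : H) + 1 *: (cls mu (fun v => W v ^+ 2 * ibox n%:R v) : H).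
  rewrite addrC -cls_linear //; congr cls; apply/funext => v.
  by rewrite !fctE /GRing.scale /=; ring.
have k01 : in_unit (res F 1 k).
  have i01 (v : P) : 0 <= ibox (n%:R : R) v <= 1 by rewrite ibox_ge0 ibox_le1.
  have b1 := ibox_weight_l2 n (cinf_cont W_cinf).
  rewrite kE; exact: (resolvent_markov W_cinf ltr01 b0 b1 b2 i01 i01).
have /in_unitP[k0 _] := k01.
have -> : ip U k = ip U (res F 1 k) + ip hc (res F 1 k) - ip T (res F 1 k).
  by rewrite [in LHS](sgint_resolvent F hc t0) res_sym // ipBl ipBl opprB addrA.
have h1 := ip_le_integral U0 sgint_integrable k01.
have h2 : ip hc (res F 1 k) <= m1 by rewrite ip_sym; exact: in_unit_ip.
have h3 := nonneg_ip T0 k0.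
move: h1 h2 h3; move: (ip U _) (ip hc _) (ip T _) (\int[mu]_v rep U v) m1 => a b c d e.
lra.
Qed.

(** The equation L U = T - h in weak form. By symmetry the time integral is moved onto phi, which
    lies in the domain of L. *)
Lemma sgint_pairing phi : test_fun phi ->
  ip U (cls mu (generator phi) : H) = ip T (cls mu phi : H) - ip hc (cls mu phi : H).
Proof.
move=> tphi; rewrite sgint_sym // (sgint_op t0 (op_test tphi)) ipBr -sg_sym.
by [].
Qed.

End L1Bounds.

(** * Conservation in the generalized sense *)

Section MassIdentity.
Context (R : realType).
Local Notation P := 'rV[R]_2.
Local Notation pl := (@plateau R).
Implicit Types (v w : P).

Lemma derive1_supp (f : R -> R) (r x : R) : (forall y, r <= `|y| -> f y = 0) ->
  r + 1 <= `|x| -> derive1 f x = 0.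
Proof.
move=> fr xr; rewrite derive1E (@near_eq_derive _ _ _ f (cst 0)) ?derive_cst //.
near=> y; apply: fr; have : `|x - y| < 1.
  by near: y; exact: (nbhsx_ballx x _ ltr01).
by have := ler_distD y x 0; rewrite !subr0; lra.
Unshelve. all: by end_near. Qed.

Definition rescale (r : R) (x : R) : R := plateau (r^-1 * x).

Lemma rescale_cinf r : cinf1 (rescale r).
Proof. by apply: (cinf_comp (@plateau_cinf R)); apply: cinfZ; exact: cinf1_id. Qed.

Lemma derive1Z (c : R) (f : R -> R) (x : R) : cinf1 f ->
  derive1 (fun y => c * f y) x = c * derive1 f x.
Proof.
by move=> hf; rewrite !derive1E; have := @deriveZ _ _ _ f c x 1 (cinf1_derivable hf).
Qed.

Lemma derive1_scale (f : R -> R) (c x : R) : cinf1 f ->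
  derive1 (fun x => f (c * x)) x = c * derive1 f (c * x).
Proof.
move=> hf; have hc : cinf1 (fun x : R => c * x) by apply: cinfZ; exact: cinf1_id.
rewrite derive1_comp_c // mulrC; congr (_ * _).
by rewrite (derive1Z _ x (@cinf1_id R)) derive1E derive_id mulr1.
Qed.

Lemma rescale_derive r x : derive1 (rescale r) x = r^-1 * derive1 pl (r^-1 * x).
Proof. by rewrite derive1_scale //; exact: plateau_cinf. Qed.

Lemma rescale_derive2 r x :
  derive1 (derive1 (rescale r)) x = r^-1 * (r^-1 * derive1 (derive1 pl) (r^-1 * x)).
Proof.
have hp := @plateau_cinf R; have hp' := cinf1_derive hp.
have -> : derive1 (rescale r) = (fun x => r^-1 * derive1 pl (r^-1 * x)).
  by apply/funext => y; exact: rescale_derive.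
have hs : cinf1 (fun x : R => derive1 pl (r^-1 * x)).
  by apply: (cinf_comp hp'); apply: cinfZ; exact: cinf1_id.
by rewrite (derive1Z _ x hs) (derive1_scale _ _ hp').
Qed.

Lemma plateau_derivatives_bounded : exists2 C : R, 0 <= C &
  forall x, `|derive1 pl x| <= C /\ `|derive1 (derive1 pl) x| <= C.
Proof.
have hp := @plateau_cinf R; have hp' := cinf1_derive hp; have hp'' := cinf1_derive hp'.
have s1 (x : R) : 2 + 1 <= `|x| -> derive1 pl x = 0.
  by apply: derive1_supp => y; exact: plateau_eq0.
have s2 (x : R) : 2 + 1 + 1 <= `|x| -> derive1 (derive1 pl) x = 0.
  by apply: derive1_supp => y; exact: s1.
have [C1 C10 h1] := bounded_support (cinf_cont hp') s1.
have [C2 C20 h2] := bounded_support (cinf_cont hp'') s2.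
exists (C1 + C2) => [|x]; first exact: addr_ge0.
by split; [apply: le_trans (h1 x) _; rewrite lerDl|apply: le_trans (h2 x) _; rewrite lerDr].
Qed.

Lemma Einv_bound v : 0 <= (Einv v : R) <= 1.
Proof. by rewrite invr_ge0 (ltW (E_gt0 v)) invf_le1 ?E_gt0 ?E_ge1. Qed.

Lemma cutoffE r : cutoff r = prodf (rescale r) (rescale r).
Proof. by []. Qed.

(** Second derivatives have a factor r^-2 <= r^-1; only the drift term, with one derivative, is of
    order e^x / r. In the direction of y the coefficient E^-2 is at most 1. One constant C for each
    direction gives C + C. *)
Lemma cutoff_laplacian_bound : exists2 C : R, 0 <= C & forall r v, 1 <= r ->
  `|dual0 (partial 0 (cutoff r)) v + dual1 (grad1 (cutoff r)) v| <=
  r^-1 * (C * (1 + expR (v 0 0))).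
Proof.
have [C C0 hC] := plateau_derivatives_bounded; exists (C + C) => [|r v r1]; first exact: addr_ge0.
have hr := rescale_cinf r; rewrite cutoffE dual0_prodf // dual1_prodf // /prodf.
have /andP[e0 e1] := Einv_bound v.
have r0 : 0 < r by exact: lt_le_trans r1.
have i0 : 0 <= r^-1 by rewrite invr_ge0 ltW.
have i1 : r^-1 <= 1 by rewrite invf_le1.
have p01 (y : R) : 0 <= rescale r y <= 1 by rewrite plateau_ge0 plateau_le1.
have d1 (y : R) : `|derive1 (rescale r) y| <= r^-1 * C.
  by rewrite rescale_derive normrM ger0_norm // ler_wpM2l //; case: (hC (r^-1 * y)).
have d2 (y : R) : `|derive1 (derive1 (rescale r)) y| <= r^-1 * C.
  rewrite rescale_derive2 normrM (ger0_norm i0) ler_wpM2l // normrM (ger0_norm i0).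
  have [_ h] := hC (r^-1 * y); apply: le_trans h.
  by rewrite ler_piMl.
move: (d1 (v 0 0)) (d2 (v 0 0)) (d2 (v 0 1)) (p01 (v 0 0)) (p01 (v 0 1)).
move: (derive1 (rescale r) (v 0 0)) (derive1 (derive1 (rescale r)) (v 0 0)) (derive1 (derive1 (rescale r)) (v 0 1)) (rescale r (v 0 0)) (rescale r (v 0 1)).
move=> a' a'' b'' a b ha' ha'' hb'' /andP[a0 a1] /andP[b0 b1].
apply: le_trans (ler_normD _ _) _; rewrite !normrN !normrM.
have x0 := expR_ge0 (v 0 0); move: (expR _) x0 => x x0.
rewrite (ger0_norm a0) (ger0_norm b0).
have e2 : `|Einv v| * `|Einv v| <= 1 by rewrite ger0_norm // mulr_ile1.
have h1 : `|a'' + x * a'| * b <= r^-1 * C * (1 + x).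
  apply: le_trans (_ : `|a'' + x * a'| <= _); first by rewrite ler_piMr.
  apply: le_trans (ler_normD _ _) _; rewrite normrM (ger0_norm x0) mulrDr mulr1 lerD //.
  by rewrite mulrC ler_wpM2r.
have h2 : `|Einv v| * `|Einv v| * (a * `|b''|) <= r^-1 * C * (1 + x).
  apply: le_trans (_ : r^-1 * C <= _); last by rewrite ler_peMr ?lerDl // mulr_ge0.
  apply: le_trans (_ : a * `|b''| <= _); first by rewrite ler_piMl // mulr_ge0.
  by apply: le_trans hb''; rewrite ler_piMl.
have -> : r^-1 * ((C + C) * (1 + x)) = r^-1 * C * (1 + x) + r^-1 * C * (1 + x) by ring.
by apply: lerD; [exact: h1|exact: h2].
Qed.

End MassIdentity.

(** * The mass identity with potential *)

Section ConservationWithPotential.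
Context (R : realType).
Local Notation P := 'rV[R]_2.
Local Notation B := (borel P).
Local Notation mR := (measurableTypeR R).
Local Notation pdir := (fun k : 'I_2 => delta_mx 0 k : P).
Local Notation mu := (@mu R).
Local Notation H := (l2_hilbert mu).
Implicit Types (v w : P) (f g phi psi : P -> R) (u x y : H).

Definition W v : R := expR (2^-1 * v 0 0).
(** The drift coefficient E'/E itself, so that 1 + V bounds the Laplacians of cutoffs. *)
Definition V v : R := expR (v 0 0).

Lemma W_cinf : cinf pdir W.
Proof. by apply: (cinf_comp (@cinf1_expR R)); apply: cinfZ; exact: coord_cinf. Qed.

Lemma V_cinf : cinf pdir V.
Proof. by apply: (cinf_comp (@cinf1_expR R)); exact: coord_cinf. Qed.

Lemma W_sqr v : W v ^+ 2 = V v.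
Proof.
rewrite /W expr2 -expRD /V; congr expR.
by rewrite -mulrDl -mulr2n -[2^-1 *+ 2]mulr_natr mulVf ?mul1r.
Qed.

Lemma V_ge0 v : 0 <= V v. Proof. exact: expR_ge0. Qed.

Local Notation F := (dirichlet_form W_cinf).

Lemma cutoff_near1 v : \forall n \near \oo, cutoff n.+1%:R v = 1.
Proof.
near=> n; have nn : n%:R <= n.+1%:R :> R by rewrite ler_nat.
apply: cutoff_eq1; first by rewrite ltr0n.
  by apply: le_trans nn; near: n; exact: nbhs_infty_ger.
by apply: le_trans nn; near: n; exact: nbhs_infty_ger.
Unshelve. all: by end_near. Qed.

Lemma cutoff_cvg v : cutoff n.+1%:R v @[n --> \oo] --> (1 : R).
Proof.
apply/cvgrPdist_le => e e0; have := cutoff_near1 v; apply: filterS => k ->.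
by rewrite subrr normr0 ltW.
Qed.

Section OneTester.
Variable h : P -> R.
Hypothesis th : tester h.
Variable t : R.
Hypothesis t0 : 0 <= t.
Local Notation hc := (cls mu h : H).
Local Notation T := (sg F t hc).
Local Notation U := (sgint F t hc).

Lemma weighted_sgint_integrable : mu.-integrable setT (EFin \o (fun v => (1 + V v) * rep U v)).
Proof.
have := sgint_weight_integrable W_cinf th t0.
by congr integrable; apply/funext => v; rewrite /= W_sqr.
Qed.

Lemma V_sgint_integrable : mu.-integrable setT (EFin \o (fun v => V v * rep U v)).
Proof.
apply: le_integrable weighted_sgint_integrable => //.
  apply/measurable_EFinP; apply: measurable_funM; last exact: (l2_measurable (rep_l2 _)).
  exact: (continuous_measurable (cinf_cont V_cinf)).
move=> v _; rewrite lee_fin !normrM ler_wpM2r //.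
by rewrite !ger0_norm ?lerDr ?addr_ge0 ?V_ge0.
Qed.

(** Dominated convergence with majorant (C + 1) (1 + V) |U|: the Laplacians of the cutoffs tend to 0
    at each point, which leaves the potential term. *)
Lemma generator_cutoff_pairing :
  dotm mu (rep U) (generator W (cutoff n.+1%:R)) @[n --> \oo] --> - (\int[mu]_v (V v * rep U v)).
Proof.
have [C C0 hC] := @cutoff_laplacian_bound R.
have tc n := generator_test W_cinf (cutoff_test (ltr0Sn R n)).
have gE n v : generator W (cutoff n.+1%:R) v =
    - (dual0 (partial 0 (cutoff n.+1%:R)) v + dual1 (grad1 (cutoff n.+1%:R)) v)
    - V v * cutoff n.+1%:R v.
  by rewrite /generator mulrA -expr2 W_sqr opprD.
have lapb n v : `|dual0 (partial 0 (cutoff n.+1%:R)) v + dual1 (grad1 (cutoff n.+1%:R)) v| <=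
    n.+1%:R^-1 * (C * (1 + V v)) by apply: hC; rewrite ler1n.
have mU := l2_measurable (rep_l2 U).
have mVU : @measurable_fun _ _ B mR setT (fun v => rep U v * - V v).
  apply: measurable_funM => //; apply: measurableT_comp => //.
  exact: (continuous_measurable (cinf_cont V_cinf)).
have -> : - (\int[mu]_v (V v * rep U v)) = \int[mu]_v (rep U v * - V v).
  rewrite -mulN1r -RintegralZl //; last exact: V_sgint_integrable.
  by apply: eq_Rintegral => v _; ring.
apply: (@Rintegral_cvg _ _ _ mu _ _ (fun v => (C + 1) * `|(1 + V v) * rep U v|)).
- by move=> n; apply: measurable_funM => //; exact: (continuous_measurable (test_fun_cont (tc n))).
- exact: mVU.
- apply: aeW => v; apply: cvgM; first exact: cvg_cst.
  rewrite (_ : - V v = - 0 - V v * 1); last by rewrite oppr0 add0r mulr1.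
  under eq_fun do rewrite gE; apply: cvgB; last by apply: cvgM; [exact: cvg_cst|exact: cutoff_cvg].
  apply: cvgN; apply/cvgrPdist_lt => e e0; rewrite /=.
  have K0 : 0 < C * (1 + V v) + 1 by rewrite ltr_wpDl // mulr_ge0 // addr_ge0 ?V_ge0.
  have [N NP] := inv_small (divr_gt0 e0 K0); exists N => // n /= /NP nN.
  rewrite sub0r normrN; apply: le_lt_trans (lapb n v) _.
  rewrite ltr_pdivlMr // in nN; apply: le_lt_trans nN.
  by rewrite ler_wpM2l ?invr_ge0 // lerDl.
- have := integrableZl measurableT (C + 1) (integrable_abse weighted_sgint_integrable).
  by [].
- apply: aeW => v n; rewrite !normrM mulrA mulrC ler_wpM2r // gE.
  have V0 := V_ge0 v; have c0 := cutoff_ge0 n.+1%:R v; have c1 := cutoff_le1 n.+1%:R v.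
  apply: le_trans (ler_normB _ _) _; rewrite normrN (ger0_norm (addr_ge0 ler01 V0)) mulrDl mul1r.
  have i1 : n.+1%:R^-1 <= 1 :> R by rewrite invf_le1 ?ltr0n // ler1n.
  apply: lerD.
    apply: le_trans (lapb n v) _; rewrite ler_piMl // mulr_ge0 // addr_ge0 //.
  rewrite normrM !ger0_norm //; apply: le_trans (_ : V v <= _); first by rewrite ler_piMr.
  by rewrite lerDr.
Qed.

Lemma mass_identity : \int[mu]_v rep T v + \int[mu]_v (V v * rep U v) = \int[mu]_v h v.
Proof.
have pair n : dotm mu (rep U) (generator W (cutoff n.+1%:R)) =
    dotm mu (rep T) (cutoff n.+1%:R) - dotm mu h (cutoff n.+1%:R).
  have tc := cutoff_test (ltr0Sn R n); have c2 := test_fun_l2 tc.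
  have g2 := test_fun_l2 (generator_test W_cinf tc).
  rewrite -(ip_cls_r U g2) -(ip_cls_r T c2) -(ip_cls (tester_l2 th) c2).
  exact: sgint_pairing.
have lim f : @measurable_fun _ _ B mR setT f -> mu.-integrable setT (EFin \o f) ->
    dotm mu f (cutoff n.+1%:R) @[n --> \oo] --> \int[mu]_v f v.
  move=> mf fi; apply: (@Rintegral_cvg _ _ _ mu _ _ (fun v => `|f v|)).
  - move=> n; apply: measurable_funM => //.
    exact: (continuous_measurable (cinf_cont (cutoff_cinf _))).
  - exact: mf.
  - apply: aeW => v; rewrite -[X in _ --> X]mulr1.
    by apply: cvgM; [exact: cvg_cst|exact: cutoff_cvg].
  - exact: (integrable_abse fi).
  - apply: aeW => v n; rewrite normrM ler_piMr //.
    by rewrite ger0_norm ?cutoff_ge0 ?cutoff_le1.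
have l1 := generator_cutoff_pairing.
have l2 := lim _ (l2_measurable (rep_l2 T)) (sg_integrable W_cinf th t).
have mh : @measurable_fun _ _ B mR setT h by case: th.
have l3 := lim _ mh (tester_integrable th).
have l4 : dotm mu (rep U) (generator W (cutoff n.+1%:R)) @[n --> \oo] -->
    \int[mu]_v rep T v - \int[mu]_v h v.
  rewrite [X in X @ _](_ : _ = fun n => dotm mu (rep T) (cutoff n.+1%:R) - dotm mu h (cutoff n.+1%:R)).
    exact: cvgB.
  by apply/funext => n; exact: pair.
have e : - (\int[mu]_v (V v * rep U v)) = \int[mu]_v rep T v - \int[mu]_v h v.
  exact: (cvg_unique (@Rhausdorff R) l1 l4).
by move: e; move: (\int[mu]_v rep T v) (\int[mu]_v (V v * rep U v)) (\int[mu]_v h v) => a b c; lra.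
Qed.

End OneTester.

End ConservationWithPotential.

(** * Exhaustion by boxes *)

Section Exhaustion.
Context (R : realType).
Local Notation P := 'rV[R]_2.
Local Notation B := (borel P).
Local Notation mR := (measurableTypeR R).
Local Notation mu := (@mu R).
Local Notation H := (l2_hilbert mu).
Implicit Types (v w : P) (f g h : P -> R) (u x y : H).

Lemma nonneg_limn (a : nat -> R) : (forall n, 0 <= a n) -> nondecreasing_seq a ->
  cvgn (fun n => (a n)%:E) /\ (0 <= limn (fun n => (a n)%:E))%E.
Proof.
move=> a0 ale; have c : cvgn (fun n => (a n)%:E).
  by apply: ereal_nondecreasing_is_cvgn => m n mn; rewrite lee_fin; exact: ale.
by split => //; apply: lime_ge => //; apply: nearW => n; rewrite lee_fin.
Qed.

Lemma limnD_eq1 (a b c : nat -> R) : cvgn (fun n => (a n)%:E) -> cvgn (fun n => (b n)%:E) ->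
  (0 <= limn (fun n => (a n)%:E))%E -> (0 <= limn (fun n => (b n)%:E))%E ->
  (forall n, c n = a n + b n) -> c n @[n --> \oo] --> (1 : R) ->
  (limn (fun n => (a n)%:E) + limn (fun n => (b n)%:E) = 1)%E.
Proof.
move=> ca cb a0 b0 e c1.
have l1 : (c n)%:E @[n --> \oo] --> 1%E by apply: cvg_EFin => //; exact: nearW.
have l2 : ((a n)%:E + (b n)%:E)%E @[n --> \oo] -->
    (limn (fun n => (a n)%:E) + limn (fun n => (b n)%:E))%E.
  by apply: cvgeD => //; exact: ge0_adde_def.
rewrite (_ : (fun n => _) = (fun n => (c n)%:E)) in l2.
  exact: (cvg_unique _ l2 l1).
by apply/funext => n; rewrite e.
Qed.

Lemma ibox_measurable (k : R) : @measurable_fun _ _ B mR setT (ibox k).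
Proof. by have [] := ibox_tester k. Qed.

Lemma ibox_integral_cvg f : mu.-integrable setT (EFin \o f) ->
  \int[mu]_v (f v * ibox n%:R v) @[n --> \oo] --> \int[mu]_v f v.
Proof.
move=> fi; have mf : @measurable_fun _ _ B mR setT f by exact/measurable_EFinP/measurable_int/fi.
apply: (@Rintegral_cvg _ _ _ mu _ _ (fun v => `|f v|)).
- by move=> n; apply: measurable_funM => //; exact: ibox_measurable.
- exact: mf.
- apply: aeW => v; rewrite -[X in _ --> X]mulr1.
  by apply: cvgM; [exact: cvg_cst|exact: ibox_cvg].
- exact: (integrable_abse fi).
- apply: aeW => v n; rewrite normrM ler_piMr //.
  by rewrite ger0_norm ?ibox_ge0 ?ibox_le1.
Qed.

Lemma integrable_ibox f (k : R) : mu.-integrable setT (EFin \o f) ->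
  mu.-integrable setT (EFin \o (fun v => f v * ibox k v)).
Proof.
move=> fi; have mf : @measurable_fun _ _ B mR setT f by exact/measurable_EFinP/measurable_int/fi.
apply: le_integrable fi => //.
  by apply/measurable_EFinP; apply: measurable_funM => //; exact: ibox_measurable.
move=> v _; rewrite lee_fin normrM ler_piMr //.
by rewrite ger0_norm ?ibox_ge0 ?ibox_le1.
Qed.

Lemma ibox_integral_le f (k : R) : mu.-integrable setT (EFin \o f) ->
  (\forall v \ae mu, 0 <= f v) -> \int[mu]_v (f v * ibox k v) <= \int[mu]_v f v.
Proof.
move=> fi f0; have mf : @measurable_fun _ _ B mR setT f by exact/measurable_EFinP/measurable_int/fi.
have mfi : @measurable_fun _ _ B mR setT (fun v => f v * ibox k v).
  by apply: measurable_funM => //; exact: ibox_measurable.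
rewrite -subr_ge0 -RintegralB //; last exact: integrable_ibox.
apply: ae_Rintegral_ge0; first exact: measurable_funB.
move: f0; apply: aeS => v f0.
by rewrite subr_ge0 ler_piMr // ibox_le1.
Qed.

Lemma ae_eq0_of_integral f : mu.-integrable setT (EFin \o f) ->
  (\forall v \ae mu, 0 <= f v) -> \int[mu]_v f v = 0 -> \forall v \ae mu, f v = 0.
Proof.
move=> fi f0 i0; have mf : @measurable_fun _ _ B mR setT f by exact/measurable_EFinP/measurable_int/fi.
have maf : @measurable_fun _ _ B mR setT (fun v => `|f v|) by exact: measurableT_comp.
have : \forall v \ae mu, `|f v| = 0.
  apply: ge0_ae_eq0 => //.
  have -> : (\int[mu]_v (`|f v|)%:E = \int[mu]_v (f v)%:E)%E.
    apply: ae_eq_integral => //; [exact/measurable_EFinP|exact/measurable_EFinP|].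
    by move: f0; apply: aeS => v f0 _; rewrite ger0_norm.
  by rewrite -[LHS]fineK ?integrable_fin_num //; congr EFin.
by apply: aeS => v /eqP; rewrite normr_eq0 => /eqP.
Qed.

(** Monotonicity is positivity applied to the differences of consecutive functions. *)
Lemma positive_monotone (S : H -> H) (f_ : nat -> P -> R) :
  (forall x y, S (x - y) = S x - S y) -> (forall x, nonneg x -> nonneg (S x)) ->
  (forall n, l2 mu (f_ n)) -> (forall n v, 0 <= f_ n v) ->
  (forall v, nondecreasing_seq (f_ ^~ v)) ->
  \forall v \ae mu, (forall n, 0 <= rep (S (cls mu (f_ n))) v) /\
    nondecreasing_seq (fun n => rep (S (cls mu (f_ n))) v).
Proof.
move=> SB S0 f2 f0 fle.
have h1 : \forall v \ae mu, forall n, 0 <= rep (S (cls mu (f_ n))) v.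
  by apply/ae_foralln => n; apply/S0/nonneg_cls => //; exact: aeW.
have h2 : \forall v \ae mu, forall n, rep (S (cls mu (f_ n))) v <= rep (S (cls mu (f_ n.+1))) v.
  apply/ae_foralln => n.
  have e : S (cls mu (f_ n.+1 - f_ n)) = S (cls mu (f_ n.+1)) - S (cls mu (f_ n)).
    by rewrite (clsB (f2 n.+1) (f2 n)) SB.
  have d0 : nonneg (S (cls mu (f_ n.+1 - f_ n))).
    apply/S0/nonneg_cls; first exact: l2B.
    by apply: aeW => v; rewrite !fctE subr_ge0; exact: fle.
  rewrite e in d0; have eB := repB (S (cls mu (f_ n.+1))) (S (cls mu (f_ n))).
  move: d0 eB; apply: aeS2 => v d0 eB.
  by rewrite -subr_ge0 -eB.
move: h1 h2; apply: aeS2 => v p q; split => //.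
exact/nondecreasing_seqP.
Qed.

End Exhaustion.

(** * From the mass identity to generalized conservation *)

Section GeneralizedConservation.
Context (R : realType).
Local Notation P := 'rV[R]_2.
Local Notation B := (borel P).
Local Notation mR := (measurableTypeR R).
Local Notation mu := (@mu R).
Local Notation H := (l2_hilbert mu).
Local Notation F := (dirichlet_form (@W_cinf R)).
Implicit Types (v w : P) (f g h : P -> R) (u x y : H).

Lemma V_ibox_l2 n : l2 mu (fun v => V v * ibox n%:R v).
Proof. exact: ibox_weight_l2 (cinf_cont (@V_cinf R)). Qed.

Section FixedTime.
Variable t : R.
Hypothesis t0 : 0 < t.
Let t_ge0 : 0 <= t := ltW t0.
(** In probabilistic terms, with respect to a box: the probability of being alive in it at time t,
    and that of having been killed by V in it before time t. *)
Let surviving n : H := sg F t (cls mu (ibox n%:R)).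
Let killed n : H := sgint F t (cls mu (fun v => V v * ibox n%:R v)).
Let mass n : H := surviving n + killed n.

(** Symmetry puts the semigroup and the time integral on h, where [mass_identity] applies to the
    density that appears. *)
Lemma mass_test n h : tester h -> ip (mass n) (cls mu h : H) =
  \int[mu]_v ((rep (sg F t (cls mu h)) v + V v * rep (sgint F t (cls mu h)) v) * ibox n%:R v).
Proof.
move=> th; have i2 := tester_l2 (ibox_tester (n%:R : R)).
rewrite /mass ipDl /surviving /killed sg_sym sgint_sym // ip_sym (ip_cls_r _ i2).
rewrite ip_sym (ip_cls_r _ (V_ibox_l2 n)) /dotm -RintegralD //.
- by apply: eq_Rintegral => v _; ring.
- exact: (l2_integrable (rep_l2 _) i2).
- exact: (l2_integrable (rep_l2 _) (V_ibox_l2 n)).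
Qed.

Lemma density_integrable h : tester h -> mu.-integrable setT (EFin \o (fun v =>
  rep (sg F t (cls mu h)) v + V v * rep (sgint F t (cls mu h)) v)).
Proof.
move=> th; have i1 := sg_integrable (@W_cinf R) th t.
exact: (integrableD measurableT i1 (V_sgint_integrable th t_ge0)).
Qed.

Lemma density_integral h : tester h ->
  \int[mu]_v (rep (sg F t (cls mu h)) v + V v * rep (sgint F t (cls mu h)) v) = \int[mu]_v h v.
Proof.
move=> th; rewrite RintegralD //; first exact: mass_identity.
- exact: sg_integrable.
- exact: V_sgint_integrable.
Qed.

Lemma density_ge0 h : tester h -> \forall v \ae mu,
  0 <= rep (sg F t (cls mu h)) v + V v * rep (sgint F t (cls mu h)) v.
Proof.
move=> th; have h0 := h_nonneg th.
move: (sg_nonneg (@W_cinf R) t h0) (sgint_nonneg (@W_cinf R) t_ge0 h0).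
by apply: aeS2 => v a b; rewrite addr_ge0 // mulr_ge0 // V_ge0.
Qed.

Lemma surviving_monotone : \forall v \ae mu, (forall n, 0 <= rep (surviving n) v) /\
  nondecreasing_seq (fun n => rep (surviving n) v).
Proof.
apply: (@positive_monotone _ (sg F t) (fun n => ibox n%:R)).
- exact: sgB.
- by move=> x; exact: sg_nonneg.
- by move=> n; exact/tester_l2/ibox_tester.
- by move=> n v; exact: ibox_ge0.
- by move=> v m n mn; apply: ibox_le; rewrite ler_nat.
Qed.

Lemma killed_monotone : \forall v \ae mu, (forall n, 0 <= rep (killed n) v) /\
  nondecreasing_seq (fun n => rep (killed n) v).
Proof.
apply: (@positive_monotone _ (sgint F t) (fun n v => V v * ibox n%:R v)).
- by move=> x y; exact: sgintB.
- by move=> x; exact: sgint_nonneg.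
- exact: V_ibox_l2.
- by move=> n v; rewrite mulr_ge0 ?ibox_ge0 ?V_ge0.
- by move=> v m n mn; rewrite ler_wpM2l ?V_ge0 // ibox_le // ler_nat.
Qed.

Lemma mass_monotone : \forall v \ae mu, nondecreasing_seq (fun n => rep (mass n) v).
Proof.
have e : \forall v \ae mu, forall n, rep (mass n) v = rep (surviving n) v + rep (killed n) v.
  apply/ae_foralln => n; have := repD (surviving n) (killed n).
  by apply: aeS => v ->.
move: e surviving_monotone killed_monotone; apply: aeS3 => v e [_ a] [_ b] m n mn.
by have := lerD (a _ _ mn) (b _ _ mn); rewrite -(e m) -(e n).
Qed.

(** Dually: the pairing with h is the integral over a box of a nonnegative density whose full
    integral is that of h. *)
Lemma mass_in_unit n : in_unit (mass n).
Proof.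
apply: in_unit_dual.
  have e : \forall v \ae mu, rep (mass n) v = rep (surviving n) v + rep (killed n) v.
    by have := repD (surviving n) (killed n); apply: aeS => v ->.
  move: e surviving_monotone killed_monotone.
  by apply: aeS3 => v e [a _] [b _]; rewrite e; exact: (addr_ge0 (a n) (b n)).
move=> h th; rewrite mass_test // -(density_integral th).
by apply: ibox_integral_le; [exact: density_integrable|exact: density_ge0].
Qed.

Lemma mass_test_cvg h : tester h -> ip (mass n) (cls mu h : H) @[n --> \oo] --> \int[mu]_v h v.
Proof.
move=> th; rewrite -(density_integral th).
under eq_fun do rewrite (mass_test _ th).
exact/ibox_integral_cvg/density_integrable.
Qed.

(** The sequence increases and is bounded by 1, so it has a limit s <= 1. The integrals of s and of
    1 over every box agree by [mass_test_cvg], hence s = 1 almost everywhere. *)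
Lemma mass_cvg1 : \forall v \ae mu, rep (mass n) v @[n --> \oo] --> (1 : R).
Proof.
(* The upper limit is measurable, and clamping gives bounds that hold at every point. *)
pose s v := Num.min 1 (Num.max 0 (fine (limn_esup (fun n => (rep (mass n) v)%:E)))).
have s01 v : 0 <= s v <= 1 by rewrite /s le_min ler01 le_max lexx ge_min lexx.
have mm n := l2_measurable (rep_l2 (mass n)).
have ms : @measurable_fun _ _ B mR setT s.
  apply: measurable_minr => //; apply: measurable_maxr => //.
  apply: measurableT_comp => //; apply: measurable_fun_limn_esup => n.
  by apply/measurable_EFinP; exact: mm.
have m01 : \forall v \ae mu, forall n, 0 <= rep (mass n) v <= 1.
  by apply/ae_foralln => n; exact: mass_in_unit.
have cs : \forall v \ae mu, rep (mass n) v @[n --> \oo] --> s v.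
  move: m01 mass_monotone; apply: aeS2 => v v01 vle.
  have c : cvgn (fun n => rep (mass n) v).
    apply: nondecreasing_is_cvgn => //; exists 1 => _ [n _ <-].
    by have /andP[] := v01 n.
  have ce : (rep (mass n) v)%:E @[n --> \oo] --> (limn (fun n => rep (mass n) v))%:E.
    by apply: cvg_EFin => //; exact: nearW.
  rewrite /s (cvg_limn_einf_sup ce).2 /= max_r ?min_r //.
    by apply: limr_le => //; apply: nearW => n; have /andP[] := v01 n.
  by apply: limr_ge => //; apply: nearW => n; have /andP[] := v01 n.
have si N : \int[mu]_v (s v * ibox N%:R v) = \int[mu]_v ibox N%:R v.
  have tN := ibox_tester (N%:R : R).
  have l1 : ip (mass n) (cls mu (ibox N%:R) : H) @[n --> \oo] --> \int[mu]_v (s v * ibox N%:R v).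
    rewrite [X in X @ _](_ : _ = fun n => \int[mu]_v (rep (mass n) v * ibox N%:R v)); last first.
      by apply/funext => n; rewrite ip_cls_r //; exact: tester_l2.
    apply: (@Rintegral_cvg _ _ _ mu _ _ (ibox N%:R)).
    - by move=> n; apply: measurable_funM; [exact: mm|exact: ibox_measurable].
    - by apply: measurable_funM => //; exact: ibox_measurable.
    - by move: cs; apply: aeS => v vs; apply: cvgM => //; exact: cvg_cst.
    - exact: tester_integrable.
    - move: m01; apply: aeS => v v01 n; have /andP[a b] := v01 n.
      by rewrite normrM (ger0_norm a) (ger0_norm (ibox_ge0 _ _)) ler_piMl // ibox_ge0.
  exact: (cvg_unique (@Rhausdorff R) l1 (mass_test_cvg tN)).
have z : \forall v \ae mu, forall N : nat, ibox (N%:R : R) v - s v * ibox N%:R v = 0.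
  apply/ae_foralln => N; have iN := tester_integrable (ibox_tester (N%:R : R)).
  have isN : mu.-integrable setT (EFin \o (fun v => s v * ibox N%:R v)).
    apply: le_integrable iN => //.
      by apply/measurable_EFinP; apply: measurable_funM => //; exact: ibox_measurable.
    move=> v _; have /andP[a b] := s01 v; rewrite lee_fin normrM ler_piMl //.
    by rewrite ger0_norm.
  apply: ae_eq0_of_integral.
  - exact: (integrableB measurableT iN isN).
  - by apply: aeW => v; have /andP[_ s1] := s01 v; rewrite subr_ge0 ler_piMl // ibox_ge0.
  - by rewrite RintegralB // si subrr.
move: cs z; apply: aeS2 => v vs z.
have [N _ /(_ N (leqnn N))/= i1] := ibox_near1 v.
suff -> : 1 = s v by [].
by have := z N; rewrite i1 mulr1 => /eqP; rewrite subr_eq0 => /eqP.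
Qed.

End FixedTime.

Lemma surface_conservation : generalized_conservative mu (@V R) (heat (@W_cinf R)).
Proof.
move=> t t0.
exists (fun f => rep (sgint F t (cls mu f))).
exists (fun v => limn (fun n => (rep (sg F t (cls mu (ibox n%:R))) v)%:E)).
exists (fun v => limn (fun n => (rep (sgint F t (cls mu (fun v => V v * ibox n%:R v))) v)%:E)).
have ca : \forall v \ae mu, cvgn (fun n => (rep (sg F t (cls mu (ibox n%:R))) v)%:E) /\
    (0 <= limn (fun n => (rep (sg F t (cls mu (ibox n%:R))) v)%:E))%E.
  by move: (surviving_monotone t); apply: aeS => v [h0 h]; exact: nonneg_limn.
have cb : \forall v \ae mu,
    cvgn (fun n => (rep (sgint F t (cls mu (fun v => V v * ibox n%:R v))) v)%:E) /\
    (0 <= limn (fun n => (rep (sgint F t (cls mu (fun v => V v * ibox n%:R v))) v)%:E))%E.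
  by move: (killed_monotone t0); apply: aeS => v [h0 h]; exact: nonneg_limn.
split.
- move=> f f2; split; first exact: rep_l2.
  move=> h h2; have := sgintP F (cls mu f) (cls mu h) (ltW t0).
  have e x : ip x (cls mu h) = dotm mu (rep x) h := ip_cls_r x h2.
  rewrite /time_pairing; under eq_Rintegral do rewrite e.
  by rewrite e.
- exists (fun n => ibox n%:R); split.
  + by move=> n; exact/tester_l2/ibox_tester.
  + apply: aeW => v; split => [n|m n mn]; first exact: ibox_ge0.
    by apply: ibox_le; rewrite ler_nat.
  + apply: aeW => v; apply: cvg_EFin; first exact: nearW.
    exact: ibox_cvg.
  + by move: ca; apply: aeS => v [].
- exists (fun n v => V v * ibox n%:R v); split.
  + exact: V_ibox_l2.
  + apply: aeW => v; split => [n|m n mn]; first by rewrite mulr_ge0 ?ibox_ge0 ?V_ge0.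
    by rewrite ler_wpM2l ?V_ge0 // ibox_le // ler_nat.
  + apply: aeW => v; apply: cvg_EFin; first exact: nearW.
    rewrite -[X in _ --> X]mulr1.
    by apply: cvgM; [exact: cvg_cst|exact: ibox_cvg].
  + by move: cb; apply: aeS => v [].
- have e : \forall v \ae mu, forall n,
      rep (sg F t (cls mu (ibox n%:R)) + sgint F t (cls mu (fun v => V v * ibox n%:R v)) : H) v =
      rep (sg F t (cls mu (ibox n%:R))) v + rep (sgint F t (cls mu (fun v => V v * ibox n%:R v))) v.
    apply/ae_foralln => n.
    have := repD (sg F t (cls mu (ibox n%:R))) (sgint F t (cls mu (fun v => V v * ibox n%:R v))).
    by apply: aeS => v ->.
  move: ca cb (mass_cvg1 t0) e; apply: aeS4 => v [ca a0] [cb b0] c1 e.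
  exact: limnD_eq1 ca cb a0 b0 e c1.
Qed.

End GeneralizedConservation.

(** * Stochastic incompleteness *)

Section TimeLimit.
Context (R : realType).
Local Notation leb := (@lebesgue_measure R).

Lemma time_cvg (t c C : R) (p_ : nat -> R -> R) : 0 < t -> (forall n, continuous (p_ n)) ->
  (forall n s, `|p_ n s| <= C) -> (forall s, 0 <= s -> p_ n s @[n --> \oo] --> c) ->
  \int[leb]_(s in `[0, t]) p_ n s @[n --> \oo] --> t * c.
Proof.
move=> t0 p_c pC pc; have mD : measurable (`[0, t]%classic : set (measurableTypeR R)) by [].
pose D : set (measurableTypeR R) := `[0, t]%classic.
have lD : leb D = t%:E by rewrite lebesgue_segment ?subr0 // ltW.
have ci (a : R) : leb.-integrable D (EFin \o fun=> a).
  by apply: integrable_continuous => s; exact: cvg_cst.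
have pi n : leb.-integrable D (EFin \o p_ n) by exact: integrable_continuous.
have [||||_ _ h] := @dominated_convergence _ _ _ leb D mD
  (fun n => EFin \o p_ n) (EFin \o (fun=> c)) (EFin \o (fun=> C)) _ _ _ (ci C).
- by move=> n; exact: (measurable_int _ (pi n)).
- exact: (measurable_int _ (ci c)).
- apply: aeW => s; rewrite /D /= in_itv /= => /andP[s0 _].
  by apply: cvg_EFin; [exact: nearW|exact: pc].
- by apply: aeW => s n _; rewrite lee_fin; exact: pC.
rewrite mulrC -[X in _ * X]/(fine t%:E) -lD -(Rintegral_cst _ mD).
rewrite /Rintegral; apply: fine_cvg; rewrite fineK; first exact: h.
exact: (integrable_fin_num mD (ci c)).
Qed.

End TimeLimit.

(** * A conservative semigroup preserves integrals *)

Section MassOfConservativeSemigroup.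
Context (R : realType).
Local Notation P := 'rV[R]_2.
Local Notation B := (borel P).
Local Notation mR := (measurableTypeR R).
Local Notation leb := (@lebesgue_measure R).
Local Notation pdir := (fun k : 'I_2 => delta_mx 0 k : P).
Local Notation mu := (@mu R).
Local Notation H := (l2_hilbert mu).
Implicit Types (v w : P) (f g h : P -> R) (u x y : H).
Variable W : P -> R.
Hypothesis W_cinf : cinf pdir W.
Local Notation F := (dirichlet_form W_cinf).

Lemma l2_norm g : l2 mu g -> l2 mu (fun v => `|g v|).
Proof.
move=> g2; apply: (l2_dominated _ g2); last by move=> v; rewrite normr_id.
by apply: measurableT_comp => //; exact: (l2_measurable g2).
Qed.

Lemma rep_le x y : nonneg (y - x) -> \forall v \ae mu, rep x v <= rep y v.
Proof.
move=> h; have e := repB y x; move: h e; apply: aeS2 => v h e.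
by rewrite -subr_ge0 -e.
Qed.

(** Positivity applied to |g| - g and |g| + g. *)
Lemma sg_norm_le t g : l2 mu g ->
  \forall v \ae mu, `|rep (sg F t (cls mu g)) v| <= rep (sg F t (cls mu (fun v => `|g v|))) v.
Proof.
move=> g2; have ag2 := l2_norm g2.
have ng2 := l2N g2.
have up : nonneg (sg F t (cls mu (fun v => `|g v|)) - sg F t (cls mu g)).
  rewrite -sgB; apply: sg_nonneg; rewrite -(clsB ag2 g2); apply: nonneg_cls; first exact: l2B.
  by apply: aeW => v; rewrite !fctE subr_ge0 ler_norm.
have lo : nonneg (sg F t (cls mu (fun v => `|g v|)) - sg F t (cls mu (- g))).
  rewrite -sgB; apply: sg_nonneg; rewrite -(clsB ag2 ng2); apply: nonneg_cls; first exact: l2B.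
  by apply: aeW => v; rewrite !fctE opprK -normrN -lerBlDr sub0r ler_norm.
have e : sg F t (cls mu (- g)) = - sg F t (cls mu g).
  have -> : cls mu (- g) = (-1) *: (cls mu g : H) by rewrite -(clsZ (-1) g2) scaleN1r.
  by rewrite sgZ scaleN1r.
have en := repN (sg F t (cls mu g)); rewrite e in lo.
move: (rep_le up) (rep_le lo) en; apply: aeS3 => v a b en; rewrite en in b.
by rewrite ler_norml lerNl b a.
Qed.

Lemma ae_le_integrable f g : @measurable_fun _ _ B mR setT f ->
  mu.-integrable setT (EFin \o g) -> (\forall v \ae mu, `|f v| <= g v) ->
  mu.-integrable setT (EFin \o f).
Proof.
move=> mf gi fg; have mg : @measurable_fun _ _ B mR setT g by exact/measurable_EFinP/measurable_int/gi.
apply/integrableP; split; first exact/measurable_EFinP.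
have /integrableP[_] := gi; apply: le_lt_trans.
apply: ae_ge0_le_integral => //.
- by apply: measurableT_comp => //; exact/measurable_EFinP.
- by apply: measurableT_comp => //; exact/measurable_EFinP.
- move: fg; apply: aeS => v fg _ /=; rewrite lee_fin; apply: le_trans fg _.
  exact: ler_norm.
Qed.

Lemma norm_dotm_le f g : l2 mu f -> l2 mu g -> mu.-integrable setT (EFin \o g) ->
  (\forall v \ae mu, 0 <= (f v : R) <= 1) -> `|dotm mu g f| <= \int[mu]_v `|g v|.
Proof.
move=> f2 g2 gi f01; have gfi := l2_integrable g2 f2.
apply: le_trans (le_normr_Rintegral _ _) _ => //.
have [mg mf] := (l2_measurable g2, l2_measurable f2).
rewrite -subr_ge0 -RintegralB //; [|exact: (integrable_abse gi)|exact: (integrable_abse gfi)].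
apply: ae_Rintegral_ge0.
  by apply: measurable_funB; apply: measurableT_comp => //; exact: measurable_funM.
move: f01; apply: aeS => v /andP[a b].
by rewrite normrM subr_ge0 ler_piMr // ger0_norm.
Qed.

Lemma dotm_cvg_integral (f_ : nat -> P -> R) g : (forall n, l2 mu (f_ n)) ->
  mu.-integrable setT (EFin \o g) -> (\forall v \ae mu, forall n, 0 <= f_ n v <= 1) ->
  (\forall v \ae mu, f_ n v @[n --> \oo] --> (1 : R)) ->
  dotm mu g (f_ n) @[n --> \oo] --> \int[mu]_v g v.
Proof.
move=> f2 gi f01 f1; have mg : @measurable_fun _ _ B mR setT g by exact/measurable_EFinP/measurable_int/gi.
apply: (@Rintegral_cvg _ _ _ mu _ _ (fun v => `|g v|)).
- by move=> n; apply: measurable_funM => //; exact: (l2_measurable (f2 n)).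
- exact: mg.
- move: f1; apply: aeS => v f1; rewrite -[X in _ --> X]mulr1.
  by apply: cvgM => //; exact: cvg_cst.
- exact: (integrable_abse gi).
- move: f01; apply: aeS => v f01 n; have /andP[a b] := f01 n.
  by rewrite normrM ler_piMr // ger0_norm.
Qed.

Lemma sg_integrable1 t g : l2 mu g -> mu.-integrable setT (EFin \o g) ->
  mu.-integrable setT (EFin \o rep (sg F t (cls mu g))).
Proof.
move=> g2 gi; have ag2 := l2_norm g2; have agi := integrable_abse gi.
have a0 : nonneg (cls mu (fun v => `|g v|) : H) by apply: nonneg_cls => //; apply: aeW.
have [||n|+ _] := @nonneg_integrable R _ (fun=> 1) (\int[mu]_v `|g v|) (sg_nonneg W_cinf t a0).
- exact: (cinf_cont (cinf_cst pdir 1)).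
- by move=> v; exact: ler01.
- rewrite (_ : (fun v => 1 * _) = ibox n%:R); last by apply/funext => v; rewrite mul1r.
  have i1 : in_unit (sg F t (cls mu (ibox n%:R))).
    exact/sg_in_unit/tester_in_unit/ibox_tester.
  rewrite sg_sym ip_sym (ip_cls_r _ ag2) dotmC; apply: le_trans (ler_norm _) _.
  have := norm_dotm_le (rep_l2 _) ag2 agi i1.
  by under eq_Rintegral do rewrite normr_id.
move=> i; apply: (ae_le_integrable (l2_measurable (rep_l2 _)) _ (sg_norm_le t g2)).
by move: i; congr integrable; apply/funext => v; rewrite /= mul1r.
Qed.

Hypothesis cons : conservative mu (heat W_cinf).

(** Let f_n increase to 1 as in the extension to L^+. Pairing T_t g with f_n equals pairing g with
    T_t f_n, and both f_n and T_t f_n stay in [0, 1] and tend to 1. *)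
Lemma conservative_mass t g : 0 < t -> l2 mu g -> mu.-integrable setT (EFin \o g) ->
  \int[mu]_v rep (sg F t (cls mu g)) v = \int[mu]_v g v.
Proof.
move=> t0 g2 gi; have Gi := sg_integrable1 t g2 gi.
have [f [f2 f0 f1 h1]] := cons t0.
have f01 : \forall v \ae mu, forall n, 0 <= f n v <= 1.
  move: f0 f1; apply: aeS2 => v [f0 fle] f1 n; rewrite f0 /=.
  have /fine_cvgP[_ f1'] := f1.
  by rewrite -(cvg_lim _ f1') //; apply: nondecreasing_cvgn_le => //; apply/cvg_ex; exists 1.
have h01 : \forall v \ae mu, forall n, 0 <= heat W_cinf t (f n) v <= 1.
  apply/ae_foralln => n; apply: sg_in_unit; apply: in_unit_cls; first exact: f2.
  by move: f01; apply: aeS => v.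
have l1 : dotm mu (rep (sg F t (cls mu g))) (f n) @[n --> \oo] -->
    \int[mu]_v rep (sg F t (cls mu g)) v.
  apply: dotm_cvg_integral => //.
  by move: f1; apply: aeS => v /fine_cvgP[].
have l2 : dotm mu g (heat W_cinf t (f n)) @[n --> \oo] --> \int[mu]_v g v.
  apply: dotm_cvg_integral => //; first by move=> n; exact: rep_l2.
  by move: h1; apply: aeS => v /fine_cvgP[].
apply: (cvg_unique (@Rhausdorff R) l1).
rewrite [X in X @ _](_ : _ = fun n => dotm mu g (heat W_cinf t (f n))) //.
apply/funext => n; rewrite -(ip_cls_r _ (f2 n)) sg_sym ip_sym (ip_cls_r _ g2) dotmC.
by [].
Qed.

(** The time integral of T_s k, which is T_t phi - phi, is paired with indicators of growing boxes
    and evaluated twice: by [conservative_mass] for phi the limit is 0, by [conservative_mass] for k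
    at each time it is t times the integral of k. *)
Lemma conservative_integral_op (t : R) phi k : 0 < t -> l2 mu phi -> mu.-integrable setT (EFin \o phi) ->
  l2 mu k -> mu.-integrable setT (EFin \o k) -> op F (cls mu phi) (cls mu k) ->
  \int[mu]_v k v = 0.
Proof.
move=> t0 phi2 phii k2 ki opk.
have i2 n := tester_l2 (ibox_tester (n%:R : R)).
have ib1 : \forall v \ae mu, forall n, 0 <= ibox (n%:R : R) v <= 1.
  by apply: aeW => v n; rewrite ibox_ge0 ibox_le1.
have ibc : \forall v \ae mu, ibox n%:R v @[n --> \oo] --> (1 : R).
  by apply: aeW => v; exact: ibox_cvg.
have l1 : ip (sgint F t (cls mu k)) (cls mu (ibox n%:R) : H) @[n --> \oo] --> (0 : R).
  rewrite -(subrr (\int[mu]_v phi v)) -{1}(conservative_mass t0 phi2 phii).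
  rewrite [X in X @ _](_ : _ = fun n => dotm mu (rep (sg F t (cls mu phi))) (ibox n%:R) -
      dotm mu phi (ibox n%:R)); last first.
    apply/funext => n; rewrite (sgint_op (ltW t0) opk) ipBl (ip_cls_r _ (i2 n)).
    by rewrite (ip_cls phi2 (i2 n)).
  by apply: cvgB; apply: dotm_cvg_integral => //; exact: sg_integrable1.
have l2 : ip (sgint F t (cls mu k)) (cls mu (ibox n%:R) : H) @[n --> \oo] -->
    t * \int[mu]_v k v.
  rewrite [X in X @ _](_ : _ = fun n => \int[leb]_(s in `[0, t]) ip (sg F s (cls mu k)) (cls mu (ibox n%:R))); last first.
    by apply/funext => n; rewrite sgintP // ltW.
  apply: (@time_cvg _ t (\int[mu]_v k v) (\int[mu]_v `|k v|)) => //.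
  - by move=> n; exact: ip_sg_continuous.
  - move=> n s; rewrite sg_sym ip_sym (ip_cls_r _ k2) dotmC.
    apply: (norm_dotm_le _ k2 ki) => //; first exact: rep_l2.
    exact/sg_in_unit/tester_in_unit/ibox_tester.
  - move=> s; rewrite le_eqVlt => /orP[/eqP<-|s0].
      rewrite sg0 // [X in X @ _](_ : _ = fun n => dotm mu k (ibox n%:R)); first exact: dotm_cvg_integral.
      by apply/funext => n; rewrite (ip_cls k2 (i2 n)).
    rewrite -(conservative_mass s0 k2 ki).
    rewrite [X in X @ _](_ : _ = fun n => dotm mu (rep (sg F s (cls mu k))) (ibox n%:R)).
      by apply: dotm_cvg_integral => //; exact: sg_integrable1.
    by apply/funext => n; rewrite (ip_cls_r _ (i2 n)).
have e : 0 = t * \int[mu]_v k v by exact: (cvg_unique (@Rhausdorff R) l1 l2).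
by move/esym/eqP: e; rewrite mulf_eq0 gt_eqF //= => /eqP.
Qed.

End MassOfConservativeSemigroup.

(** * Integrals of products over boxes *)

Section BoxIntegrals.
Context (R : realType).
Local Notation P := 'rV[R]_2.
Local Notation B := (borel P).
Local Notation mR := (measurableTypeR R).
Local Notation leb := (@lebesgue_measure R).
Local Notation mu := (@mu R).
Local Notation H := (l2_hilbert mu).
Implicit Types (v w : P) (f g h : P -> R) (a b c d : R -> R) (u x y : H).

Lemma Rintegral_segment_derive1 a (r : R) : cinf1 a -> 0 < r ->
  \int[leb]_(x in `[- r, r]) derive1 a x = a r - a (- r).
Proof.
move=> ha r0; have ca := cinf_cont ha; rewrite /Rintegral (@continuous_FTC2 _ (derive1 a) a) //.
- lra.
- exact/continuous_subspaceT/cinf_cont/cinf1_derive.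
- split; [by move=> x _; exact: cinf1_derivable|exact: cvg_at_right_filter (ca _)|].
  exact: cvg_at_left_filter (ca _).
Qed.

Lemma prodf_continuous c d : continuous c -> continuous d -> continuous (prodf c d : P -> R).
Proof.
by move=> cc cd; apply: continuous_mul => v; apply: continuous_comp;
  [exact: coord_continuous|exact: cc|exact: coord_continuous|exact: cd].
Qed.

Lemma ibox_pt (r x y : R) : ibox r (pt x y) = (x \in `[- r, r])%:R * (y \in `[- r, r])%:R.
Proof.
rewrite /ibox -natrM mulnb; congr ((nat_of_bool _)%:R).
by apply/idP/idP; rewrite inE boxP pt0 pt1 !in_itv /= -!ler_norml => /andP.
Qed.

Lemma lam_ibox_integrable g (r : R) : continuous g ->
  (@lam R).-integrable setT (EFin \o (fun v => g v * ibox r v)).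
Proof.
move=> cg; have s0 : 0 < `|r| + 1 by rewrite ltr_wpDl.
have tc := cutoff_test s0; have [_ [s cs]] := tc.
have i : (@lam R).-integrable setT (EFin \o (fun v => g v * cutoff (`|r| + 1) v)).
  apply: (@integrable_supported _ s); last exact: supportedMr.
  exact: continuous_mul cg (test_fun_cont tc).
apply: (le_integrable measurableT _ _ i).
  apply/measurable_EFinP; apply: measurable_funM; last exact: ibox_measurable.
  exact: continuous_measurable.
move=> v _; rewrite lee_fin normrM [leRHS]normrM ler_wpM2l //.
have [vb|vb] := pselect (box r v); last by rewrite /ibox memNset // normr0.
have [b0 b1] := iffLR (boxP _ _) vb.
have rr : r <= `|r| + 1 by apply: le_trans (ler_norm r) _; rewrite lerDl.
by rewrite cutoff_eq1 ?(le_trans b0) ?(le_trans b1) // normr1 ger0_norm ?ibox_ge0 // ibox_le1.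
Qed.

Lemma integral_prodf_ibox c d (r : R) : continuous c -> continuous d ->
  (\int[@lam R]_v (prodf c d v * ibox r v)%:E =
   ((\int[leb]_(x in `[- r, r]) c x) * \int[leb]_(y in `[- r, r]) d y)%:E)%E.
Proof.
move=> cc cd; have ci := @lam_ibox_integrable _ r (prodf_continuous cc cd).
have seg a : continuous a -> leb.-integrable `[- r, r] (EFin \o a).
  move=> ca; apply: continuous_compact_integrable; first exact: segment_compact.
  exact: continuous_subspaceT.
have one a (z : R) : continuous a ->
  (\int[leb]_x (z * a x * (x \in `[- r, r])%:R)%:E = (z * \int[leb]_(x in `[- r, r]) a x)%:E)%E.
  move=> ca; rewrite EFinM /Rintegral fineK; last exact: integrable_fin_num (seg _ ca).
  rewrite -integralZl //; last exact: seg.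
  rewrite [RHS]integral_mkcond; apply: eq_integral => x _; rewrite patchE.
  case: ifPn => h; first by rewrite mem_setE in h; rewrite h mulr1 EFinM.
  by rewrite mem_setE in h; rewrite (negbTE h) mulr0.
rewrite (integral_lam21 ci).
transitivity (\int[leb]_y ((\int[leb]_(x in `[- r, r]) c x) * d y * (y \in `[- r, r])%:R)%:E)%E.
  apply: eq_integral => y _.
  rewrite (_ : _ * d y * _ = d y * (y \in `[- r, r])%:R * \int[leb]_(x in `[- r, r]) c x); last by ring.
  rewrite -one //; apply: eq_integral => x _; congr EFin.
  by rewrite ibox_pt /prodf pt0 pt1; ring.
exact: one.
Qed.

(** The factor E^-1 cancels the density of mu, so the integral over a box splits into
    one-dimensional ones. *)
Lemma integral_mu_prodf_ibox c d (r : R) : continuous c -> continuous d ->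
  (\int[mu]_v (Einv v * prodf c d v * ibox r v)%:E =
   ((\int[leb]_(x in `[- r, r]) c x) * \int[leb]_(y in `[- r, r]) d y)%:E)%E.
Proof.
move=> cc cd; rewrite integral_mu.
  rewrite -(integral_prodf_ibox r cc cd); apply: eq_integral => v _; rewrite -EFinM; congr EFin.
  rewrite -[RHS]mul1r -(EinvK v); ring.
apply/measurable_EFinP; apply: measurable_funM; last exact: ibox_measurable.
apply: continuous_measurable; apply: continuous_mul; last exact: prodf_continuous.
exact: (cinf_cont (@Einv_cinf R)).
Qed.

Lemma sqr_lt_abs (x e : R) : 0 < e -> 0 <= x -> x ^+ 2 < e ^+ 2 -> x < e.
Proof. by move=> e0 x0; rewrite ltr_pXn2r // ?nnegrE // ltW. Qed.

(** Dominated convergence in L^2: the squared distance has the integrable majorant (2 g)^2. *)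
Lemma cls_cvg (f_ : nat -> P -> R) f g : l2 mu g -> (forall v, 0 <= g v) ->
  (forall n, @measurable_fun _ _ B mR setT (f_ n)) -> @measurable_fun _ _ B mR setT f ->
  (forall n v, `|f_ n v| <= g v) -> (forall v, `|f v| <= g v) ->
  (forall v, f_ n v @[n --> \oo] --> f v) -> (cls mu (f_ n) : H) @[n --> \oo] --> (cls mu f : H).
Proof.
move=> g2 g0 mf_ mf f_g fg f_f.
have f_2 n : l2 mu (f_ n).
  by apply: (l2_dominated (mf_ n) g2) => v; apply: le_trans (f_g n v) (ler_norm _).
have f2 : l2 mu f by apply: (l2_dominated mf g2) => v; apply: le_trans (fg v) (ler_norm _).
have d : dotm mu (f_ n - f) (f_ n - f) @[n --> \oo] --> (0 : R).
  have -> : 0 = \int[mu]_(v in setT) (0 : R) :> R by rewrite Rintegral_cst // mul0r.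
  have g22 := l2_integrable g2 g2.
  apply: (@Rintegral_cvg _ _ _ mu _ _ (fun v => 4 * (g v * g v))).
  - by move=> n; have m := l2_measurable (l2B (f_2 n) f2); exact: measurable_funM.
  - exact: measurable_cst.
  - apply: aeW => v; rewrite -(mulr0 0).
    have z : (f_ n - f) v @[n --> \oo] --> (0 : R).
      by rewrite -(subrr (f v)); apply: cvgB => //; exact: cvg_cst.
    exact: cvgM.
  - exact: (integrableZl measurableT 4 g22).
  - apply: aeW => v n; have h : `|(f_ n - f) v| <= 2 * g v.
      by rewrite !fctE; apply: le_trans (ler_normB _ _) _; have := f_g n v; have := fg v; lra.
    rewrite normrM (_ : 4 * (g v * g v) = (2 * g v) * (2 * g v)); last by ring.
    exact: ler_pM.
apply/cvgrPdist_lt => e e0.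
have e2 : 0 < e ^+ 2 by rewrite exprn_gt0.
have /cvgrPdist_lt/(_ _ e2) := d; apply: filterS => n.
have d2 := l2B (f_2 n) f2.
have nE : `|(cls mu (f_ n) : H) - cls mu f| ^+ 2 = dotm mu (f_ n - f) (f_ n - f).
  by rewrite -(clsB (f_2 n) f2) norm_sq (ip_cls d2 d2).
rewrite sub0r normrN ger0_norm ?dotm_ge0 // -nE distrC => h.
exact: sqr_lt_abs e0 (normr_ge0 _) h.
Qed.

End BoxIntegrals.

(** * Explicit majorants *)

Section Majorants.
Context (R : realType).
Local Notation P := 'rV[R]_2.
Local Notation B := (borel P).
Local Notation mR := (measurableTypeR R).
Local Notation leb := (@lebesgue_measure R).
Local Notation mu := (@mu R).
Implicit Types (v w : P) (f g h : P -> R) (a b c d : R -> R).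

(** Its derivative [rho] is an explicit positive function whose integral over a segment is a
    difference of two values in [0, 1]; [rho] behaves like e^-x for large x. *)
Definition logistic (x : R) : R := (1 + expR (- x))^-1.
Definition rho : R -> R := derive1 logistic.
Definition decay (x : R) : R := expR (- expR x).

Lemma cinf1_expRN : cinf1 (fun x : R => expR (- x)).
Proof. by apply: (cinf_comp (@cinf1_expR R)); apply: cinfN; exact: cinf1_id. Qed.

Lemma one_expRN_gt0 (x : R) : 0 < 1 + expR (- x).
Proof. by rewrite addr_gt0 ?expR_gt0. Qed.

Lemma logistic_cinf : cinf1 logistic.
Proof.
apply: cinfV; last by move=> x; rewrite gt_eqF // one_expRN_gt0.
exact: (cinfD (@cinf1_cst R 1) cinf1_expRN).
Qed.

Lemma logistic_bound x : 0 <= logistic x <= 1.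
Proof.
rewrite invr_ge0 (ltW (one_expRN_gt0 x)) /= invf_le1 ?one_expRN_gt0 //.
by rewrite lerDl expR_ge0.
Qed.

Lemma derive1_expRN (x : R) : derive1 (fun x : R => expR (- x)) x = - expR (- x).
Proof.
rewrite (@derive1_comp_c R expR (fun x => - x)) ?derive1_expR.
- by rewrite derive1E (_ : (fun x => - x) = - id) // deriveN // derive_id mulrN1.
- exact: cinf1_expR.
- by apply: cinfN; exact: cinf1_id.
Qed.

Lemma rhoE x : rho x = expR (- x) * logistic x ^+ 2.
Proof.
have d0 : derivable (fun x : R => 1 + expR (- x)) x 1.
  exact: (cinf1_derivable (cinfD (@cinf1_cst R 1) cinf1_expRN)).
have d1 : derivable (fun x : R => expR (- x)) x 1 := cinf1_derivable cinf1_expRN.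
rewrite /rho derive1E /logistic deriveV ?gt_eqF ?one_expRN_gt0 //.
have -> : 'D_1 (fun x : R => 1 + expR (- x)) x = - expR (- x).
  have := @deriveD _ _ _ (fun _ : R => (1 : R)) (fun x : R => expR (- x)) x 1 (@derivable_cst _ _ _ _ _ _) d1.
  by rewrite derive_cst add0r -(derive1E (fun x : R => expR (- x))) derive1_expRN.
by rewrite /GRing.scale /= exprVn; ring.
Qed.

Lemma rho_ge0 x : 0 <= rho x.
Proof. by rewrite rhoE mulr_ge0 ?expR_ge0 ?sqr_ge0. Qed.

Lemma rho_gt0 x : 0 < rho x.
Proof. by rewrite rhoE mulr_gt0 ?expR_gt0 // exprn_gt0 // invr_gt0 one_expRN_gt0. Qed.

Lemma rho_le1 x : rho x <= 1.
Proof.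
have /andP[l0 l1] := logistic_bound x.
have e : logistic x * (1 + expR (- x)) = 1 by rewrite mulVf // gt_eqF // one_expRN_gt0.
rewrite rhoE (_ : _ * _ = logistic x * (logistic x * (1 + expR (- x))) - logistic x ^+ 2); last by ring.
rewrite e mulr1; have := sqr_ge0 (logistic x); lra.
Qed.

Lemma rho_continuous : continuous rho.
Proof. exact: (cinf_cont (cinf1_derive logistic_cinf)). Qed.

Lemma decay_bound x : 0 <= decay x <= 1.
Proof. by rewrite expR_ge0 -expR0 ler_expR oppr_le0 expR_ge0. Qed.

Lemma decay_le x : decay x <= expR (- x).
Proof. by rewrite ler_expR lerN2; have := expR_ge1Dx x; lra. Qed.

Lemma decay_cinf : cinf1 decay.
Proof. by apply: (cinf_comp (@cinf1_expR R)); apply: cinfN; exact: cinf1_expR. Qed.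

Lemma Einv_decay v : Einv v = decay (v 0 0).
Proof. by rewrite /Einv /E /decay expRN. Qed.

Lemma rho_integral_le1 n : \int[leb]_(x in `[- n%:R, n%:R]) rho x <= 1.
Proof.
have [->|n0] := eqVneq n 0; first by rewrite oppr0 set_itv1 Rintegral_set1.
rewrite (Rintegral_segment_derive1 logistic_cinf) ?ltr0n ?lt0n //.
have /andP[_ b1] := logistic_bound n%:R; have /andP[a0 _] := logistic_bound (- n%:R).
by move: a0 b1; lra.
Qed.

Lemma rho_integral_ge0 n : 0 <= \int[leb]_(x in `[- n%:R, n%:R]) rho x.
Proof. by apply: Rintegral_ge0 => x _; exact: rho_ge0. Qed.

(** Two majorants are needed. [majorant1] is integrable and controls psi and its Laplacian. The
    truncations of psi have Laplacians with an extra e^x, and are only controlled by [majorant2],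
    which is square integrable. *)
Definition majorant1 v : R := Einv v * prodf rho rho v.
Definition majorant2 v : R := decay (v 0 0) * logistic (v 0 0) * rho (v 0 1).

Lemma majorant1_ge0 v : 0 <= majorant1 v.
Proof. by rewrite mulr_ge0 ?invr_ge0 ?(ltW (E_gt0 v)) // mulr_ge0 ?rho_ge0. Qed.

Lemma majorant2_ge0 v : 0 <= majorant2 v.
Proof.
have /andP[a _] := decay_bound (v 0 0); have /andP[b _] := logistic_bound (v 0 0).
by rewrite mulr_ge0 ?rho_ge0 // mulr_ge0.
Qed.

Lemma majorant1_integrable : mu.-integrable setT (EFin \o majorant1).
Proof.
have m : @measurable_fun _ _ B mR setT majorant1.
  apply: continuous_measurable; apply: continuous_mul; first exact: (cinf_cont (@Einv_cinf R)).
  exact: prodf_continuous rho_continuous rho_continuous.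
have [|//] := @integrable_of_boxes R majorant1 1 m.
move=> n.
under eq_integral do rewrite ger0_norm ?majorant1_ge0 //.
rewrite (integral_mu_prodf_ibox _ rho_continuous rho_continuous) lee_fin.
by rewrite mulr_ile1 ?rho_integral_ge0 ?rho_integral_le1.
Qed.

(** Its square is at most [majorant1]: one factor [decay] is bounded by e^-x, which with the square
    of [logistic] makes [rho]. *)
Lemma majorant2_l2 : l2 mu majorant2.
Proof.
have m : @measurable_fun _ _ B mR setT majorant2.
  apply: continuous_measurable.
  apply: (@prodf_continuous R (fun x => decay x * logistic x) rho); last exact: rho_continuous.
  exact: (cinf_cont (cinf1_mul decay_cinf logistic_cinf)).
apply/l2P; split => //; have /integrableP[_] := majorant1_integrable; apply: le_lt_trans.
apply: ge0_le_integral => //.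
- by move=> v _; rewrite lee_fin sqr_ge0.
- by apply/measurable_EFinP; exact: measurable_funX.
- by apply: measurableT_comp => //; exact: (measurable_int _ majorant1_integrable).
- move=> v _; rewrite /= lee_fin ger0_norm ?majorant1_ge0 //.
  rewrite /majorant2 /majorant1 Einv_decay /prodf.
  have /andP[q0 q1] := decay_bound (v 0 0); have /andP[l0 _] := logistic_bound (v 0 0).
  have e : (decay (v 0 0) * logistic (v 0 0) * rho (v 0 1)) ^+ 2 =
    decay (v 0 0) * (decay (v 0 0) * logistic (v 0 0) ^+ 2 * (rho (v 0 1) * rho (v 0 1))) by ring.
  rewrite e ler_wpM2l // ler_pM ?mulr_ge0 ?sqr_ge0 ?rho_ge0 //.
    by rewrite [leRHS]rhoE ler_wpM2r ?sqr_ge0 // decay_le.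
  by rewrite ler_piMl ?rho_ge0 ?rho_le1.
Qed.

Lemma majorant1_le v : majorant1 v <= majorant2 v.
Proof.
rewrite /majorant1 /majorant2 Einv_decay /prodf mulrA.
have /andP[q0 q1] := decay_bound (v 0 0); have /andP[l0 l1] := logistic_bound (v 0 0).
rewrite ler_wpM2r ?rho_ge0 // ler_wpM2l //.
have e : logistic (v 0 0) * (1 + expR (- v 0 0)) = 1 by rewrite mulVf // gt_eqF // one_expRN_gt0.
rewrite rhoE (_ : _ * _ = logistic (v 0 0) * (logistic (v 0 0) * (1 + expR (- v 0 0))) - logistic (v 0 0) ^+ 2); last by ring.
by rewrite e mulr1 gerBl sqr_ge0.
Qed.

Lemma half_logistic x : 0 <= x -> 1 <= 2 * logistic x.
Proof.
move=> x0; have e : expR (- x) <= 1 by rewrite -expR0 ler_expR oppr_le0.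
by rewrite /logistic ler_pdivlMr ?one_expRN_gt0 // mul1r; lra.
Qed.

Lemma expRN_le_rho x : 0 <= x -> expR (- x) <= 4 * rho x.
Proof.
move=> /half_logistic h; rewrite rhoE mulrCA ler_peMr ?expR_ge0 //.
have -> : 4 * logistic x ^+ 2 = (2 * logistic x) ^+ 2 by ring.
exact: exprn_ege1.
Qed.

Lemma supported_le_rho b (r : R) : continuous b -> (forall y, r <= `|y| -> b y = 0) ->
  exists2 K, 0 <= K & forall y, `|b y| <= K * rho y.
Proof.
move=> cb b0.
have c : continuous (fun y => b y / rho y).
  move=> y; apply: cvgM; first exact: cb.
  by apply: cvgV; [rewrite gt_eqF // rho_gt0|exact: rho_continuous].
have z (y : R) : r <= `|y| -> b y / rho y = 0 by move=> /b0 ->; rewrite mul0r.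
have [K K0 hK] := bounded_support c z; exists K => // y.
have := hK y; rewrite normrM normfV (ger0_norm (rho_ge0 y)).
by rewrite ler_pdivrMr ?rho_gt0.
Qed.

End Majorants.

(** * The radial profile and its truncations *)

Section Leakage.
Context (R : realType).
Local Notation P := 'rV[R]_2.
Implicit Types (v w : P) (f g h : R -> R) (n : nat) (x : R).

(** The Laplacian of the surface on functions of x alone. *)
Definition lap1 f x : R := derive1 (derive1 f) x + expR x * derive1 f x.

Lemma derive1_add f g x : cinf1 f -> cinf1 g ->
  derive1 (fun x => f x + g x) x = derive1 f x + derive1 g x.
Proof.
move=> hf hg; rewrite !derive1E.
by have := @deriveD _ _ _ f g x 1 (cinf1_derivable hf) (cinf1_derivable hg).
Qed.

Lemma lap1M f g x : cinf1 f -> cinf1 g -> lap1 (fun x => f x * g x) x =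
  lap1 f x * g x + 2 * (derive1 f x * derive1 g x) + f x * lap1 g x.
Proof.
move=> hf hg; have hf' := cinf1_derive hf; have hg' := cinf1_derive hg.
have e : derive1 (fun x => f x * g x) = (fun x => derive1 f x * g x + f x * derive1 g x).
  by apply/funext => y; exact: derive1_mul.
rewrite /lap1 e (derive1_add x (cinf1_mul hf' hg) (cinf1_mul hf hg')).
rewrite (derive1_mul x hf' hg) (derive1_mul x hf hg').
move: (derive1 (derive1 f) x) (derive1 (derive1 g) x) (derive1 f x) (derive1 g x) (f x) (g x) (expR x).
by move=> f2 g2 f1 g1 f0 g0 e0; ring.
Qed.

(* The decaying solution of [f'' + e^x f' = f]. *)
Definition tail x : R := expR (- expR x - x).

Lemma tail_cinf : cinf1 tail.
Proof.
apply: (cinf_comp (@cinf1_expR R)); apply: cinfB; last exact: cinf1_id.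
by apply: cinfN; exact: cinf1_expR.
Qed.

Lemma tailE x : tail x = decay x * expR (- x).
Proof. by rewrite /tail expRD. Qed.

Lemma derive1_tail : derive1 tail = (fun x => - (1 + expR x) * tail x).
Proof.
apply/funext => x.
have hi : cinf1 (fun x : R => - expR x) by apply: cinfN; exact: cinf1_expR.
have hn : cinf1 (fun x : R => - x) by apply: cinfN; exact: cinf1_id.
rewrite (@derive1_comp_c R expR (fun x => - expR x - x)); last 2 first.
- exact: cinf1_expR.
- exact: (cinfD hi hn).
rewrite derive1_expR (derive1_add x hi hn) !derive1E.
have -> : 'D_1 (fun x : R => - expR x) x = - expR x.
  have := @deriveN _ _ _ (@expR R) x 1 (cinf1_derivable (@cinf1_expR R)).
  by rewrite -(derive1E (@expR R)) derive1_expR.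
have -> : 'D_1 (fun x : R => - x) x = -1.
  by rewrite (_ : (fun x => - x) = - id) // deriveN // derive_id.
by rewrite -/(tail x); ring.
Qed.

Lemma lap1_tail x : lap1 tail x = tail x.
Proof.
have h1 : cinf1 (fun x : R => 1 + expR x) by apply: cinfD; [exact: cinf1_cst|exact: cinf1_expR].
have h1N : cinf1 (fun x : R => - (1 + expR x)) by exact: cinfN h1.
have d : derive1 (fun x : R => - (1 + expR x)) x = - expR x.
  rewrite derive1E; have := @deriveN _ _ _ (fun x : R => 1 + expR x) x 1 (cinf1_derivable h1).
  rewrite -(derive1E (fun x : R => 1 + expR x)) (derive1_add x (@cinf1_cst R 1) (@cinf1_expR R)).
  by rewrite derive1_expR derive1_cst add0r.
rewrite /lap1 {1}derive1_tail (derive1_mul x h1N tail_cinf) d derive1_tail; ring.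
Qed.

Definition start x : R := step x * tail x.

Lemma start_cinf : cinf1 start.
Proof. exact: cinf1_mul (@step_cinf R) tail_cinf. Qed.

Lemma derive1_start x : derive1 start x = tail x * (derive1 (@step R) x - (1 + expR x) * step x).
Proof. by rewrite (derive1_mul x (@step_cinf R) tail_cinf) derive1_tail; ring. Qed.

Lemma lap1_start x : lap1 start x =
  tail x * (lap1 (@step R) x - 2 * (1 + expR x) * derive1 (@step R) x + step x).
Proof. by rewrite (lap1M x (@step_cinf R) tail_cinf) lap1_tail derive1_tail; ring. Qed.

Lemma derive1_near_cst f (c x : R) : (\forall y \near x, f y = c) -> derive1 f x = 0.
Proof.
by move=> fc; rewrite derive1E (@near_eq_derive _ _ _ f (cst c)) ?derive_cst.
Qed.

Lemma derive1_step_eq0 x : x < 0 \/ 1 < x -> derive1 (@step R) x = 0.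
Proof.
move=> [x0|x1].
  apply: (@derive1_near_cst _ 0); near=> y; apply: step_eq0; apply: ltW.
  by near: y; exact: (@cvgr_lt _ _ _ _ id _ (@cvg_id _ _) _ x0).
apply: (@derive1_near_cst _ 1); near=> y; apply: step_eq1; apply: ltW.
by near: y; exact: (@cvgr_gt _ _ _ _ id _ (@cvg_id _ _) _ x1).
Unshelve. all: by end_near. Qed.

Lemma derive2_step_eq0 x : x < 0 \/ 1 < x -> derive1 (derive1 (@step R)) x = 0.
Proof.
move=> [x0|x1]; apply: (@derive1_near_cst _ 0); near=> y; apply: derive1_step_eq0.
  by left; near: y; exact: (@cvgr_lt _ _ _ _ id _ (@cvg_id _ _) _ x0).
by right; near: y; exact: (@cvgr_gt _ _ _ _ id _ (@cvg_id _ _) _ x1).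
Unshelve. all: by end_near. Qed.

(** The second expression, the bracket of [lap1_start], equals step'' - (2 + e^x) step' + step. Its
    derivative terms live on [0, 1], so e^x does no harm. *)
Lemma step_bounds : exists2 C, 0 <= C & forall x, `|derive1 (@step R) x| <= C /\
  `|lap1 (@step R) x - 2 * (1 + expR x) * derive1 (@step R) x + step x| <= C.
Proof.
have h1 := cinf1_derive (@step_cinf R); have h2 := cinf1_derive h1.
have out x : 2 <= `|x| -> x < 0 \/ 1 < x.
  by case: (ltP x 0) => [_ _|x0]; [left|rewrite ger0_norm // => x2; right; lra].
have s1 x : 2 <= `|x| -> derive1 (@step R) x = 0 by move=> /out/derive1_step_eq0.
have [C1 C10 b1] := bounded_support (cinf_cont h1) s1.
pose f x := derive1 (derive1 (@step R)) x - (2 + expR x) * derive1 (@step R) x.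
have cf : continuous f.
  apply: cinf_cont; apply: (cinfB h2 (cinf1_mul _ h1)).
  by apply: cinfD; [exact: cinf1_cst|exact: cinf1_expR].
have sf x : 2 <= `|x| -> f x = 0.
  by move=> /out xo; rewrite /f derive1_step_eq0 // derive2_step_eq0 // mulr0 subrr.
have [C2 C20 b2] := bounded_support cf sf.
exists (C1 + C2 + 1) => [|x]; first by rewrite addr_ge0 ?addr_ge0.
split; first by apply: le_trans (b1 x) _; lra.
rewrite (_ : _ + _ = f x + step x); last by rewrite /f /lap1; ring.
apply: le_trans (ler_normD _ _) _.
by have := b2 x; have := @step_le1 R x; rewrite (ger0_norm (step_ge0 x)); lra.
Qed.

Definition trunc n x : R := start x * rescale n.+1%:R x.

Lemma trunc_cinf n : cinf1 (trunc n).
Proof. exact: cinf1_mul start_cinf (rescale_cinf _). Qed.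

Lemma start_eq0 x : x < 0 -> [/\ start x = 0, derive1 start x = 0 & lap1 start x = 0].
Proof.
move=> x0; rewrite derive1_start lap1_start /start /lap1.
rewrite derive1_step_eq0 ?derive2_step_eq0 ?step_eq0 ?ltW //; try by left.
by split; ring.
Qed.

Lemma lap1_trunc n x : lap1 (trunc n) x = lap1 start x * rescale n.+1%:R x +
  2 * (derive1 start x * derive1 (rescale n.+1%:R) x) + start x * lap1 (rescale n.+1%:R) x.
Proof. by rewrite (lap1M x start_cinf (rescale_cinf _)). Qed.

Lemma rescale_cvg x : rescale n.+1%:R x @[n --> \oo] --> (1 : R).
Proof.
apply/cvgrPdist_lt => e e0; near=> n.
have xn : `|x| <= n.+1%:R.
  apply: (@le_trans _ _ n%:R); last by rewrite ler_nat.
  by near: n; exact: nbhs_infty_ger.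
rewrite /rescale plateau_eq1 ?subrr ?normr0 //.
by rewrite normrM ger0_norm ?invr_ge0 // mulrC ler_pdivrMr ?ltr0Sn // mul1r.
Unshelve. all: by end_near. Qed.

Lemma inv_cvg0 (C : R) (u : nat -> R) : 0 <= C -> (forall n, `|u n| <= n.+1%:R^-1 * C) ->
  u n @[n --> \oo] --> (0 : R).
Proof.
move=> C0 uC; apply/cvgrPdist_lt => e e0.
have K0 : 0 < C + 1 by rewrite ltr_wpDl.
have [N NP] := inv_small (divr_gt0 e0 K0); exists N => // n /= /NP nN.
rewrite sub0r normrN; apply: le_lt_trans (uC n) _.
rewrite ltr_pdivlMr // in nN; apply: le_lt_trans nN.
by rewrite ler_wpM2l ?invr_ge0 // lerDl.
Qed.

Lemma rescale_derivatives : exists2 D, 0 <= D & forall n x,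
  `|derive1 (rescale n.+1%:R) x| <= n.+1%:R^-1 * D /\
  `|lap1 (rescale n.+1%:R) x| <= n.+1%:R^-1 * (D * (1 + expR x)).
Proof.
have [D D0 hD] := @plateau_derivatives_bounded R; exists D => // n x.
have i0 : 0 <= n.+1%:R^-1 :> R by rewrite invr_ge0.
have i1 : n.+1%:R^-1 <= 1 :> R by rewrite invf_le1 ?ltr0n // ler1n.
have [h1 h2] := hD (n.+1%:R^-1 * x).
have d1 : `|derive1 (rescale n.+1%:R) x| <= n.+1%:R^-1 * D.
  by rewrite rescale_derive normrM ger0_norm // ler_wpM2l.
have d2 : `|derive1 (derive1 (rescale n.+1%:R)) x| <= n.+1%:R^-1 * D.
  rewrite rescale_derive2 normrM (ger0_norm i0) ler_wpM2l // normrM (ger0_norm i0).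
  by apply: le_trans h2; rewrite ler_piMl.
split => //; apply: le_trans (ler_normD _ _) _; rewrite normrM (ger0_norm (expR_ge0 x)).
rewrite mulrA mulrDr mulr1 lerD // mulrC.
by rewrite ler_wpM2r ?expR_ge0.
Qed.

Lemma trunc_cvg x : trunc n x @[n --> \oo] --> start x.
Proof.
by rewrite -[X in _ --> X]mulr1; apply: cvgM; [exact: cvg_cst|exact: rescale_cvg].
Qed.

Lemma lap1_trunc_cvg x : lap1 (trunc n) x @[n --> \oo] --> lap1 start x.
Proof.
have [D D0 hD] := rescale_derivatives.
have c1 : derive1 (rescale n.+1%:R) x @[n --> \oo] --> (0 : R).
  by apply: (inv_cvg0 D0) => n; have [] := hD n x.
have c2 : lap1 (rescale n.+1%:R) x @[n --> \oo] --> (0 : R).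
  have h : 0 <= D * (1 + expR x) by rewrite mulr_ge0 ?addr_ge0 ?expR_ge0.
  by apply: (inv_cvg0 h) => n; have [] := hD n x.
have -> : lap1 start x = lap1 start x * 1 + 2 * (derive1 start x * 0) + start x * 0 by ring.
under eq_fun do rewrite lap1_trunc.
apply: cvgD; last by apply: cvgM => //; exact: cvg_cst.
apply: cvgD; first by apply: cvgM; [exact: cvg_cst|exact: rescale_cvg].
by apply: cvgM; [exact: cvg_cst|apply: cvgM => //; exact: cvg_cst].
Qed.

(** The letters stand, at a point x >= 0, for: q = decay, e = e^-x, X = e^x, l = logistic, r = rho,
    S = step, S1 = step', m the bracket in [lap1_start], and k, k1, k2 for [rescale], its derivative
    and its [lap1]. Terms without X keep the factor e, comparable to r; in the truncated terms e is
    spent on X through e X = 1, which leaves l. *)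
Lemma trunc_estimate (C D q e X l r S S1 m k k1 k2 : R) : 0 <= C -> 0 <= D -> 0 <= q -> 0 <= e ->
  0 <= X -> e <= 1 -> e * X = 1 -> 1 <= 2 * l -> e <= 4 * r -> 0 <= S <= 1 -> `|S1| <= C ->
  `|m| <= C -> 0 <= k <= 1 -> `|k1| <= D -> `|k2| <= D * (1 + X) ->
  let K := 4 * (1 + C + 4 * D + 2 * (D * C)) in
  [/\ `|S * (q * e)| <= K * (q * r), `|q * e * m| <= K * (q * r),
      `|S * (q * e) * k| <= K * (q * l) &
      `|q * e * m * k + 2 * (q * e * (S1 - (1 + X) * S) * k1) + S * (q * e) * k2| <= K * (q * l)].
Proof.
move=> C0 D0 q0 e0 X0 e1 eX hl hr /andP[S0 S01] hS1 hm /andP[k0 k01] hk1 hk2 K.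
have DC0 := mulr_ge0 D0 C0.
have K4 : 4 <= K by rewrite /K; lra.
have K4C : 4 * C <= K by rewrite /K; lra.
have qr c : 0 <= c -> 4 * c <= K -> q * e * c <= K * (q * r).
  move=> c0 cK; have r0 : 0 <= r by lra.
  have h : e * c <= K * r.
    apply: le_trans (_ : 4 * r * c <= _); first exact: ler_wpM2r.
    by rewrite mulrAC ler_wpM2r.
  by rewrite -mulrA [leRHS]mulrCA ler_wpM2l.
have ql c : 0 <= c -> 2 * c <= K -> q * c <= K * (q * l).
  move=> c0 cK; have l0 : 0 <= l by lra.
  rewrite [leRHS]mulrCA ler_wpM2l //; apply: le_trans (_ : 2 * c * l <= _); last exact: ler_wpM2r.
  by have := ler_wpM2r c0 hl; rewrite mul1r; lra.
have qe0 : 0 <= q * e by exact: mulr_ge0.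
split.
- rewrite ger0_norm ?mulr_ge0 //; apply: le_trans (qr 1 ler01 _); last by lra.
  by rewrite mulr1 ler_piMl.
- rewrite normrM (ger0_norm qe0); apply: le_trans (qr C C0 K4C).
  exact: ler_wpM2l.
- rewrite ger0_norm ?mulr_ge0 //; apply: le_trans (ql 1 ler01 _); last by lra.
  rewrite mulr1; apply: le_trans (_ : q * e <= _); last by rewrite ler_piMr.
  by apply: le_trans (_ : S * (q * e) <= _); [rewrite ler_piMr ?mulr_ge0|rewrite ler_piMl].
- apply: le_trans (ql (C + 2 * ((C + 2) * D) + 2 * D) _ _); last 2 first.
  + by have := mulr_ge0 (addr_ge0 C0 (ler0n _ 2)) D0; lra.
  + by rewrite /K; lra.
  apply: le_trans (ler_normD _ _) _; apply: le_trans (lerD (ler_normD _ _) (lexx _)) _.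
  rewrite [leRHS]mulrDr [X in _ <= X + _]mulrDr; apply: lerD; first apply: lerD.
  + rewrite !normrM (ger0_norm q0) (ger0_norm e0) (ger0_norm k0) -!mulrA ler_wpM2l //.
    rewrite mulrA; apply: le_trans (_ : e * `|m| <= _); first by rewrite ler_piMr ?mulr_ge0.
    by apply: le_trans hm; rewrite ler_piMl.
  + have h : e * `|S1 - (1 + X) * S| <= C + 2.
      have h1 : `|S1 - (1 + X) * S| <= C + (1 + X).
        apply: le_trans (ler_normB _ _) _; apply: lerD => //.
        by rewrite ger0_norm ?mulr_ge0 ?addr_ge0 // ler_piMr ?addr_ge0.
      apply: le_trans (ler_wpM2l e0 h1) _; rewrite !mulrDr eX mulr1.
      have := ler_piMl C0 e1; lra.
    rewrite !normrM (ger0_norm q0) (ger0_norm e0) (ger0_norm (ler0n _ 2)).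
    rewrite [leLHS](_ : _ = q * (2 * (e * `|S1 - (1 + X) * S| * `|k1|))); last by ring.
    by rewrite ler_wpM2l // ler_wpM2l // ler_pM // mulr_ge0.
  + rewrite !normrM (ger0_norm q0) (ger0_norm e0) (ger0_norm S0).
    apply: le_trans (_ : q * e * (D * (1 + X)) <= _).
      by apply: ler_pM => //; rewrite ?mulr_ge0 // ler_piMl.
    rewrite -mulrA ler_wpM2l // mulrCA mulrDr eX mulr1 [leRHS]mulrC ler_wpM2l //; lra.
Qed.

(** For x < 0 all the functions vanish, so the comparisons of [trunc_estimate], valid for x >= 0,
    suffice. *)
Lemma start_bound : exists2 C, 0 <= C & forall x,
  [/\ `|start x| <= C * (decay x * rho x), `|lap1 start x| <= C * (decay x * rho x) &
   forall n, `|trunc n x| <= C * (decay x * logistic x) /\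
             `|lap1 (trunc n) x| <= C * (decay x * logistic x)].
Proof.
have [C C0 hC] := step_bounds; have [D D0 hD] := rescale_derivatives.
exists (4 * (1 + C + 4 * D + 2 * (D * C))) => [|x].
  by have := mulr_ge0 D0 C0; lra.
have i0 n : 0 <= n.+1%:R^-1 :> R by rewrite invr_ge0.
have i1 n : n.+1%:R^-1 <= 1 :> R by rewrite invf_le1 ?ltr0n // ler1n.
have K0 : 0 <= 4 * (1 + C + 4 * D + 2 * (D * C)) by have := mulr_ge0 D0 C0; lra.
have d0 : 0 <= decay x by have /andP[] := decay_bound x.
have l0 : 0 <= logistic x by have /andP[] := logistic_bound x.
have [x0|x0] := ltP x 0.
  have [e1 e2 e3] := start_eq0 x0.
  have pos1 := mulr_ge0 K0 (mulr_ge0 d0 (rho_ge0 x)); have pos2 := mulr_ge0 K0 (mulr_ge0 d0 l0).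
  split; rewrite ?e1 ?e3 ?normr0 // => n; split; first by rewrite /trunc e1 mul0r normr0.
  by rewrite lap1_trunc e1 e2 e3 !mul0r mulr0 !addr0 normr0.
have [hC1 hC2] := hC x.
have e1 : expR (- x) <= 1 by rewrite -expR0 ler_expR oppr_le0.
have eX : expR (- x) * expR x = 1 by rewrite -expRD addNr expR0.
have s01 : 0 <= step x <= 1 by rewrite step_ge0 step_le1.
have est n := @trunc_estimate C D (decay x) (expR (- x)) (expR x) (logistic x) (rho x) (step x)
  (derive1 (@step R) x) _ (rescale n.+1%:R x) (derive1 (rescale n.+1%:R) x)
  (lap1 (rescale n.+1%:R) x) C0 D0 d0 (expR_ge0 _) (expR_ge0 _) e1 eX (half_logistic x0)
  (expRN_le_rho x0) s01 hC1 hC2 _ _ _.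
have k01 n : 0 <= rescale n.+1%:R x <= 1 by rewrite plateau_ge0 plateau_le1.
have k1 n : `|derive1 (rescale n.+1%:R) x| <= D.
  by have [h _] := hD n x; apply: le_trans h _; rewrite ler_piMl.
have k2 n : `|lap1 (rescale n.+1%:R) x| <= D * (1 + expR x).
  by have [_ h] := hD n x; apply: le_trans h _; rewrite ler_piMl // mulr_ge0 ?addr_ge0 ?expR_ge0.
split.
- by rewrite /start tailE; have [] := est k01 k1 k2 0%N.
- by rewrite lap1_start tailE; have [] := est k01 k1 k2 0%N.
move=> n; have [_ _ a b] := est k01 k1 k2 n.
split; first by rewrite /trunc /start tailE.
by rewrite lap1_trunc lap1_start derive1_start /start tailE.
Qed.

End Leakage.

(** * Loss of mass at infinity *)

Section StochasticIncompleteness.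
Context (R : realType).
Local Notation P := 'rV[R]_2.
Local Notation B := (borel P).
Local Notation mR := (measurableTypeR R).
Local Notation leb := (@lebesgue_measure R).
Local Notation pdir := (fun k : 'I_2 => delta_mx 0 k : P).
Local Notation mu := (@mu R).
Local Notation H := (l2_hilbert mu).
Local Notation W_cinf := (cinf_cst pdir (0 : R)).
Local Notation F := (dirichlet_form W_cinf).
Local Notation b := (@plateau R).
Implicit Types (v w : P) (c : R -> R) (n : nat).

Definition b2 : R -> R := derive1 (derive1 (@plateau R)).

Definition lap c v : R := prodf (lap1 c) b v + Einv v ^+ 2 * prodf c b2 v.

Lemma generator_prodf c v : cinf1 c -> generator (fun=> 0) (prodf c b) v = lap c v.
Proof.
move=> hc; rewrite /generator mul0r addr0 dual0_prodf ?dual1_prodf //; try exact: plateau_cinf.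
by rewrite opprD !opprK.
Qed.

Lemma product_estimate (C K c1 c2 p d1 d2 r e : R) : 0 <= C -> 0 <= K -> 0 <= p -> 0 <= r ->
  0 <= e <= 1 -> `|c1| <= C * p -> `|c2| <= C * p -> `|d1| <= K * r -> `|d2| <= K * r ->
  `|c2 * d1| <= 2 * C * K * (p * r) /\
  `|c1 * d1 + e ^+ 2 * (c2 * d2)| <= 2 * C * K * (p * r).
Proof.
move=> C0 K0 p0 r0 /andP[e0 e1] hc1 hc2 hd1 hd2.
have t (c d : R) : `|c| <= C * p -> `|d| <= K * r -> `|c * d| <= C * K * (p * r).
  by move=> hc hd; rewrite normrM [leRHS]mulrACA; exact: ler_pM.
have z : 0 <= C * K * (p * r) by rewrite !mulr_ge0.
have e2 : e ^+ 2 <= 1 by rewrite expr_le1.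
split; first by have := t _ _ hc2 hd1; lra.
apply: le_trans (ler_normD _ _) _; have h1 := t _ _ hc1 hd1.
have h2 : `|e ^+ 2 * (c2 * d2)| <= C * K * (p * r).
  by rewrite normrM ger0_norm ?sqr_ge0 //; apply: le_trans (t _ _ hc2 hd2); rewrite ler_piMl.
by move: h1 h2; lra.
Qed.

Lemma prodf_measurable c d : continuous c -> continuous d ->
  @measurable_fun _ _ B mR setT (prodf c d).
Proof. by move=> cc cd; apply: continuous_measurable; exact: prodf_continuous. Qed.

Lemma b_cinf : cinf1 b. Proof. exact: plateau_cinf. Qed.
Lemma b2_cinf : cinf1 b2. Proof. exact: cinf1_derive (cinf1_derive b_cinf). Qed.

Lemma lap_continuous c : cinf1 c -> continuous (lap c).
Proof.
move=> hc; have hc' := cinf1_derive hc; have hc2 := cinf1_derive hc'.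
have hl : cinf1 (lap1 c) by exact: (cinfD hc2 (cinf1_mul (@cinf1_expR R) hc')).
have hI := @Einv_cinf R.
apply: cinf_cont; apply: (cinfD (prodf_cinf hl b_cinf)).
by apply: cinfM; [exact: (cinfM hI hI)|exact: prodf_cinf hc b2_cinf].
Qed.

Lemma leak_bounds : exists2 C, 0 <= C & forall v,
  [/\ `|prodf (@start R) b v| <= C * majorant1 v,
      `|lap (@start R) v| <= C * majorant1 v &
      forall n, `|prodf (trunc n) b v| <= C * majorant2 v /\
                `|lap (trunc n) v| <= C * majorant2 v].
Proof.
have [C C0 hC] := @start_bound R.
have s0 (x : R) : 2 <= `|x| -> b x = 0 by exact: plateau_eq0.
have s1 (x : R) : 2 + 1 <= `|x| -> derive1 b x = 0 by apply: derive1_supp.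
have s2 (x : R) : 2 + 1 + 1 <= `|x| -> b2 x = 0 by apply: derive1_supp.
have [K1 K10 hK1] := supported_le_rho (cinf_cont b_cinf) s0.
have [K2 K20 hK2] := supported_le_rho (cinf_cont b2_cinf) s2.
pose K := K1 + K2; have K0 : 0 <= K by rewrite addr_ge0.
have hb x : `|b x| <= K * rho x.
  by apply: le_trans (hK1 x) _; rewrite ler_wpM2r ?rho_ge0 // lerDl.
have hb2 x : `|b2 x| <= K * rho x.
  by apply: le_trans (hK2 x) _; rewrite ler_wpM2r ?rho_ge0 // lerDr.
exists (2 * C * K) => [|v]; first by rewrite !mulr_ge0.
have [h1 h2 h3] := hC (v 0 0); have r0 := rho_ge0 (v 0 1); have r00 := rho_ge0 (v 0 0).
have /andP[d0 _] := decay_bound (v 0 0); have /andP[l0 _] := logistic_bound (v 0 0).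
have [k1 k2] := product_estimate C0 K0 (mulr_ge0 d0 r00) r0 (Einv_bound v) h2 h1 (hb (v 0 1)) (hb2 (v 0 1)).
have -> : majorant1 v = decay (v 0 0) * rho (v 0 0) * rho (v 0 1).
  by rewrite /majorant1 /prodf Einv_decay mulrA.
split; [exact: k1|exact: k2|move=> n; have [h4 h5] := h3 n].
exact: product_estimate C0 K0 (mulr_ge0 d0 l0) r0 (Einv_bound v) h5 h4 (hb (v 0 1)) (hb2 (v 0 1)).
Qed.

Lemma leak_integrable : mu.-integrable setT (EFin \o prodf (@start R) b) /\
  mu.-integrable setT (EFin \o lap (@start R)).
Proof.
have [C C0 hC] := leak_bounds.
have i : mu.-integrable setT (EFin \o (fun v => C * majorant1 v)).
  exact: (integrableZl measurableT C (@majorant1_integrable R)).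
split.
  apply: (ae_le_integrable _ i); last by apply: aeW => v; have [] := hC v.
  exact: prodf_measurable (cinf_cont (@start_cinf R)) (cinf_cont b_cinf).
apply: (ae_le_integrable _ i); last by apply: aeW => v; have [] := hC v.
exact: continuous_measurable (lap_continuous (@start_cinf R)).
Qed.

(** psi does not have compact support, so it is reached through its truncations in x, which are test
    functions. They and their Laplacians converge in L^2 under a multiple of [majorant2], and the
    operator is closed. *)
Lemma leak_op : [/\ l2 mu (prodf (@start R) b), l2 mu (lap (@start R)) &
  op F (cls mu (prodf (@start R) b)) (cls mu (lap (@start R)))].
Proof.
have [C C0 hC] := leak_bounds.
have m2 := l2Z C (@majorant2_l2 R); set g := C *: _ in m2.
have g0 v : 0 <= g v by rewrite mulr_ge0 ?majorant2_ge0.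
have le12 (f : P -> R) v : `|f v| <= C * majorant1 v -> `|f v| <= g v.
  by move=> h; apply: le_trans h _; rewrite /g /GRing.scale /= ler_wpM2l // majorant1_le.
have m1 := prodf_measurable (cinf_cont (@start_cinf R)) (cinf_cont b_cinf).
have ml : @measurable_fun _ _ B mR setT (lap (@start R)).
  exact: continuous_measurable (lap_continuous (@start_cinf R)).
have b1 v : `|prodf (@start R) b v| <= g v by apply: le12; have [] := hC v.
have bl v : `|lap (@start R) v| <= g v by apply: le12; have [] := hC v.
split.
- by apply: (l2_dominated m1 m2) => v; apply: le_trans (b1 v) (ler_norm _).
- by apply: (l2_dominated ml m2) => v; apply: le_trans (bl v) (ler_norm _).
have tn n : test_fun (prodf (@trunc R n) b).
  have tc : cinf pdir (prodf (@trunc R n) b) by apply: prodf_cinf; [exact: trunc_cinf|exact: b_cinf].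
  split; first exact: tc.
  exists (2 * n.+1%:R) => v; have n0 : 0 < n.+1%:R :> R by rewrite ltr0n.
  have n1 : 1 <= n.+1%:R :> R by rewrite ler1n.
  move=> /orP[h|h]; rewrite /prodf; last by rewrite plateau_eq0 ?mulr0 //; move: h; lra.
  rewrite /trunc /rescale plateau_eq0 ?mulr0 ?mul0r //.
  by rewrite normrM gtr0_norm ?invr_gt0 // mulrC ler_pdivlMr.
apply: (@op_closed R H F (fun n => cls mu (prodf (trunc n) b) : H) (fun n => cls mu (lap (trunc n)) : H)).
- move=> n; have := op_test W_cinf (tn n); congr op; congr cls.
  by apply/funext => v; exact/generator_prodf/trunc_cinf.
- apply: (cls_cvg m2 g0 _ m1 _ b1).
  + by move=> n; exact: prodf_measurable (cinf_cont (@trunc_cinf R n)) (cinf_cont b_cinf).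
  + by move=> n v; have [_ _ h] := hC v; have [] := h n.
  + by move=> v; apply: cvgM; [exact: trunc_cvg|exact: cvg_cst].
- apply: (cls_cvg m2 g0 _ ml _ bl).
  + by move=> n; exact: continuous_measurable (lap_continuous (@trunc_cinf R n)).
  + by move=> n v; have [_ _ h] := hC v; have [] := h n.
  + move=> v; apply: cvgD; first by apply: cvgM; [exact: lap1_trunc_cvg|exact: cvg_cst].
    by apply: cvgM; [exact: cvg_cst|apply: cvgM; [exact: trunc_cvg|exact: cvg_cst]].
Qed.

Lemma mu_ibox_integrable (g : P -> R) n : continuous g ->
  mu.-integrable setT (EFin \o (fun v => g v * ibox n%:R v)).
Proof.
move=> cg; have := l2_integrable (ibox_weight_l2 n cg) (tester_l2 (ibox_tester (n%:R : R))).
by congr integrable; apply/funext => v; rewrite /= /ibox -mulrA -natrM mulnb andbb.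
Qed.

(** E f' for the profile f. By [lap1_flux] the radial Laplacian is E^-1 (E f')', so its integral
    against the density E is a difference of boundary values. *)
Definition flux (x : R) : R := expR (expR x) * derive1 (@start R) x.

Lemma flux_cinf : cinf1 flux.
Proof. exact: cinf1_mul (@cinf1_expexp R) (cinf1_derive (@start_cinf R)). Qed.

Lemma decay_expexp (x : R) : decay x * expR (expR x) = 1.
Proof. by rewrite -expRD addNr expR0. Qed.

Lemma lap1_flux (x : R) : lap1 (@start R) x = decay x * derive1 flux x.
Proof.
rewrite (derive1_mul x (@cinf1_expexp R) (cinf1_derive (@start_cinf R))) derive1_expexp /lap1.
have := decay_expexp x.
move: (derive1 _ x) (derive1 _ x) (decay x) (expR (expR x)) (expR x) => f1 f2 d E e dE.
by rewrite -[LHS]mul1r -dE; ring.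
Qed.

Lemma flux_neg (x : R) : x < 0 -> flux x = 0.
Proof. by move=> x0; have [_ e _] := start_eq0 x0; rewrite /flux e mulr0. Qed.

(** For x > 1 the step equals 1 and E times [tail] is e^-x, so the flux is exactly - (e^-x + 1). *)
Lemma flux_large (x : R) : 1 < x -> flux x <= -1.
Proof.
move=> x1; rewrite /flux derive1_start derive1_step_eq0; last by right.
rewrite step_eq1 ?(ltW x1) // mulr1 sub0r mulrA tailE.
have -> : expR (expR x) * (decay x * expR (- x)) = expR (- x).
  by rewrite mulrA [expR (expR x) * _]mulrC decay_expexp mul1r.
have e : expR (- x) * expR x = 1 by rewrite -expRD addNr expR0.
have := expR_ge0 (- x); rewrite mulrN mulrDr e mulr1; lra.
Qed.

Lemma plateau_integral n : (0 < n)%N -> 2 <= \int[leb]_(x in `[- n%:R, n%:R]) b x.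
Proof.
move=> n0; have n1 : 1 <= n%:R :> R by rewrite ler1n.
have cb := cinf_cont b_cinf.
have seg (r : R) : leb.-integrable `[- r, r] (EFin \o b).
  apply: continuous_compact_integrable; first exact: segment_compact.
  exact: continuous_subspaceT.
have -> : 2 = \int[leb]_(x in `[(- 1), 1]) b x :> R.
  transitivity (\int[leb]_(x in `[(-1 : R), 1]) (1 : R)).
    have l2 : leb `[(-1 : R), 1]%classic = 2%:E.
      by rewrite lebesgue_segment; [congr EFin; lra|lra].
    have m2 : measurable (`[(-1 : R), 1]%classic : set mR) by [].
    by rewrite -[LHS]mul1r -[X in _ * X]/(fine 2%:E) -l2 -(Rintegral_cst _ m2).
  apply: eq_Rintegral => x; rewrite inE /= in_itv /= => h.
  by rewrite plateau_eq1 // ler_norml.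
rewrite -lee_fin /Rintegral !fineK; last 2 first.
- exact: integrable_fin_num (seg n%:R).
- exact: integrable_fin_num (seg 1).
apply: ge0_subset_integral => //.
- exact: (measurable_int _ (seg n%:R)).
- by move=> x _; rewrite lee_fin plateau_ge0.
- by move=> x /=; rewrite !in_itv /= => /andP[h1 h2]; apply/andP; split; lra.
Qed.

(** b' vanishes where |y| >= 3, so for n > 3 the y-part integrates to 0. The x-part is flux(n) times
    the integral of b, which are at most -1 and at least 2 respectively. *)
Lemma leak_ibox n : (3 < n)%N -> \int[mu]_v (lap (@start R) v * ibox n%:R v) <= -2.
Proof.
move=> n3; have n4 : 3 < n%:R :> R by rewrite ltr_nat.
have cf := cinf_cont (cinf1_derive flux_cinf).
have cds := cinf_cont (cinf1_mul (@decay_cinf R) (@start_cinf R)).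
have cb := cinf_cont b_cinf; have cb2 := cinf_cont b2_cinf.
have cI := cinf_cont (@Einv_cinf R).
pose g1 v := Einv v * prodf (derive1 flux) b v.
pose g2 v := Einv v * prodf (fun x => decay x * start x) b2 v.
have c1 : continuous g1 by exact: continuous_mul cI (prodf_continuous cf cb).
have c2 : continuous g2 by exact: continuous_mul cI (prodf_continuous cds cb2).
have e v : lap (@start R) v * ibox n%:R v = g1 v * ibox n%:R v + g2 v * ibox n%:R v.
  by rewrite /lap /g1 /g2 /prodf lap1_flux Einv_decay; ring.
under eq_Rintegral do rewrite e.
rewrite RintegralD //; [|exact: mu_ibox_integrable|exact: mu_ibox_integrable].
rewrite /Rintegral (integral_mu_prodf_ibox n%:R cf cb) (integral_mu_prodf_ibox n%:R cds cb2) /=.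
rewrite -!/(Rintegral _ _ _).
have n0 : 0 < n%:R :> R by lra.
rewrite (Rintegral_segment_derive1 flux_cinf n0) (Rintegral_segment_derive1 (cinf1_derive b_cinf) n0).
have s1 (x : R) : 2 + 1 <= `|x| -> derive1 b x = 0.
  by apply: derive1_supp => y; exact: plateau_eq0.
rewrite (@flux_neg (- n%:R)) ?oppr_lt0 // !s1 ?normrN ?gtr0_norm //; [|lra|lra].
rewrite !subr0 mulr0 addr0.
have n_gt0 : (0 < n)%N by exact: leq_trans n3.
have n_gt1 : 1 < n%:R :> R by lra.
have h1 := plateau_integral n_gt0; have h2 := flux_large n_gt1.
move: h1 h2; move: (Rintegral _ _ _) (flux _) => I f h1 h2.
have := ler_wnM2l (_ : f <= 0) h1; have := ler_wpM2r (_ : 0 <= I) h2.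
by move=> /(_ ltac:(lra)) a /(_ ltac:(lra)) c; lra.
Qed.

Lemma leak_negative : \int[mu]_v lap (@start R) v <= -2.
Proof.
have [_ i] := leak_integrable; have l := ibox_integral_cvg i.
rewrite -(cvg_lim _ l) //; apply: limr_le; first by apply/cvg_ex; eexists; exact: l.
by exists 4%N => // n /= n4; exact: leak_ibox.
Qed.

Lemma surface_stochastically_incomplete : ~ conservative mu (heat W_cinf).
Proof.
move=> cons; have [i1 i2] := leak_integrable; have [l1 l2 o] := leak_op.
have := conservative_integral_op cons ltr01 l1 i1 l2 i2 o.
by have := leak_negative; lra.
Qed.

End StochasticIncompleteness.

Theorem corollary6p7 (R : realType) :
  exists (n : nat) (M : riemannian R n)
         (mu : {measure set (borel M) -> \bar R}),
    [/\ is_riemannian_measure mu,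
        geodesically_complete M,
        exists2 T, is_heat_semigroup mu (cst 0) T & ~ conservative mu T &
        exists V : M -> R,
          [/\ smooth V, forall x, 0 <= V x &
              exists2 T, is_heat_semigroup mu V T &
                generalized_conservative mu V T]].
Proof.
exists 2%N, (surface R), (mu R); split.
- exact: is_riemannian_measure_mu.
- exact: surface_complete.
- exists (heat (cinf_cst (fun k : 'I_2 => delta_mx 0 k : 'rV[R]_2) (0 : R))); last first.
    exact: surface_stochastically_incomplete.
  (* The construction only knows potentials of the form W^2; here W = 0. *)
  have -> : cst 0 = (fun _ : 'rV[R]_2 => (0 : R) ^+ 2) by apply/funext => v; rewrite expr0n.
  exact: heat_is_heat_semigroup.
- exists (@V R); split.
  + by move=> i; exact: (cinf_smooth_on (@V_cinf R)).
  + exact: V_ge0.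
  + exists (heat (@W_cinf R)); last exact: surface_conservation.
    have -> : @V R = (fun v => W v ^+ 2) by apply/funext => v; rewrite W_sqr.
    exact: heat_is_heat_semigroup.
Qed.
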